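(* Let $d\in\mathbb{N}$, let $\Omega\subset\mathbb{R}^d$ be a bounded Lipschitz domain, $s\in(0,1)$ and $1<p<\infty$. Then the trace operator $$\mathrm{Tr}_s: V^{s,p}(\Omega\,|\,\mathbb{R}^d)\to\mathcal{T}^{s,p}(\Omega^c),\qquad u\mapsto u|_{\Omega^c},$$ is well defined, linear and continuous, and there exists a continuous linear right inverse $$\mathrm{Ext}_s:\mathcal{T}^{s,p}(\Omega^c)\to V^{s,p}(\Omega\,|\,\mathbb{R}^d),\qquad \mathrm{Tr}_s(\mathrm{Ext}_s(g))=g .$$ Moreover, the continuity constants of both operators depend only on $\Omega$, a lower bound on $s$, and a lower and an upper bound on $p$; that is, for all $s_\star\in(0,1)$ and $1<p_\star\le p^\star<\infty$ there is a constant $C=C(\Omega,s_\star,p_\star,p^\star)>0$ such that for all $s\in[s_\star,1)$ and $p\in[p_\star,p^\star]$ one has $\|\mathrm{Tr}_s u\|_{\mathcal{T}^{s,p}(\Omega^c)}\le C\|u\|_{V^{s,p}(\Omega|\mathbb{R}^d)}$ for all $u\in V^{s,p}(\Omega\,|\,\mathbb{R}^d)$ and $\|\mathrm{Ext}_s g\|_{V^{s,p}(\Omega|\mathbb{R}^d)}\le C\|g\|_{\mathcal{T}^{s,p}(\Omega^c)}$ for all $g\in\mathcal{T}^{s,p}(\Omega^c)$.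
   Context: $\Omega\subset\mathbb{R}^d$ is a Lipschitz domain if it is open (not necessarily connected) and has a uniform Lipschitz boundary: $\partial\Omega\neq\emptyset$ and there are $r>0$, $L>0$ such that for every $z\in\partial\Omega$ there are a map $T_z:\mathbb{R}^d\to\mathbb{R}^d$ composed of a translation and a rotation with $T_z(z)=0$, and a Lipschitz function $\phi_z:\mathbb{R}^{d-1}\to\mathbb{R}$ with Lipschitz constant at most $L$, with $T_z(\Omega\cap B_r(z))=\{(x',x_d)\in B_r(0): \phi_z(x')>x_d\}$. Write $\Omega^c=\mathbb{R}^d\setminus\Omega$, $d_x=\mathrm{dist}(x,\partial\Omega)$, $a\wedge b=\min\{a,b\}$. Functions are identified if equal almost everywhere. $V^{s,p}(\Omega\,|\,\mathbb{R}^d)$ is the space of measurable $u:\mathbb{R}^d\to\mathbb{R}$ with $[u]_{V^{s,p}(\Omega|\mathbb{R}^d)}<\infty$, where $$[u]^p_{V^{s,p}(\Omega|\mathbb{R}^d)}=(1-s)\int_\Omega\int_{\mathbb{R}^d}\frac{|u(x)-u(y)|^p}{|x-y|^{d+sp}}\,dy\,dx,$$ with norm $\|u\|^p_{V^{s,p}(\Omega|\mathbb{R}^d)}=\|u\|^p_{L^p(\Omega)}+[u]^p_{V^{s,p}(\Omega|\mathbb{R}^d)}$. The measure $\mu_s$ (depending on $s,p,\Omega$) is $\mu_s(dx)=\mathbf{1}_{\Omega^c}(x)(1-s)d_x^{-s}(1+d_x)^{-d-s(p-1)}\,dx$. The space $\mathcal{T}^{s,p}(\Omega^c)$ consists of measurable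 $g:\Omega^c\to\mathbb{R}$ with $\|g\|_{\mathcal{T}^{s,p}(\Omega^c)}<\infty$, where $\|g\|^p_{\mathcal{T}^{s,p}(\Omega^c)}=\|g\|^p_{L^p(\Omega^c;\mu_s)}+[g]^p_{\mathcal{T}^{s,p}(\Omega^c)}$ and $$[g]^p_{\mathcal{T}^{s,p}(\Omega^c)}=\int_{\Omega^c}\int_{\Omega^c}\frac{|g(x)-g(y)|^p}{((|x-y|+d_x+d_y)\wedge1)^{d+s(p-2)}}\,\mu_s(dx)\,\mu_s(dy).$$ *)

(* Defs.v *)
From HB Require Import structures.
From mathcomp Require Import all_boot all_order all_algebra.
From mathcomp Require Import all_classical all_reals all_analysis.
From mathcomp Require Import measurable_realfun.
Import Order.TTheory GRing.Theory Num.Theory numFieldNormedType.Exports.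

Set Implicit Arguments.
Unset Strict Implicit.
Unset Printing Implicit Defensive.

Local Open Scope classical_set_scope.
Local Open Scope ring_scope.

Definition measure_rV_display : measure_display -> measure_display.
Proof. exact. Qed.

Section measurable_rV.
Context {d} {T : measurableType d}.
Variable n : nat.

Let coors : 'I_n -> 'rV[T]_n -> T := fun i x => x ord0 i.

Let rV_set0 : g_sigma_preimage coors set0.
Proof. exact: sigma_algebra0. Qed.

Let rV_setC A : g_sigma_preimage coors A -> g_sigma_preimage coors (~` A).
Proof. exact: sigma_algebraC. Qed.

Let rV_bigcup (F : _^nat) : (forall i, g_sigma_preimage coors (F i)) ->
  g_sigma_preimage coors (\bigcup_i (F i)).
Proof. exact: sigma_algebra_bigcup. Qed.

HB.instance Definition _ := @isMeasurable.Build (measure_rV_display d)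
  'rV[T]_n (g_sigma_preimage coors) rV_set0 rV_setC rV_bigcup.

End measurable_rV.

Lemma measurable_coord_rV d (T : measurableType d) n (i : 'I_n) :
  measurable_fun [set: 'rV[T]_n] (fun x : 'rV[T]_n => x ord0 i).
Proof.
move=> _ Y mY; rewrite setTI; apply: sub_sigma_algebra => /=.
rewrite -bigcup_seq/=; exists i => /=; first by rewrite mem_index_enum.
by exists Y => //; rewrite setTI.
Qed.

Lemma measurable_fun_rVP d1 d2 (T1 : measurableType d1) (T2 : measurableType d2)
    n (f : T1 -> 'rV[T2]_n) :
  measurable_fun [set: T1] f <->
  forall i, measurable_fun [set: T1] (fun x => f x ord0 i).
Proof.
split=> [mf i|mf].
  exact: (@measurableT_comp _ _ _ _ _ _ (fun x : 'rV[T2]_n => x ord0 i) _ f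
    (measurable_coord_rV i)).
move=> _ Y mY; rewrite setTI.
suff : g_sigma_preimage (fun i (x : T1) => f x ord0 i) `<=` measurable.
  have := @g_sigma_preimage_comp _ T2 n 'rV[T2]_n
    (fun i x => x ord0 i) T1 f.
  rewrite /comp => -> /(_ (f @^-1` Y)); apply.
  by exists Y => //; rewrite setTI.
apply: smallest_sub; first exact: sigma_algebra_measurable.
rewrite -bigcup_seq/=; apply: bigcup_sub => i _.
by move=> A [B mB <-]; exact: mf.
Qed.

Section lebesgue_measure_rV.
Context {R : realType}.

Definition cons_rV n (x : R * 'rV[R]_n) : 'rV[R]_n.+1 :=
  \row_i if unlift ord0 i is Some j then x.2 ord0 j else x.1.

Definition uncons_rV n (v : 'rV[R]_n.+1) : R * 'rV[R]_n :=
  (v ord0 ord0, \row_j v ord0 (lift ord0 j)).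

Lemma cons_rVK n : cancel (@cons_rV n) (@uncons_rV n).
Proof.
move=> [x v]; rewrite /uncons_rV /cons_rV mxE unlift_none; congr pair.
by apply/rowP => j; rewrite !mxE liftK.
Qed.

Lemma measurable_cons_rV n : measurable_fun [set: R * 'rV[R]_n] (@cons_rV n).
Proof.
apply/measurable_fun_rVP => i.
rewrite [X in measurable_fun _ X](_ : _ = fun x : R * 'rV[R]_n =>
  if unlift ord0 i is Some j then x.2 ord0 j else x.1); last first.
  by apply/funext => x; rewrite mxE.
case: unlift => [j|]; last exact: measurable_fst.
exact: (measurableT_comp (measurable_coord_rV j)).
Qed.

Lemma measurable_uncons_rV n :
  measurable_fun [set: 'rV[R]_n.+1] (@uncons_rV n).
Proof.
apply: measurable_fun_pair; first exact: measurable_coord_rV.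
apply/measurable_fun_rVP => i.
rewrite [X in measurable_fun _ X](_ : _ = fun v : 'rV[R]_n.+1 =>
  v ord0 (lift ord0 i)); last by apply/funext => x; rewrite mxE.
exact: measurable_coord_rV.
Qed.

Section step.
Variables (n : nat) (m : {sigma_finite_measure set 'rV[R]_n -> \bar R}).

Definition lebesgue_rV_step : set 'rV[R]_n.+1 -> \bar R :=
  pushforward (lebesgue_measure \x m)%E (@cons_rV n).


HB.instance Definition _ := Measure.copy lebesgue_rV_step
  (measure_function_pushforward__canonical__measure_function_Measure
     (lebesgue_measure \x m)%E (@measurable_cons_rV n)).

Let lebesgue_rV_step_sigma_finite : sigma_finite setT lebesgue_rV_step.
Proof.
have /sigma_finiteP[F [TF ndF Foo]] := sigma_finiteT (@lebesgue_measure R).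
have /sigma_finiteP[G [TG ndG Goo]] := sigma_finiteT m.
exists (fun k => @uncons_rV n @^-1` (F k `*` G k)).
  rewrite -preimage_bigcup (_ : \bigcup_k _ = setT) ?preimage_setT//.
  rewrite -subTset => -[x v] _.
  have [i _ Fi] : (\bigcup_i F i) x by rewrite -TF.
  have [j _ Gj] : (\bigcup_i G i) v by rewrite -TG.
  exists (maxn i j) => //; split => /=.
    by move: x Fi; exact/subsetPset/ndF/leq_maxl.
  by move: v Gj; exact/subsetPset/ndG/leq_maxr.
move=> k; have [mF Fk] := Foo k; have [mG Gk] := Goo k.
split.
  rewrite -[X in measurable X]setTI; apply: measurable_uncons_rV => //.
  exact: measurableX.
rewrite /lebesgue_rV_step /pushforward -comp_preimage.
rewrite (_ : _ \o _ = id); last by apply/funext => x /=; exact: cons_rVK.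
by rewrite preimage_id product_measure1E// lte_mul_pinfty// ge0_fin_numE.
Qed.

HB.instance Definition _ := Measure_isSigmaFinite.Build _ _ _
  lebesgue_rV_step lebesgue_rV_step_sigma_finite.

End step.

Fixpoint lebesgue_rV n : {sigma_finite_measure set 'rV[R]_n -> \bar R} :=
  match n with
  | 0 => \d_(0 : 'rV[R]_0)
  | n'.+1 => lebesgue_rV_step (lebesgue_rV n')
  end.

End lebesgue_measure_rV.

Section open_measurable_rV.
Context {R : realType}.

Let rat_box n (qk : 'rV[rat]_n * nat) : set 'rV[R]_n :=
  [set x | forall i, `|x ord0 i - ratr (qk.1 ord0 i)| < qk.2.+1%:R^-1].

Let measurable_rat_box n (qk : 'rV[rat]_n * nat) : measurable (rat_box qk).
Proof.
rewrite (_ : rat_box qk = \bigcap_(i in [set: 'I_n])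
    (fun x : 'rV[R]_n => x ord0 i) @^-1`
      (ball (ratr (qk.1 ord0 i) : R) qk.2.+1%:R^-1)); last first.
  apply/seteqP; split => x /= xB i; first by move=> _; rewrite /ball/= distrC.
  by have := xB i I; rewrite /ball/= distrC.
apply: fin_bigcap_measurable => // i _.
rewrite -[X in measurable X]setTI; apply: measurable_coord_rV => //.
exact: open_measurable (ball_open _ _).
Qed.

Lemma open_measurable_rV n (U : set 'rV[R]_n) : open U -> measurable U.
Proof.
move=> oU.
rewrite (_ : U = \bigcup_(qk in [set: 'rV[rat]_n * nat])
    if `[< rat_box qk `<=` U >] then rat_box qk else set0); last first.
  apply/seteqP; split => [x Ux|x [qk _]]; last by case: asboolP => // sub /sub.
  have /nbhs_ballP[e /= e0 xeU] : nbhs x U by exact: open_nbhs_nbhs.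
  have [k ke] := @ltr_add_invr R 0 (e / 2) (divr_gt0 e0 (ltr0n _ 2)).
  rewrite add0r in ke.
  have kpos : 0 < k.+1%:R^-1 :> R by rewrite invr_gt0.
  have /choice[q xq] i : exists q : rat, `|x ord0 i - ratr q| < k.+1%:R^-1.
    have /rat_in_itvoo[q] : x ord0 i - k.+1%:R^-1 < x ord0 i + k.+1%:R^-1 :> R.
      by rewrite ltrD2l gtrN.
    by rewrite in_itv/= -ltr_distlC => xq; exists q.
  exists (\row_i q i, k) => //.
  have xB : rat_box (\row_i q i, k) x by move=> i /=; rewrite mxE.
  case: asboolP => // -[] y yB; apply: xeU; split => // i j.
  rewrite ord1 /ball/= (splitr e).
  have := yB j; have := xB j => /= xj yj.
  rewrite -(subrKA (ratr ((\row_i q i) ord0 j))) (le_lt_trans (ler_normD _ _))//.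
  by rewrite ltrD// (lt_trans _ ke)// distrC.
apply: countable_bigcupT_measurable; first exact: countableP.
by move=> qk; case: asboolP => // _; exact: measurable_rat_box.
Qed.

End open_measurable_rV.

Section euclidean.
Context {R : realType}.

(* The library norm on ['rV[R]_n] is the sup norm; it induces the same topology
   and the same bounded sets as the Euclidean norm. *)
Definition enorm n (x : 'rV[R]_n) : R := Num.sqrt (\sum_i x ord0 i ^+ 2).

Definition eball n (z : 'rV[R]_n) (r : R) : set 'rV[R]_n :=
  [set x | enorm (x - z) < r].

Definition boundary {T : topologicalType} (A : set T) : set T :=
  closure A `\` interior A.

Definition dist_bd n (Omega : set 'rV[R]_n) (x : 'rV[R]_n) : R :=
  inf [set enorm (x - z) | z in boundary Omega].

(* Orthogonal matrices of either determinant are allowed: for [n.+1 >= 2] a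
   reflection can be absorbed into [phi], while in dimension 1 the proper
   rotations alone would leave no bounded Lipschitz domain. *)
Definition rigid_motion n (T : 'rV[R]_n -> 'rV[R]_n) : Prop :=
  exists Q : 'M[R]_n, exists b : 'rV[R]_n,
    Q *m Q^T = 1%:M /\ forall x, T x = x *m Q + b.

Definition lipschitz_domain n (Omega : set 'rV[R]_n.+1) : Prop :=
  [/\ open Omega, boundary Omega !=set0 &
    exists r L : R, [/\ 0 < r, 0 < L & forall z, boundary Omega z ->
      exists T : 'rV[R]_n.+1 -> 'rV[R]_n.+1, exists phi : 'rV[R]_n -> R,
        [/\ rigid_motion T, T z = 0,
            forall x y, `|phi x - phi y| <= L * enorm (x - y) &
            T @` (Omega `&` eball z r) =
              [set x | eball 0 r x /\ x ord0 ord_max < phi (col' ord_max x)]]]].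

Lemma enormB_continuous n (z : 'rV[R]_n) :
  continuous (fun x : 'rV[R]_n => enorm (x - z)).
Proof.
rewrite (_ : (fun x => _) = fun x : 'rV[R]_n =>
  Num.sqrt (\sum_i (x ord0 i - z ord0 i) ^+ 2)); last first.
  by apply/funext => x; congr Num.sqrt; apply: eq_bigr => i _; rewrite !mxE.
move=> x; apply: continuous_comp; last exact: sqrt_continuous.
apply: (@continuous_big _ 'I_n +%R 0 xpredT (@add_continuous R)) => i _ y.
apply: (@continuous_comp _ _ _ (fun v : 'rV[R]_n => v ord0 i - z ord0 i)
  (fun a => a ^+ 2)); last exact: exprn_continuous.
have cy := @coord_continuous R 1 n ord0 i y.
apply: (cvgB cy); exact: cvg_cst.
Qed.

Lemma eball_open n (z : 'rV[R]_n) r : open (eball z r).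
Proof.
rewrite (_ : eball z r = (fun x => enorm (x - z)) @^-1` `]-oo, r[%classic).
  apply: open_comp => [x _|]; last exact: interval_open.
  exact: enormB_continuous.
by apply/seteqP; split => x /=; rewrite in_itv.
Qed.

Lemma measurable_dist_bd n (Omega : set 'rV[R]_n) :
  measurable_fun [set: 'rV[R]_n] (dist_bd Omega).
Proof.
have [bd0|/set0P bd0] := eqVneq (boundary Omega) set0.
  by rewrite /dist_bd bd0 (_ : (fun x => _) = cst (inf set0))//;
    apply/funext => x; rewrite image_set0.
apply: (measurability _ (RGenInftyO.measurableE R)) => _ [_ [a ->] <-].
rewrite setTI (_ : _ @^-1` _ = \bigcup_(z in boundary Omega) eball z a).
  by apply: open_measurable_rV; apply: bigcup_open => z _; exact: eball_open.
apply/seteqP; split => x /=; rewrite in_itv /=.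
  move=> /inf_lt[]; first by case: bd0 => z bz; exists (enorm (x - z)), z.
  by move=> _ [z bz <-] xza; exists z.
move=> [z bz]; apply: le_lt_trans; apply: ge_inf; last by exists z.
by exists 0 => _ [w _ <-]; exact: sqrtr_ge0.
Qed.

End euclidean.

Section exterior_measure.
Context {R : realType} (n : nat) (s p : R) (Omega : set 'rV[R]_n.+1).

(* On [boundary Omega] the density vanishes, as [0 `^ (- s) = 0], instead of
   being infinite; that set is Lebesgue-null for a Lipschitz domain. *)
Definition mu_density (x : 'rV[R]_n.+1) : R :=
  (1 - s) * dist_bd Omega x `^ (- s)
          * (1 + dist_bd Omega x) `^ (- n.+1%:R - s * (p - 1)).

Definition mu_s (A : set 'rV[R]_n.+1) : \bar R :=
  (\int[lebesgue_rV n.+1]_(x in A) (\1_(~` Omega) x * mu_density x)%:E)%E.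

Hypotheses (s1 : s <= 1) (mOmega : measurable Omega).

Let mu_s_density_ge0 x : 0 <= \1_(~` Omega) x * mu_density x.
Proof. by rewrite !mulr_ge0 ?powR_ge0 ?subr_ge0. Qed.

Lemma measurable_mu_density : measurable_fun setT mu_density.
Proof.
apply: measurable_funM; first apply: measurable_funM => //.
  apply: (measurableT_comp (measurable_powR _)).
  exact: measurable_dist_bd.
apply: (measurableT_comp (measurable_powR _)).
by apply: measurable_funD => //; exact: measurable_dist_bd.
Qed.

Let mu_s0 : mu_s set0 = 0%E.
Proof. exact: integral_set0. Qed.

Let mu_s_ge0 A : (0 <= mu_s A)%E.
Proof. by apply: integral_ge0 => x _; rewrite lee_fin mu_s_density_ge0. Qed.

Let mu_s_sigma_additive : semi_sigma_additive mu_s.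
Proof.
move=> F mF tF mUF; rewrite /mu_s ge0_integral_bigcup//=.
- apply: is_cvg_ereal_nneg_natsum_cond => k _ _.
  exact: mu_s_ge0.
- apply: measurable_funTS; apply/measurable_EFinP; apply: measurable_funM.
    exact/measurable_indicP/measurableC.
  exact: measurable_mu_density.
- by move=> x _; rewrite lee_fin mu_s_density_ge0.
Qed.

HB.instance Definition _ := isMeasure.Build _ _ _
  mu_s mu_s0 mu_s_ge0 mu_s_sigma_additive.

End exterior_measure.

(* A normed space of functions identified almost everywhere: [fs_mem] are the
   representatives, [fs_eq] the identification, [fs_norm] the norm. *)
Record fspace (R : realType) (E : Type) := FSpace {
  fs_mem : set (E -> R);
  fs_eq : (E -> R) -> (E -> R) -> Prop;
  fs_norm : (E -> R) -> \bar R
}.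

Section operators.
Context {R : realType} {E : Type}.
Implicit Types (X Y : fspace R E) (F : (E -> R) -> E -> R).

Definition well_defined X Y F : Prop :=
  (forall u, fs_mem X u -> fs_mem Y (F u)) /\
  (forall u v, fs_mem X u -> fs_mem X v -> fs_eq X u v -> fs_eq Y (F u) (F v)).

Definition linear_op X Y F : Prop :=
  forall (a : R) u v, fs_mem X u -> fs_mem X v ->
    fs_eq Y (F (fun x => a * u x + v x)) (fun x => a * F u x + F v x).

Definition continuous_op X Y F : Prop :=
  forall u, fs_mem X u -> forall eps : R, 0 < eps ->
    exists2 delta : R, 0 < delta &
      forall v, fs_mem X v ->
        (fs_norm X (fun x => v x - u x)%R < delta%:E)%E ->
        (fs_norm Y (fun x => F v x - F u x)%R < eps%:E)%E.

Definition bounded_op_by (C : R) X Y F : Prop :=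
  forall u, fs_mem X u -> (fs_norm Y (F u) <= C%:E * fs_norm X u)%E.

End operators.

Section spaces.
Context {R : realType} (n : nat) (s p : R) (Omega : set 'rV[R]_n.+1).
Implicit Types u g : 'rV[R]_n.+1 -> R.
Local Open Scope ereal_scope.
Local Notation leb := (lebesgue_rV n.+1).

(* The suffix [_pow] marks the [p]-th power of a seminorm. The quotients take
   the value 0 where the denominator vanishes, a Lebesgue-null set. *)
Definition V_seminorm_pow u : \bar R :=
  (1 - s)%:E * \int[leb]_(x in Omega) \int[leb]_y
    (`|u x - u y| `^ p / enorm (x - y) `^ (n.+1%:R + s * p))%:E.

Definition V_norm u : \bar R :=
  (\int[leb]_(x in Omega) (`|u x| `^ p)%:E + V_seminorm_pow u) `^ p^-1.

Definition V_space : fspace R 'rV[R]_n.+1 := {|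
  fs_mem := [set u | measurable_fun setT u /\ V_seminorm_pow u < +oo];
  fs_eq := fun u v => u = v %[ae leb];
  fs_norm := V_norm |}.

Local Notation d := (dist_bd Omega).

Definition T_seminorm_pow g : \bar R :=
  \int[mu_s s p Omega]_(y in ~` Omega) \int[mu_s s p Omega]_(x in ~` Omega)
    (`|g x - g y| `^ p /
     Num.min (enorm (x - y) + d x + d y)%R 1%R `^ (n.+1%:R + s * (p - 2)))%:E.

Definition T_norm g : \bar R :=
  (\int[mu_s s p Omega]_(x in ~` Omega) (`|g x| `^ p)%:E + T_seminorm_pow g)
    `^ p^-1.

(* Functions on the complement of [Omega] are represented by total functions
   whose values on [Omega] are irrelevant. *)
Definition T_space : fspace R 'rV[R]_n.+1 := {|
  fs_mem := [set g | measurable_fun (~` Omega) g /\ T_norm g < +oo];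
  fs_eq := fun g h => g = h %[ae leb in ~` Omega];
  fs_norm := T_norm |}.

End spaces.

Definition trace (R : realType) n (Omega : set 'rV[R]_n.+1)
  (u : 'rV[R]_n.+1 -> R) : 'rV[R]_n.+1 -> R := u \_ (~` Omega).

(* Main.v *)
From HB Require Import structures.
Require Import Defs.
From mathcomp Require Import all_boot all_order all_algebra.
From mathcomp Require Import all_classical all_reals all_analysis.
From mathcomp Require Import measurable_realfun.
From mathcomp Require Import ring lra.
Import Order.TTheory GRing.Theory Num.Theory numFieldNormedType.Exports.

Set Implicit Arguments.
Unset Strict Implicit.
Unset Printing Implicit Defensive.

Local Open Scope classical_set_scope.
Local Open Scope ring_scope.

(* Both bounds rest on a uniform cone condition extracted from the Lipschitz graph
   charts: near the boundary, a fixed direction [v] with [enorm v <= M] moves a point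
   at distance [t] from the boundary to the centre of a ball of radius comparable to
   [t] inside [Omega]. It also gives [\int_(B_t) d_x ^ (- s) <= C t ^ (d - s) / (1 - s)],
   which absorbs the factor [1 - s] of the measure [mu_s] uniformly in [s].

   Extension. Inside [Omega], [Ext g x] is the average of [g] against [mu_s] weighted
   by a Lipschitz bump of radius [4 d_x] centred at [x]. Jensen's inequality bounds
   the [L^p] norm and the interactions of [x] with the complement; for nearby points
   of [Omega] one uses the Lipschitz bound of the normalised bump.

   Trace. For [x] outside and a scale [t_j = r q ^ j], let [N_j x] be the average of
   [|u x - u y| ^ p] over the ball of radius [t_j] shifted by [t_j v] into [Omega].
   Two consecutive averages satisfy [N_j <= lam N_(j+1) + C osc_j] with [lam] as close
   to 1 as desired, so that against the weights [t_j ^ (- s (p - 1))] the sum over the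
   scales above [d_x] telescopes into the last scale, controlled by the interaction of
   [x] with [Omega], plus oscillations inside [Omega]. The latter are estimated by a
   fractional Poincare inequality whose constant carries the factor [1 - s]; that
   factor comes from summing the halving inequality over dyadic scales. *)

(** [V_space] sees no interaction between two points of the complement, so [|u x - u y|] for outer
    points must be routed through [Omega] at the scale [t] of [enorm (x - y) + d x + d y].
    Estimating every such scale directly fails: the weight [d x] to the power -s in [mu_s] would
    face [t] to the power -s from the kernel of [V_space], and [d x] may be far smaller than [t].
    Hence averages are carried down to the scale [d x], where the two weights agree.

    The factor 1 - s decides the rest. In the trace, [mu_s] and the Poincare inequality bring one
    factor each and the integral of the weight consumes one, which leaves the one of the seminorm.
    In the extension, convergence at the diagonal needs the power |x - y|^p, supplied by differences
    of Lipschitz bumps; the radial integral then costs 1 / (p (1 - s)), paid by the seminorm.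

    The lower bounds on the parameters enter through [s_lo] in the decay of [mu_s] at infinity and
    through 1 < [p_lo] in the gain s (p - 1) from one scale to the next. *)

(** * Integrals of nonnegative functions and Tonelli's theorem *)

Section nonneg_integrals.
Local Open Scope ereal_scope.
Context d (T : measurableType d) (R : realType).
Variable mu : {measure set T -> \bar R}.
Implicit Types f g : T -> \bar R.
Import HBNNSimple.

(** No measurability is required: the integral of a nonnegative function is the supremum over the
    simple functions below it. Most comparisons of integrals rely on this. *)
Lemma le_int f g : (forall x, 0 <= f x) -> (forall x, f x <= g x) ->
  \int[mu]_x f x <= \int[mu]_x g x.
Proof.
move=> f0 fg; have g0 x : 0 <= g x by apply: le_trans (fg x).
rewrite !ge0_integralTE//; apply: ereal_sup_le => _ [h hf <-].
by exists h => // x; exact: le_trans (fg x).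
Qed.

Lemma intZl (k : R) f : (0 <= k)%R -> measurable_fun setT f ->
  (forall x, 0 <= f x) -> \int[mu]_x (k%:E * f x) = k%:E * \int[mu]_x f x.
Proof. by move=> k0 mf f0; rewrite ge0_integralZl_EFin. Qed.

Lemma int_mkcond (D : set T) f :
  \int[mu]_(x in D) f x = \int[mu]_x ((\1_D x)%:E * f x).
Proof.
rewrite integral_mkcond; apply: eq_integral => x _.
by rewrite /patch indicE; case: (x \in D); rewrite ?mul1e ?mul0e.
Qed.

End nonneg_integrals.

Section tonelli.
Local Open Scope ereal_scope.
Context d1 d2 (T1 : measurableType d1) (T2 : measurableType d2) (R : realType).
Variables (m1 : {sigma_finite_measure set T1 -> \bar R})
          (m2 : {sigma_finite_measure set T2 -> \bar R}).
Variable f : T1 -> T2 -> \bar R.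
Hypotheses (mf : measurable_fun setT (fun t : T1 * T2 => f t.1 t.2))
           (f0 : forall x y, 0 <= f x y).

Lemma tonelli : \int[m1]_x \int[m2]_y f x y = \int[m2]_y \int[m1]_x f x y.
Proof.
exact: (@fubini_tonelli _ _ _ _ _ m1 m2 (fun t => f t.1 t.2) mf
  (fun t => f0 t.1 t.2)).
Qed.

Lemma measurable_int : measurable_fun setT (fun x => \int[m2]_y f x y).
Proof.
exact: (@measurable_fun_fubini_tonelli_F _ _ _ _ _ m2 (fun t => f t.1 t.2) mf
  (fun t => f0 t.1 t.2)).
Qed.

End tonelli.

(** * Affine changes of variables for Lebesgue measure *)

Section lebesgue_affine_1d.
Local Open Scope ereal_scope.
Context {R : realType}.
Local Notation leb := (@lebesgue_measure R).

Let measurable_affine (a b : R) :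
  measurable_fun [set: measurableTypeR R]
    (fun x : measurableTypeR R => (a * x + b)%R : measurableTypeR R).
Proof. by apply: measurable_funD => //; exact: measurable_funM. Qed.

(** The push-forward of Lebesgue measure under x -> a x + b, multiplied by [a], agrees with Lebesgue
    measure on half-open intervals, hence everywhere by uniqueness. *)
Lemma int_affine (a b : R) (f : R -> \bar R) : (0 < a)%R ->
  measurable_fun setT f -> (forall x, 0 <= f x) ->
  \int[leb]_x f x = a%:E * \int[leb]_x f (a * x + b)%R.
Proof.
move=> a0 mf f0.
pose pf : {measure set (measurableTypeR R) -> \bar R} :=
  measure_function_pushforward__canonical__measure_function_Measure leb
    (measurable_affine a b).
pose nu : {measure set (measurableTypeR R) -> \bar R} :=
  mscale (NngNum (ltW a0)) pf.
have nuE A : measurable A -> leb A = nu A.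
  apply: lebesgue_measure_unique => _ [[c e] _ <-].
  rewrite /nu /pf /= /mscale/= /pushforward.
  rewrite (_ : _ @^-1` _ = `](c - b) / a, (e - b) / a]%classic)%R; last first.
    apply/seteqP; split => x /=; rewrite !in_itv/=.
      by move=> /andP[? ?]; rewrite ltr_pdivrMr// ler_pdivlMr//; apply/andP; split; lra.
    by rewrite ltr_pdivrMr// ler_pdivlMr// => /andP[? ?]; apply/andP; split; lra.
  rewrite !lebesgue_measure_itv/= !lte_fin ltr_pM2r ?invr_gt0//.
  rewrite ltrD2r; case: ifPn => _; last by rewrite mule0.
 rewrite -!EFinB -EFinM; congr EFin.
  by field; rewrite gt_eqF.
transitivity (\int[nu]_x f x).
  by apply: eq_measure_integral => A mA _; exact: nuE.
rewrite /nu ge0_integral_mscale//; congr (_ * _).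
have := @ge0_integral_pushforward _ _ _ _ _ _ (measurable_affine a b) leb setT f measurableT mf.
rewrite preimage_setT; apply => x _; exact: f0.

Qed.

End lebesgue_affine_1d.

Section lebesgue_rV_integral.
Local Open Scope ereal_scope.
Context {R : realType}.
Local Notation leb := (@lebesgue_measure R).

Lemma cons_uncons_rV n : cancel (@uncons_rV R n) (@cons_rV R n).
Proof.
move=> v; apply/rowP => i; rewrite /cons_rV /uncons_rV mxE.
by case: unliftP => [j|] ->; rewrite /= ?mxE.
Qed.

Lemma int_rVS n (f : 'rV[R]_n.+1 -> \bar R) : measurable_fun setT f ->
  (forall x, 0 <= f x) ->
  \int[lebesgue_rV n.+1]_x f x =
  \int[leb]_a \int[lebesgue_rV n]_v f (cons_rV (a, v)).
Proof.
move=> mf f0.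
have mc : @measurable_fun _ _ (measurableTypeR R * 'rV[R]_n)%type _ setT
  (@cons_rV R n) := @measurable_cons_rV R n.
have := @ge0_integral_pushforward _ _ _ _ _ _ mc (leb \x lebesgue_rV n) setT f
  measurableT mf (fun x _ => f0 x).
rewrite preimage_setT => ->; rewrite fubini_tonelli1//.
  exact: (measurableT_comp mf mc).
by move=> x /=; exact: f0.
Qed.

Lemma cons_rVD n (a b : R) (v w : 'rV[R]_n) :
  (cons_rV (a, v) + cons_rV (b, w) = cons_rV (a + b, v + w)%R)%R.
Proof.
by apply/rowP => i; rewrite !mxE; case: unliftP => [j|] _ /=; rewrite ?mxE.
Qed.

Lemma cons_rVZ n (c a : R) (v : 'rV[R]_n) :
  (c *: cons_rV (a, v) = cons_rV (c * a, c *: v)%R)%R.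
Proof.
by apply/rowP => i; rewrite !mxE; case: unliftP => [j|] _ /=; rewrite ?mxE.
Qed.

Lemma measurable_affine_rV n (c : R) (b : 'rV[R]_n) :
  measurable_fun setT (fun x : 'rV[R]_n => (c *: x + b)%R).
Proof.
apply/measurable_fun_rVP => i.
rewrite [X in measurable_fun _ X](_ : _ = fun x : 'rV[R]_n =>
  (c * x ord0 i + b ord0 i)%R); last by apply/funext => x; rewrite !mxE.
apply: measurable_funD => //; apply: measurable_funM => //.
exact: measurable_coord_rV.
Qed.

(** Induction on the dimension, each coordinate contributing one factor [c]. It covers translations,
    the scaling of balls and the midpoint map of the halving inequality. *)
Lemma int_affine_rV n (c : R) (b : 'rV[R]_n) (f : 'rV[R]_n -> \bar R) :
  (0 < c)%R -> measurable_fun setT f -> (forall x, 0 <= f x) ->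
  \int[lebesgue_rV n]_x f x =
  (c ^+ n)%:E * \int[lebesgue_rV n]_x f (c *: x + b)%R.
Proof.
move=> c0; elim: n b f => [|n IH] b f mf f0.
  rewrite expr0 mul1e; apply: eq_integral => x _; congr f.
  by apply/rowP => -[].
rewrite -(cons_uncons_rV b); set b0 := (uncons_rV b).1; set b1 := (uncons_rV b).2.
have mg : measurable_fun setT (f \o @cons_rV R n).
  by apply: measurableT_comp => //; exact: measurable_cons_rV.
have mg1 a : measurable_fun setT (fun v => f (cons_rV (a, v))).
  exact: (measurableT_comp mg (pair1_measurable a)).
have mF : measurable_fun setT (fun a => \int[lebesgue_rV n]_v f (cons_rV (a, v))).
  by apply: (@measurable_int _ _ _ _ _ (lebesgue_rV n) (fun a v => f (cons_rV (a, v)))) => //.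
rewrite int_rVS// (int_affine (a := c) b0)//; last first.
  by move=> x; exact: integral_ge0.
rewrite exprS EFinM -muleA; congr (_ * _).
rewrite int_rVS//; last first.
  by apply: measurableT_comp => //; exact: measurable_affine_rV.
rewrite -intZl ?exprn_ge0 ?(ltW c0)//; last 2 first.
- apply: (@measurable_int _ _ _ _ _ (lebesgue_rV n) (fun a v => f (c *: cons_rV (a, v) + cons_rV (b0, b1))%R)) => //.
  rewrite (_ : (fun t => _) = f \o ((fun x => c *: x + cons_rV (b0, b1))%R \o
    @cons_rV R n)); last by apply/funext => -[].
  have mc : @measurable_fun _ _ (measurableTypeR R * 'rV[R]_n)%type _ setT
    (@cons_rV R n) := @measurable_cons_rV R n.
  exact: (measurableT_comp mf (measurableT_comp (measurable_affine_rV _ _) mc)).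
- by move=> x; exact: integral_ge0.
apply: eq_integral => a _.
rewrite (IH b1)//; congr (_ * _); apply: eq_integral => v _.
by rewrite cons_rVZ cons_rVD.
Qed.

Lemma int_shift n (b : 'rV[R]_n) (f : 'rV[R]_n -> \bar R) :
  measurable_fun setT f -> (forall x, 0 <= f x) ->
  \int[lebesgue_rV n]_x f (x + b)%R = \int[lebesgue_rV n]_x f x.
Proof.
move=> mf f0; rewrite [RHS](int_affine_rV (c := 1) b)// expr1n mul1e.
by apply: eq_integral => x _; rewrite scale1r.
Qed.

End lebesgue_rV_integral.

(** * The Euclidean norm *)

Section enorm_theory.
Context {R : realType} {n : nat}.
Implicit Types (x y z : 'rV[R]_n) (c : R).

Lemma enorm_ge0 x : 0 <= enorm x. Proof. exact: sqrtr_ge0. Qed.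

Lemma sqr_enorm x : enorm x ^+ 2 = \sum_i x ord0 i ^+ 2.
Proof. by rewrite sqr_sqrtr// sumr_ge0// => i _; exact: sqr_ge0. Qed.

Lemma enorm0 : enorm (0 : 'rV[R]_n) = 0.
Proof.
by rewrite /enorm big1 ?sqrtr0// => i _; rewrite mxE expr0n.
Qed.

Lemma enormZ c x : enorm (c *: x) = `|c| * enorm x.
Proof.
rewrite /enorm -sqrtr_sqr -sqrtrM ?sqr_ge0// mulr_sumr.
by congr Num.sqrt; apply: eq_bigr => i _; rewrite mxE exprMn.
Qed.

Lemma enormN x : enorm (- x) = enorm x.
Proof. by rewrite -scaleN1r enormZ normrN1 mul1r. Qed.

Lemma enormBC x y : enorm (x - y) = enorm (y - x).
Proof. by rewrite -enormN opprB. Qed.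

Lemma enorm_eq0 x : (enorm x == 0) = (x == 0).
Proof.
apply/eqP/eqP => [x0|->]; last exact: enorm0.
have /eqP : \sum_i x ord0 i ^+ 2 = 0 by rewrite -sqr_enorm x0 expr0n.
rewrite psumr_eq0; last by move=> i _; exact: sqr_ge0.
move=> /allP h; apply/rowP => i; rewrite mxE; apply/eqP.
by have := h i (mem_index_enum _); rewrite /= sqrf_eq0.
Qed.

(** Cauchy-Schwarz, from expanding the sum of the squares of |y| x_i - |x| y_i. *)
Lemma dot_le_enorm x y :
  \sum_i x ord0 i * y ord0 i <= enorm x * enorm y.
Proof.
have [/eqP|x0] := eqVneq (enorm x) 0.
  rewrite enorm_eq0 => /eqP ->; rewrite enorm0 mul0r big1// => i _.
  by rewrite mxE mul0r.
have [/eqP|y0] := eqVneq (enorm y) 0.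
  rewrite enorm_eq0 => /eqP ->; rewrite enorm0 mulr0 big1// => i _.
  by rewrite mxE mulr0.
have xp : 0 < enorm x by rewrite lt_neqAle eq_sym x0 enorm_ge0.
have yp : 0 < enorm y by rewrite lt_neqAle eq_sym y0 enorm_ge0.
have : 0 <= \sum_i (enorm y * x ord0 i - enorm x * y ord0 i) ^+ 2.
  by apply: sumr_ge0 => i _; exact: sqr_ge0.
under eq_bigr do rewrite sqrrB !exprMn.
rewrite big_split/= sumrB -!mulr_sumr -!sqr_enorm.
rewrite sumrMnl -mulr_natr.
have -> : \sum_i enorm y * x ord0 i * (enorm x * y ord0 i) =
  enorm x * enorm y * \sum_i x ord0 i * y ord0 i.
  by rewrite mulr_sumr; apply: eq_bigr => i _; ring.
set S := \sum_i _ => h.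
have {}h : 0 <= 2 * (enorm x * enorm y) * (enorm x * enorm y - S).
  by apply: le_trans h _; rewrite le_eqVlt; apply/orP; left; apply/eqP; ring.
rewrite -subr_ge0 -(pmulr_rge0 _ (x := 2 * (enorm x * enorm y)))//.
by rewrite !mulr_gt0.
Qed.

Lemma enormD x y : enorm (x + y) <= enorm x + enorm y.
Proof.
rewrite -(@ler_pXn2r _ 2)// ?nnegrE ?addr_ge0 ?enorm_ge0//.
rewrite sqr_enorm sqrrD !sqr_enorm.
under eq_bigr do rewrite mxE sqrrD.
rewrite !big_split/= lerD2r lerD2l.
by rewrite -mulr2n lerMn2r/= dot_le_enorm.
Qed.

Lemma enormB x y : enorm (x - y) <= enorm x + enorm y.
Proof. by rewrite (le_trans (enormD _ _))// enormN. Qed.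

Lemma enorm_tri z x y : enorm (x - y) <= enorm (x - z) + enorm (z - y).
Proof. by rewrite -[in leLHS](subrKA z); exact: enormD. Qed.

Lemma enorm_coord x i : `|x ord0 i| <= enorm x.
Proof.
rewrite -(@ler_pXn2r _ 2)// ?nnegrE ?enorm_ge0// sqr_enorm real_normK ?num_real//.
rewrite (bigD1 i)//= lerDl sumr_ge0// => j _; exact: sqr_ge0.
Qed.

Lemma enorm_le_sum x : enorm x <= \sum_i `|x ord0 i|.
Proof.
rewrite -(@ler_pXn2r _ 2)// ?nnegrE ?enorm_ge0 ?sumr_ge0// sqr_enorm.
have : forall (r : seq 'I_n), \sum_(i <- r) x ord0 i ^+ 2 <=
    (\sum_(i <- r) `|x ord0 i|) ^+ 2; last exact.
elim=> [|i r IH]; first by rewrite !big_nil expr0n.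
rewrite !big_cons sqrrD real_normK ?num_real// -addrA lerD2l.
by rewrite (le_trans IH)// lerDr mulrn_wge0// mulr_ge0// sumr_ge0.
Qed.

End enorm_theory.

(** * Measurability of norms, distances, powers and indicators *)

Section measurability.
Context {R : realType} d (T : measurableType d).
Implicit Types D : set T.

Lemma measurable_enorm n :
  measurable_fun setT (fun x : 'rV[R]_n => enorm x).
Proof.
apply: (measurability _ (RGenInftyO.measurableE R)) => _ [_ [a ->] <-].
rewrite setTI (_ : _ @^-1` _ = eball 0 a).
  by apply: open_measurable_rV; exact: eball_open.
by apply/seteqP; split => x /=; rewrite in_itv/= /eball/= subr0.
Qed.

Lemma measurable_subrV n (f g : T -> 'rV[R]_n) : measurable_fun setT f ->
  measurable_fun setT g -> measurable_fun setT (fun x => f x - g x).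
Proof.
move=> mf mg; apply/measurable_fun_rVP => i.
rewrite (_ : (fun x => _) = fun x => f x ord0 i - g x ord0 i); last first.
  by apply/funext => x; rewrite !mxE.
apply: measurable_funB.
- by have /measurable_fun_rVP := mf; exact.
- by have /measurable_fun_rVP := mg; exact.
Qed.

Lemma measurable_addrV n (f g : T -> 'rV[R]_n) : measurable_fun setT f ->
  measurable_fun setT g -> measurable_fun setT (fun x => f x + g x).
Proof.
move=> mf mg; apply/measurable_fun_rVP => i.
rewrite (_ : (fun x => _) = fun x => f x ord0 i + g x ord0 i); last first.
  by apply/funext => x; rewrite !mxE.
apply: measurable_funD.
- by have /measurable_fun_rVP := mf; exact.
- by have /measurable_fun_rVP := mg; exact.
Qed.

Lemma measurable_scalerV n c (f : T -> 'rV[R]_n) : measurable_fun setT f ->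
  measurable_fun setT (fun x => c *: f x).
Proof.
move=> mf; apply/measurable_fun_rVP => i.
rewrite (_ : (fun x => _) = fun x => c * f x ord0 i); last first.
  by apply/funext => x; rewrite !mxE.
by apply: measurable_funM => //; have /measurable_fun_rVP := mf; exact.
Qed.

Lemma measurable_enorm_comp n (f : T -> 'rV[R]_n) : measurable_fun setT f ->
  measurable_fun setT (fun x => enorm (f x)).
Proof. by move=> mf; apply: measurableT_comp mf; exact: measurable_enorm. Qed.

Lemma measurable_dist_comp n (O : set 'rV[R]_n) (f : T -> 'rV[R]_n) :
  measurable_fun setT f -> measurable_fun setT (fun x => dist_bd O (f x)).
Proof. by move=> mf; apply: measurableT_comp mf; exact: measurable_dist_bd. Qed.

Lemma measurable_powR_comp D (f : T -> R) a : measurable_fun D f ->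
  measurable_fun D (fun x => f x `^ a).
Proof. by move=> mf; exact: (measurableT_comp (@measurable_powR R a) mf). Qed.

Lemma measurable_norm_comp D (f : T -> R) : measurable_fun D f ->
  measurable_fun D (fun x => `|f x|).
Proof. by move=> mf; exact: (measurableT_comp (@normr_measurable R setT) mf). Qed.

Lemma measurable_boolR (b : T -> bool) : measurable_fun setT b ->
  measurable_fun setT (fun x => (b x)%:R : R).
Proof.
move=> mb; rewrite (_ : (fun x => _) = fun x => if b x then 1 else 0 : R).
  exact: measurable_fun_ifT.
by apply/funext => x; case: (b x).
Qed.

Lemma measurable_indic_comp d' (T' : measurableType d') (A : set T') (f : T -> T') :
  measurable A -> measurable_fun setT f ->
  measurable_fun setT (fun x => \1_A (f x) : R).
Proof.
move=> mA mf.
have mi : measurable_fun setT (\1_A : T' -> R) by exact: measurable_indic.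
exact: (measurableT_comp mi mf).
Qed.

Lemma measurable_invR D (f : T -> R) : measurable_fun D f ->
  (forall x, 0 <= f x) -> measurable_fun D (fun x => (f x)^-1).
Proof.
move=> mf f0; rewrite (_ : (fun x => _) = fun x => f x `^ (-1)).
  exact: measurable_powR_comp.
by apply/funext => x; rewrite powR_inv1.
Qed.

End measurability.

(** * Volumes of cubes and balls *)

Section volume.
Context {R : realType}.
Local Open Scope ereal_scope.

Definition box n (c : 'rV[R]_n) (r : R) (y : 'rV[R]_n) : bool :=
  [forall i, `|y ord0 i - c ord0 i| < r]%R.

Lemma measurable_box n (c : 'rV[R]_n) r : measurable_fun setT (box c r).
Proof.
apply: (measurable_fun_bool true); rewrite setTI.
rewrite (_ : _ @^-1` _ = \bigcap_(i in [set: 'I_n])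
    (fun x : 'rV[R]_n => x ord0 i) @^-1` (ball (c ord0 i : R) r)); last first.
  apply/seteqP; split => x /=.
    by move=> /forallP h i _; rewrite /ball/= distrC.
  by move=> h; apply/forallP => i; rewrite distrC; exact: h.
apply: fin_bigcap_measurable => // i _.
rewrite -[X in measurable X]setTI; apply: measurable_coord_rV => //.
exact: open_measurable (ball_open _ _).
Qed.

Lemma int_box n (c : 'rV[R]_n) (r : R) : (0 <= r)%R ->
  \int[lebesgue_rV n]_y ((box c r y)%:R)%:E = ((r *+ 2) ^+ n)%:E.
Proof.
move=> r0; elim: n c => [|n IH] c.
  rewrite [LHS](_ : _ = \int[\d_(0%R : 'rV[R]_0)]_y 1).
    by rewrite integral_cst// mul1e expr0 /= diracE in_setT.
  apply: eq_integral => y _; rewrite (_ : box c r y)//.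
  by apply/forallP => -[].
have mb k (b : 'rV[R]_k) : measurable_fun setT (fun y => ((box b r y)%:R : R)%:E).
  by apply/measurable_EFinP; apply: measurable_boolR; exact: measurable_box.
rewrite int_rVS//.
rewrite -(cons_uncons_rV c); case: (uncons_rV c) => c0 c1.
have bE a v : box (cons_rV (c0, c1)) r (cons_rV (a, v)) =
    (`|a - c0| < r)%R && box c1 r v.
  apply/forallP/andP => [h|[h1 /forallP h2] i].
    split; first by have /= := h ord0; rewrite !mxE unlift_none.
    by apply/forallP => i; have /= := h (lift ord0 i); rewrite !mxE liftK.
  by rewrite !mxE; case: unliftP.
transitivity (\int[lebesgue_measure]_a
    (((r *+ 2) ^+ n)%:E * ((`|a - c0| < r)%R%:R : R)%:E)).
  apply: eq_integral => a _.
  under eq_integral => v _ do rewrite bE -mulnb natrM EFinM.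
  by rewrite intZl ?IH 1?muleC// ?ler0n//; exact: mb.
rewrite intZl ?exprn_ge0 ?mulrn_wge0//; last first.
  apply/measurable_EFinP; apply: measurable_boolR.
  apply: measurable_fun_ltr => //; apply: measurable_norm_comp.
  exact: measurable_funB.
rewrite exprSr EFinM; congr (_ * _).
rewrite (_ : (fun x => _) = fun x => (\1_(ball c0 r) x)%:E); last first.
  apply/funext => x; rewrite indicE.
  case: (boolP (`|x - c0| < r)%R) => h.
    by rewrite mem_set// /ball/= distrC.
  by rewrite memNset// /ball/= distrC; exact/negP.
rewrite integral_indic//; last exact: measurable_ball.
by rewrite setIT; exact: lebesgue_measure_ball.
Qed.

End volume.

Lemma powR_add {R : realType} (x r s : R) : 0 < x -> x `^ (r + s) = x `^ r * x `^ s.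
Proof. by move=> x0; rewrite powRD// (gt_eqF x0) implybT. Qed.

Section ball_volume.
Context {R : realType} {n : nat}.
Local Notation leb := (@lebesgue_rV R n.+1).
Local Open Scope ereal_scope.

Lemma measurable_eball_ind d (T : measurableType d) (f g : T -> 'rV[R]_n.+1)
    (h : T -> R) :
  measurable_fun setT f -> measurable_fun setT g -> measurable_fun setT h ->
  measurable_fun setT (fun t => ((enorm (f t - g t) < h t)%R%:R : R)).
Proof.
move=> mf mg mh; apply: measurable_boolR; apply: measurable_fun_ltr => //.
by apply: measurable_enorm_comp; exact: measurable_subrV.
Qed.

Definition vball : R :=
  fine (\int[leb]_y ((enorm y < 1)%R%:R)%:E).

Let mb1 : measurable_fun setT (fun y : 'rV[R]_n.+1 => ((enorm y < 1)%R%:R : R)%:E).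
Proof.
apply/measurable_EFinP; apply: measurable_boolR; apply: measurable_fun_ltr => //.
exact: measurable_enorm.
Qed.

Let int_ball1_le : \int[leb]_y ((enorm y < 1)%R%:R)%:E <= (2 ^+ n.+1)%:E.
Proof.
rewrite -[in leRHS](mulr_natl 1 2) mulr1 -[2%:R]/(1 *+ 2 : R)%R.
rewrite -(@int_box R n.+1 0 1)//.
apply: le_int => y; first by rewrite lee_fin.
rewrite lee_fin; have [y1|//] := ltP (enorm y) 1%R.
rewrite (_ : box 0 1 y)//; apply/forallP => i.
by rewrite mxE subr0 (le_lt_trans (enorm_coord _ _)).
Qed.

Let int_ball1_gt0 : 0 < \int[leb]_y ((enorm y < 1)%R%:R)%:E.
Proof.
(* In the cube of half-side 1 / (n + 2) the absolute values of the n + 1 coordinates sum to at most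
   (n + 1) / (n + 2) < 1, so this cube lies in the unit ball. *)
have r0 : (0 < n.+2%:R^-1 :> R)%R by rewrite invr_gt0.
apply: (@lt_le_trans _ _ ((n.+2%:R^-1 *+ 2) ^+ n.+1)%:E).
  by rewrite lte_fin exprn_gt0// mulrn_wgt0.
rewrite -(@int_box R n.+1 0%R); last exact: ltW.
apply: le_int => y; first by rewrite lee_fin.
rewrite lee_fin; case: (boolP (box _ _ _)) => // /forallP h.
rewrite (_ : (enorm y < 1)%R)// (le_lt_trans (enorm_le_sum _))//.
apply: (@le_lt_trans _ _ (\sum_(i < n.+1) n.+2%:R^-1)%R).
  by apply: ler_sum => i _; apply: ltW; have := h i; rewrite mxE subr0.
rewrite sumr_const card_ord -[X in (X < _)%R]mulr_natl ltr_pdivrMr// mul1r ltr_nat.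
exact: ltnSn.
Qed.

Let vballE : \int[leb]_y ((enorm y < 1)%R%:R)%:E = vball%:E.
Proof.
rewrite /vball fineK// ge0_fin_numE ?(ltW int_ball1_gt0)//.
by rewrite (le_lt_trans int_ball1_le) ?ltry.
Qed.

Lemma vball_gt0 : (0 < vball)%R.
Proof. by rewrite -lte_fin -vballE; exact: int_ball1_gt0. Qed.

Lemma int_eball (x : 'rV[R]_n.+1) (r : R) : (0 < r)%R ->
  \int[leb]_y ((enorm (y - x) < r)%R%:R)%:E = (vball * r ^+ n.+1)%:E.
Proof.
move=> r0; rewrite (int_affine_rV (c := r) x)//.
- rewrite EFinM -vballE muleC; congr (_ * _); apply: eq_integral => y _.
  by rewrite addrK enormZ gtr0_norm// -ltr_pdivlMl// mulVf ?gt_eqF.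
- by apply/measurable_EFinP; exact: measurable_eball_ind.
Qed.

End ball_volume.

(** * Jensen's inequality for weights of bounded mass *)

Section jensen.
Context d (T : measurableType d) (R : realType).
Variable mu : {measure set T -> \bar R}.
Local Open Scope ereal_scope.

Lemma poweR_ge1 (x : \bar R) p : (1 <= p)%R -> 0 <= x -> x <= 1 + x `^ p.
Proof.
move=> p1; have p0 : (p != 0)%R by rewrite gt_eqF// (lt_le_trans _ p1).
case: x => [r| |//] r0; last by rewrite poweRyr//= leey.
rewrite poweR_EFin -EFinD lee_fin; rewrite lee_fin in r0.
have [r1|/ltW r1] := leP r 1%R; first by rewrite ler_wpDr ?powR_ge0.
by rewrite ler_wpDl// -[leLHS](powRr1 r0) ler_powR.
Qed.

(* Young's inequality with [c ^ (p - 1)], where [c] is the [mu]-mean of [f]. *)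
Lemma jensen_powR (k f : T -> R) (M p : R) : (1 < p)%R -> (0 <= M)%R ->
  measurable_fun setT k -> measurable_fun setT f ->
  (forall x, 0 <= k x)%R -> (forall x, 0 <= f x)%R ->
  \int[mu]_x (k x)%:E <= M%:E ->
  (\int[mu]_x (k x * f x)%:E) `^ p <=
  (M `^ (p - 1))%:E * \int[mu]_x (k x * f x `^ p)%:E.
Proof.
move=> p1 M0 mk mf k0 f0 kM.
have p0 : (0 < p)%R by rewrite (lt_trans _ p1).
have mfp : measurable_fun setT (fun x => f x `^ p)%R by exact: measurable_powR_comp.
set B := \int[mu]_x (k x * f x `^ p)%:E.
have B0 : 0 <= B by apply: integral_ge0 => x _; rewrite lee_fin mulr_ge0 ?powR_ge0.
set A := \int[mu]_x (k x * f x)%:E.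
have A0 : 0 <= A by apply: integral_ge0 => x _; rewrite lee_fin mulr_ge0.
(* Pointwise, f c^(p - 1) is at most f^p / p + (1 - 1 / p) c^p. Integrating against [k] gives one
   bound for each c, used below at c = 1 and at c = A / M. *)
have young (c : R) : (0 <= c)%R ->
    A * (c `^ (p - 1))%:E <= (p^-1)%:E * B + ((1 - p^-1) * c `^ p)%:E * M%:E.
  move=> c0.
  pose q := (p / (p - 1))%R.
  have pm1 : (0 < p - 1)%R by rewrite subr_gt0.
  have q0 : (0 < q)%R by rewrite divr_gt0.
  have qV : (q^-1 = 1 - p^-1)%R by rewrite /q; field; rewrite !gt_eqF.
  have c'0 : (0 <= (1 - p^-1) * c `^ p)%R.
    by rewrite mulr_ge0 ?powR_ge0// subr_ge0 invf_le1// ltW.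
  rewrite (@le_trans _ _ (\int[mu]_x ((p^-1)%:E * (k x * f x `^ p)%:E +
      ((1 - p^-1) * c `^ p)%:E * (k x)%:E)))//.
    rewrite muleC -intZl ?powR_ge0//; last 2 first.
    - by apply/measurable_EFinP; exact: measurable_funM.
    - by move=> x; rewrite lee_fin mulr_ge0.
    apply: le_int => x; first by rewrite -EFinM lee_fin !mulr_ge0 ?powR_ge0.
    rewrite -!EFinM -EFinD lee_fin.
    have /(_ p0 q0) := @conjugate_powR R (f x) (c `^ (p - 1))%R p q (f0 x) (powR_ge0 _ _).
    rewrite qV addrC subrK => /(_ erefl).
    rewrite -powRrM (_ : (p - 1) * q = p)%R; last by rewrite /q; field; rewrite gt_eqF.
    move=> /(ler_wpM2l (k0 x)) h; lra.
  rewrite ge0_integralD//; last 4 first.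
  - by move=> x _; rewrite -EFinM lee_fin !mulr_ge0 ?powR_ge0 ?invr_ge0 ?(ltW p0).
  - by apply/measurable_EFinP; apply: measurable_funM => //; exact: measurable_funM.
  - by move=> x _; rewrite -EFinM lee_fin mulr_ge0.
  - by apply/measurable_EFinP; exact: measurable_funM.
  rewrite !intZl ?invr_ge0 ?(ltW p0)//; last 3 first.
  - exact/measurable_EFinP.
  - by apply/measurable_EFinP; exact: measurable_funM.
  - by move=> x; rewrite lee_fin mulr_ge0 ?powR_ge0.
  by rewrite leeD2l// lee_wpmul2l.
(* For M = 0 there is no mean A / M; in that case [k] vanishes almost everywhere. *)
have [M00|M_gt0] := leP M 0%R.
  have M_eq0 : M = 0%R by apply/eqP; rewrite eq_le M00.
  have K0 : \int[mu]_x (k x)%:E = 0.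
    by apply/eqP; rewrite eq_le -[X in _ <= X]/(0%:E) -{1}M_eq0 kM integral_ge0// => x _; rewrite lee_fin.
  have : ae_eq mu setT (EFin \o k) (cst 0).
    apply/ae_eq_integral_abs => //; first exact/measurable_EFinP.
    by rewrite -[RHS]K0; apply: eq_integral => x _; rewrite /= ger0_norm.
  move=> k_ae.
  have -> : A = 0.
    rewrite /A (ae_eq_integral (cst 0)) ?integral0//.
    - by apply/measurable_EFinP; exact: measurable_funM.
    - by apply: filterS k_ae => x /= /(_ I)[->] _; rewrite mul0r.
  by rewrite poweR0r ?gt_eqF// mule_ge0// lee_fin powR_ge0.
have [Boo|Bfin] := eqVneq B +oo.
  by rewrite Boo gt0_muley ?leey// lte_fin powR_gt0.
have Bf : B \is a fin_num by rewrite ge0_fin_numE// ltey.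
(* The choice c = 1 only shows that A is finite, which makes A / M available as the final choice of
   c. *)
have Af : A \is a fin_num.
  have := young 1%R ler01; rewrite powR1 mule1 => h.
  by rewrite ge0_fin_numE// (le_lt_trans h)// -(fineK Bf) -!EFinM -EFinD ltry.
have [a AE] : exists a, A = a%:E by exists (fine A); rewrite fineK.
have [b BE] : exists b, B = b%:E by exists (fine B); rewrite fineK.
have a0 : (0 <= a)%R by rewrite -lee_fin -AE.
have := young (a / M)%R (divr_ge0 a0 M0).
rewrite AE BE -!EFinM -EFinD poweR_EFin !lee_fin.
have aMp : (a * (a / M) `^ (p - 1) = a `^ p * M `^ (1 - p))%R.
  rewrite powRM ?invr_ge0// mulrA mulr_powRB1//; congr (_ * _)%R.
  by rewrite -powR_inv1// -powRrM; congr (_ `^ _)%R; ring.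
have aMp' : ((a / M) `^ p * M = a `^ p * M `^ (1 - p))%R.
  rewrite powRM ?invr_ge0// -mulrA; congr (_ * _)%R.
  rewrite -powR_inv1// -powRrM -[X in (_ * X)%R](powRr1 M0) -powR_add//.
  by congr (_ `^ _)%R; ring.
rewrite aMp -mulrA aMp' => h.
have {}h : (a `^ p * M `^ (1 - p) <= b)%R.
  have : (p^-1 * (a `^ p * M `^ (1 - p)) <= p^-1 * b)%R by lra.
  by rewrite ler_pM2l ?invr_gt0.
rewrite (_ : a `^ p = M `^ (p - 1) * (a `^ p * M `^ (1 - p)))%R; last first.
  rewrite mulrCA -powR_add// addrC subrKA subrr powRr0 mulr1//.
by rewrite ler_wpM2l ?powR_ge0.
Qed.

End jensen.

(** * Integration against a measure with a density *)

Section change_of_density.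
Context d (T : measurableType d) (R : realType).
Variables (mu nu : {measure set T -> \bar R}) (w : T -> R).
Hypotheses (mw : measurable_fun setT w) (w0 : forall x, 0 <= w x).
Local Open Scope ereal_scope.
Hypothesis nuE : forall A, measurable A -> nu A = \int[mu]_(x in A) (w x)%:E.
Import HBNNSimple.

Let density_nnsfun (h : {nnsfun T >-> R}) :
  \int[nu]_x (h x)%:E = \int[mu]_x ((w x)%:E * (h x)%:E).
Proof.
rewrite integralT_nnsfun sintegralE.
transitivity (\sum_(r \in range h) \int[mu]_x (r * (w x * \1_(h @^-1` [set r]) x))%:E).
  apply: eq_fsbigr => r /[!inE] -[x _ hxr].
  have r0 : (0 <= r)%R by rewrite -hxr fun_ge0.
  have mhr : measurable (h @^-1` [set r]) by [].
  rewrite nuE// int_mkcond.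
  under [in RHS]eq_integral do rewrite EFinM.
  rewrite intZl//.
  - by congr (_ * _); apply: eq_integral => y _; rewrite EFinM muleC.
  - apply/measurable_EFinP; apply: measurable_funM => //.
  - by move=> y; rewrite lee_fin mulr_ge0.
rewrite -ge0_integral_fsum//.
- apply: eq_integral => x _.
  rewrite -EFinM [in RHS](fimfunE h x) fsumEFin//.
  congr EFin; rewrite mulr_fsumr//.
  by apply: eq_fsbigr => r _; rewrite mulrCA.
- move=> r; apply/measurable_EFinP; apply: measurable_funM => //.
  exact: measurable_funM.
- move=> r x _; rewrite lee_fin.
  rewrite indicE; case: (boolP (x \in _)) => [|_]; last by rewrite !mulr0.
  by rewrite inE/= => <-; rewrite !mulr_ge0.
Qed.

Lemma int_density (f : T -> \bar R) : measurable_fun setT f ->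
  (forall x, 0 <= f x) -> \int[nu]_x f x = \int[mu]_x ((w x)%:E * f x).
Proof.
move=> mf f0; pose f_ := nnsfun_approx measurableT mf.
have cvf x : (f_ n x)%:E @[n --> \oo] --> f x.
  by apply: cvg_nnsfun_approx => // *; exact: f0.
transitivity (limn (fun n => \int[nu]_x (f_ n x)%:E)).
  rewrite -monotone_convergence//.
  - by apply: eq_integral => x _; apply/esym/cvg_lim.
  - by move=> n; exact/measurable_EFinP.
  - by move=> n x _; rewrite lee_fin.
  - by move=> x _ m n mn; rewrite lee_fin; exact/lefP/nd_nnsfun_approx.
under eq_fun do rewrite density_nnsfun.
rewrite -monotone_convergence//.
- apply: eq_integral => x _; apply/cvg_lim => //.
  by apply: cvgeZl.
- by move=> n; apply: emeasurable_funM; exact/measurable_EFinP.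
- by move=> n x _; rewrite mule_ge0 ?lee_fin.
- move=> x _ m n mn; rewrite lee_wpmul2l ?lee_fin//.
  exact/lefP/nd_nnsfun_approx.
Qed.

End change_of_density.

(** * Geometric scales and geometric series *)

Section geometric.
Context {R : realType}.

Lemma nneseries_geometric (c q : R) : 0 <= c -> 0 <= q < 1 ->
  (\sum_(j <oo) (c * q ^+ j)%:E = (c / (1 - q))%:E)%E.
Proof.
move=> c0 /andP[q0 q1].
have := @cvg_geometric_series R c q; rewrite ger0_norm// => /(_ q1) h.
rewrite (_ : (fun _ => _) = EFin \o series (geometric c q)); last first.
  by apply/funext => k /=; rewrite /series/= sumEFin.
by apply/cvg_lim => //; apply/cvg_EFin; [exact: nearW|exact: h].
Qed.

Lemma exists_geom_lt (q e : R) : 0 <= q < 1 -> 0 < e -> exists k, q ^+ k < e.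
Proof.
move=> /andP[q0 q1] e0; have : `|q| < 1 by rewrite ger0_norm.
move=> /cvg_expr /cvgrPdist_lt /(_ _ e0) [k _ /(_ k (leqnn k))] /=.
by rewrite sub0r normrN ger0_norm ?exprn_ge0// => h; exists k.
Qed.

Lemma geom_scale (q T f : R) : 0 < q < 1 -> 0 < f < T ->
  exists j, q ^+ j.+1 * T <= f < q ^+ j * T.
Proof.
move=> /andP[q0 q1] /andP[f0 fT]; have T0 : 0 < T by exact: lt_trans fT.
have ex : exists k, q ^+ k * T <= f.
  have [|k] := @exists_geom_lt q (f / T) _ (divr_gt0 f0 T0).
    by rewrite (ltW q0).
  by rewrite ltr_pdivlMr// => /ltW; exists k.
case: (ex_minnP ex) => -[|k] hk kmin.
  by move: hk; rewrite expr0 mul1r leNgt fT.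
exists k; rewrite hk/= ltNge; apply/negP => /kmin.
by rewrite ltnn.
Qed.

Lemma geom_scale_up (T f : R) : 0 < T <= f ->
  exists j, 2 ^+ j * T <= f < 2 ^+ j.+1 * T.
Proof.
move=> /andP[T0 Tf]; have f0 : 0 < f by exact: lt_le_trans Tf.
have ex : exists k, f < 2 ^+ k * T.
  have [|k] := @exists_geom_lt 2^-1 (T / f) _ (divr_gt0 T0 f0).
    by rewrite invr_ge0 ler0n invf_lt1// ltr1n.
  rewrite ltr_pdivlMr// exprVn mulrC ltr_pdivrMr ?exprn_gt0// mulrC => h.
  by exists k.
case: (ex_minnP ex) => -[|k] hk kmin.
  by move: hk; rewrite expr0 mul1r ltNge Tf.
exists k; rewrite hk/= andbT leNgt; apply/negP => /kmin.
by rewrite ltnn.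
Qed.

(** The exponent may have either sign, hence the absolute value of [c] and the comparability
    hypothesis in both directions. *)
Lemma powR_comparable (L x y c : R) : 0 < x -> 0 < y -> x <= L * y ->
  y <= L * x -> x `^ c <= L `^ `|c| * y `^ c.
Proof.
move=> x0 y0 xy yx.
have L0 : 0 < L by rewrite -(pmulr_lgt0 _ y0) (lt_le_trans x0).
have [c0|c0] := leP 0 c.
  rewrite ger0_norm//.
  by rewrite -powRM ?(ltW L0) ?(ltW y0)// ge0_ler_powR// nnegrE ltW// mulr_gt0.
rewrite ltr0_norm//.
have -> : x `^ c = (x `^ (- c))^-1 by rewrite -powRN opprK.
have -> : y `^ c = (y `^ (- c))^-1 by rewrite -powRN opprK.
rewrite ler_pdivlMr ?powR_gt0 ?oppr_gt0// mulrC ler_pdivrMr ?powR_gt0//.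
by rewrite -powRM ?(ltW L0) ?(ltW x0)// ge0_ler_powR ?oppr_ge0 ?(ltW c0)// nnegrE ltW// mulr_gt0.
Qed.

Lemma ln2_ge : 2^-1 <= ln (2 : R).
Proof.
rewrite -ler_expR lnK ?posrE//.
have := expR_ge1Dx (- 2^-1 : R); rewrite expRN => h.
rewrite -[leLHS]invrK -[leRHS]invrK lef_pV2 ?posrE ?invr_gt0 ?expR_gt0//.
by apply: le_trans h; lra.
Qed.

Lemma ln2_le : ln (2 : R) <= 1.
Proof.
rewrite -ler_expR lnK ?posrE//; have := expR_ge1Dx (1 : R); lra.
Qed.

Lemma half_powE (y : R) : 2^-1 `^ y = expR (- (y * ln 2)).
Proof. by rewrite /powR gt_eqF ?invr_gt0// lnV ?posrE// mulrN. Qed.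

(** Together with [geom_ratio_ge] this makes the dyadic series of ratio 2^(-y) comparable to 1 / y
    for bounded y. With y = 1 - s it produces the factor 1 / (1 - s) in the integrals of the weight;
    with y = p (1 - s), [geom_ratio_ge] produces the gain in the Poincare inequality. *)
Lemma geom_ratio_le (y : R) : 0 < y -> (1 - 2^-1 `^ y)^-1 <= 2 * (1 + y) / y.
Proof.
move=> y0; rewrite half_powE; set x := y * ln 2.
have x0 : 0 < x by rewrite mulr_gt0// (lt_le_trans _ ln2_ge).
have ex : expR (- x) <= (1 + x)^-1.
  by rewrite expRN lef_pV2 ?posrE ?expR_gt0 ?expR_ge1Dx// addr_gt0.
have h : x / (1 + x) <= 1 - expR (- x).
  have -> : x / (1 + x) = 1 - (1 + x)^-1 by field; rewrite gt_eqF// addr_gt0.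
  by rewrite lerB.
have xy : y / 2 <= x <= y.
  by rewrite /x ler_pM2l// ln2_ge/= ger_pMr// ln2_le.
case/andP: xy => yx xy.
have : 0 < x / (1 + x) by rewrite divr_gt0// addr_gt0.
move=> h0; rewrite (@le_trans _ _ (x / (1 + x))^-1)//.
  by rewrite lef_pV2 ?posrE// (lt_le_trans h0).
rewrite invf_div ler_pdivrMr// mulrAC ler_pdivlMr//.
nra.
Qed.

Lemma geom_ratio_ge (y : R) : 0 < y -> y^-1 <= (1 - 2^-1 `^ y)^-1.
Proof.
move=> y0; have y2 : 0 < y * ln 2 by rewrite mulr_gt0// (lt_le_trans _ ln2_ge).
rewrite half_powE lef_pV2 ?posrE//; last first.
  by rewrite subr_gt0 -[ltRHS]expR0 ltr_expR oppr_lt0.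
have := expR_ge1Dx (- (y * ln (2 : R))).
have : y * ln 2 <= y by rewrite ger_pMr// ln2_le.
lra.
Qed.

Lemma half_pow_lt1 (y : R) : 0 < y -> 0 <= (2^-1 : R) `^ y < 1.
Proof.
move=> y0; rewrite powR_ge0/= half_powE -[ltRHS]expR0 ltr_expR oppr_lt0 mulr_gt0//.
by rewrite (lt_le_trans _ ln2_ge).
Qed.

End geometric.

(** * Integrals of negative powers from bounds on sublevel sets *)

Section layer_cake.
Context d (T : measurableType d) (R : realType).
Variable mu : {measure set T -> \bar R}.
Variables (w f : T -> R).
Hypotheses (mw : measurable_fun setT w) (w0 : forall x, 0 <= w x).
Hypotheses (mf : measurable_fun setT f).
Variables (K T0 a b : R).
Hypotheses (K0 : 0 <= K) (T00 : 0 < T0).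
Local Open Scope ereal_scope.

Let mlayer (t : R) : measurable_fun setT (fun x => (w x * (f x < t)%R%:R : R)%:E).
Proof.
apply/measurable_EFinP; apply: measurable_funM => //; apply: measurable_boolR.
exact: measurable_fun_ltr.
Qed.

Let layer_ge0 (t : R) x : 0 <= (w x * (f x < t)%R%:R : R)%:E.
Proof. by rewrite lee_fin mulr_ge0. Qed.

(* Dyadic decomposition of the range of [f]. *)
Lemma int_negpow_small : (b < a)%R ->
  (forall t, (0 < t)%R -> (t <= T0)%R ->
    \int[mu]_x (w x * (f x < t)%R%:R : R)%:E <= (K * t `^ a)%:E) ->
  \int[mu]_x (w x * ((0 < f x < T0)%R%:R * f x `^ (- b)) : R)%:E <=
  (K * 2 `^ `|b| * (2 * (1 + (a - b)) / (a - b)) * T0 `^ (a - b))%:E.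
Proof.
move=> ba hK; pose r j : R := (2^-1 ^+ j * T0)%R.
have r0 j : (0 < r j)%R by rewrite mulr_gt0// exprn_gt0// invr_gt0.
(* Where r (j + 1) <= f x < r j, the value f x is within a factor 2 of r j, so that f x to the power
   -b is at most c j. *)
pose c j : R := (2 `^ `|b| * (r j) `^ (- b))%R.
have c0 j : (0 <= c j)%R by rewrite mulr_ge0 ?powR_ge0.
have ab0 : (0 < a - b)%R by rewrite subr_gt0.
apply: (@le_trans _ _ (\int[mu]_x \sum_(j <oo) ((c j)%:E * (w x * (f x < r j)%R%:R)%:E))).
  apply: le_int => x; first by rewrite lee_fin !mulr_ge0 ?powR_ge0.
  have [/andP[fx0 fxT]|_] := boolP (0 < f x < T0)%R; last first.
    rewrite mul0r mulr0; apply: nneseries_ge0 => j _ _.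
    by rewrite mule_ge0// lee_fin.
  have [||j /andP[h1 h2]] := @geom_scale R 2^-1 T0 (f x).
  - by rewrite invr_gt0/= ltr0n invf_lt1// ltr1n.
  - by rewrite fx0.
  rewrite (@nneseriesD1 _ _ j xpredT)//; last by move=> k _; rewrite mule_ge0// lee_fin.
  rewrite -[leLHS]adde0 leeD//; last first.
    by apply: nneseries_ge0 => k _ _; rewrite mule_ge0// lee_fin.
  rewrite -EFinM lee_fin h2 mul1r mulr1 mulrC ler_wpM2r//.
  rewrite /c -[`|b|%R]normrN; apply: powR_comparable => //.
  - by rewrite (le_trans (ltW h2))// ler_pMl ?(r0 j)// ler1n.
  - by move: h1; rewrite exprS -mulrA -/(r j) ler_pdivrMl.
rewrite integral_nneseries//; last 2 first.
- by move=> j; exact: measurable_funeM.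
- by move=> j x _; rewrite mule_ge0// lee_fin.
apply: (@le_trans _ _ (\sum_(j <oo)
    ((K * 2 `^ `|b| * T0 `^ (a - b)) * (2^-1 `^ (a - b)) ^+ j)%:E)).
  apply: lee_nneseries => [j _ _|j _]; first by apply: integral_ge0 => x _; rewrite mule_ge0// lee_fin.
  rewrite intZl//.
  apply: (@le_trans _ _ ((c j)%:E * (K * r j `^ a)%:E)).
    rewrite lee_wpmul2l ?lee_fin// hK// ger_pMl// exprn_ile1 ?invr_ge0//.
    by rewrite invf_le1// ler1n.
  rewrite -EFinM lee_fin le_eqVlt; apply/orP; left; apply/eqP.
  have -> : (c j * (K * r j `^ a) = K * 2 `^ `|b| * (r j `^ (- b) * r j `^ a))%R.
    by rewrite /c; ring.
  rewrite -powR_add// addrC /r powRM ?exprn_ge0 ?invr_ge0 ?(ltW T00)//.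
  rewrite -powR_mulrn ?invr_ge0// powRAC powR_mulrn ?powR_ge0//; ring.
rewrite nneseries_geometric; last 2 first.
- by rewrite !mulr_ge0 ?powR_ge0.
- exact: half_pow_lt1.
rewrite lee_fin -[leRHS]mulrA [X in (_ <= _ * X)%R]mulrC mulrA.
by rewrite ler_wpM2l ?geom_ratio_le// !mulr_ge0 ?powR_ge0.
Qed.

(** The same decomposition upwards: on the layers 2^j T0 <= f < 2^(j + 1) T0 the series converges
    because the decay [b] now exceeds the growth [a] of the sublevel sets. *)
Lemma int_negpow_large : (a < b)%R ->
  (forall t, (T0 <= t)%R ->
    \int[mu]_x (w x * (f x < t)%R%:R : R)%:E <= (K * t `^ a)%:E) ->
  \int[mu]_x (w x * ((T0 <= f x)%R%:R * f x `^ (- b)) : R)%:E <=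
  (K * 2 `^ `|b| * (2 * (1 + (b - a)) / (b - a)) * T0 `^ (a - b))%:E.
Proof.
move=> ab hK; pose r j : R := (2 ^+ j.+1 * T0)%R.
have r0 j : (0 < r j)%R by rewrite mulr_gt0// exprn_gt0.
pose c j : R := (2 `^ `|b| * (r j) `^ (- b))%R.
have c0 j : (0 <= c j)%R by rewrite mulr_ge0 ?powR_ge0.
have ab0 : (0 < b - a)%R by rewrite subr_gt0.
apply: (@le_trans _ _ (\int[mu]_x \sum_(j <oo) ((c j)%:E * (w x * (f x < r j)%R%:R)%:E))).
  apply: le_int => x; first by rewrite lee_fin !mulr_ge0 ?powR_ge0.
  have [fxT|_] := boolP (T0 <= f x)%R; last first.
    rewrite mul0r mulr0; apply: nneseries_ge0 => j _ _.
    by rewrite mule_ge0// lee_fin.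
  have fx0 : (0 < f x)%R by exact: lt_le_trans fxT.
  have [|j /andP[h1 h2]] := @geom_scale_up R T0 (f x).
    by rewrite T00.
  rewrite (@nneseriesD1 _ _ j xpredT)//; last by move=> k _; rewrite mule_ge0// lee_fin.
  rewrite -[leLHS]adde0 leeD//; last first.
    by apply: nneseries_ge0 => k _ _; rewrite mule_ge0// lee_fin.
  rewrite -EFinM lee_fin h2 mul1r mulr1 mulrC ler_wpM2r//.
  rewrite /c -[`|b|%R]normrN; apply: powR_comparable => //.
  - by rewrite (le_trans (ltW h2))// ler_pMl ?(r0 j)// ler1n.
  - by rewrite /r exprS -mulrA ler_pM2l.
rewrite integral_nneseries//; last 2 first.
- by move=> j; exact: measurable_funeM.
- by move=> j x _; rewrite mule_ge0// lee_fin.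
apply: (@le_trans _ _ (\sum_(j <oo)
    ((K * 2 `^ `|b| * T0 `^ (a - b)) * (2^-1 `^ (b - a)) ^+ j)%:E)).
  apply: lee_nneseries => [j _ _|j _]; first by apply: integral_ge0 => x _; rewrite mule_ge0// lee_fin.
  rewrite intZl//.
  apply: (@le_trans _ _ ((c j)%:E * (K * r j `^ a)%:E)).
    rewrite lee_wpmul2l ?lee_fin// hK// ler_pMl// exprn_ege1//.
    by rewrite ler1n.
  rewrite -EFinM lee_fin.
  have -> : (c j * (K * r j `^ a) = K * 2 `^ `|b| * (r j `^ (- b) * r j `^ a))%R.
    by rewrite /c; ring.
  rewrite -powR_add// addrC /r powRM ?exprn_ge0 ?(ltW T00)//.
  rewrite -[leRHS]mulrA [X in (_ <= _ * X)%R]mulrC.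
  rewrite ler_wpM2l ?ler_wpM2r ?mulr_ge0 ?powR_ge0//.
  have -> : (2^-1 `^ (b - a) = 2 `^ (a - b) :> R)%R.
    by rewrite -powR_inv1// -powRrM; congr (_ `^ _)%R; ring.
  rewrite -powR_mulrn// powRAC powR_mulrn ?powR_ge0// exprS.
  rewrite ger_pMl ?exprn_gt0 ?powR_gt0//.
  rewrite -[leRHS](powRr0 2) ler_powR ?ler1n//; lra.
rewrite nneseries_geometric; last 2 first.
- by rewrite !mulr_ge0 ?powR_ge0.
- exact: half_pow_lt1.
rewrite lee_fin -[leRHS]mulrA [X in (_ <= _ * X)%R]mulrC mulrA.
by rewrite ler_wpM2l ?geom_ratio_le// !mulr_ge0 ?powR_ge0.
Qed.

End layer_cake.

(** * Distance to the boundary of an open set *)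

Section distance.
Context {R : realType} {n : nat} (Omega : set 'rV[R]_n.+1).
Hypotheses (oO : open Omega) (bd0 : boundary Omega !=set0).
Implicit Types x y z : 'rV[R]_n.+1.
Local Notation d := (dist_bd Omega).

Let has_inf_dist x : has_inf [set enorm (x - z) | z in boundary Omega].
Proof.
split; first by case: bd0 => z bz; exists (enorm (x - z)), z.
by exists 0 => _ [w _ <-]; exact: enorm_ge0.
Qed.

Lemma dist_le x z : boundary Omega z -> d x <= enorm (x - z).
Proof. by move=> bz; apply: ge_inf; [have [] := has_inf_dist x|exists z]. Qed.

Lemma dist_ge0 x : 0 <= d x.
Proof.
by apply: lb_le_inf; [have [] := has_inf_dist x|move=> _ [z _ <-]; exact: enorm_ge0].
Qed.

Lemma dist_lt x t : d x < t -> exists2 z, boundary Omega z & enorm (x - z) < t.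
Proof.
move=> /inf_lt[]; first by have [] := has_inf_dist x.
by move=> _ [z bz <-] h; exists z.
Qed.

Lemma dist_ge x t : (forall z, boundary Omega z -> t <= enorm (x - z)) -> t <= d x.
Proof.
move=> h; rewrite leNgt; apply/negP => /dist_lt[z bz].
by rewrite ltNge h.
Qed.

Lemma dist_lip x y : d x <= enorm (x - y) + d y.
Proof.
rewrite -lerBlDl; apply: dist_ge => z bz; rewrite lerBlDl.
by rewrite (le_trans (dist_le x bz))// enorm_tri.
Qed.

Lemma open_eball x : Omega x ->
  exists2 e, 0 < e & forall y, enorm (x - y) < e -> Omega y.
Proof.
move=> Ox; have /nbhs_ballP[e /= e0 xe] : nbhs x Omega by exact: open_nbhs_nbhs.
exists e => // y xy; apply: xe; split => // i j.
by rewrite ord1 /ball/= (le_lt_trans _ xy)// -[leLHS](_ : `|(x - y) ord0 j| = _) ?enorm_coord// !mxE.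
Qed.

Lemma boundaryP z : boundary Omega z <->
  ~ Omega z /\ forall e, 0 < e -> exists2 y, Omega y & enorm (z - y) < e.
Proof.
rewrite /boundary (interior_id _).1//; split => [[cz Oz]|[Oz h]].
  split=> // e e0; have [|y [Oy ye]] := cz (eball z e).
    apply: open_nbhs_nbhs; split; first exact: eball_open.
    by rewrite /eball/= subrr enorm0.
  by exists y => //; rewrite enormBC.
split=> // U /nbhs_ballP[e /= e0 Ue].
have [y Oy ye] := h _ e0; exists y; split => //; apply: Ue; split => // i j.
by rewrite ord1 /ball/= (le_lt_trans _ ye)// -[leLHS](_ : `|(z - y) ord0 j| = _) ?enorm_coord// !mxE.
Qed.

Lemma dist_lt_in x t : d x < t -> exists2 y, Omega y & enorm (x - y) < t.
Proof.
move=> /dist_lt[z /boundaryP[_ h] xz].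
have [|y Oy zy] := h (t - enorm (x - z)); first by rewrite subr_gt0.
exists y => //; rewrite (le_lt_trans (enorm_tri z _ _))//.
by rewrite -ltrBrDl.
Qed.

Lemma dist_gt0 x : Omega x -> 0 < d x.
Proof.
move=> /open_eball[e e0 he]; apply: lt_le_trans e0 _; apply: dist_ge => z.
by move=> /boundaryP[Oz _]; rewrite leNgt; apply/negP => /he.
Qed.

(** The first parameter at which the segment from [x] to [y] leaves the open set gives a boundary
    point on the segment. This is what bounds the boundary distances of two points on opposite sides
    by their mutual distance. *)
Lemma segment_crosses x y : Omega x -> ~ Omega y ->
  exists2 z, boundary Omega z & enorm (x - z) <= enorm (x - y) /\
                               enorm (y - z) <= enorm (x - y).
Proof.
move=> Ox Oy; pose f (t : R) := x + t *: (y - x).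
have f0 : f 0 = x by rewrite /f scale0r addr0.
have f1 : f 1 = y by rewrite /f scale1r addrC subrK.
have fd a b : enorm (f a - f b) = `|a - b| * enorm (x - y).
  by rewrite /f opprD addrACA subrr add0r -scalerBl enormZ enormBC.
pose S := [set t | 0 <= t <= 1 /\ ~ Omega (f t)].
have S1 : S 1 by rewrite /S/= f1 ler01 lexx.
have Sinf : has_inf S by split; [exists 1|exists 0 => t [/andP[]]].
pose T := inf S.
have T0 : 0 <= T by apply: lb_le_inf; [exists 1|move=> t [/andP[]]].
have T1 : T <= 1 by apply: ge_inf; [case: Sinf|].
have ltT t : 0 <= t -> t < T -> Omega (f t).
  move=> t0 tT; apply: contrapT => Ot; have := tT; rewrite ltNge => /negP; apply.
  apply: ge_inf; first by case: Sinf.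
  by split => //; rewrite t0/= (ltW (lt_le_trans tT T1)).
have xy0 : 0 <= enorm (x - y) by exact: enorm_ge0.
have OT : ~ Omega (f T).
  (* Were f T inside, so would be the segment slightly beyond T, against the choice of T as an
     infimum of outer parameters. *)
  move=> /open_eball[e e0 he].
  have e1 : 0 < e / (enorm (x - y) + 1) by rewrite divr_gt0// ltr_wpDl.
  have /inf_lt[] : inf S < T + e / (enorm (x - y) + 1) by rewrite ltrDl.
    by case: Sinf.
  move=> t [t01 Ot] tT; have Tt : T <= t by apply: ge_inf; [case: Sinf|].
  apply: Ot; apply: he; rewrite fd.
  rewrite distrC ger0_norm ?subr_ge0//.
  have : (t - T) < e / (enorm (x - y) + 1) by lra.
  rewrite ltr_pdivlMr ?ltr_wpDl// => h; apply: le_lt_trans h.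
  by rewrite ler_wpM2l ?subr_ge0// lerDl.
have T_gt0 : 0 < T.
  by rewrite lt_neqAle T0 andbT; apply/eqP => T00; apply: OT; rewrite -T00 f0.
exists (f T); last first.
  split.
    rewrite -[X in enorm (X - f T)]f0 fd sub0r normrN ger0_norm//.
    by rewrite ler_piMl.
  rewrite -[X in enorm (X - f T)]f1 fd ger0_norm ?subr_ge0//.
  by rewrite ler_piMl// gerBl.
apply/boundaryP; split => // e e0.
have e1 : 0 < e / (enorm (x - y) + 1) by rewrite divr_gt0// ltr_wpDl.
(* A parameter slightly before T: its point is inside and as close to f T as wished. *)
pose t := Num.max 0 (T - e / (enorm (x - y) + 1) / 2).
have tT : t < T by rewrite /t gt_max T_gt0/= ltrBlDr ltrDl divr_gt0.
exists (f t); first by apply: ltT => //; rewrite /t le_max lexx.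
rewrite fd ger0_norm ?subr_ge0 ?(ltW tT)//.
have : T - t < e / (enorm (x - y) + 1).
  have : T - e / (enorm (x - y) + 1) / 2 <= t by rewrite /t le_max lexx orbT.
  lra.
rewrite ltr_pdivlMr ?ltr_wpDl// => h; apply: le_lt_trans h.
by rewrite ler_wpM2l ?subr_ge0 ?(ltW tT)// lerDl.
Qed.

Lemma dist_cross_in x y : Omega x -> ~ Omega y -> d x <= enorm (x - y).
Proof.
move=> Ox Oy; have [z bz [h _]] := segment_crosses Ox Oy.
exact: le_trans (dist_le _ bz) h.
Qed.

Lemma dist_cross_out x y : Omega x -> ~ Omega y -> d y <= enorm (x - y).
Proof.
move=> Ox Oy; have [z bz [_ h]] := segment_crosses Ox Oy.
exact: le_trans (dist_le _ bz) h.
Qed.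

Lemma dist_ball_out x y : ~ Omega x -> enorm (x - y) < d x -> ~ Omega y.
Proof.
move=> Ox h Oy; move: h; rewrite ltNge => /negP; apply.
by rewrite enormBC dist_cross_out.
Qed.

Lemma dist_ge_ball_in x t : (forall y, enorm (x - y) < t -> Omega y) -> t <= d x.
Proof.
move=> h; apply: dist_ge => z /boundaryP[Oz _].
by rewrite leNgt; apply/negP => /h.
Qed.

Lemma dist_ge_ball_out x t : (forall y, enorm (x - y) < t -> ~ Omega y) -> t <= d x.
Proof.
move=> h; apply: dist_ge => z /boundaryP[_ hz]; rewrite leNgt; apply/negP => xz.
have [|y Oy zy] := hz (t - enorm (x - z)); first by rewrite subr_gt0.
by apply: (h y) => //; rewrite (le_lt_trans (enorm_tri z _ _))// -ltrBrDl.
Qed.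

Lemma dist_eq0_boundary x : ~ Omega x -> d x = 0 -> boundary Omega x.
Proof.
move=> Ox dx; apply/boundaryP; split => // e e0.
by apply: dist_lt_in; rewrite dx.
Qed.

Lemma boundary_dist0 z : boundary Omega z -> d z = 0.
Proof.
move=> bz; apply/eqP; rewrite eq_le dist_ge0 andbT.
by rewrite (le_trans (dist_le z bz))// subrr enorm0.
Qed.

End distance.

(** * The cone condition in a Lipschitz chart *)

Section charts.
Context {R : realType} {n : nat} (Omega : set 'rV[R]_n.+1).
Implicit Types x y z v eta : 'rV[R]_n.+1.

(* Near [z], translating by [t v] moves any point at distance less than [3 t]
   from [Omega] to the centre of a ball of radius [4 t] inside [Omega], and
   translating by [- t v] does the same for the complement. *)
Definition cone_chart (r : R) z v : Prop := forall x (t : R) eta,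
  enorm (x - z) < 4 * r -> 0 < t <= r -> enorm eta <= 4 * t ->
  (forall y, Omega y -> enorm (x - y) < 3 * t -> Omega (x + t *: v + eta)) /\
  (forall y, ~ Omega y -> enorm (x - y) < 3 * t -> ~ Omega (x - t *: v + eta)).

Lemma enorm_mulmx_orth m (Q : 'M[R]_m) (x : 'rV[R]_m) :
  Q *m Q^T = 1%:M -> enorm (x *m Q) = enorm x.
Proof.
move=> QQ; have dotE (y : 'rV[R]_m) : \sum_i y ord0 i ^+ 2 = (y *m y^T) ord0 ord0.
  by rewrite mxE; apply: eq_bigr => i _; rewrite mxE expr2.
by rewrite /enorm !dotE trmx_mul mulmxA -(mulmxA x) QQ mulmx1.
Qed.

Lemma enorm_col' m (i : 'I_m.+1) (x : 'rV[R]_m.+1) : enorm (col' i x) <= enorm x.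
Proof.
rewrite /enorm ler_wsqrtr// [leRHS](bigD1_ord i)//= -[leLHS]add0r lerD ?sqr_ge0//.
by apply: ler_sum => j _; rewrite mxE.
Qed.

Lemma lipschitz_cone_chart : lipschitz_domain Omega ->
  exists r M : R, [/\ 0 < r, 0 < M & forall z, boundary Omega z ->
    exists v, enorm v <= M /\ cone_chart r z v].
Proof.
move=> [oO bd0 [r0 [L [r00 L0 hz]]]].
(* Between [x + t *: v + eta] and a reference point y with |x - y| < 3 t, the last coordinate can
   change by up to 3 t + 4 t apart from the displacement along [v], and [phi] by up to 7 L t. A
   vertical displacement of t M = 7 t + 7 L t compensates both. *)
pose M := 7 * (1 + L).
have M0 : 0 < M by rewrite mulr_gt0// addr_gt0.
(* Keeps every point involved in the chart ball of radius r0: the distance 4 r of x from z and the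
   displacement t (M + 4) each take at most r0 / 2. *)
pose r := Num.min (r0 / 8) (r0 / 2 / (M + 4)).
have M4 : 0 < M + 4 by rewrite addr_gt0.
have rr1 : r <= r0 / 8 by rewrite /r ge_min lexx.
have rr2 : r * (M + 4) <= r0 / 2 by rewrite -ler_pdivlMr// /r ge_min lexx orbT.
have r_gt0 : 0 < r by rewrite /r lt_min !divr_gt0.
exists r, M; split => // z bz.
have [T [phi [[Q [b [QQ TE]]] Tz philip HT]]] := hz z bz.
have QQ' : Q^T *m Q = 1%:M by exact: mulmx1C.
have Tiso x y : enorm (T x - T y) = enorm (x - y).
  by rewrite !TE opprD addrACA subrr addr0 -mulmxBl enorm_mulmx_orth.
have Tinj x y : T x = T y -> x = y.
  move=> xy; apply/eqP; rewrite -subr_eq0 -enorm_eq0 -Tiso xy subrr.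
  by rewrite enorm0.
have memO x : enorm (x - z) < r0 ->
    Omega x <-> T x ord0 ord_max < phi (col' ord_max (T x)).
  move=> xz; split => [Ox|h].
    have : (T @` (Omega `&` eball z r0)) (T x) by exists x.
    by rewrite HT => -[].
  have : [set x | eball 0 r0 x /\ x ord0 ord_max < phi (col' ord_max x)] (T x).
    by split => //; rewrite /eball/= -Tz Tiso.
  by rewrite -HT => -[y [Oy _] /Tinj <-].
(* The preimage under the rotation of -M times the last unit vector: in the chart, [Omega] lies
   below the graph of [phi], and [v] points downwards. *)
pose v : 'rV[R]_n.+1 := (- M) *: (delta_mx ord0 ord_max *m Q^T).
have vQ : v *m Q = (- M) *: delta_mx ord0 ord_max.
  by rewrite -scalemxAl -mulmxA QQ' mulmx1.
have ev : enorm v = M.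
  rewrite -(enorm_mulmx_orth v QQ) vQ enormZ normrN gtr0_norm//.
  rewrite /enorm (bigD1 ord_max)//= mxE !eqxx/= expr1n big1 ?addr0 ?sqrtr1 ?mulr1//.
  by move=> i /negbTE ni; rewrite mxE ni andbF expr0n.
exists v; split; first by rewrite ev.
have TD x (t : R) eta : T (x + t *: v + eta) = T x + (t * - M) *: delta_mx ord0 ord_max + eta *m Q.
  rewrite !TE !mulmxDl -scalemxAl vQ scalerA.
  by move: (x *m Q) (eta *m Q) => A B; apply/rowP => j; rewrite !mxE; ring.
have TDd x (t : R) eta : T (x + t *: v + eta) ord0 ord_max =
    T x ord0 ord_max - t * M + (eta *m Q) ord0 ord_max.
  by rewrite TD mxE mxE mxE mxE !eqxx/= mulr1 mulrN.
have TD' x (t : R) eta : col' ord_max (T (x + t *: v + eta)) =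
    col' ord_max (T x) + col' ord_max (eta *m Q).
  rewrite TD; apply/rowP => j; rewrite !mxE.
  rewrite (_ : (lift ord_max j == ord_max) = false) ?andbF ?mulr0 ?addr0//.
  by rewrite eq_sym; apply/negbTE; exact: neq_lift.
have coord x y i : `|T x ord0 i - T y ord0 i| <= enorm (x - y).
  by rewrite -Tiso -[leLHS](_ : `|(T x - T y) ord0 i| = _) ?enorm_coord// !mxE.
have coord' x y : enorm (col' ord_max (T x) - col' ord_max (T y)) <= enorm (x - y).
  rewrite -Tiso -[col' _ _ - _](_ : col' ord_max (T x - T y) = _) ?enorm_col'//.
  by apply/rowP => j; rewrite !mxE.
move=> x t eta xz /andP[t0 tr] het.
have tM : t * (M + 4) <= r0 / 2.
  by apply: le_trans rr2; rewrite ler_pM2r.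
have xz' : enorm (x - z) < r0 / 2 by lra.
have bnd (c : R) : `|c| = t -> enorm (x + c *: v + eta - z) < r0.
  move=> ct; rewrite -[x + _ + _]addrA addrAC.
  rewrite (le_lt_trans (enormD _ _))// (splitr r0) ltr_leD//.
  by rewrite (le_trans (enormD _ _))// enormZ ct ev; lra.
have eQ := enorm_mulmx_orth eta QQ.
have eQd : `|(eta *m Q) ord0 ord_max| <= 4 * t.
  by rewrite (le_trans (enorm_coord _ _))// eQ.
have eQ' : enorm (col' ord_max (eta *m Q)) <= 4 * t.
  by rewrite (le_trans (enorm_col' _ _))// eQ.
have ynear y : enorm (x - y) < 3 * t -> enorm (y - z) < r0.
  move=> xy; rewrite (le_lt_trans (enorm_tri x _ _))// (enormBC y x).
  have : 0 <= t * M by rewrite mulr_ge0// ltW.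
  lra.
have phil y (c : R) : enorm (x - y) < 3 * t ->
  `|phi (col' ord_max (T (x + c *: v + eta))) - phi (col' ord_max (T y))| <= L * (7 * t).
  move=> xy; rewrite (le_trans (philip _ _))// ler_wpM2l ?(ltW L0)// TD' addrAC.
  rewrite (le_trans (enormD _ _))// (_ : 7 * t = 3 * t + 4 * t); last by ring.
  by rewrite lerD// (le_trans (coord' _ _))// ltW.
split=> y Oy xy.
  apply/(memO _ (bnd _ (gtr0_norm t0))).
  have /(memO _ (ynear _ xy)) hy := Oy.
  have := phil y t xy; have := coord x y ord_max; rewrite TDd.
  move: eQd; rewrite !ler_norml => /andP[_ e1] /andP[_ e2] /andP[e3 _].
  rewrite /M; lra.
rewrite -scaleNr => /(memO _ (bnd (- t) _)); rewrite normrN gtr0_norm// => /(_ erefl).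
have hy : ~ (T y ord0 ord_max < phi (col' ord_max (T y))).
  by move=> h; apply: Oy; apply/(memO _ (ynear _ xy)).
have := phil y (- t) xy; have := coord x y ord_max; rewrite TDd.
move: hy => /negP; rewrite -leNgt.
move: eQd; rewrite !ler_norml => /andP[e1 _] hy /andP[e2 _] /andP[_ e3].
rewrite /M; lra.
Qed.

End charts.

(** * A finite family of charts along the boundary *)

Section cover.
Context {R : realType} {n : nat} (Omega : set 'rV[R]_n.+1).

Lemma bounded_enorm : bounded_set Omega ->
  exists2 D : R, 0 < D & forall x, Omega x -> enorm x <= D.
Proof.
move=> [M [Mr hM]]; pose D := n.+1%:R * (`|M| + 1).
exists D; first by rewrite mulr_gt0// ltr_wpDl.
move=> x Ox; rewrite (le_trans (enorm_le_sum x))//.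
have xM : `|x| <= `|M| + 1 by apply: (hM (`|M| + 1)) => //; rewrite (le_lt_trans (ler_norm _))// ltrDl.
rewrite /D mulr_natl -[n.+1 in leRHS]card_ord -sumr_const; apply: ler_sum => i _.
by rewrite (le_trans _ xM)// [leRHS]/Num.norm/= mx_normrE (le_trans _ (le_bigmax _ _ (ord0, i))).
Qed.

(** The boundary is closed and bounded, hence covered by finitely many balls of radius [r] about
    chart centres; a point at distance less than [r] from the boundary is then less than 2 r from
    one of these centres. *)
Lemma finite_charts : lipschitz_domain Omega -> bounded_set Omega ->
  exists (zs : seq 'rV[R]_n.+1) (v : 'rV[R]_n.+1 -> 'rV[R]_n.+1) (r M : R),
    [/\ 0 < r, 0 < M,
      forall z, z \in zs -> enorm (v z) <= M /\ cone_chart Omega r z (v z) &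
      forall x, dist_bd Omega x < r -> exists2 z, z \in zs & enorm (x - z) < 2 * r].
Proof.
move=> Olip Obnd; have [oO bd0 _] := Olip.
have [r [M [r0 M0 hz]]] := lipschitz_cone_chart Olip.
have /choice[v hv] : forall z, exists v, boundary Omega z ->
    enorm v <= M /\ cone_chart Omega r z v.
  move=> z; have [/hz[v hv]|nbz] := pselect (boundary Omega z); first by exists v.
  by exists 0.
have [D D0 hD] := bounded_enorm Obnd.
have cbd : compact (boundary Omega).
  apply: bounded_closed_compact.
    exists (D + 1); split; first exact: num_real.
    move=> N DN z /boundaryP[]// _ /(_ _ ltr01)[y Oy zy].
    apply: le_trans (ltW DN); rewrite [leLHS]/Num.norm/= mx_normrE.
    apply: bigmax_le => [|[i j] _]; first by rewrite addr_ge0// ltW.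
    rewrite /= ord1 (le_trans (enorm_coord _ _))//.
    have := enormD (z - y) y; rewrite subrK => /le_trans; apply.
    by rewrite addrC lerD ?hD// ltW.
  rewrite /boundary; apply: closedI; first exact: closed_closure.
  by apply: open_closedC; exact: open_interior.
move: cbd; rewrite compact_cover => /(_ _ (boundary Omega) (fun z => eball z r)).
case=> [z _|z bz|zs hzs cov].
- exact: eball_open.
- by exists z => //; rewrite /eball/= subrr enorm0.
exists (finmap.enum_fset zs), v, r, M; split => // [z zin|x dx].
  by apply: hv; have := hzs z zin; rewrite inE.
have [y by_ xy] := dist_lt bd0 dx.
have [z /= zin yz] := cov _ by_; exists z => //.
by rewrite (le_lt_trans (enorm_tri y _ _))// mulr_natl ltrD.
Qed.

End cover.

(** * Automation for measurability; sums over mutually exclusive cases *)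

Lemma measurable_comp2 d0 d1 d2 d3 (T : measurableType d0) (T1 : measurableType d1)
  (T2 : measurableType d2) (T3 : measurableType d3) (u : T1 -> T2 -> T3) f g :
  measurable_fun setT (fun t => u t.1 t.2) -> measurable_fun setT f ->
  measurable_fun setT g -> measurable_fun setT (fun x : T => u (f x) (g x)).
Proof. by move=> mu mf mg; exact: (measurableT_comp mu (measurable_fun_pair mf mg)). Qed.

Ltac meas_step :=
  lazymatch goal with
  | |- measurable_fun _ (@fst _ _) => exact: measurable_fst
  | |- measurable_fun _ (@snd _ _) => exact: measurable_snd
  | |- measurable_fun _ (dist_bd ?O) => exact: measurable_dist_bd
  | |- measurable_fun _ (@enorm _ _) => exact: measurable_enorm
  | |- measurable_fun _ (indic ?A) => apply: measurable_indic
  | |- measurable_fun _ (fun x => (@?f x)%:E) => apply/measurable_EFinP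
  | |- measurable_fun _ (fun x => (nat_of_bool (@?b x))%:R) => apply: measurable_boolR
  | |- measurable_fun _ (fun x => (@?a x) && (@?b x)) => apply: measurable_and
  | |- measurable_fun _ (fun x => (@?a x < @?b x)%R) => apply: measurable_fun_ltr
  | |- measurable_fun _ (fun x => (@?a x <= @?b x)%R) => apply: measurable_fun_ler
  | |- measurable_fun _ (fun x => (@?a x * @?b x)%E) => apply: emeasurable_funM
  | |- measurable_fun _ (fun x => (@?a x + @?b x)%E) => apply: emeasurable_funD
  | |- measurable_fun _ (fun x => powR (@?f x) ?a) => apply: measurable_powR_comp
  | |- measurable_fun _ (fun x => enorm (@?f x)) => apply: measurable_enorm_comp
  | |- measurable_fun _ (fun x => dist_bd ?O (@?f x)) => apply: measurable_dist_comp
  | |- measurable_fun _ (fun x => indic ?A (@?f x)) => apply: measurable_indic_comp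
  | |- measurable_fun _ (fun x => Num.norm (@?f x)) => apply: measurable_norm_comp
  | |- measurable_fun _ (fun x => (@?f x * @?g x)%R) => apply: measurable_funM
  | |- measurable_fun _ (fun x => (@?f x - @?g x)%R) =>
      first [apply: measurable_funB | apply: measurable_subrV]
  | |- measurable_fun _ (fun x => (@?f x + @?g x)%R) =>
      first [apply: measurable_funD | apply: measurable_addrV]
  | |- measurable_fun _ (fun x => (?c *: @?f x)%R) => apply: measurable_scalerV
  | |- measurable_fun _ (fun x => Num.max (@?f x) (@?g x)) => apply: measurable_maxr
  | |- measurable_fun _ (fun x => Num.min (@?f x) (@?g x)) => apply: measurable_minr
  | |- measurable_fun _ (fun x => (@?f x, @?g x)) => apply: measurable_fun_pair
  | |- measurable_fun _ (fun x => x) => exact: measurable_id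
  | |- measurable_fun _ (fun x => fst x) => exact: measurable_fst
  | |- measurable_fun _ (fun x => snd x) => exact: measurable_snd
  | |- measurable_fun _ (fun x => fst (@?f x)) => apply: (measurableT_comp measurable_fst)
  | |- measurable_fun _ (fun x => snd (@?f x)) => apply: (measurableT_comp measurable_snd)
  | |- measurable_fun _ (fun x => ?c) => exact: measurable_cst
  end.
(* [constr_eq] avoids the conversion tests of non-linear patterns and of [assumption]. *)
Ltac meas := solve [repeat first [
  lazymatch goal with |- measurable_fun _ _ => fail | _ => assumption end |
  match goal with
  | H : measurable_fun _ ?f |- measurable_fun _ ?g => constr_eq f g; exact: H
  | H : measurable_fun setT ?u |- measurable_fun _ (fun x => ?v (@?f x)) =>
      constr_eq u v; apply: (measurableT_comp H)
  | H : measurable_fun setT (fun t => ?u (fst t) (snd t)) |-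
      measurable_fun _ (fun x => ?v (@?f x) (@?g x)) =>
      constr_eq u v; apply: (measurable_comp2 H)
  end |
  meas_step]].

Lemma sum_exclusive_le1 {R : realType} (K : nat) (P : 'I_K -> bool) :
  (forall i j, P i -> P j -> i = j) -> \sum_(i < K) (P i)%:R <= 1 :> R.
Proof.
move=> hP; have [/existsP[i Pi]|/existsPn nP] := boolP [exists i, P i].
  rewrite (bigD1 i)//= Pi big1 ?addr0// => j ji.
  by case: (boolP (P j)) => // Pj; rewrite (hP _ _ Pi Pj) eqxx in ji.
by rewrite big1// => i _; rewrite (negbTE (nP i)).
Qed.

Lemma sume_const_ord {R : realType} (K : nat) (x : \bar R) :
  (\sum_(k < K) x = K%:R%:E * x)%E.
Proof.
elim: K => [|K IH]; first by rewrite big_ord0 mul0e.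
rewrite big_ord_recr/= IH -natr1 EFinD ge0_muleDl ?lee_fin// mul1e//.
Qed.

(** At most one term is nonzero. It is applied to the disjoint layers of a decomposition by distance
    to the boundary. *)
Lemma nneseries_exclusive {R : realType} (P : nat -> bool) (a : nat -> \bar R) (B : \bar R) :
  (forall i j, P i -> P j -> i = j) -> (0 <= B)%E ->
  (forall i, P i -> (0 <= a i <= B)%E) ->
  (\sum_(i <oo) ((P i)%:R%:E * a i) <= B)%E.
Proof.
move=> hP B0 aB.
have a0 i : (0 <= (P i)%:R%:E * a i)%E.
  by case: (boolP (P i)) => [/aB/andP[a0 _]|_]; rewrite ?mul1e ?mul0e.
have [[i Pi]|nP] := pselect (exists i, P i); last first.
  rewrite eseries0// => i _ _; case: (boolP (P i)) => Pi; last by rewrite mul0e.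
  by exfalso; apply: nP; exists i.
rewrite (@nneseriesD1 _ _ i xpredT)//.
rewrite eseries0 => [|j _ /= ji]; last first.
  case: (boolP (P j)) => Pj; last by rewrite mul0e.
  by rewrite (hP _ _ Pi Pj) eqxx in ji.
by rewrite adde0 Pi mul1e; case/andP: (aB _ Pi).
Qed.

(** * Upper bounds for boundary layers and for the weight *)

Section chart_measure.
Context {R : realType} {n : nat} (Omega : set 'rV[R]_n.+1).
Local Notation V := 'rV[R]_n.+1.
Variables (zs : seq V) (v : V -> V) (r M : R).
Hypotheses (oO : open Omega) (bd0 : boundary Omega !=set0).
Hypotheses (r0 : 0 < r) (M0 : 0 < M).
Hypothesis hv : forall z, z \in zs -> enorm (v z) <= M /\ cone_chart Omega r z (v z).
Hypothesis hcov : forall x, dist_bd Omega x < r ->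
  exists2 z, z \in zs & enorm (x - z) < 2 * r.
Local Notation d := (dist_bd Omega).
Local Notation leb := (@lebesgue_rV R n.+1).
Local Notation om := (@vball R n).
Local Open Scope ereal_scope.

Let mO : measurable Omega := open_measurable_rV oO.

(* The translates of the sublevel set by [k t v] are pairwise disjoint. *)
Lemma sublevel_measure z x0 (rho m t : R) : z \in zs -> (0 < t <= m)%R ->
  (m <= rho)%R -> (m <= r)%R ->
  \int[leb]_y (((enorm (y - z) < 4 * r) && (enorm (y - x0) < rho) &&
     (d y < t))%R%:R)%:E <=
  (2 * om * ((1 + M) * rho) ^+ n.+1 * m^-1 * t)%:E.
Proof.
move=> zin /andP[t0 tm] mrho mr.
have [vM cc] := hv zin.
have m0 : (0 < m)%R by exact: lt_le_trans tm.
have rho0 : (0 < rho)%R by exact: lt_le_trans mrho.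
pose A y := ((enorm (y - z) < 4 * r) && (enorm (y - x0) < rho) && (d y < t))%R.
have mA : measurable_fun setT (fun y => ((A y)%:R : R)%:E) by rewrite /A; meas.
pose K := Num.truncn (m / t).
have K1 : (0 < K)%N by rewrite truncn_gt0 ler_pdivlMr// mul1r.
have Km : (K%:R * t <= m)%R by rewrite -ler_pdivlMr// truncn_le// divr_ge0// ltW.
have mK : (m < 2 * K%:R * t)%R.
  rewrite -ltr_pdivrMr// (lt_le_trans (truncnS_gt _))// -/K -[K.+1]addn1 natrD.
  by rewrite mulr_natl mulr2n lerD2l ler1n.
pose sh (k : nat) (y : V) : V := (y + (- (k%:R * t)) *: v z)%R.
have excl y (i j : 'I_K) : A (sh i y) -> A (sh j y) -> i = j.
  (* If the point with index b is closer than t to the boundary, displacing it by (b - a) t v makes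
     it the centre of a ball of radius at least t inside [Omega]; so the point with index a cannot
     be closer than t. *)
  have key (a b : 'I_K) : (a < b)%N -> A (sh a y) -> A (sh b y) -> False.
    move=> ab /andP[_ da] /andP[/andP[bz _] db].
    pose u := ((b - a)%:R * t)%R.
    have tu : (t <= u)%R by rewrite ler_peMl ?(ltW t0)// ler1n subn_gt0.
    have u0 : (0 < u)%R by exact: lt_le_trans tu.
    have ur : (u <= r)%R.
      apply: le_trans mr; apply: le_trans Km; rewrite ler_pM2r// ler_nat.
      by rewrite (leq_trans (leq_subr _ _))// ltnW.
    have [y' Oy' by'] := dist_lt_in oO bd0 db.
    have sE : sh a y = (sh b y + u *: v z)%R.
      rewrite /sh -addrA -scalerDl; congr (_ + _ *: _)%R.
      by rewrite /u natrB 1?ltnW//; ring.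
    move: da; rewrite ltNge => /negP; apply; apply: (le_trans tu).
    apply: (dist_ge_ball_in oO bd0) => w hw.
    have -> : w = (sh b y + u *: v z + (w - sh a y))%R.
      by rewrite -sE addrCA subrr addr0.
    have [||h _] := cc (sh b y) u (w - sh a y)%R bz.
    - by rewrite u0.
    - by rewrite enormBC (le_trans (ltW hw))// ler_peMl ?(ltW u0)// ler1n.
    apply: (h _ Oy'); apply: (lt_trans by'); apply: (le_lt_trans tu).
    by rewrite ltr_pMl// ltr1n.
  move=> Ai Aj; apply/val_inj; case: (ltngtP i j) => // ij.
  - by case: (key _ _ ij Ai Aj).
  - by case: (key _ _ ij Aj Ai).
have : \int[leb]_y (\sum_(k < K) ((A (sh k y))%:R)%:E) <=
       (om * ((1 + M) * rho) ^+ n.+1)%:E.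
  rewrite -(@int_eball R n x0); last by rewrite mulr_gt0// addr_gt0.
  apply: le_int => y; first by apply: sume_ge0 => k _; rewrite lee_fin.
  rewrite sumEFin lee_fin.
  have [h|h] := ltP (enorm (y - x0)) ((1 + M) * rho)%R.
    by apply: sum_exclusive_le1 => i j; exact: excl.
  rewrite big1// => k _; case: (boolP (A _)) => // /andP[/andP[_ h'] _].
  move: h; rewrite leNgt => /negP; case.
  have -> : (y - x0 = (sh k y - x0) + (k%:R * t) *: v z)%R.
    by rewrite /sh scaleNr addrAC subrK.
  rewrite (le_lt_trans (enormD _ _))// mulrDl mul1r ltr_leD// enormZ.
  rewrite ger0_norm ?mulr_ge0// ?(ltW t0)// mulrC ler_pM ?enorm_ge0 ?mulr_ge0 ?(ltW t0)//.
  apply: le_trans mrho; apply: le_trans Km; rewrite ler_pM2r// ler_nat.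
  exact: ltnW.
rewrite ge0_integral_sum//; last first.
  by move=> k; rewrite /A /sh; meas.
under eq_bigr => k _.
  rewrite (int_shift (- (k%:R * t) *: v z)%R mA)//.
  over.
rewrite sume_const_ord => h.
have I0 : 0 <= \int[leb]_y ((A y)%:R)%:E by apply: integral_ge0 => y _; rewrite lee_fin.
move: h; set I := integral _ _ _; rewrite -/I in I0 *.
case: I I0 => [i||]// i0; last first.
  by rewrite gt0_muley ?lte_fin ?ltr0n// leye_eq.
rewrite -EFinM !lee_fin mulr_natl => h.
rewrite lee_fin in i0.
have : (m * i <= 2 * om * ((1 + M) * rho) ^+ n.+1 * t)%R.
  rewrite (le_trans (ler_wpM2r i0 (ltW mK)))//.
  rewrite (_ : _ * i = 2 * t * (i *+ K))%R; last by rewrite -mulr_natr; ring.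
  by rewrite (le_trans (ler_wpM2l _ h))// ?mulr_ge0 ?(ltW t0)// le_eqVlt; apply/orP; left; apply/eqP; ring.
by move=> h2; rewrite mulrAC ler_pdivlMr// mulrC.
Qed.

(** By [sublevel_measure] the sublevel sets grow linearly, so [int_negpow_small] applies with
    exponents 1 and s. Its factor 1 / (1 - s) is the one that the density of [mu_s] cancels. *)
Lemma chart_weight z x0 (rho m s : R) : z \in zs -> (0 < m)%R ->
  (m <= rho)%R -> (m <= r)%R -> (0 < s < 1)%R ->
  \int[leb]_y (((enorm (y - z) < 4 * r) && (enorm (y - x0) < rho))%R%:R *
     ((0 < d y < m)%R%:R * d y `^ (- s)) : R)%:E <=
  (16 * om * ((1 + M) * rho) ^+ n.+1 * m `^ (- s) / (1 - s))%:E.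
Proof.
move=> zin m0 mrho mr /andP[s0 s1].
pose w (y : V) : R := ((enorm (y - z) < 4 * r) && (enorm (y - x0) < rho))%R%:R.
have mw : measurable_fun setT w by rewrite /w; meas.
have md : measurable_fun setT d by exact: measurable_dist_bd.
pose K := (2 * om * ((1 + M) * rho) ^+ n.+1 * m^-1)%R.
have K0 : (0 <= K)%R.
  rewrite !mulr_ge0 ?exprn_ge0 ?invr_ge0 ?(ltW m0) ?(ltW vball_gt0)//.
  by rewrite mulr_ge0 ?addr_ge0 ?(ltW M0)// (le_trans (ltW m0)).
have := @int_negpow_small _ V R leb w d mw (fun y => ler0n _ _) md K m 1 s K0 m0 s1.
move=> /(_ _)/le_trans; apply.
  move=> t t0 tm; rewrite powRr1 ?(ltW t0)//.
  have := @sublevel_measure z x0 rho m t zin; rewrite t0 tm => /(_ isT mrho mr).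
  apply: le_trans; rewrite le_eqVlt; apply/orP; left; apply/eqP.
  by apply: eq_integral => y _; rewrite /w -natrM mulnb.
rewrite lee_fin ger0_norm ?(ltW s0)//.
have e1 : (m `^ (1 - s) = m * m `^ (- s))%R.
  by rewrite powR_add// powRr1// ltW.
have -> : (K * 2 `^ s * (2 * (1 + (1 - s)) / (1 - s)) * m `^ (1 - s) =
   (4 * om * ((1 + M) * rho) ^+ n.+1 * m `^ (- s) / (1 - s)) * (2 `^ s * (1 + (1 - s))))%R.
  by rewrite e1 /K; field; rewrite !gt_eqF// subr_gt0.
have -> : (16 * om * ((1 + M) * rho) ^+ n.+1 * m `^ (- s) / (1 - s) =
   (4 * om * ((1 + M) * rho) ^+ n.+1 * m `^ (- s) / (1 - s)) * (2 * 2))%R by ring.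
apply: ler_wpM2l.
  rewrite !mulr_ge0 ?exprn_ge0 ?powR_ge0 ?(ltW vball_gt0) ?invr_ge0 ?subr_ge0 ?(ltW s1)//.
  by rewrite mulr_ge0 ?addr_ge0 ?(ltW M0)// (le_trans (ltW m0)).
have p2 : (2 `^ s <= 2 :> R)%R by rewrite -[leRHS](@powRr1 _ 2)// ler_powR ?ler1n// ltW.
by rewrite ler_pM ?powR_ge0//; lra.
Qed.

(** Points with d < m lie in one of the charts and are handled by [chart_weight]; elsewhere the
    weight is at most m to the power -s. *)
Lemma ball_weight x0 (rho m s : R) : (0 < m)%R ->
  (m <= rho)%R -> (m <= r)%R -> (0 < s < 1)%R ->
  \int[leb]_y ((enorm (y - x0) < rho)%R%:R * d y `^ (- s) : R)%:E <=
  ((16 * (size zs)%:R + 1) * om * ((1 + M) * rho) ^+ n.+1 * m `^ (- s) / (1 - s))%:E.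
Proof.
move=> m0 mrho mr /andP[s0 s1].
have rho0 : (0 < rho)%R by exact: lt_le_trans mrho.
have M1 : (0 <= (1 + M) * rho)%R by rewrite mulr_ge0 ?addr_ge0 ?(ltW M0)// ltW.
pose F z (y : V) : R := ((((enorm (y - z) < 4 * r) && (enorm (y - x0) < rho))%R%:R *
     ((0 < d y < m)%R%:R * d y `^ (- s))))%R.
have F0 z y : (0 <= F z y)%R by rewrite /F !mulr_ge0 ?powR_ge0.
have md : measurable_fun setT d by exact: measurable_dist_bd.
have mF z : measurable_fun setT (fun y => (F z y)%:E) by rewrite /F; meas.
pose G (y : V) : R := (m `^ (- s) * (enorm (y - x0) < rho)%R%:R)%R.
have G0 y : (0 <= G y)%R by rewrite /G mulr_ge0 ?powR_ge0.
have mG : measurable_fun setT (fun y => (G y)%:E) by rewrite /G; meas.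
apply: (@le_trans _ _ (\int[leb]_y ((\sum_(z <- zs) (F z y)%:E) + (G y)%:E))).
  apply: le_int => y; first by rewrite lee_fin mulr_ge0 ?powR_ge0.
  have S0 : 0 <= \sum_(z <- zs) (F z y)%:E by apply: sume_ge0 => z _; rewrite lee_fin.
  have [yx|_] := boolP (enorm (y - x0) < rho)%R; last first.
    by rewrite mul0r adde_ge0// lee_fin.
  rewrite mul1r.
  have [dm|dm] := ltP (d y) m; last first.
    rewrite -[leLHS]add0e leeD// lee_fin /G yx mulr1.
    rewrite !powRN lef_pV2 ?posrE ?powR_gt0 ?(lt_le_trans m0)//.
    by rewrite ge0_ler_powR ?nnegrE ?dist_ge0// ltW.
  (* On the boundary the weight is 0, by the convention for powers of 0. *)
  have [d0|d0] := leP (d y) 0%R.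
    have -> : d y = 0%R by apply/eqP; rewrite eq_le d0 dist_ge0.
    by rewrite powR0 ?oppr_eq0 ?gt_eqF// adde_ge0// lee_fin.
  rewrite -[leLHS]adde0 leeD//; last by rewrite lee_fin.
  have [z zin yz] := hcov (lt_le_trans dm mr).
  rewrite (big_rem z)//= -[leLHS]adde0 leeD//.
    rewrite lee_fin /F yx d0 dm (lt_trans yz) ?mul1r// ltr_pM2r// ltr_nat.
    by [].
  by apply: sume_ge0 => ? _; rewrite lee_fin.
rewrite ge0_integralD//; last 3 first.
- by move=> y _; apply: sume_ge0 => z _; rewrite lee_fin.
- by apply: emeasurable_sum => z; exact: mF.
- by move=> y _; rewrite lee_fin.
rewrite ge0_integral_sum//; last by move=> z y _; rewrite lee_fin.
pose Cz := (om * ((1 + M) * rho) ^+ n.+1 * m `^ (- s) / (1 - s))%R.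
have Cz0 : (0 <= Cz)%R.
  by rewrite !mulr_ge0 ?exprn_ge0 ?powR_ge0 ?(ltW vball_gt0) ?invr_ge0 ?subr_ge0 ?(ltW s1).
apply: (@le_trans _ _ ((16 * Cz *+ size zs)%:E + Cz%:E)); last first.
  by rewrite -EFinD lee_fin le_eqVlt; apply/orP; left; apply/eqP; rewrite -mulr_natr /Cz; ring.
rewrite leeD//.
  apply: (@le_trans _ _ (\sum_(z <- zs) (16 * Cz)%:E)); last first.
    by rewrite sumEFin big_const_seq count_predT iter_addr_0.
  rewrite !big_seq; apply: lee_sum => z zin.
  have s01 : (0 < s < 1)%R by rewrite s0.
  apply: le_trans (@chart_weight z x0 rho m s zin m0 mrho mr s01) _.
  by rewrite lee_fin le_eqVlt; apply/orP; left; apply/eqP; rewrite /Cz; ring.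
rewrite /G; under eq_integral do rewrite EFinM.
rewrite intZl ?powR_ge0//; last by meas.
rewrite int_eball// -EFinM lee_fin.
apply: (@le_trans _ _ (om * ((1 + M) * rho) ^+ n.+1 * m `^ (- s)))%R.
  rewrite mulrC ler_wpM2r ?powR_ge0// ler_wpM2l ?(ltW vball_gt0)//.
  by rewrite lerXn2r// ?nnegrE ?(ltW rho0)// ler_peMl ?(ltW rho0)// lerDl ltW.
rewrite /Cz ler_peMr ?mulr_ge0 ?exprn_ge0 ?powR_ge0 ?(ltW vball_gt0)//.
by rewrite invf_ge1 ?subr_gt0// gerBl ltW.
Qed.

End chart_measure.

(** * A lower bound for the weight outside the domain *)

Section chart_measure_low.
Context {R : realType} {n : nat} (Omega : set 'rV[R]_n.+1).
Local Notation V := 'rV[R]_n.+1.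
Variables (zs : seq V) (v : V -> V) (r M : R).
Hypotheses (oO : open Omega) (bd0 : boundary Omega !=set0).
Hypotheses (r0 : 0 < r) (M0 : 0 < M).
Hypothesis hv : forall z, z \in zs -> enorm (v z) <= M /\ cone_chart Omega r z (v z).
Hypothesis hcov : forall x, dist_bd Omega x < r ->
  exists2 z, z \in zs & enorm (x - z) < 2 * r.
Local Notation d := (dist_bd Omega).
Local Notation leb := (@lebesgue_rV R n.+1).
Local Notation om := (@vball R n).

Let mO : measurable Omega := open_measurable_rV oO.

Definition outer_ball (z : V) (tau : R) (y : V) : R :=
  \1_(~` Omega) y * (enorm (y - z) < tau)%R%:R.

(* On a path leaving a ball of the complement towards [Omega] by steps of
   length at most [t], some step lands in the layer [t <= d < 2 t]. *)
Lemma layer_measure z (tau t : R) : boundary Omega z -> 0 < tau <= r ->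
  0 < t <= tau / (2 * (M + 1) ^+ 2) ->
  ((2 / 3 * om * (tau / (2 * (M + 1) ^+ 2)) ^+ n.+1 * t / tau)%:E <=
   \int[leb]_y (outer_ball z tau y * (t <= d y < 2 * t)%R%:R)%:E)%E.
Proof.
move=> bz /andP[tau0 taur] /andP[t0 tt'].
set tau' := tau / _ in tt' *.
have M1 : 0 < M + 1 by rewrite addr_gt0.
have M1' : 1 <= M + 1 by rewrite lerDr ltW.
have tau'0 : 0 < tau' by exact: lt_le_trans tt'.
pose T := tau' * (M + 1).
have T0 : 0 < T by rewrite mulr_gt0.
have TM : T * (M + 1) = tau / 2 by rewrite /T /tau'; field; rewrite gt_eqF.
have tau'T : tau' <= T by rewrite /T ler_peMr// ltW.
have Tr : T <= r.
  have : T <= T * (M + 1) by rewrite ler_peMr// ltW.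
  rewrite TM; lra.
have [z0 z0in zz0] : exists2 z0, z0 \in zs & enorm (z - z0) < 2 * r.
  by apply: hcov; rewrite boundary_dist0.
have [vM cc] := hv z0in.
have Oz : ~ Omega z by have /boundaryP[] := bz.
pose K := (Num.truncn (T * (M + 1) / t)).+1.
have K0 : (0 < K%:R :> R) by rewrite ltr0n.
have KT : T * (M + 1) / t < K%:R by exact: truncnS_gt.
have KT' : K.+1%:R <= 3 * (T * (M + 1) / t).
  have h1 : 1 <= T * (M + 1) / t.
    rewrite ler_pdivlMr// mul1r (le_trans tt')// (le_trans tau'T)//.
    by rewrite ler_peMr// ltW.
  have h2 : (Num.truncn (T * (M + 1) / t))%:R <= T * (M + 1) / t.
    by rewrite truncn_le// (le_trans ler01).
  rewrite /K -!natr1; lra.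
pose del := T / K%:R.
have del0 : 0 < del by rewrite divr_gt0.
have delM : del * M <= t.
  have : T * (M + 1) < K%:R * t by rewrite -ltr_pdivrMr.
  by move=> h; rewrite /del mulrAC ler_pdivrMr//; lra.
pose w k (y : V) : V := y + (k%:R * del) *: v z0.
pose A y := outer_ball z tau y * (t <= d y < 2 * t)%R%:R.
have A0 y : 0 <= A y by rewrite /A /outer_ball !mulr_ge0.
have mA : measurable_fun setT (fun y => (A y)%:E).
  by rewrite /A /outer_ball; have := measurableC mO => ?; meas.
(* Pushing z outwards gives the centre of a ball of radius tau' whose points all have distance at
   least 3 tau' from the boundary. *)
pose xi := z - tau' *: v z0.
have hits y : enorm (y - xi) < tau' -> exists k : 'I_K.+1, A (w k y) = 1.
  move=> yxi.
  have ball3 y' : enorm (y - y') < 3 * tau' -> ~ Omega y'.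
    move=> yy'.
    have -> : y' = z - tau' *: v z0 + (y' - xi) by rewrite /xi addrCA subrr addr0.
    have [|||_ h] := cc z tau' (y' - xi).
    - by rewrite (lt_trans zz0)// ltr_pM2r// ltr_nat.
    - by rewrite tau'0 (le_trans tau'T).
    - rewrite (le_trans (enorm_tri y _ _))// (enormBC y' y); lra.
    - by apply: (h z) => //; rewrite subrr enorm0 mulr_gt0.
  have Oy : ~ Omega y by apply: ball3; rewrite subrr enorm0 mulr_gt0.
  have dy : 3 * tau' <= d y by exact: (dist_ge_ball_out oO bd0).
  have yz : enorm (y - z) < T.
    rewrite (le_lt_trans (enorm_tri xi _ _))// /T mulrDr mulr1 addrC.
    rewrite ler_ltD// /xi addrC addKr enormN enormZ gtr0_norm//.
    by rewrite ler_wpM2l ?(ltW tau'0).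
  have OK : Omega (w K y).
    have -> : w K y = y + T *: v z0 + 0.
      by rewrite /w /del addr0; congr (_ + _ *: _); field; rewrite gt_eqF.
    have [|||h _] := cc y T 0.
    - rewrite (le_lt_trans (enorm_tri z _ _))// (_ : 4 * r = 2 * r + 2 * r); last ring.
      rewrite ltrD// (lt_le_trans yz)// (le_trans Tr)// ler_peMl ?(ltW r0)// ler1n//.
    - by rewrite T0.
    - by rewrite enorm0 mulr_ge0// ltW.
    - have [_ /(_ T T0)[y' Oy' zy']] := (boundaryP oO z).1 bz.
      apply: (h y') => //; rewrite (le_lt_trans (enorm_tri z _ _))//; lra.
  (* The first index at which the path is in [Omega] or closer than 2 t to the boundary. It is not
     0, since d y >= 3 tau'; the preceding point is outside at distance at least 2 t, and a step has
     length at most t, so the point is still outside with t <= d < 2 t. *)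
  pose Pk k := `[< Omega (w k y) >] || (d (w k y) < 2 * t).
  have exk : exists k, Pk k by exists K; rewrite /Pk asboolT.
  case: (ex_minnP exk) => -[|k] hk kmin.
    exfalso; move: hk; rewrite /Pk /w mul0r scale0r addr0.
    rewrite asboolF//= ltNge => /negP; apply; apply: le_trans dy.
    by rewrite ler_pM ?(ltW t0)// ler_nat.
  have kK : (k.+1 <= K)%N by apply: kmin; rewrite /Pk asboolT.
  have /negP : ~ Pk k by move=> /kmin; rewrite ltnn.
  rewrite /Pk negb_or -leNgt => /andP[/asboolPn Ok dk].
  have step : enorm (w k y - w k.+1 y) <= t.
    rewrite /w opprD addrACA subrr add0r -scalerBl enormZ -mulrBl -natr1.
    rewrite opprD addrA subrr add0r mulN1r normrN gtr0_norm//.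
    by apply: le_trans delM; rewrite ler_wpM2l ?(ltW del0).
  have Ok1 : ~ Omega (w k.+1 y).
    by apply: (dist_ball_out oO bd0 Ok); rewrite (le_lt_trans step)//; lra.
  have dk1 : d (w k.+1 y) < 2 * t by move: hk; rewrite /Pk asboolF.
  have dk1' : t <= d (w k.+1 y).
    rewrite -(lerD2l t) -mulr2n -mulr_natl.
    exact: le_trans dk (le_trans (dist_lip bd0 _ _) (lerD step (lexx _))).
  exists (@Ordinal K.+1 k.+1 kK) => /=.
  have kd : k.+1%:R * del <= T.
    rewrite /del mulrCA -[leRHS]mulr1 ler_wpM2l ?(ltW T0)//.
    by rewrite ler_pdivrMr// mul1r ler_nat.
  rewrite /A /outer_ball dk1 dk1' /= mulr1.
  rewrite indicE mem_set//= mul1r.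
  rewrite (_ : (enorm _ < tau)%R)// /w addrAC (le_lt_trans (enormD _ _))//.
  have kd0 : 0 <= k.+1%:R * del by rewrite mulr_ge0// ltW.
  rewrite enormZ ger0_norm//.
  have : k.+1%:R * del * enorm (v z0) <= T * M by exact: ler_pM kd0 (enorm_ge0 _) kd vM.
  move: TM yz; rewrite mulrDr mulr1 => TM yz h.
  have := divr_gt0 tau0 (ltr0n R 2); lra.
(* Each point of the ball about xi hits the layer with at least one of the K + 1 translates.
   Dividing its volume by K + 1 <= 3 tau / (2 t) leaves the multiple 2 t / (3 tau) of it. *)
have : ((om * tau' ^+ n.+1)%:E <= \int[leb]_y (\sum_(k < K.+1) (A (w k y))%:E))%E.
  rewrite -(@int_eball R n xi tau')//; apply: le_int => y; first by rewrite lee_fin.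
  rewrite sumEFin lee_fin.
  have [/hits[k Ak]|_] := ltP (enorm (y - xi)) tau'; last by rewrite sumr_ge0.
  by rewrite (bigD1 k)//= Ak lerDl sumr_ge0.
rewrite ge0_integral_sum//; last 2 first.
- move=> k; apply: (measurableT_comp mA); rewrite /w; meas.
- by move=> k x _; rewrite lee_fin.
under eq_bigr => k _.
  rewrite (int_shift (k%:R * del *: v z0)%R mA); last by move=> x; rewrite lee_fin.
  over.
rewrite sume_const_ord => h.
rewrite -(@lee_pmul2l _ K.+1%:R%:E)//.
apply: le_trans h; rewrite -EFinM lee_fin.
have c0 : 0 <= 2 / 3 * om * tau' ^+ n.+1 * t / tau.
  by rewrite !mulr_ge0 ?exprn_ge0 ?invr_ge0 ?(ltW tau'0) ?(ltW t0) ?(ltW tau0) ?(ltW vball_gt0).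
apply: le_trans (ler_wpM2r c0 KT') _.
by rewrite TM le_eqVlt; apply/orP; left; apply/eqP; field; rewrite !gt_eqF.
Qed.

(** Sums [layer_measure] over the disjoint layers t_j = 2^(-j) tau'; [geom_ratio_ge] yields 1 / (1 -
    s). This counterpart of [ball_weight] keeps the normalisation of the extension kernel away from
    0. *)
Lemma outer_ball_weight z (tau s : R) : boundary Omega z -> 0 < tau <= r ->
  0 < s < 1 ->
  ((3^-1 * om / (2 * (M + 1) ^+ 2) ^+ n.+2 * tau `^ (n.+1%:R - s) / (1 - s))%:E <=
   \int[leb]_y (outer_ball z tau y * d y `^ (- s))%:E)%E.
Proof.
move=> bz tau0r /andP[s0 s1]; have /andP[tau0 taur] := tau0r.
have M1 : 0 < M + 1 by rewrite addr_gt0.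
set L := 2 * (M + 1) ^+ 2.
have L1 : 1 <= L.
  have : 1 <= (M + 1) ^+ 2 by rewrite exprn_ege1// lerDr ltW.
  rewrite /L; lra.
have L0 : 0 < L by exact: lt_le_trans L1.
pose tau' := tau / L.
have tau'0 : 0 < tau' by rewrite divr_gt0.
pose t j : R := 2^-1 ^+ j * tau'.
have t0 j : 0 < t j by rewrite mulr_gt0// exprn_gt0// invr_gt0.
have tt j : t j <= tau'.
  by rewrite /t ler_piMl ?(ltW tau'0)// exprn_ile1 ?invr_ge0// invf_le1// ler1n.
pose A j y := outer_ball z tau y * (t j <= d y < 2 * t j)%R%:R.
have ob0 y : 0 <= outer_ball z tau y by rewrite /outer_ball mulr_ge0.
have mcO := measurableC mO.
apply: (@le_trans _ _ (\int[leb]_y (\sum_(j <oo)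
    ((t j <= d y < 2 * t j)%R%:R%:E *
       ((2 * t j) `^ (- s) * outer_ball z tau y)%:E)))%E); last first.
  apply: le_int => y.
    by apply: nneseries_ge0 => j _ _; rewrite -EFinM lee_fin !mulr_ge0 ?powR_ge0.
  apply: nneseries_exclusive.
  - move=> i j /andP[i1 i2] /andP[j1 j2].
    have key a b : (a < b)%N -> t a <= d y -> d y < 2 * t b -> False.
      move=> ab h1 h2; have : 2 * t b <= t a.
        have -> : t b = 2^-1 ^+ (b - a.+1) * (2^-1 * t a).
          by rewrite /t -{1}(subnK ab) exprD exprS; ring.
        rewrite mulrCA mulVKf// ler_piMl ?(ltW (t0 a))//.
        by rewrite exprn_ile1 ?invr_ge0// invf_le1// ler1n.
      lra.
    case: (ltngtP i j) => // ij; exfalso; [exact: key ij i1 j2|exact: key ij j1 i2].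
  - by rewrite lee_fin mulr_ge0 ?powR_ge0.
  - move=> j /andP[j1 j2]; rewrite !lee_fin mulr_ge0 ?powR_ge0//= mulrC.
    have dy0 : 0 < d y by exact: lt_le_trans j1.
    have t20 : 0 < 2 * t j by rewrite mulr_gt0.
    rewrite ler_wpM2l// !powRN lef_pV2 ?posrE ?powR_gt0//.
    by apply: ge0_ler_powR; rewrite ?nnegrE ltW.
have mob : measurable_fun setT (outer_ball z tau) by rewrite /outer_ball; meas.
rewrite integral_nneseries//; last 2 first.
- move=> j; meas.
- by move=> j y _; rewrite -EFinM lee_fin !mulr_ge0 ?powR_ge0.
pose c := (2 / 3 * om * tau' ^+ n.+1 / tau * 2 `^ (- s) * tau' `^ (1 - s))%R.
have c0 : 0 <= c.
  by rewrite /c !mulr_ge0 ?powR_ge0 ?exprn_ge0 ?invr_ge0 ?(ltW tau0) ?(ltW tau'0) ?(ltW vball_gt0).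
apply: (@le_trans _ _ (\sum_(j <oo) (c * (2^-1 `^ (1 - s)) ^+ j)%:E)%E); last first.
  apply: lee_nneseries => [j _ _|j _]; first by rewrite lee_fin mulr_ge0 ?exprn_ge0 ?powR_ge0.
  have := @layer_measure z tau (t j) bz tau0r; rewrite t0 tt => /(_ isT) h.
  rewrite (_ : (fun x => _) = fun y => (((2 * t j) `^ (- s))%:E *
    (outer_ball z tau y * (t j <= d y < 2 * t j)%R%:R)%:E)%E); last first.
    by apply/funext => y; rewrite -!EFinM; congr EFin; ring.
  rewrite intZl ?powR_ge0//; last 2 first.
  - by meas.
  - by move=> y; rewrite lee_fin mulr_ge0.
  have px : (0 <= ((2 * t j) `^ (- s))%:E)%E by rewrite lee_fin powR_ge0.
  apply: le_trans (lee_wpmul2l px h).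
  rewrite -EFinM lee_fin le_eqVlt; apply/orP; left; apply/eqP.
  have e1 : (t j) `^ (- s) * t j = (2^-1 `^ (1 - s)) ^+ j * tau' `^ (1 - s).
    rewrite -[X in _ * X](powRr1 (ltW (t0 j))) -powR_add// addrC.
    rewrite /t powRM ?exprn_ge0 ?invr_ge0 ?(ltW tau'0)//.
    by rewrite -powR_mulrn ?invr_ge0// powRAC powR_mulrn ?powR_ge0.
  rewrite powRM ?(ltW (t0 j))// /c -/L -/tau'.
  transitivity (2 / 3 * om * tau' ^+ n.+1 / tau * 2 `^ (- s) * (t j `^ (- s) * t j)).
    by rewrite e1; ring.
  by ring.
rewrite nneseries_geometric//; last by apply: half_pow_lt1; rewrite subr_gt0.
have s1' : 0 < 1 - s by rewrite subr_gt0.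
rewrite lee_fin (le_trans _ (ler_wpM2l c0 (geom_ratio_ge s1')))//.
rewrite ler_wpM2r ?invr_ge0 ?(ltW s1')//.
have p2 : 2^-1 <= 2 `^ (- s) :> R.
  by rewrite -powR_inv1// ler_powR ?ler1n// lerN2 ltW.
have q1 : tau' `^ (1 - s) = tau `^ (1 - s) * L^-1 `^ (1 - s).
  by rewrite /tau' powRM ?invr_ge0 ?(ltW tau0) ?(ltW L0).
(* Uniformly in s, the power 1 - s of 1 / L is at least 1 / L: this is the last factor of L^(n +
   2). *)
have q2 : L^-1 <= L^-1 `^ (1 - s).
  by rewrite ger1_powR ?invr_gt0 ?L0 ?invf_le1//= gerBl ltW.
have e2 : tau `^ (n.+1%:R - s) = tau ^+ n.+1 / tau * tau `^ (1 - s).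
  rewrite (_ : n.+1%:R - s = n.+1%:R + (- 1) + (1 - s)); last by ring.
  by rewrite !powR_add// powR_mulrn ?(ltW tau0)// powR_inv1 ?(ltW tau0).
have -> : c = (3^-1 * om * (tau ^+ n.+1 / tau * tau `^ (1 - s)) / L ^+ n.+1) *
              (2 * 2 `^ (- s) * L^-1 `^ (1 - s)).
  by rewrite /c q1 /tau' expr_div_n; field; rewrite !gt_eqF ?exprn_gt0.
have -> : 3^-1 * om / L ^+ n.+2 * tau `^ (n.+1%:R - s) =
   (3^-1 * om * (tau ^+ n.+1 / tau * tau `^ (1 - s)) / L ^+ n.+1) * L^-1.
  by rewrite e2 exprS; field; rewrite !gt_eqF ?exprn_gt0.
apply: ler_wpM2l.
  by rewrite !mulr_ge0 ?powR_ge0 ?exprn_ge0 ?invr_ge0 ?exprn_ge0 ?(ltW tau0) ?(ltW L0) ?(ltW vball_gt0).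
rewrite -[leLHS]mul1r ler_pM ?invr_ge0 ?(ltW L0)//; lra.
Qed.

End chart_measure_low.

Ltac pos :=
  lazymatch goal with
  | |- is_true (_ <= EFin _)%E => rewrite lee_fin; pos
  | |- is_true (_ < EFin _)%E => rewrite lte_fin; pos
  | |- is_true (_ <= mule _ _)%E => apply: mule_ge0; pos
  | |- is_true (_ <= adde _ _)%E => apply: adde_ge0; pos
  | |- is_true (_ <= integral _ _ _)%E =>
      let x := fresh "x" in apply: integral_ge0 => x _; pos
  | |- is_true (0 <= _ * _)%R => apply: mulr_ge0; pos
  | |- is_true (0 < _ * _)%R => apply: mulr_gt0; pos
  | |- is_true (0 <= _ ^-1)%R => rewrite invr_ge0; pos
  | |- is_true (0 < _ ^-1)%R => rewrite invr_gt0; pos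
  | |- is_true (0 <= _ ^+ _)%R => apply: exprn_ge0; pos
  | |- is_true (0 < _ ^+ _)%R => apply: exprn_gt0; pos
  | |- is_true (0 <= powR _ _)%R => exact: powR_ge0
  | |- is_true (0 < powR _ _)%R => apply: powR_gt0; pos
  | |- is_true (0 <= enorm _)%R => exact: enorm_ge0
  | |- is_true (0 <= _ + _)%R => first [solve [apply: addr_ge0; pos] | lra]
  | |- is_true (0 < _ + _)%R => first [solve [apply: addr_gt0; pos]
      | solve [apply: ltr_wpDl; pos] | solve [apply: ltr_wpDr; pos] | lra]
  | _ => first [assumption | done | by apply: ltW | solve [auto] | lra]
  end.

(** * Radial integrals *)

Section radial_integrals.
Context {R : realType} {n : nat}.
Local Notation V := 'rV[R]_n.+1.
Local Notation leb := (@lebesgue_rV R n.+1).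
Local Notation om := (@vball R n).
Local Open Scope ereal_scope.

Lemma int_radial_small (z : V) (T a : R) : (0 < a)%R -> (0 < T)%R ->
  \int[leb]_x ((0 < enorm (x - z) < T)%R%:R * enorm (x - z) `^ (a - n.+1%:R))%:E
  <= (om * 2 `^ `|n.+1%:R - a| * (2 * (1 + a) / a) * T `^ a)%:E.
Proof.
move=> a0 T0.
have mf : measurable_fun setT (fun x : V => enorm (x - z)) by meas.
have := @int_negpow_small _ V R leb (cst 1%R) _ (@measurable_cst _ _ _ _ _ _) (fun=> ler01) mf om T
  n.+1%:R (n.+1%:R - a)%R (ltW vball_gt0) T0.
rewrite ltrBlDl ltrDr => /(_ a0).
rewrite (_ : n.+1%:R - (n.+1%:R - a) = a)%R; last by ring.
move=> h; apply: (le_trans _ (h _)).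
  rewrite le_eqVlt; apply/orP; left; apply/eqP; apply: eq_integral => x _.
  by rewrite mul1r opprB.
move=> t t0 tT; rewrite powR_mulrn ?(ltW t0)// -(int_eball z)// le_eqVlt; apply/orP; left.
by apply/eqP; apply: eq_integral => x _; rewrite mul1r.
Qed.

Lemma int_radial_large (z : V) (T b : R) : (0 < b)%R -> (0 < T)%R ->
  \int[leb]_x ((T <= enorm (x - z))%R%:R * enorm (x - z) `^ (- (n.+1%:R + b)))%:E
  <= (om * 2 `^ (n.+1%:R + b) * (2 * (1 + b) / b) * T `^ (- b))%:E.
Proof.
move=> b0 T0.
have mf : measurable_fun setT (fun x : V => enorm (x - z)) by meas.
have := @int_negpow_large _ V R leb (cst 1%R) _ (@measurable_cst _ _ _ _ _ _) (fun=> ler01) mf om T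
  n.+1%:R (n.+1%:R + b)%R (ltW vball_gt0) T0.
rewrite ltrDl => /(_ b0).
rewrite (_ : n.+1%:R + b - n.+1%:R = b)%R; last by ring.
rewrite (_ : n.+1%:R - (n.+1%:R + b) = - b)%R; last by ring.
rewrite ger0_norm ?addr_ge0 ?(ltW b0)// => h; apply: (le_trans _ (h _)).
  rewrite le_eqVlt; apply/orP; left; apply/eqP; apply: eq_integral => x _.
  by rewrite mul1r.
move=> t Tt; have t0 := lt_le_trans T0 Tt.
rewrite powR_mulrn ?(ltW t0)// -(int_eball z)// le_eqVlt; apply/orP; left.
by apply/eqP; apply: eq_integral => x _; rewrite mul1r.
Qed.

(** Split at |x - z| = rho: in the sum rho + |x - z| the smaller summand is dropped on each side,
    and the two radial integrals converge at 0 and at infinity with exponents a and b. The constant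
    is uniform for exponents in [lo, hi]. *)
Lemma int_radial_kernel (lo hi : R) : (0 < lo)%R -> exists2 C : R, (0 < C)%R &
  forall (a b rho : R) (z : V), (lo <= a <= hi)%R -> (lo <= b <= hi)%R -> (0 < rho)%R ->
  \int[leb]_x ((0 < enorm (x - z))%R%:R * (enorm (x - z) `^ (a - n.+1%:R) *
      (rho + enorm (x - z)) `^ (- (a + b))))%:E <= (C * rho `^ (- b))%:E.
Proof.
move=> lo0; pose C0 := (om * 2 `^ (n.+1%:R + hi) * (2 * (1 + hi) / lo))%R.
have om0 := @vball_gt0 R n.
exists (2 * `|C0| + 1)%R; first by rewrite ltr_wpDl// mulr_ge0.
move=> a b rho z /andP[la ah] /andP[lb bh] rho0.
have a0 : (0 < a)%R by exact: lt_le_trans la.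
have b0 : (0 < b)%R by exact: lt_le_trans lb.
have hi0 : (0 < hi)%R by exact: lt_le_trans ah.
have key c e : (lo <= c <= hi)%R -> (e <= n.+1%:R + hi)%R ->
    (om * 2 `^ e * (2 * (1 + c) / c) <= C0)%R.
  move=> /andP[lc ch] he; have c0 : (0 < c)%R by exact: lt_le_trans lc.
  have f0 : (0 <= 2 * (1 + c) / c)%R.
    by pos.
  rewrite /C0 ler_pM//; first by pos.
    by rewrite ler_wpM2l ?(ltW om0)// ler_powR ?ler1n.
  rewrite ler_pM//; [by pos|by pos|by rewrite ler_wpM2l// lerD2l|].
  by rewrite lef_pV2 ?posrE.
pose f1 (x : V) : R := ((0 < enorm (x - z) < rho)%R%:R * enorm (x - z) `^ (a - n.+1%:R))%R.
pose f2 (x : V) : R := ((rho <= enorm (x - z))%R%:R * enorm (x - z) `^ (- (n.+1%:R + b)))%R.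
have f10 x : (0 <= f1 x)%R by rewrite mulr_ge0 ?powR_ge0.
have f20 x : (0 <= f2 x)%R by rewrite mulr_ge0 ?powR_ge0.
apply: (@le_trans _ _ (\int[leb]_x ((rho `^ (- (a + b)))%:E * (f1 x)%:E + (f2 x)%:E))).
  apply: le_int => x; first by rewrite lee_fin !mulr_ge0 ?powR_ge0.
  rewrite -EFinM -EFinD lee_fin /f1 /f2.
  have [x0|_] := ltP 0%R (enorm (x - z)); last by rewrite mul0r addr_ge0 ?mulr_ge0 ?powR_ge0.
  rewrite mul1r /=; set e := enorm (x - z) in x0 *.
  have [er|re] := ltP e rho.
    rewrite mul1r mul0r addr0 mulrC ler_wpM2r ?powR_ge0//.
    rewrite !powRN lef_pV2 ?posrE ?powR_gt0 ?addr_gt0//.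
    by apply: ge0_ler_powR; rewrite ?nnegrE ?addr_ge0 ?lerDl// ltW.
  rewrite mul0r mulr0 add0r mul1r.
  have -> : (- (n.+1%:R + b) = (a - n.+1%:R) + - (a + b) :> R)%R by ring.
  rewrite [in leRHS]powR_add// ler_wpM2l ?powR_ge0//.
  rewrite !powRN lef_pV2 ?posrE ?powR_gt0 ?addr_gt0//.
  by apply: ge0_ler_powR; rewrite ?nnegrE ?addr_ge0 ?lerDr// ltW.
have mf1 : measurable_fun setT f1 by rewrite /f1; meas.
have mf2 : measurable_fun setT f2 by rewrite /f2; meas.
rewrite ge0_integralD//; last 4 first.
- by move=> x _; rewrite -EFinM lee_fin mulr_ge0 ?powR_ge0.
- by apply/measurable_EFinP; apply: measurable_funM.
- by move=> x _; rewrite lee_fin.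
- exact/measurable_EFinP.
rewrite intZl ?powR_ge0//; last exact/measurable_EFinP.
have p0 : 0 <= (rho `^ (- (a + b)))%:E by rewrite lee_fin powR_ge0.
apply: le_trans (leeD (lee_wpmul2l p0 (int_radial_small z a0 rho0))
  (int_radial_large z b0 rho0)) _.
rewrite -EFinM -EFinD lee_fin.
have -> : (rho `^ (- (a + b)) * (om * 2 `^ `|n.+1%:R - a| * (2 * (1 + a) / a) * rho `^ a)
  = om * 2 `^ `|n.+1%:R - a| * (2 * (1 + a) / a) * rho `^ (- b))%R.
  have -> : (- b = - (a + b) + a)%R by ring.
  by rewrite powR_add//; ring.
rewrite -mulrDl ler_wpM2r ?powR_ge0//.
have /le_trans -> // : (om * 2 `^ `|n.+1%:R - a| * (2 * (1 + a) / a) +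
  om * 2 `^ (n.+1%:R + b) * (2 * (1 + b) / b) <= C0 + C0)%R.
  rewrite lerD// key ?lerD2l ?la ?lb ?ah ?bh//.
  rewrite ler_norml; apply/andP; split.
    by rewrite -subr_ge0; have : (0 <= n.+1%:R :> R)%R by []; lra.
  by rewrite lerD2l; lra.
have := ler_norm C0; lra.
Qed.

End radial_integrals.

(** * Uniform estimates for the weight on a bounded domain *)

Section domain_facts.
Context {R : realType} {n : nat} (Omega : set 'rV[R]_n.+1).
Hypotheses (Olip : lipschitz_domain Omega) (Obnd : bounded_set Omega).
Local Notation V := 'rV[R]_n.+1.
Local Notation d := (dist_bd Omega).
Local Notation leb := (@lebesgue_rV R n.+1).
Local Notation om := (@vball R n).

Let oO : open Omega. Proof. by have [] := Olip. Qed.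
Let bd0 : boundary Omega !=set0. Proof. by have [] := Olip. Qed.
Let mO : measurable Omega := open_measurable_rV oO.
Let mcO : measurable (~` Omega) := measurableC mO.
Let om0 := @vball_gt0 R n.

Lemma bounded_domain : exists2 D : R, 1 <= D &
  (forall x, Omega x -> enorm x <= D) /\
  (forall x, Omega x -> d x <= D) /\ (forall z, boundary Omega z -> enorm z <= D).
Proof.
have [D D0 hD] := bounded_enorm Obnd.
have hbd z : boundary Omega z -> enorm z <= D + 1.
  move=> /(boundaryP oO)[_ /(_ _ ltr01)[y Oy zy]].
  have := enormD (z - y) y; rewrite subrK => /le_trans; apply.
  by rewrite addrC lerD ?hD// ltW.
exists (D + (D + 1)); first lra.
split=> [x Ox|]; first by have := hD x Ox; lra.
split=> [x Ox|z bz].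
  have [z bz] := bd0; rewrite (le_trans (dist_le bd0 x bz))//.
  by rewrite (le_trans (enormB _ _))// lerD ?hD ?hbd.
by have := hbd z bz; lra.
Qed.

(** [ball_weight] with m the minimum of rho and r. As rho <= Q m for Q = 1 + P / r, the power -s of
    m exceeds that of rho by a factor at most Q, whatever s < 1. *)
Lemma ball_weight_unif (P : R) : exists2 C : R, 0 < C &
  forall (s rho : R) (x0 : V), 0 < s < 1 -> 0 < rho <= P ->
  (\int[leb]_y ((enorm (y - x0) < rho)%R%:R * d y `^ (- s) : R)%:E <=
   (C * rho `^ (n.+1%:R - s) / (1 - s))%:E)%E.
Proof.
have [zs [v [r [M [r0 M0 hv hcov]]]]] := finite_charts Olip Obnd.
pose S := (16 * (size zs)%:R + 1) * om * (1 + M) ^+ n.+1.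
have S0 : 0 < S by rewrite /S; pos.
pose Q := 1 + P / r.
exists (S * (1 + `|Q|)); first by rewrite mulr_gt0// ltr_wpDr.
move=> s rho x0 s01 /andP[rho0 rhoP]; have /andP[s0 s1] := s01.
pose m := Num.min rho r.
have m0 : 0 < m by rewrite /m lt_min rho0.
have mrho : m <= rho by rewrite /m ge_min lexx.
have mr : m <= r by rewrite /m ge_min lexx orbT.
apply: le_trans (ball_weight oO bd0 r0 M0 hv hcov x0 m0 mrho mr s01) _.
have s1' : 0 < 1 - s by rewrite subr_gt0.
rewrite lee_fin ler_wpM2r ?invr_ge0 ?(ltW s1')//.
have P0 : 0 < P by exact: lt_le_trans rhoP.
have Q1 : 1 <= Q by rewrite lerDl divr_ge0 ?ltW.
have rQ : rho <= Q * m.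
  rewrite /m; case: (leP rho r) => _; first by rewrite ler_peMl// ltW.
  by rewrite /Q mulrDl mul1r divfK ?gt_eqF//; rewrite (le_trans rhoP)// lerDr ltW.
have : m `^ (- s) <= Q * rho `^ (- s).
  apply: le_trans (powR_comparable (L := Q) (- s) m0 rho0 _ rQ) _.
    by rewrite (le_trans mrho)// ler_peMl// ltW.
  rewrite ler_wpM2r ?powR_ge0// normrN gtr0_norm// ler1_powR//.
  exact: ltW.
move=> hm.
rewrite exprMn powR_add// powR_mulrn ?(ltW rho0)//.
rewrite -/S (_ : _ * m `^ (- s) = S * rho ^+ n.+1 * m `^ (- s)); last by rewrite /S; ring.
rewrite (_ : S * (1 + `|Q|) * _ = S * rho ^+ n.+1 * ((1 + `|Q|) * rho `^ (- s))); last by ring.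
rewrite ler_wpM2l//; first by pos.
apply: le_trans hm _; rewrite ler_wpM2r ?powR_ge0//.
by rewrite (le_trans (ler_norm _))// lerDr.
Qed.

Lemma outer_ball_weight_unif : exists r c : R, [/\ 0 < r, 0 < c &
  forall (s tau : R) (z : V), boundary Omega z -> 0 < s < 1 -> 0 < tau <= r ->
  ((c * tau `^ (n.+1%:R - s) / (1 - s))%:E <=
  \int[leb]_y (outer_ball Omega z tau y * d y `^ (- s))%:E)%E].
Proof.
have [zs [v [r [M [r0 M0 hv hcov]]]]] := finite_charts Olip Obnd.
exists r, (3^-1 * om / (2 * (M + 1) ^+ 2) ^+ n.+2); split => //.
  by pos.
move=> s tau z bz s01 tau0.
exact: (outer_ball_weight oO bd0 r0 M0 hv hcov bz tau0 s01).
Qed.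

(** The boundary lies in each sublevel set of the distance, whose measure within a bounded set is
    O(t). *)
Lemma boundary_null : leb (boundary Omega) = 0%E.
Proof.
have [zs [v [r [M [r0 M0 hv hcov]]]]] := finite_charts Olip Obnd.
have [D D1 [_ [_ hD]]] := bounded_domain.
have mbd : measurable (boundary Omega).
  apply: measurableD; last by apply: open_measurable_rV; exact: open_interior.
  rewrite -[closure _]setCK; apply: measurableC; apply: open_measurable_rV.
  by rewrite openC; exact: closed_closure.
pose rho := Num.max (D + 1) r.
have rrho : r <= rho by rewrite /rho le_max lexx orbT.
have rho0 : 0 < rho by exact: lt_le_trans rrho.
pose C := (size zs)%:R * (2 * om * ((1 + M) * rho) ^+ n.+1 * r^-1).
have C0 : 0 <= C.
  by rewrite !mulr_ge0 ?exprn_ge0 ?invr_ge0 ?mulr_ge0 ?addr_ge0 ?(ltW M0) ?(ltW rho0) ?(ltW r0) ?(ltW om0).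
have small t : 0 < t <= r -> (leb (boundary Omega) <= (C * t)%:E)%E.
  move=> /andP[t0 tr].
  pose A z y : bool := (enorm (y - z) < 4 * r) && (enorm (y - 0) < rho) && (d y < t).
  have mA z : measurable_fun setT (fun y => ((A z y)%:R : R)%:E) by rewrite /A; meas.
  rewrite -[boundary Omega]setIT -integral_indic//.
  apply: (@le_trans _ _ (\int[leb]_y (\sum_(z <- zs) ((A z y)%:R)%:E))%E).
    apply: le_int => y; first by rewrite lee_fin.
    rewrite indicE; case: (boolP (y \in _)) => yb; last first.
      by apply: sume_ge0 => z _; rewrite lee_fin.
    rewrite inE in yb; have dy := boundary_dist0 bd0 yb.
    have [|z zin yz] := hcov y; first by rewrite dy.
    rewrite (big_rem z)//= -[leLHS]adde0 leeD//; last by apply: sume_ge0 => ? _; rewrite lee_fin.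
    rewrite lee_fin /A dy t0 subr0 (lt_trans yz) ?ltr_pM2r ?ltr_nat//=.
    rewrite (_ : enorm y < rho)// (le_lt_trans (hD _ yb))//.
    by rewrite /rho lt_max ltrDl ltr01.
  rewrite ge0_integral_sum//.
  apply: (@le_trans _ _ (\sum_(z <- zs) (2 * om * ((1 + M) * rho) ^+ n.+1 * r^-1 * t)%:E)%E).
    rewrite !big_seq; apply: lee_sum => z zin.
    by apply: (sublevel_measure oO bd0 M0 hv 0 zin _ rrho (lexx r)); rewrite t0.
  rewrite sumEFin big_const_seq count_predT iter_addr_0 lee_fin.
  by rewrite le_eqVlt; apply/orP; left; apply/eqP; rewrite -mulr_natr /C; ring.
apply/eqP; rewrite eq_le measure_ge0 andbT.
apply/lee_addgt0Pr => e e0; rewrite add0e.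
pose t := Num.min r (e / (C + 1)).
have C1 : 0 < C + 1 by rewrite ltr_wpDl.
have t0 : 0 < t by rewrite /t lt_min r0 divr_gt0.
apply: (le_trans (small t _)); first by rewrite t0 /t ge_min lexx.
rewrite lee_fin (@le_trans _ _ ((C + 1) * t))//.
  by rewrite ler_wpM2r ?(ltW t0)// lerDl.
by rewrite mulrC -ler_pdivlMr// /t ge_min lexx orbT.
Qed.

(** The density of [mu_s], extended by 0 into [Omega]: integrals against [mu_s] become Lebesgue
    integrals over the whole space, where Tonelli's theorem applies directly. *)
Definition wt (s p : R) (x : V) : R := \1_(~` Omega) x * mu_density s p Omega x.

Lemma wt_ge0 s p x : s < 1 -> 0 <= wt s p x.
Proof. by move=> s1; rewrite /wt !mulr_ge0 ?powR_ge0// subr_ge0 ltW. Qed.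

Lemma measurable_wt s p : measurable_fun setT (wt s p).
Proof.
apply: measurable_funM; first exact: measurable_indic.
exact: measurable_mu_density.
Qed.

Lemma wt_in s p x : Omega x -> wt s p x = 0.
Proof. by move=> Ox; rewrite /wt indicE memNset ?mul0r// => /(_ Ox). Qed.

Lemma wt_out s p x : ~ Omega x -> wt s p x = mu_density s p Omega x.
Proof. by move=> Ox; rewrite /wt indicE mem_set// mul1r. Qed.

Lemma wt_dist0 s p x : 0 < s -> d x = 0 -> wt s p x = 0.
Proof.
move=> s0 dx; rewrite /wt /mu_density dx powR0 ?oppr_eq0 ?gt_eqF//.
by rewrite mulr0 mul0r mulr0.
Qed.

Lemma wt_le s p x : 0 < s < 1 -> 1 <= p -> wt s p x <= (1 - s) * d x `^ (- s).
Proof.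
move=> /andP[s0 s1] p1.
have h : 0 <= (1 - s) * d x `^ (- s) by rewrite mulr_ge0 ?powR_ge0// subr_ge0 ltW.
have [Ox|Ox] := pselect (Omega x); first by rewrite wt_in.
rewrite wt_out// /mu_density ler_piMr// -opprD powRN invf_le1.
  rewrite -[leLHS](powRr0 (1 + d x)) ler_powR ?lerDl ?dist_ge0//.
  by rewrite addr_ge0// mulr_ge0// ?subr_ge0// ltW.
by rewrite powR_gt0// ltr_wpDr ?dist_ge0.
Qed.

(** On the ball of radius P the factor 1 - s cancels the constant of [ball_weight_unif]. Outside of
    it [d x] is comparable to |x| and at least 1, so the density decays at least like the power -(n
    + 1 + s_lo) of |x|, an integrable tail independent of s and p. *)
Lemma int_wt_unif (s_lo : R) : 0 < s_lo -> exists2 C : R, 0 < C &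
  forall s p, s_lo <= s < 1 -> 1 <= p -> (\int[leb]_x (wt s p x)%:E <= C%:E)%E.
Proof.
move=> slo0; have [D D1 [hD1 [hD2 hD3]]] := bounded_domain.
pose P := 4 * D; have P0 : 0 < P by rewrite mulr_gt0// (lt_le_trans ltr01).
have [C1 C10 hC1] := ball_weight_unif P.
pose C2 := 2 `^ (n.+1%:R + s_lo) * (om * 2 `^ (n.+1%:R + s_lo) * (2 * (1 + s_lo) / s_lo) * P `^ (- s_lo)).
have C20 : 0 <= C2.
  by rewrite !mulr_ge0 ?powR_ge0 ?invr_ge0 ?addr_ge0 ?(ltW slo0) ?(ltW om0).
have P1 : 1 <= P by rewrite /P; lra.
exists (C1 * P `^ n.+1%:R + C2); first by rewrite ltr_wpDr// mulr_gt0// powR_gt0.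
move=> s p /andP[slo s1] p1.
have s0 : 0 < s by exact: lt_le_trans slo.
have s01 : 0 < s < 1 by rewrite s0.
have s1' : 0 < 1 - s by rewrite subr_gt0.
pose f1 (x : V) := (enorm (x - 0) < P)%R%:R * d x `^ (- s).
pose f2 (x : V) := (P <= enorm (x - 0))%R%:R * enorm (x - 0) `^ (- (n.+1%:R + s_lo)).
have f10 x : 0 <= f1 x by rewrite mulr_ge0 ?powR_ge0.
have f20 x : 0 <= f2 x by rewrite mulr_ge0 ?powR_ge0.
have mf1 : measurable_fun setT f1 by rewrite /f1; meas.
have mf2 : measurable_fun setT f2 by rewrite /f2; meas.
apply: (@le_trans _ _ (\int[leb]_x ((1 - s)%:E * (f1 x)%:E +
    (2 `^ (n.+1%:R + s_lo))%:E * (f2 x)%:E))%E).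
  apply: le_int => x; first by rewrite lee_fin wt_ge0.
  rewrite -!EFinM -EFinD lee_fin /f1 /f2 subr0.
  have [xP|Px] := ltP (enorm x) P.
    by rewrite mul1r mul0r mulr0 addr0 wt_le.
  rewrite mul0r mulr0 add0r mul1r.
  have x0 : 0 < enorm x by exact: lt_le_trans Px.
  have dx : enorm x <= 2 * d x.
    have : enorm x - D <= d x.
      apply: (dist_ge bd0) => z bz.
      have := enormD (x - z) z; rewrite subrK; have := hD3 z bz; lra.
    move: Px; rewrite /P; lra.
  have dx1 : 1 <= d x by move: Px dx; rewrite /P; lra.
  have Ox : ~ Omega x by move=> /hD1; move: Px; rewrite /P; lra.
  have dx0 : 0 < d x by exact: lt_le_trans dx1.
  rewrite wt_out// /mu_density.
  apply: (@le_trans _ _ (d x `^ (- (n.+1%:R + s_lo)))).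
    have e1 : (1 + d x) `^ (- n.+1%:R - s * (p - 1)) <= d x `^ (- n.+1%:R).
      rewrite -opprD !powRN lef_pV2 ?posrE ?powR_gt0 ?addr_gt0//.
      apply: (@le_trans _ _ ((1 + d x) `^ n.+1%:R)).
        by apply: ge0_ler_powR; rewrite ?nnegrE ?addr_ge0 ?(ltW dx0) ?lerDr.
      by rewrite ler_powR ?lerDl ?(ltW dx0)// mulr_ge0 ?(ltW s0)// subr_ge0.
    have e2 : d x `^ (- s) <= d x `^ (- s_lo) by rewrite ler_powR// lerN2.
    rewrite [leRHS](_ : _ = d x `^ (- s_lo) * d x `^ (- n.+1%:R)); last first.
      by rewrite -powR_add//; congr (_ `^ _); ring.
    rewrite ler_pM//; [by pos|by pos|].
    by rewrite -[leRHS]mul1r ler_pM ?powR_ge0 ?(ltW s1')// gerBl ltW.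
  have h0 : 0 <= n.+1%:R + s_lo by rewrite addr_ge0// ltW.
  rewrite -[X in 2 `^ X](ger0_norm h0) -[X in 2 `^ X]normrN.
  apply: powR_comparable => //.
  have : d x <= enorm x + D.
    have [z bz] := bd0; have := dist_le bd0 x bz; have := enormB x z; have := hD3 z bz; lra.
  move: Px; rewrite /P; lra.
rewrite ge0_integralD//; last 4 first.
- by move=> x _; rewrite -EFinM lee_fin mulr_ge0 ?(ltW s1').
- by apply/measurable_EFinP; apply: measurable_funM.
- by move=> x _; rewrite -EFinM lee_fin mulr_ge0 ?powR_ge0.
- by apply/measurable_EFinP; apply: measurable_funM.
rewrite !intZl ?powR_ge0 ?(ltW s1')//; last 2 first.
- exact/measurable_EFinP.
- exact/measurable_EFinP.
rewrite [in leRHS]EFinD leeD//.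
  have a0 : (0 <= (1 - s)%:E)%E by rewrite lee_fin ltW.
  have := hC1 s P 0 s01; rewrite P0 lexx => /(_ isT) h.
  apply: le_trans (lee_wpmul2l a0 h) _.
  rewrite -EFinM lee_fin mulrC divfK ?gt_eqF// ler_wpM2l ?(ltW C10)//.
  by rewrite ler_powR// gerBl ltW.
have a0 : (0 <= (2 `^ (n.+1%:R + s_lo) : R)%:E)%E by rewrite lee_fin powR_ge0.
apply: le_trans (lee_wpmul2l a0 (int_radial_large 0 slo0 P0)) _.
by rewrite -EFinM lee_fin.
Qed.

End domain_facts.

(** * Tonelli's theorem for three and four variables *)

Section swap.
Context d1 d2 d3 d4 (X : measurableType d1) (Y : measurableType d2)
  (Z : measurableType d3) (W : measurableType d4) (R : realType).
Variables (mx : {sigma_finite_measure set X -> \bar R})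
  (my : {sigma_finite_measure set Y -> \bar R})
  (mz : {sigma_finite_measure set Z -> \bar R})
  (mw : {sigma_finite_measure set W -> \bar R}).
Local Open Scope ereal_scope.

Lemma tonelli3 (f : X -> Y -> Z -> \bar R) :
  measurable_fun setT (fun t : (X * Y) * Z => f t.1.1 t.1.2 t.2) ->
  (forall x y z, 0 <= f x y z) ->
  \int[mx]_x \int[my]_y \int[mz]_z f x y z =
  \int[my]_y \int[mz]_z \int[mx]_x f x y z.
Proof.
move=> mf f0.
rewrite (@tonelli _ _ _ _ _ mx my (fun x y => \int[mz]_z f x y z)); last 2 first.
- exact: (@measurable_int _ _ _ _ _ mz (fun (t : X * Y) z => f t.1 t.2 z)).
- by move=> x y; apply: integral_ge0.
apply: eq_integral => y _; apply: tonelli => //.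
have mp : measurable_fun setT (fun t : X * Z => ((t.1, y), t.2)).
  apply: measurable_fun_pair; last exact: measurable_snd.
  by apply: measurable_fun_pair => //; exact: measurable_fst.
exact: (measurableT_comp mf mp).
Qed.

Lemma tonelli4 (f : X -> Y -> Z -> W -> \bar R) :
  measurable_fun setT (fun t : ((X * Y) * Z) * W => f t.1.1.1 t.1.1.2 t.1.2 t.2) ->
  (forall x y z w, 0 <= f x y z w) ->
  \int[mx]_x \int[my]_y \int[mz]_z \int[mw]_w f x y z w =
  \int[mz]_z \int[mw]_w \int[mx]_x \int[my]_y f x y z w.
Proof.
move=> mf f0.
transitivity (\int[mx]_x \int[mz]_z \int[my]_y \int[mw]_w f x y z w).
  apply: eq_integral => x _.
  apply: (@tonelli _ _ _ _ _ my mz (fun y z => \int[mw]_w f x y z w)); last first.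
    by move=> y z; apply: integral_ge0.
  apply: (@measurable_int _ _ _ _ _ mw (fun (t : Y * Z) w => f x t.1 t.2 w)) => //.
  have mp : measurable_fun setT (fun t : (Y * Z) * W => (((x, t.1.1), t.1.2), t.2)).
    apply: measurable_fun_pair; last exact: measurable_snd.
    by meas.
  exact: (measurableT_comp mf mp).
transitivity (\int[mz]_z \int[mx]_x \int[my]_y \int[mw]_w f x y z w).
  apply: (@tonelli _ _ _ _ _ mx mz (fun x z => \int[my]_y \int[mw]_w f x y z w)); last first.
    by move=> y z; apply: integral_ge0 => ? _; apply: integral_ge0.
  apply: (@measurable_int _ _ _ _ _ my (fun (t : X * Z) y => \int[mw]_w f t.1 y t.2 w)) => //; last first.
    by move=> y z; apply: integral_ge0.
  apply: (@measurable_int _ _ _ _ _ mw (fun (t : (X * Z) * Y) w => f t.1.1 t.2 t.1.2 w)) => //.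
  have mp : measurable_fun setT (fun t : ((X * Z) * Y) * W => (((t.1.1.1, t.1.2), t.1.1.2), t.2)).
    by meas.
  exact: (measurableT_comp mf mp).
apply: eq_integral => z _.
transitivity (\int[mx]_x \int[mw]_w \int[my]_y f x y z w).
  apply: eq_integral => x _; apply: tonelli => //.
  have mp : measurable_fun setT (fun t : Y * W => (((x, t.1), z), t.2)).
    by meas.
  exact: (measurableT_comp mf mp).
apply: (@tonelli _ _ _ _ _ mx mw (fun x w => \int[my]_y f x y z w)); last first.
  by move=> x w; apply: integral_ge0.
apply: (@measurable_int _ _ _ _ _ my (fun (t : X * W) y => f t.1 y z t.2)) => //.
have mp : measurable_fun setT (fun t : (X * W) * Y => (((t.1.1, t.2), z), t.1.2)).
  by meas.
exact: (measurableT_comp mf mp).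
Qed.

End swap.

Lemma powR_add_le {R : realType} (a b p : R) : 0 <= a -> 0 <= b -> 1 <= p ->
  (a + b) `^ p <= 2 `^ p * (a `^ p + b `^ p).
Proof.
move=> a0 b0 p1; have p0 : 0 <= p by lra.
wlog ab : a b a0 b0 / a <= b.
  move=> h; have [ab|/ltW ba] := leP a b; first exact: h.
  by rewrite addrC [X in _ * X]addrC h.
apply: (@le_trans _ _ ((2 * b) `^ p)).
  by apply: ge0_ler_powR; rewrite ?nnegrE ?addr_ge0 ?mulr_ge0//; lra.
by rewrite powRM// ler_wpM2l ?powR_ge0// lerDr powR_ge0.
Qed.

(** * Weighted means *)

Section weighted_mean.
Context d (T : measurableType d) (R : realType).
Variable mu : {measure set T -> \bar R}.
Local Open Scope ereal_scope.

(** From |g| <= 1 + |g|^p and the finiteness of the mass. *)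
Lemma integrable_weight (k g : T -> R) (p : R) : (1 <= p)%R ->
  measurable_fun setT k -> measurable_fun setT g -> (forall x, 0 <= k x)%R ->
  \int[mu]_x (k x)%:E < +oo -> \int[mu]_x (k x * `|g x| `^ p)%:E < +oo ->
  mu.-integrable setT (fun x => (k x * g x)%:E).
Proof.
move=> p1 mk mg k0 kfin kgfin; apply/integrableP; split; first by meas.
apply: (@le_lt_trans _ _ (\int[mu]_x ((k x)%:E + (k x * `|g x| `^ p)%:E))).
  apply: le_int => x; first exact: abse_ge0.
  rewrite abse_EFin -EFinD lee_fin normrM ger0_norm// -{2}[k x]mulr1 -mulrDr.
  rewrite ler_wpM2l//; have := poweR_ge1 p1 (normr_ge0 (g x) : (0 <= `|g x|%:E)).
  by rewrite poweR_EFin -EFinD lee_fin.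
rewrite ge0_integralD//; last 4 first.
- by move=> x _; pos.
- by meas.
- by move=> x _; pos.
- by meas.
by rewrite lte_add_pinfty.
Qed.

Lemma integrable_ge0_fin (k : T -> R) : measurable_fun setT k ->
  (forall x, 0 <= k x)%R -> \int[mu]_x (k x)%:E < +oo ->
  mu.-integrable setT (fun x => (k x)%:E).
Proof.
move=> mk k0 kfin; apply/integrableP; split; first by meas.
by under eq_integral do rewrite abse_EFin ger0_norm//.
Qed.

(** Since [k] has mass 1, the constant [c] moves under the integral. [fine] loses nothing, because
    the p-th moment makes the integral finite. *)
Lemma jensen_mean (k g : T -> R) (p c : R) : (1 < p)%R ->
  measurable_fun setT k -> measurable_fun setT g -> (forall x, 0 <= k x)%R ->
  \int[mu]_x (k x)%:E = 1 -> \int[mu]_x (k x * `|g x| `^ p)%:E < +oo ->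
  (`|fine (\int[mu]_x (k x * g x)%:E) - c| `^ p)%:E <=
  \int[mu]_x (k x * `|g x - c| `^ p)%:E.
Proof.
move=> p1 mk mg k0 k1 kgfin.
have kfin : \int[mu]_x (k x)%:E < +oo by rewrite k1 ltry.
have ik := integrable_ge0_fin mk k0 kfin.
have ikg := integrable_weight (ltW p1) mk mg k0 kfin kgfin.
have fkg : \int[mu]_x (k x * g x)%:E \is a fin_num by exact: integrable_fin_num.
have E1 : (fine (\int[mu]_x (k x * g x)%:E) - c)%:E = \int[mu]_x (k x * (g x - c))%:E.
  rewrite EFinB fineK//.
  transitivity (\int[mu]_x (k x * g x)%:E - \int[mu]_x (c%:E * (k x)%:E)).
    by rewrite integralZl// k1 mule1.
  rewrite -integralB//; last exact: integrableZl.
  by apply: eq_integral => x _; rewrite -EFinM -EFinB mulrBr (mulrC c).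
have := @jensen_powR _ _ _ mu k (fun x => `|g x - c|)%R 1 p p1 ler01 mk.
rewrite powR1 mul1e => h; apply: le_trans (h _ k0 _ _) => //.
- rewrite -poweR_EFin; apply: gt0_ler_poweR; rewrite ?in_itv/= ?leey ?andbT ?lee_fin//.
  + by lra.
  + by rewrite integral_ge0// => x _; pos.
  + rewrite -abse_EFin E1; apply: le_trans (le_abse_integral _ _ _) _ => //; first by meas.
    apply: le_int => x; first exact: abse_ge0.
    by rewrite abse_EFin normrM ger0_norm.
- by meas.
- by rewrite k1.
Qed.

(* Subtracting the mean with weight [k2] kills the [k2]-term of the difference. *)
Lemma mean_diff (k1 k2 g : T -> R) (N1 N2 E1 E2 p : R) : (1 < p)%R ->
  measurable_fun setT k1 -> measurable_fun setT k2 -> measurable_fun setT g ->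
  (forall x, 0 <= k1 x)%R -> (forall x, 0 <= k2 x)%R -> (0 < N1)%R -> (0 < N2)%R ->
  \int[mu]_x (k1 x)%:E = N1%:E -> \int[mu]_x (k2 x)%:E = N2%:E ->
  \int[mu]_x (k1 x * `|g x| `^ p)%:E < +oo -> \int[mu]_x (k2 x * `|g x| `^ p)%:E < +oo ->
  E1 = (fine (\int[mu]_x (k1 x * g x)%:E) / N1)%R ->
  E2 = (fine (\int[mu]_x (k2 x * g x)%:E) / N2)%R ->
  (N1 * `|E1 - E2|)%:E <= \int[mu]_x (`|k1 x - k2 x| * `|g x - E2|)%:E.
Proof.
move=> p1 mk1 mk2 mg k10 k20 N10 N20 i1 i2 g1 g2 E1E E2E.
have f1 : \int[mu]_x (k1 x)%:E < +oo by rewrite i1 ltry.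
have f2 : \int[mu]_x (k2 x)%:E < +oo by rewrite i2 ltry.
have ik1 := integrable_ge0_fin mk1 k10 f1.
have ik2 := integrable_ge0_fin mk2 k20 f2.
have ig1 := integrable_weight (ltW p1) mk1 mg k10 f1 g1.
have ig2 := integrable_weight (ltW p1) mk2 mg k20 f2 g2.
have e1 : \int[mu]_x (k1 x * g x)%:E = (N1 * E1)%:E.
  by rewrite E1E mulrC divfK ?gt_eqF// fineK//; exact: integrable_fin_num.
have e2 : \int[mu]_x (k2 x * g x)%:E = (N2 * E2)%:E.
  by rewrite E2E mulrC divfK ?gt_eqF// fineK//; exact: integrable_fin_num.
have key (k : T -> R) N E : mu.-integrable setT (fun x => (k x)%:E) ->
    mu.-integrable setT (fun x => (k x * g x)%:E) ->
    \int[mu]_x (k x)%:E = N%:E -> \int[mu]_x (k x * g x)%:E = (N * E)%:E ->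
    mu.-integrable setT (fun x => (k x * (g x - E2))%:E) /\
    \int[mu]_x (k x * (g x - E2))%:E = (N * E - E2 * N)%:E.
  move=> ik ig hN hE.
  have H x : (k x * (g x - E2))%:E = (k x * g x)%:E - E2%:E * (k x)%:E.
    by rewrite -EFinM -EFinB mulrBr (mulrC E2).
  split.
    rewrite (_ : (fun x => _) = (fun x => (k x * g x)%:E) \- (fun x => E2%:E * (k x)%:E)).
      by apply: integrableB => //; exact: integrableZl.
    by apply/funext => x; rewrite H.
  under eq_integral do rewrite H.
  rewrite integralB//; last exact: integrableZl.
  by rewrite integralZl// hN hE -EFinM -EFinB.
have [j1 h1] := key _ _ _ ik1 ig1 i1 e1.
have [j2 h2] := key _ _ _ ik2 ig2 i2 e2.
have -> : (N1 * `|E1 - E2|)%:E =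
    `| \int[mu]_x ((k1 x * (g x - E2))%:E - (k2 x * (g x - E2))%:E) |.
  rewrite integralB// h1 h2 -EFinB abse_EFin; congr EFin.
  rewrite -[in LHS](gtr0_norm N10) -normrM; congr (`|_|)%R; ring.
apply: le_trans (le_abse_integral _ _ _) _ => //.
  by apply: emeasurable_funB; meas.
apply: le_int => x; first exact: abse_ge0.
by rewrite -EFinB abse_EFin -mulrBl normrM.
Qed.

End weighted_mean.

(** This lemma and the next three isolate the chains of triangle inequalities as linear arithmetic.
    In the next three, X and in [far_arith] also Y are points of [Omega], the other letters are
    outer points; dX is a boundary distance and XZ a mutual distance. *)
Lemma center_arith {R : realType} (a b c e t : R) :
  b <= c + e -> e < 2 * a -> c < t -> t <= a -> a <= 4 * a - b.
Proof. by move=> *; lra. Qed.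

Lemma cross_arith {R : realType} (dX dY dZ XZ XY ZY : R) : XZ < 4 * dX -> ZY <= XZ + XY ->
  dX <= XZ -> dZ <= XZ -> dX <= XY -> dY <= XY -> ZY + dZ + dY + XZ <= 14 * XY.
Proof. by move=> *; lra. Qed.

Lemma far_arith {R : realType} (dX dY dZ dW XY XZ YW ZW XW : R) :
  0 < XY -> dX <= 2 * XY -> XZ < 4 * dX ->
  YW < 4 * dY -> dZ <= XZ -> dW <= YW -> dY <= XY + dX -> ZW <= XZ + XW -> XW <= XY + YW ->
  ZW + dZ + dW + XZ <= 53 * XY /\ ZW + dZ + dW + YW <= 53 * XY.
Proof. by move=> *; split; lra. Qed.

Lemma near_arith {R : realType} (dX dZ dW XZ XW ZW : R) : XZ < 8 * dX -> XW < 8 * dX ->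
  dZ <= XZ -> dW <= XW -> ZW <= XZ + XW -> ZW + dZ + dW + XZ <= 40 * dX.
Proof. by move=> *; lra. Qed.

Lemma exponent_ranges {R : realType} (n : nat) (s_lo p_lo p_hi s p : R) :
  0 < s_lo < 1 -> 1 < p_lo -> s_lo <= s < 1 -> p_lo <= p <= p_hi ->
  [/\ 0 < s, 0 <= n.+1%:R - s, n.+1%:R - s <= n.+1%:R + p_hi + 1 & 0 <= s * p <= p_hi].
Proof.
move=> /andP[slo0 _] plo1 /andP[slo s1] /andP[plo phi].
have s0 := lt_le_trans slo0 slo; have p0 := lt_trans ltr01 (lt_le_trans plo1 plo).
have n1 : 1 <= n.+1%:R :> R by rewrite ler1n.
split => //; [lra|lra|apply/andP; split; first by rewrite mulr_ge0// ltW].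
by rewrite (le_trans _ phi)// ler_piMl// ltW.
Qed.

(** * The extension kernel and its integrals *)

Section extension_kernel.
Context {R : realType} {n : nat} (Omega : set 'rV[R]_n.+1).
Local Notation V := 'rV[R]_n.+1.
Local Notation d := (dist_bd Omega).
Local Notation leb := (@lebesgue_rV R n.+1).
Local Notation om := (@vball R n).
Local Notation wt := (wt Omega).

(** A Lipschitz bump. The radius 4 d x leaves room for a boundary point at distance less than 2 d x
    together with the ball of radius d x about it, on which the bump is still at least d x. *)
Definition kfun (x z : V) : R := Num.max 0 (4 * d x - enorm (z - x)).
Definition kden (s p : R) (x : V) : R :=
  fine (\int[leb]_z (kfun x z * wt s p z)%:E)%E.
Definition kker (s p : R) (x z : V) : R := kfun x z * wt s p z / kden s p x.

Definition rho (z w : V) : R := enorm (z - w) + d z + d w.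

(** The mass is taken over the radius 8 d x because, for 2 |x - y| < d x, that ball also contains
    the ball of radius 4 d y about y: a single ball serves both points of a near pair. *)
Record kernel_facts (A s p : R) (x : V) : Prop := KernelFacts {
  kf_den : (\int[leb]_z (kfun x z * wt s p z)%:E = (kden s p x)%:E)%E;
  kf_den_gt0 : 0 < kden s p x;
  kf_den_inv : (kden s p x)^-1 <= A * d x `^ (s - n.+1%:R - 1);
  kf_ker : forall z, kker s p x z <=
    A * (d x `^ (s - n.+1%:R) * ((enorm (z - x) < 4 * d x)%R%:R * wt s p z));
  kf_mass : (\int[leb]_z ((enorm (z - x) < 8 * d x)%R%:R * wt s p z)%:E <=
    (A * d x `^ (n.+1%:R - s))%:E)%E }.

Lemma negpow_le (a b L e : R) : 0 < a -> 0 < b -> 0 < L -> 0 <= e -> a <= L * b ->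
  b `^ (- e) <= L `^ e * a `^ (- e).
Proof.
move=> a0 b0 L0 e0 ab; rewrite !powRN ler_pdivlMr ?powR_gt0//.
rewrite mulrC ler_pdivrMr ?powR_gt0// -powRM ?(ltW L0) ?(ltW b0)//.
by apply: ge0_ler_powR; rewrite ?nnegrE ?mulr_ge0//; exact: ltW.
Qed.

Hypotheses (Olip : lipschitz_domain Omega) (Obnd : bounded_set Omega).
Let oO : open Omega. Proof. by have [] := Olip. Qed.
Let bd0 : boundary Omega !=set0. Proof. by have [] := Olip. Qed.
Let mO : measurable Omega := open_measurable_rV oO.
Let mcO : measurable (~` Omega) := measurableC mO.
Let om0 := @vball_gt0 R n.

Variables (s_lo p_lo p_hi : R).
Hypotheses (slo01 : 0 < s_lo < 1) (plo1 : 1 < p_lo) (plohi : p_lo <= p_hi).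

Lemma kfun_ge0 x z : 0 <= kfun x z. Proof. by rewrite /kfun le_max lexx. Qed.

Lemma kfun_le x z : Omega x ->
  kfun x z <= 4 * d x * (enorm (z - x) < 4 * d x)%R%:R.
Proof.
move=> Ox; have dx := dist_gt0 oO bd0 Ox.
have e0 := enorm_ge0 (z - x).
rewrite /kfun; case: ltP => h; last by rewrite mulr0 ge_max lexx; lra.
by rewrite mulr1 ge_max; apply/andP; split; lra.
Qed.

(** The upper bounds come from [ball_weight_unif] at radius 8 d x. For the lower bound on [kden],
    the bump is at least d x near a boundary point, where [outer_ball_weight_unif] measures the
    outer part. In both the factor 1 - s of the density cancels 1 / (1 - s). *)
Lemma exists_kernel_facts : exists2 A : R, 0 < A &
  forall s p x, s_lo <= s < 1 -> p_lo <= p <= p_hi -> Omega x ->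
  kernel_facts A s p x.
Proof.
have /andP[slo0 slo1] := slo01; have plo1' := plo1; have plohi' := plohi.
have [D D1 [hD1 [hD2 hD3]]] := bounded_domain Olip Obnd.
have D0 : 0 < D by lra.
have [C C0 hC] := ball_weight_unif Olip Obnd (8 * D).
have [r [c [r0 c0 hc]]] := outer_ball_weight_unif Olip Obnd.
(* Since d x <= D, the radius kap d x stays in the range r in which the lower bound on the weight is
   available. *)
pose kap := Num.min 1 (r / D).
have kap0 : 0 < kap by rewrite /kap lt_min ltr01 divr_gt0.
have kap1 : kap <= 1 by rewrite /kap ge_min lexx.
have kapr : kap * D <= r by rewrite -ler_pdivlMr// /kap ge_min lexx orbT.
pose c1 := (1 + r) `^ (- (n.+1%:R + p_hi)) * c * kap ^+ n.+1.
have c10 : 0 < c1 by rewrite /c1; pos.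
pose C1 := C * 8 ^+ n.+1.
have C10 : 0 < C1 by rewrite /C1; pos.
exists (C1 + 4 / c1); first by pos.
move=> s p x /andP[slo s1] /andP[plo phi] Ox.
have s0 : 0 < s by lra. have p1 : 1 < p by lra.
have s01 : 0 < s < 1 by rewrite s0.
have s1' : 0 < 1 - s by lra.
have dx := dist_gt0 oO bd0 Ox.
have dxD := hD2 x Ox.
have ns0 : 0 <= n.+1%:R - s by have n1 : 1 <= n.+1%:R :> R := etrans (ler1n _ _) (ltn0Sn n); lra.
have mw := measurable_wt Olip s p.
have w0 z : 0 <= wt s p z by exact: wt_ge0.
have mk : measurable_fun setT (fun z => kfun x z) by rewrite /kfun; meas.
have k0 := kfun_ge0 x.
have mass : (\int[leb]_z ((enorm (z - x) < 8 * d x)%R%:R * wt s p z)%:E <=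
    (C1 * d x `^ (n.+1%:R - s))%:E)%E.
  apply: (@le_trans _ _ (\int[leb]_z ((1 - s)%:E *
      ((enorm (z - x) < 8 * d x)%R%:R * d z `^ (- s))%:E))%E).
    apply: le_int => z; first by pos.
    rewrite -EFinM lee_fin [leRHS]mulrCA ler_wpM2l//.
    by apply: wt_le => //; lra.
  rewrite intZl ?(ltW s1')//; last 2 first.
  - by meas.
  - by move=> z; pos.
  have := hC s (8 * d x) x s01; rewrite mulr_gt0//= ler_pM2l// dxD => /(_ isT) h.
  have a0 : (0 <= (1 - s)%:E)%E by rewrite lee_fin ltW.
  apply: le_trans (lee_wpmul2l a0 h) _.
  rewrite -EFinM lee_fin mulrC divfK ?gt_eqF// /C1 -mulrA ler_wpM2l ?(ltW C0)//.
  rewrite powRM ?(ltW dx)// ler_wpM2r ?powR_ge0//.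
  rewrite -powR_mulrn// ler_powR ?ler1n// gerBl; exact: ltW.
have den_fin : (\int[leb]_z (kfun x z * wt s p z)%:E)%E \is a fin_num.
  rewrite ge0_fin_numE; last by pos.
  apply: (@le_lt_trans _ _ (\int[leb]_z ((4 * d x)%:E *
      ((enorm (z - x) < 8 * d x)%R%:R * wt s p z)%:E))%E).
    apply: le_int => z; first by rewrite lee_fin mulr_ge0.
    rewrite -EFinM lee_fin [leRHS]mulrA ler_wpM2r//.
    apply: le_trans (kfun_le z Ox) _; rewrite ler_wpM2l//; first by pos.
    case: (boolP (enorm (z - x) < 4 * d x)) => // h.
    rewrite (_ : enorm (z - x) < 8 * d x)//; lra.
  rewrite intZl; last 3 first.
  - by pos.
  - by meas.
  - by move=> z; pos.
  rewrite lte_mul_pinfty ?lee_fin//; first by pos.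
  by apply: le_lt_trans mass _; rewrite ltry.
have den : (\int[leb]_z (kfun x z * wt s p z)%:E = (kden s p x)%:E)%E.
  by rewrite /kden fineK.
have low : c1 * d x `^ (n.+1%:R - s + 1) <= kden s p x.
  have [z0 bz0 xz0] : exists2 z, boundary Omega z & enorm (x - z) < 2 * d x.
    by apply: (dist_lt bd0); lra.
  pose tau := kap * d x.
  have tau0 : 0 < tau by rewrite /tau; pos.
  have taur : tau <= r.
    by apply: le_trans kapr; rewrite /tau ler_wpM2l// ltW.
  have taud : tau <= d x by rewrite /tau ler_piMl// ltW.
  have := hc s tau z0 bz0 s01; rewrite tau0 taur => /(_ isT) h.
  rewrite -lee_fin -den.
  pose B := d x * ((1 - s) * (1 + r) `^ (- (n.+1%:R + p_hi))).
  have B0 : 0 <= B := mulr_ge0 (ltW dx) (mulr_ge0 (ltW s1') (powR_ge0 _ _)).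
  apply: (@le_trans _ _ (\int[leb]_z (B%:E *
      (outer_ball Omega z0 tau z * d z `^ (- s))%:E))%E); last first.
    apply: le_int => z.
      by rewrite /outer_ball; pos.
    rewrite -EFinM lee_fin /outer_ball indicE.
    have [Oz|Oz] := pselect (Omega z).
      rewrite memNset; last by move=> /(_ Oz).
      by rewrite !mul0r mulr0; pos.
    rewrite mem_set// mul1r.
    have [ztau|_] := ltP (enorm (z - z0)) tau; last by rewrite mul0r mulr0; pos.
    rewrite mul1r wt_out// /mu_density.
    have dz : d z <= r.
      by rewrite (le_trans (dist_le bd0 z bz0))// (le_trans (ltW ztau)).
    have kf : d x <= kfun x z.
      rewrite /kfun le_max; apply/orP; right.
      have tri := enorm_tri z0 z x; rewrite (enormBC z0 x) in tri.
      exact: center_arith tri xz0 ztau taud.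
    have dz0 := dist_ge0 bd0 z.
    have e1 : (1 + r) `^ (- (n.+1%:R + p_hi)) <= (1 + d z) `^ (- n.+1%:R - s * (p - 1)).
      rewrite -opprD; apply: (@le_trans _ _ ((1 + r) `^ (- (n.+1%:R + s * (p - 1))))).
        rewrite ler_powR//; first by rewrite lerDl ltW.
        rewrite lerN2 lerD2l; have : s * (p - 1) <= 1 * (p - 1).
          by apply: ler_wpM2r; [rewrite subr_ge0 ltW|exact: ltW].
        by rewrite mul1r => /le_trans; apply; rewrite (le_trans _ phi)// gerBl.
      have /(_ _ _ _ _ _)/le_trans -> // := @negpow_le (1 + d z) (1 + r) 1 (n.+1%:R + s * (p - 1)).
      - exact: ltr_pwDl ltr01 dz0.
      - exact: addr_gt0 ltr01 r0.
      - apply: addr_ge0 => //; apply: mulr_ge0 (ltW s0) _.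
        by rewrite subr_ge0 ltW.
      - by rewrite mul1r lerD2l.
      - by rewrite powR1 mul1r.
    rewrite /B (_ : d x * _ * _ = d x * ((1 - s) * d z `^ (- s) *
       (1 + r) `^ (- (n.+1%:R + p_hi)))); last by ring.
    have sd0 : 0 <= (1 - s) * d z `^ (- s) := mulr_ge0 (ltW s1') (powR_ge0 _ _).
    apply: (ler_pM (ltW dx) (mulr_ge0 sd0 (powR_ge0 _ _)) kf).
    exact: ler_wpM2l sd0 _ _ e1.
  rewrite intZl; last 3 first.
  - exact: B0.
  - by clear -mcO; rewrite /outer_ball; meas.
  - by clear; move=> z; rewrite /outer_ball; pos.
  have B0' : (0 <= B%:E)%E by pos.
  apply: le_trans (lee_wpmul2l B0' h).
  rewrite -EFinM lee_fin /B /c1 /tau powRM ?(ltW kap0) ?(ltW dx)//.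
  rewrite [X in c1 * X]powR_add// powRr1 ?(ltW dx)//.
  rewrite (_ : _ * (c * _ / (1 - s)) = (1 + r) `^ (- (n.+1%:R + p_hi)) * c *
    kap `^ (n.+1%:R - s) * (d x `^ (n.+1%:R - s) * d x)); last by field; rewrite gt_eqF.
  rewrite ler_wpM2r//; first by pos.
  rewrite ler_wpM2l//; first by pos.
  by rewrite -powR_mulrn ?(ltW kap0)// ger_powR ?kap0// gerBl ltW.
have low0 : 0 < c1 * d x `^ (n.+1%:R - s + 1) by pos.
have den0 : 0 < kden s p x by exact: lt_le_trans low.
have inv : (kden s p x)^-1 <= c1^-1 * d x `^ (s - n.+1%:R - 1).
  rewrite (_ : s - n.+1%:R - 1 = - (n.+1%:R - s + 1)); last by ring.
  by rewrite powRN -invfM lef_pV2.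
split => //.
- apply: le_trans inv _; rewrite ler_wpM2r ?powR_ge0//.
  rewrite -[leLHS]add0r; apply: lerD (ltW C10) _.
  by rewrite -[leLHS]mul1r ler_wpM2r ?ler1n// invr_ge0 ltW.
- move=> z; rewrite /kker mulrAC [leRHS]mulrA [leRHS]mulrA ler_wpM2r//.
  apply: (@le_trans _ _ (4 * d x * (enorm (z - x) < 4 * d x)%R%:R *
     (c1^-1 * d x `^ (s - n.+1%:R - 1)))).
    by rewrite ler_pM ?kfun_le// invr_ge0 ltW.
  have -> : d x `^ (s - n.+1%:R) = d x `^ (s - n.+1%:R - 1) * d x.
    by rewrite -[X in _ * X](powRr1 (ltW dx)) -powR_add// subrK.
  set P := d x `^ _; have P0 : 0 <= P by exact: powR_ge0.
  rewrite [leLHS](_ : _ = (4 / c1) * (P * d x * (enorm (z - x) < 4 * d x)%R%:R)); last by ring.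
  rewrite -[leRHS]mulrA; apply: ler_wpM2r; first by pos.
  by rewrite lerDr ltW.
- apply: le_trans mass _; rewrite lee_fin ler_wpM2r ?powR_ge0// lerDl.
  by pos.
Qed.

(** An upper bound for the exponents below, so that powers of fixed numbers can be replaced by
    constants independent of s and p. *)
Let Q : R := n.+1%:R + p_hi + 1.

(* The exponent [d + s (p - 2)] of the trace kernel stays away from 0. *)
Lemma trace_exponent_ge s p : s_lo <= s < 1 -> p_lo <= p <= p_hi ->
  Num.min 1 (p_lo - 1) <= n.+1%:R + s * (p - 2).
Proof.
move=> /andP[slo s1] /andP[plo phi]; have /andP[slo0 _] := slo01; have plo1' := plo1; have plohi' := plohi.
have n1 : 1 <= n.+1%:R :> R by rewrite ler1n.
have [p2|p2] := leP 2 p.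
  rewrite ge_min; apply/orP; left.
  have : 0 <= s * (p - 2) by rewrite mulr_ge0; lra.
  lra.
rewrite ge_min; apply/orP; right.
have : s * (2 - p) <= 1 * (2 - p) by rewrite ler_wpM2r; lra.
lra.
Qed.

(** A common lower bound for s and for the trace exponent multiplied by any c between 1 / 2 and 1:
    [kernel_far] uses half of that exponent, [kernel_near] all of it. *)
Let lo : R := Num.min s_lo (Num.min 1 (p_lo - 1) / 2).
Let lo_gt0 : 0 < lo.
Proof.
have /andP[slo0 _] := slo01; have plo1' := plo1; have plohi' := plohi.
by rewrite /lo lt_min slo0 divr_gt0// lt_min ltr01 subr_gt0.
Qed.

Let lo_s s : s_lo <= s < 1 -> lo <= s <= Q.
Proof.
have plo1' := plo1; have plohi' := plohi; move=> /andP[h1 h2]; rewrite /lo ge_min h1/= /Q.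
have n1 : 1 <= n.+1%:R :> R := etrans (ler1n _ _) (ltn0Sn n); lra.
Qed.

Let lo_e s p c : s_lo <= s < 1 -> p_lo <= p <= p_hi -> 2^-1 <= c <= 1 ->
  lo <= c * (n.+1%:R + s * (p - 2)) <= Q.
Proof.
move=> hs hp /andP[c1 c2]; have /andP[slo s1] := hs; have /andP[plo phi] := hp.
have e := trace_exponent_ge hs hp; have /andP[slo0 _] := slo01; have plo1' := plo1; have plohi' := plohi.
set E := n.+1%:R + _ in e *.
have m0 : 0 < Num.min 1 (p_lo - 1) by rewrite lt_min ltr01 subr_gt0.
have E0 : 0 < E by lra.
apply/andP; split.
  apply: (@le_trans _ _ (Num.min 1 (p_lo - 1) / 2)); first by rewrite /lo ge_min lexx orbT.
  by rewrite mulrC ler_pM//; lra.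
apply: (@le_trans _ _ E); first by rewrite ler_piMl// ltW.
rewrite /E /Q; have : s * (p - 2) <= p_hi.
  have [p2|p2] := leP 2 p.
    have : s * (p - 2) <= 1 * (p - 2) by rewrite ler_wpM2r; lra.
    lra.
  have : 0 <= s * (2 - p) by rewrite mulr_ge0; lra.
  lra.
lra.
Qed.

Let powQ (L e : R) : 1 <= L -> e <= Q -> L `^ e <= L `^ Q.
Proof. by move=> L1 eQ; exact: ler_powR. Qed.

(** As d x <= |x - z| < 8 d x, the power of d x becomes a radial power about z. Its integral over
    the ball of radius 8 D is of order 1 / s, hence bounded for s >= s_lo. *)
Lemma kernel_mass : exists2 C : R, 0 < C & forall s z, s_lo <= s < 1 -> ~ Omega z ->
  (\int[leb]_x (\1_Omega x * ((enorm (z - x) < 8 * d x)%R%:R * d x `^ (s - n.+1%:R)))%:E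
   <= C%:E)%E.
Proof.
have /andP[slo0 slo1] := slo01; have plo1' := plo1; have plohi' := plohi.
have [D D1 [hD1 [hD2 hD3]]] := bounded_domain Olip Obnd.
have D0 : 0 < D by lra.
pose C := om * 2 `^ n.+1%:R * (2 * (1 + 1) / s_lo) * (8 * D).
exists (8 `^ n.+1%:R * C); first by rewrite /C; pos.
move=> s z hs Oz; have /andP[slo s1] := hs.
have s0 : 0 < s by lra.
have ns0 : 0 <= n.+1%:R - s by have n1 : 1 <= n.+1%:R :> R := etrans (ler1n _ _) (ltn0Sn n); lra.
have D80 : 0 < 8 * D by pos.
apply: (@le_trans _ _ (\int[leb]_x ((8 `^ n.+1%:R)%:E *
   ((0 < enorm (x - z) < 8 * D)%R%:R * enorm (x - z) `^ (s - n.+1%:R))%:E))%E).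
  apply: le_int => x; first by pos.
  rewrite -EFinM lee_fin indicE; have [Ox|Ox] := pselect (Omega x); last first.
    by rewrite memNset// mul0r; pos.
  rewrite mem_set// mul1r (enormBC z x).
  have dx := dist_gt0 oO bd0 Ox.
  have dxz := dist_cross_in oO bd0 Ox Oz.
  have [h|_] := ltP (enorm (x - z)) (8 * d x); last by rewrite mul0r; pos.
  have xz0 : 0 < enorm (x - z) by lra.
  rewrite xz0 (_ : enorm (x - z) < 8 * D)/=; last by have := hD2 x Ox; lra.
  rewrite !mul1r -opprB.
  apply: le_trans (negpow_le (L := 8) xz0 dx _ ns0 (ltW h)) _ => //.
  by rewrite ler_wpM2r ?powR_ge0// ler_powR ?ler1n// gerBl ltW.
rewrite intZl ?powR_ge0//; last 2 first.
- by meas.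
- by move=> x; pos.
have a0 : (0 <= (8 `^ n.+1%:R : R)%:E)%E by pos.
apply: le_trans (lee_wpmul2l a0 (int_radial_small z s0 D80)) _.
rewrite -EFinM lee_fin ler_wpM2l ?powR_ge0// /C.
rewrite ger0_norm// ler_pM//; [by pos|by pos| |].
  rewrite ler_pM//; [by pos|by pos| |].
    by rewrite ler_wpM2l ?(ltW om0)// ler_powR ?ler1n// gerBl ltW.
  rewrite ler_pM//; [by pos|by pos|lra|].
  by rewrite lef_pV2 ?posrE.
rewrite -[leRHS](powRr1 (ltW D80)) ler_powR; lra.
Qed.

(** The factor 1 / (1 - s) cancels the one inside [wt s p y]. For d y <= 1, |x - y| dominates rho z
    y + |x - z| up to 14, and [int_radial_kernel] gives the power -b of rho with b = d + s (p - 1),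
    which splits into -s, bounded by d y to the power -s, and the trace kernel. For d y > 1, |x - y|
    >= d y leaves [kernel_mass], and the truncated minimum is 1. *)
Lemma kernel_cross : exists2 C : R, 0 < C & forall s p y z,
  s_lo <= s < 1 -> p_lo <= p <= p_hi -> ~ Omega y -> ~ Omega z -> 0 < d y ->
  (\int[leb]_x (\1_Omega x * ((enorm (z - x) < 4 * d x)%R%:R * d x `^ (s - n.+1%:R) *
      enorm (x - y) `^ (- (n.+1%:R + s * p))))%:E
   <= (C / (1 - s) * wt s p y * (Num.min (rho z y) 1) `^ (- (n.+1%:R + s * (p - 2))))%:E)%E.
Proof.
have /andP[slo0 slo1] := slo01; have plo1' := plo1; have plohi' := plohi.
have [C1 C10 hC1] := kernel_mass.
have [C2 C20 hC2] := @int_radial_kernel R n lo Q lo_gt0.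
exists (2 `^ Q * (C1 + 14 `^ Q * 4 `^ Q * C2)); first by pos.
move=> s p y z hs hp Oy Oz dy0; have /andP[slo s1] := hs; have /andP[plo phi] := hp.
have [s0 ns0 nsQ sp] := exponent_ranges n slo01 plo1 hs hp; have /andP[sp0 sphi] := sp.
have n1 : 1 <= n.+1%:R :> R by rewrite ler1n.
have spQ : n.+1%:R + s * p <= Q by rewrite /Q; lra.
pose b := n.+1%:R + s * (p - 1).
have bE : b = n.+1%:R + s * p - s by rewrite /b; ring.
have b0 : lo <= b <= Q.
  rewrite bE; apply/andP; split; last by rewrite /Q; lra.
  apply: (@le_trans _ _ s_lo); first by rewrite /lo ge_min lexx.
  have : 1 * s <= p * s by apply: ler_wpM2r; [exact: ltW|exact: ltW (lt_le_trans plo1' plo)].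
  by have := n1; have := slo; lra.
have /andP[lob bQ] := b0.
have b_ge0 : 0 <= b by have := lo_gt0; lra.
have rho0 : 0 < rho z y.
  by rewrite /rho ltr_wpDl// addr_ge0 ?enorm_ge0 ?dist_ge0.
have dyrho : d y <= rho z y by rewrite /rho lerDr addr_ge0 ?enorm_ge0 ?dist_ge0.
have e0 : 0 <= n.+1%:R + s * (p - 2).
  by apply: le_trans (trace_exponent_ge hs hp); rewrite ltW// lt_min ltr01 subr_gt0.
have m0 : 0 < Num.min (rho z y) 1 by rewrite lt_min rho0 ltr01.
have wtE : wt s p y = (1 - s) * (d y `^ (- s) * (1 + d y) `^ (- b)).
  by rewrite wt_out// /mu_density -opprD mulrA.
rewrite wtE.
have s1' : 0 < 1 - s by lra.
set Rt := Num.min _ _ `^ _.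
rewrite (_ : _ / (1 - s) * ((1 - s) * _) * Rt =
  (C1 + 14 `^ Q * 4 `^ Q * C2) * (2 `^ Q * (d y `^ (- s) * (1 + d y) `^ (- b) * Rt))); last first.
  by field; rewrite gt_eqF.
have [dy1|dy1] := leP (d y) 1.
  apply: (@le_trans _ _ (\int[leb]_x ((14 `^ Q * 4 `^ Q)%:E *
    ((0 < enorm (x - z))%R%:R * (enorm (x - z) `^ (s - n.+1%:R) *
      (rho z y + enorm (x - z)) `^ (- (s + b))))%:E))%E).
    apply: le_int => x; first by pos.
    rewrite -EFinM lee_fin indicE; have [Ox|Ox] := pselect (Omega x); last first.
      by rewrite memNset// mul0r; pos.
    rewrite mem_set// mul1r (enormBC z x).
    have dx := dist_gt0 oO bd0 Ox.
    have dxz := dist_cross_in oO bd0 Ox Oz.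
    have dxz' := dist_cross_out oO bd0 Ox Oz.
    have dxy := dist_cross_in oO bd0 Ox Oy.
    have dxy' := dist_cross_out oO bd0 Ox Oy.
    have [h|_] := ltP (enorm (x - z)) (4 * d x); last by rewrite !mul0r; pos.
    have xz0 : 0 < enorm (x - z) := lt_le_trans dx dxz.
    have xy0 : 0 < enorm (x - y) := lt_le_trans dx dxy.
    rewrite xz0 !mul1r -[s - n.+1%:R]opprB (_ : s + b = n.+1%:R + s * p); last by rewrite bE; ring.
    have tri := enorm_tri x z y; rewrite (enormBC z x) in tri.
    have T14 : rho z y + enorm (x - z) <= 14 * enorm (x - y).
      exact: cross_arith h tri dxz dxz' dxy dxy'.
    have T0 : 0 < rho z y + enorm (x - z) := addr_gt0 rho0 xz0.
    have q0 : 0 <= n.+1%:R + s * p := addr_ge0 (ler0n _ _) sp0.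
    have h1 := negpow_le (L := 4) xz0 dx (ltr0n _ 4) ns0 (ltW h).
    have h2 := negpow_le (L := 14) T0 xy0 (ltr0n _ 14) q0 T14.
    apply: le_trans (ler_pM (powR_ge0 _ _) (powR_ge0 _ _) h1 h2) _.
    rewrite [leLHS]mulrACA ler_wpM2r//; first by pos.
    by rewrite mulrC ler_pM ?powR_ge0//; apply: powQ => //; rewrite ler1n.
  rewrite intZl; last 3 first.
  - by pos.
  - by meas.
  - by move=> x; pos.
  have a0 : (0 <= (14 `^ Q * 4 `^ Q : R)%:E)%E by pos.
  apply: le_trans (lee_wpmul2l a0 (hC2 s b _ z (lo_s hs) b0 rho0)) _.
  rewrite -EFinM lee_fin mulrA.
  have key : rho z y `^ (- b) <= 2 `^ Q * (d y `^ (- s) * (1 + d y) `^ (- b) * Rt).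
    have -> : rho z y `^ (- b) = rho z y `^ (- s + - (n.+1%:R + s * (p - 2))).
      by congr powR; rewrite /b; ring.
    rewrite powR_add//.
    have h1 : rho z y `^ (- s) <= d y `^ (- s).
      by have := negpow_le (L := 1) dy0 rho0 ltr01 (ltW s0); rewrite powR1 !mul1r; exact.
    have h2 : rho z y `^ (- (n.+1%:R + s * (p - 2))) <= Rt.
      have := negpow_le (L := 1) m0 rho0 ltr01 e0; rewrite powR1 !mul1r; apply.
      by rewrite ge_min lexx.
    apply: le_trans (ler_pM (powR_ge0 _ _) (powR_ge0 _ _) h1 h2) _.
    have h3 : 1 <= 2 `^ Q * (1 + d y) `^ (- b).
      have : 2 `^ (- b) <= (1 + d y) `^ (- b).
        have := negpow_le (L := 1) (a := 1 + d y) (b := 2) _ (ltr0n _ 2) ltr01 b_ge0.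
        rewrite powR1 !mul1r; apply; [exact: addr_gt0 ltr01 dy0|by rewrite (natrD _ 1 1) lerD2l].
      move=> h; apply: (@le_trans _ _ (2 `^ Q * 2 `^ (- b))).
        rewrite -powR_add// -[leLHS](powRr0 2) ler_powR ?ler1n//.
        by rewrite subr_ge0.
      by rewrite ler_wpM2l ?powR_ge0.
    rewrite [leRHS](_ : _ = (2 `^ Q * (1 + d y) `^ (- b)) * (d y `^ (- s) * Rt)); last by ring.
    by rewrite ler_peMl// mulr_ge0 ?powR_ge0.
  apply: (@le_trans _ _ (14 `^ Q * 4 `^ Q * C2 * (2 `^ Q * (d y `^ (- s) * (1 + d y) `^ (- b) * Rt)))).
    rewrite -[leRHS]mulrA; apply: ler_wpM2l; first by pos.
    by rewrite ler_wpM2l// ltW.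
  rewrite -[leRHS]mulrA; apply: ler_wpM2r; first by rewrite /Rt; pos.
  by rewrite lerDr ltW.
have aux (a1 a2 a3 : R) : (true%:R * a1 * a2 <= a3 * (true%:R * a1)) = (a2 * a1 <= a3 * a1).
  by rewrite !mul1r mulrC.
apply: (@le_trans _ _ (\int[leb]_x ((d y `^ (- (n.+1%:R + s * p)))%:E *
  (\1_Omega x * ((enorm (z - x) < 8 * d x)%R%:R * d x `^ (s - n.+1%:R)))%:E))%E).
  apply: le_int => x; first by pos.
  rewrite -EFinM lee_fin indicE; have [Ox|Ox] := pselect (Omega x); last first.
    by rewrite memNset// mul0r; pos.
  rewrite mem_set// !mul1r.
  have dx := dist_gt0 oO bd0 Ox.
  have dxy' := dist_cross_out oO bd0 Ox Oy.
  have [h|_] := ltP (enorm (z - x)) (4 * d x); last first.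
    by rewrite !mul0r; exact: mulr_ge0 (powR_ge0 _ _) (mulr_ge0 (ler0n _ _) (powR_ge0 _ _)).
  rewrite (_ : enorm (z - x) < 8 * d x); last by apply: lt_trans h _; rewrite ltr_pM2r// ltr_nat.
  rewrite aux; apply: ler_wpM2r; first exact: powR_ge0.
  have q0 : 0 <= n.+1%:R + s * p := addr_ge0 (ler0n _ _) sp0.
  have := negpow_le (L := 1) dy0 _ ltr01 q0; rewrite powR1 mul1r; apply; last by rewrite mul1r.
  exact: lt_le_trans dxy'.
rewrite intZl ?powR_ge0//; last 2 first.
- by meas.
- by move=> x; pos.
have a0 : (0 <= (d y `^ (- (n.+1%:R + s * p)))%:E)%E by pos.
apply: le_trans (lee_wpmul2l a0 (hC1 s z hs Oz)) _.
rewrite -EFinM lee_fin mulrC.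
have Rt1 : 1 <= Rt.
  rewrite /Rt (_ : Num.min _ _ = 1) ?powR1//.
  by apply/min_idPr; exact: le_trans (ltW dy1) dyrho.
have key : d y `^ (- (n.+1%:R + s * p)) <= 2 `^ Q * (d y `^ (- s) * (1 + d y) `^ (- b) * Rt).
  have -> : - (n.+1%:R + s * p) = - s + - b by rewrite bE; ring.
  rewrite powR_add//.
  have y1 : 0 < 1 + d y := addr_gt0 ltr01 dy0.
  have h := negpow_le (L := 2) y1 dy0 (ltr0n _ 2) b_ge0.
  have {}h : d y `^ (- b) <= 2 `^ Q * (1 + d y) `^ (- b).
    apply: le_trans (h _) _; first by rewrite mulrDl mul1r lerD2r ltW.
    by rewrite ler_wpM2r ?powR_ge0// powQ ?ler1n.
  apply: (@le_trans _ _ (d y `^ (- s) * (2 `^ Q * (1 + d y) `^ (- b)))).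
    by rewrite ler_wpM2l ?powR_ge0.
  rewrite [leRHS](_ : _ = (d y `^ (- s) * (2 `^ Q * (1 + d y) `^ (- b))) * Rt); last by ring.
  by rewrite ler_peMr//; pos.
apply: (@le_trans _ _ (C1 * (2 `^ Q * (d y `^ (- s) * (1 + d y) `^ (- b) * Rt)))).
  by rewrite ler_wpM2l// ltW.
rewrite ler_wpM2r//; first by pos.
by rewrite lerDl; pos.
Qed.

(** The singular kernel is split into two equal halves |x - y|^(-q). One is dominated through rho z
    w + |x - z|, the other through rho z w + |y - w|, so the double integral factorises into two
    radial ones, each yielding half of the trace exponent. *)
Lemma kernel_far : exists2 C : R, 0 < C & forall s p z w,
  s_lo <= s < 1 -> p_lo <= p <= p_hi -> ~ Omega z -> ~ Omega w -> 0 < d z ->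
  (\int[leb]_x \int[leb]_y (\1_Omega x * \1_Omega y *
     ((d x <= 2 * enorm (x - y))%R%:R *
      ((enorm (z - x) < 4 * d x)%R%:R * d x `^ (s - n.+1%:R)) *
      ((enorm (w - y) < 4 * d y)%R%:R * d y `^ (s - n.+1%:R)) *
      enorm (x - y) `^ (- (n.+1%:R + s * p))))%:E
   <= (C * (Num.min (rho z w) 1) `^ (- (n.+1%:R + s * (p - 2))))%:E)%E.
Proof.
have /andP[slo0 slo1] := slo01; have plo1' := plo1; have plohi' := plohi.
have [C2 C20 hC2] := @int_radial_kernel R n lo Q lo_gt0.
pose K : R := 53 `^ Q * (4 `^ Q * 4 `^ Q).
have K0 : 0 < K by rewrite /K; pos.
exists (K * (C2 * C2)); first by pos.
move=> s p z w hs hp Oz Ow dz0; have /andP[slo s1] := hs; have /andP[plo phi] := hp.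
have [s0 ns0 nsQ /andP[sp0 sphi]] := exponent_ranges n slo01 plo1 hs hp.
have n1 : 1 <= n.+1%:R :> R by rewrite ler1n.
pose b := 2^-1 * (n.+1%:R + s * (p - 2)).
have b0 : lo <= b <= Q by apply: lo_e => //; lra.
have e0 : 0 <= n.+1%:R + s * (p - 2).
  by apply: le_trans (trace_exponent_ge hs hp); rewrite ltW// lt_min ltr01 subr_gt0.
have rho0 : 0 < rho z w.
  by rewrite /rho -addrA ltr_wpDl ?enorm_ge0// ltr_pwDl// dist_ge0.
have m0 : 0 < Num.min (rho z w) 1 by rewrite lt_min rho0 ltr01.
pose F (z' x : V) : R := (0 < enorm (x - z'))%R%:R * (enorm (x - z') `^ (s - n.+1%:R) *
      (rho z w + enorm (x - z')) `^ (- (s + b))).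
have F0 z' x : 0 <= F z' x by rewrite /F; pos.
have mF z' : measurable_fun setT (F z') by rewrite /F; meas.
pose q := (n.+1%:R + s * p) / 2.
have KB : 53 `^ q * 53 `^ q * (4 `^ (n.+1%:R - s) * 4 `^ (n.+1%:R - s)) <= K.
  have qQ : q + q <= Q by rewrite /q /Q; lra.
  have h53 : 53 `^ q * 53 `^ q <= 53 `^ Q.
    by rewrite -powR_add//; apply: powQ; rewrite ?ler1n.
  have h4 : 4 `^ (n.+1%:R - s) <= 4 `^ Q by apply: powQ; rewrite ?ler1n.
  apply: (ler_pM _ _ h53); [by pos|by pos|].
  by apply: (ler_pM _ _ h4 h4); pos.
have aux (a1 a2 a3 : R) : true%:R * (true%:R * a1) * (true%:R * a2) * a3 = a1 * a2 * a3.
  by rewrite !mul1r.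
have FE z' x : 0 < enorm (x - z') -> F z' x =
    enorm (x - z') `^ (- (n.+1%:R - s)) * (rho z w + enorm (x - z')) `^ (- q).
  move=> h; rewrite /F h mul1r; congr (_ `^ _ * _ `^ _); first by rewrite opprB.
  by rewrite /q /b; field.
apply: (@le_trans _ _ (\int[leb]_x \int[leb]_y ((K * F z x)%:E * (F w y)%:E))%E).
  apply: le_int => x; first by pos.
  apply: le_int => y; first by pos.
  rewrite -EFinM lee_fin !indicE.
  have [Ox|Ox] := pselect (Omega x); last by rewrite (memNset Ox) !mul0r; pos.
  have [Oy|Oy] := pselect (Omega y); last by rewrite (memNset Oy) mulr0 !mul0r; pos.
  rewrite !mem_set// !mul1r (enormBC z x) (enormBC w y).
  have [xy|_] := leP (d x) (2 * enorm (x - y)); last by rewrite !mul0r; pos.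
  have [xz|_] := ltP (enorm (x - z)) (4 * d x); last by rewrite !(mul0r, mulr0); pos.
  have [yw|_] := ltP (enorm (y - w)) (4 * d y); last by rewrite !(mul0r, mulr0); pos.
  have dx := dist_gt0 oO bd0 Ox; have dy := dist_gt0 oO bd0 Oy.
  have dxz := dist_cross_in oO bd0 Ox Oz.
  have dxz' := dist_cross_out oO bd0 Ox Oz.
  have dyw := dist_cross_in oO bd0 Oy Ow.
  have dyw' := dist_cross_out oO bd0 Oy Ow.
  have dyx := dist_lip bd0 y x; rewrite (enormBC y x) in dyx.
  have xz0 : 0 < enorm (x - z) := lt_le_trans dx dxz.
  have yw0 : 0 < enorm (y - w) := lt_le_trans dy dyw.
  have xy0 : 0 < enorm (x - y) by rewrite -(pmulr_rgt0 _ (ltr0n R 2)); exact: lt_le_trans dx xy.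
  have t1 := enorm_tri x z w; have t2 := enorm_tri y x w; rewrite (enormBC z x) in t1.
  have T1 : rho z w + enorm (x - z) <= 53 * enorm (x - y).
    by case: (far_arith xy0 xy xz yw dxz' dyw' dyx t1 t2).
  have T2 : rho z w + enorm (y - w) <= 53 * enorm (x - y).
    by case: (far_arith xy0 xy xz yw dxz' dyw' dyx t1 t2).
  have T10 : 0 < rho z w + enorm (x - z) := addr_gt0 rho0 xz0.
  have T20 : 0 < rho z w + enorm (y - w) := addr_gt0 rho0 yw0.
  rewrite (FE _ _ xz0) (FE _ _ yw0) -[s - n.+1%:R]opprB.
  rewrite aux.
  have q0 : 0 <= q := divr_ge0 (addr_ge0 (ler0n _ _) sp0) (ler0n _ 2).
  have -> : - (n.+1%:R + s * p) = - q + - q by rewrite /q; field.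
  rewrite (powR_add _ _ xy0).
  have g1 := negpow_le (L := 53) T10 xy0 (ltr0n _ 53) q0 T1.
  have g2 := negpow_le (L := 53) T20 xy0 (ltr0n _ 53) q0 T2.
  have g3 := negpow_le (L := 4) xz0 dx (ltr0n _ 4) ns0 (ltW xz).
  have g4 := negpow_le (L := 4) yw0 dy (ltr0n _ 4) ns0 (ltW yw).
  have g12 := ler_pM (powR_ge0 _ _) (powR_ge0 _ _) g1 g2.
  have g34 := ler_pM (powR_ge0 _ _) (powR_ge0 _ _) g3 g4.
  apply: le_trans (ler_pM (mulr_ge0 (powR_ge0 _ _) (powR_ge0 _ _))
    (mulr_ge0 (powR_ge0 _ _) (powR_ge0 _ _)) g34 g12) _.
  set X1 := enorm (x - z) `^ _; set X2 := enorm (y - w) `^ _.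
  set Y1 := (_ + enorm (x - z)) `^ _; set Y2 := (_ + enorm (y - w)) `^ _.
  rewrite [leLHS](_ : _ = ((53 `^ q * 53 `^ q) * (4 `^ (n.+1%:R - s) * 4 `^ (n.+1%:R - s))) *
    (X1 * Y1 * (X2 * Y2))); last by ring.
  rewrite [leRHS](_ : _ = K * (X1 * Y1 * (X2 * Y2))); last by ring.
  rewrite ler_wpM2r//; first by rewrite /X1 /X2 /Y1 /Y2; pos.
apply: (@le_trans _ _ (\int[leb]_x ((K * (C2 * rho z w `^ (- b)))%:E * (F z x)%:E))%E).
  apply: le_int => x; first by pos.
  rewrite intZl; last 3 first.
  - by pos.
  - by apply/measurable_EFinP; exact: mF.
  - by move=> y; rewrite lee_fin.
  have a0 : (0 <= (K * F z x)%:E)%E by pos.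
  apply: le_trans (lee_wpmul2l a0 (hC2 s b _ w (lo_s hs) b0 rho0)) _.
  by rewrite -!EFinM lee_fin le_eqVlt; apply/orP; left; apply/eqP; ring.
rewrite intZl; last 3 first.
- by pos.
- by apply/measurable_EFinP; exact: mF.
- by move=> y; rewrite lee_fin.
have a0 : (0 <= (K * (C2 * rho z w `^ (- b)))%:E)%E by pos.
apply: le_trans (lee_wpmul2l a0 (hC2 s b _ z (lo_s hs) b0 rho0)) _.
rewrite -!EFinM lee_fin.
rewrite [leLHS](_ : _ = K * (C2 * C2) * (rho z w `^ (- b) * rho z w `^ (- b))); last by ring.
rewrite ler_wpM2l//; first by pos.
rewrite -powR_add// (_ : - b + - b = - (n.+1%:R + s * (p - 2))); last by rewrite /b; field.
have := negpow_le (L := 1) m0 rho0 ltr01 e0; rewrite powR1 !mul1r; apply.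
by rewrite ge_min lexx.
Qed.

(** Here d x is comparable to |x - z| and dominates rho z w + |x - z| up to 40. One power d - s goes
    to |x - z|, the remaining s + b to the sum, with b the full trace exponent. *)
Lemma kernel_near : exists2 C : R, 0 < C & forall s p z w,
  s_lo <= s < 1 -> p_lo <= p <= p_hi -> ~ Omega z -> ~ Omega w -> 0 < d z ->
  (\int[leb]_x (\1_Omega x *
     ((enorm (z - x) < 8 * d x)%R%:R * (enorm (w - x) < 8 * d x)%R%:R *
       d x `^ (- (s * p + 2 * (n.+1%:R - s)))))%:E
   <= (C * (Num.min (rho z w) 1) `^ (- (n.+1%:R + s * (p - 2))))%:E)%E.
Proof.
have /andP[slo0 slo1] := slo01; have plo1' := plo1; have plohi' := plohi.
have [C2 C20 hC2] := @int_radial_kernel R n lo Q lo_gt0.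
pose K : R := 8 `^ Q * 40 `^ Q.
have K0 : 0 < K by rewrite /K; pos.
exists (K * C2); first by pos.
move=> s p z w hs hp Oz Ow dz0; have /andP[slo s1] := hs; have /andP[plo phi] := hp.
have [s0 ns0 nsQ /andP[sp0 sphi]] := exponent_ranges n slo01 plo1 hs hp.
have n1 : 1 <= n.+1%:R :> R by rewrite ler1n.
pose b := n.+1%:R + s * (p - 2).
have b0 : lo <= b <= Q by rewrite -[b]mul1r; apply: lo_e => //; lra.
have e0 : 0 <= n.+1%:R + s * (p - 2).
  by apply: le_trans (trace_exponent_ge hs hp); rewrite ltW// lt_min ltr01 subr_gt0.
have rho0 : 0 < rho z w.
  by rewrite /rho -addrA ltr_wpDl ?enorm_ge0// ltr_pwDl// dist_ge0.
have m0 : 0 < Num.min (rho z w) 1 by rewrite lt_min rho0 ltr01.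
apply: (@le_trans _ _ (\int[leb]_x (K%:E *
    ((0 < enorm (x - z))%R%:R * (enorm (x - z) `^ (s - n.+1%:R) *
      (rho z w + enorm (x - z)) `^ (- (s + b))))%:E))%E).
  apply: le_int => x; first by pos.
  rewrite -EFinM lee_fin indicE.
  have [Ox|Ox] := pselect (Omega x); last by rewrite (memNset Ox) !mul0r; pos.
  rewrite !mem_set// !mul1r (enormBC z x) (enormBC w x).
  have [xz|_] := ltP (enorm (x - z)) (8 * d x); last by rewrite !(mul0r, mulr0); pos.
  have [xw|_] := ltP (enorm (x - w)) (8 * d x); last by rewrite !(mul0r, mulr0); pos.
  have dx := dist_gt0 oO bd0 Ox.
  have dxz := dist_cross_in oO bd0 Ox Oz.
  have dxz' := dist_cross_out oO bd0 Ox Oz.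
  have dxw' := dist_cross_out oO bd0 Ox Ow.
  have xz0 : 0 < enorm (x - z) := lt_le_trans dx dxz.
  have t1 := enorm_tri x z w; rewrite (enormBC z x) in t1.
  have T1 : rho z w + enorm (x - z) <= 40 * d x := near_arith xz xw dxz' dxw' t1.
  have T10 : 0 < rho z w + enorm (x - z) := addr_gt0 rho0 xz0.
  rewrite !mul1r xz0 !mul1r -[s - n.+1%:R]opprB.
  have sbE : s + b = s * p + (n.+1%:R - s) by rewrite /b; ring.
  have -> : - (s * p + 2 * (n.+1%:R - s)) = - (n.+1%:R - s) + - (s + b) by rewrite /b; ring.
  have q0 : 0 <= s + b := addr_ge0 (ltW s0) e0.
  rewrite powR_add//.
  have g1 := negpow_le (L := 40) T10 dx (ltr0n _ 40) q0 T1.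
  have g3 := negpow_le (L := 8) xz0 dx (ltr0n _ 8) ns0 (ltW xz).
  apply: le_trans (ler_pM (powR_ge0 _ _) (powR_ge0 _ _) g3 g1) _.
  rewrite [leLHS]mulrACA ler_wpM2r//; first by pos.
  have sbQ : s + b <= Q.
    rewrite sbE addrC /Q -[leRHS]addrA; apply: lerD; first by rewrite gerBl ltW.
    by rewrite (le_trans sphi)// lerDl.
  by rewrite /K ler_pM ?powR_ge0//; apply: powQ => //; rewrite ler1n.
rewrite intZl; last 3 first.
- by pos.
- by meas.
- by move=> x; pos.
have a0 : (0 <= K%:E)%E by pos.
apply: le_trans (lee_wpmul2l a0 (hC2 s b _ z (lo_s hs) b0 rho0)) _.
rewrite -EFinM lee_fin mulrA ler_wpM2l//; first by pos.
have := negpow_le (L := 1) m0 rho0 ltr01 e0; rewrite powR1 !mul1r; apply.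
by rewrite ge_min lexx.
Qed.

End extension_kernel.

Lemma eq_le_trans disp (T : porderType disp) (x y z : T) :
  x = y -> (y <= z)%O -> (x <= z)%O.
Proof. by move=> ->. Qed.

Lemma measurable_slice d1 d2 d3 (T1 : measurableType d1) (T2 : measurableType d2)
  (T3 : measurableType d3) (u : T1 -> T2 -> T3) y :
  measurable_fun setT (fun t => u t.1 t.2) -> measurable_fun setT (u y).
Proof. by move=> mu; exact: (measurable_comp2 mu (measurable_cst y) (@measurable_id _ _ _)). Qed.

Section scaled_bound.
Context d (T : measurableType d) (R : realType).
Variable mu : {measure set T -> \bar R}.
Local Open Scope ereal_scope.

(** The bound is asked only for positive [c]. The coefficients used below vanish unless the outer
    variables really lie outside, which is where the kernel estimates hold. *)
Lemma int_scale_le (c K : R) (f : T -> \bar R) : (0 <= c)%R ->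
  measurable_fun setT f -> (forall x, 0 <= f x) ->
  ((0 < c)%R -> \int[mu]_x f x <= K%:E) ->
  \int[mu]_x (c%:E * f x) <= (c * K)%:E.
Proof.
move=> c0 mf f0 h; rewrite intZl//.
move: c0; rewrite le_eqVlt => /predU1P[<-|c0]; first by rewrite mul0e mul0r.
by rewrite EFinM lee_wpmul2l ?lee_fin ?(ltW c0)// h.
Qed.

End scaled_bound.

(** * The averaging operator: mass, cross and far terms *)

Section averaging_operator.
Context {R : realType} {n : nat} (Omega : set 'rV[R]_n.+1).
Local Notation V := 'rV[R]_n.+1.
Local Notation d := (dist_bd Omega).
Local Notation leb := (@lebesgue_rV R n.+1).
Local Notation wt := (wt Omega).
Local Notation kker := (kker Omega).
Local Notation kfun := (kfun Omega).
Local Notation kden := (kden Omega).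
Local Notation rho := (rho Omega).

Definition eop (s p : R) (g : V -> R) (x : V) : R :=
  fine (\int[leb]_z (kker s p x z * g z)%:E)%E.

Definition trk (s p : R) (z w : V) : R :=
  Num.min (rho z w) 1 `^ (- (n.+1%:R + s * (p - 2))).

Definition T_mass (s p : R) (g : V -> R) : \bar R :=
  (\int[leb]_z (wt s p z * `|g z| `^ p)%:E)%E.

Definition T_energy (s p : R) (g : V -> R) : \bar R :=
  (\int[leb]_z \int[leb]_w
    (wt s p z * wt s p w * (`|g z - g w| `^ p * trk s p z w))%:E)%E.

Hypotheses (Olip : lipschitz_domain Omega) (Obnd : bounded_set Omega).
Let oO : open Omega. Proof. by have [] := Olip. Qed.
Let bd0 : boundary Omega !=set0. Proof. by have [] := Olip. Qed.
Let mO : measurable Omega := open_measurable_rV oO.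
Let mcO : measurable (~` Omega) := measurableC mO.

Lemma kden_ge0 s p x : s < 1 -> 0 <= kden s p x.
Proof.
move=> s1; apply: fine_ge0; apply: integral_ge0 => z _.
by rewrite lee_fin mulr_ge0 ?wt_ge0// kfun_ge0.
Qed.

Lemma kker_ge0 s p x z : s < 1 -> 0 <= kker s p x z.
Proof.
by move=> s1; rewrite /kker mulr_ge0 ?invr_ge0 ?kden_ge0// mulr_ge0 ?wt_ge0// kfun_ge0.
Qed.

Lemma rho_sym z w : rho z w = rho w z.
Proof. by rewrite /rho enormBC; ring. Qed.

Lemma trk_ge0 s p z w : 0 <= trk s p z w.
Proof. exact: powR_ge0. Qed.

Lemma trk_sym s p z w : trk s p z w = trk s p w z.
Proof. by rewrite /trk rho_sym. Qed.

Lemma measurable_kden s p : s < 1 -> measurable_fun setT (kden s p).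
Proof.
move=> s1; have mw := measurable_wt Olip s p.
apply: (measurableT_comp (fine_measurable measurableT)).
apply: (@measurable_int _ _ _ _ _ leb (fun x z => (kfun x z * wt s p z)%:E)).
  by rewrite /kfun; meas.
by move=> x z; rewrite lee_fin mulr_ge0 ?wt_ge0// kfun_ge0.
Qed.

Lemma measurable_kker s p : s < 1 ->
  measurable_fun setT (fun t : V * V => kker s p t.1 t.2).
Proof.
move=> s1; have mw := measurable_wt Olip s p; have mk := measurable_kden p s1.
rewrite /kker; apply: measurable_funM; first by rewrite /kfun; meas.
apply: measurable_invR; first by meas.
by move=> t; exact: kden_ge0.
Qed.

Lemma measurable_eop s p g : s < 1 -> measurable_fun setT g ->
  measurable_fun setT (eop s p g).
Proof.
move=> s1 mg; have mk := measurable_kker p s1.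
apply: (measurableT_comp (fine_measurable measurableT)).
have mf : measurable_fun setT (fun t : V * V => (kker s p t.1 t.2 * g t.2)%:E).
  by apply/measurable_EFinP; apply: measurable_funM => //; meas.
(* The integrand changes sign, so measurability in x is shown for its positive and negative parts
   separately. *)
under eq_fun do rewrite integralE.
apply: emeasurable_funB.
  apply: (@measurable_int _ _ _ _ _ leb
    (fun x z => (fun z => (kker s p x z * g z)%:E)^\+%E z)).
    have := measurable_funepos mf; congr measurable_fun.
    by apply/funext => t; rewrite !funeposE.
  by move=> x z; exact: funepos_ge0.
apply: (@measurable_int _ _ _ _ _ leb
  (fun x z => (fun z => (kker s p x z * g z)%:E)^\-%E z)).
  have := measurable_funeneg mf; congr measurable_fun.
  by apply/funext => t; rewrite !funenegE.
by move=> x z; exact: funeneg_ge0.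
Qed.

Lemma measurable_trk s p : measurable_fun setT (fun t : V * V => trk s p t.1 t.2).
Proof. by rewrite /trk /rho; meas. Qed.

Lemma measurable_kker1 s p x : s < 1 -> measurable_fun setT (kker s p x).
Proof.
move=> s1; have mk := measurable_kker p s1.
have mp : measurable_fun setT (fun z : V => (x, z)) by meas.
exact: (measurableT_comp mk mp).
Qed.

Section kernel.
Variables (A s p : R) (x : V).
Hypotheses (A0 : 0 < A) (s1 : s < 1) (p1 : 1 < p) (kf : kernel_facts Omega A s p x).

Lemma int_kker : (\int[leb]_z (kker s p x z)%:E = 1)%E.
Proof.
have mw := measurable_wt Olip s p.
have dn := kf_den_gt0 kf.
transitivity (\int[leb]_z ((kden s p x)^-1%:E * (kfun x z * wt s p z)%:E))%E.
  by apply: eq_integral => z _; rewrite -EFinM mulrC.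
rewrite intZl; last 3 first.
- by rewrite invr_ge0 ltW.
- by rewrite /kfun; meas.
- by move=> z; rewrite lee_fin mulr_ge0 ?wt_ge0// kfun_ge0.
by rewrite (kf_den kf) -EFinM mulVf ?gt_eqF.
Qed.

Lemma kker_finite g : measurable_fun setT g -> (T_mass s p g < +oo)%E ->
  (\int[leb]_z (kker s p x z * `|g z| `^ p)%:E < +oo)%E.
Proof.
move=> mg gfin; have mw := measurable_wt Olip s p.
have w0 z : 0 <= wt s p z by exact: wt_ge0.
apply: (@le_lt_trans _ _ (\int[leb]_z ((A * d x `^ (s - n.+1%:R))%:E *
    (wt s p z * `|g z| `^ p)%:E))%E).
  apply: le_int => z; first by rewrite lee_fin mulr_ge0 ?powR_ge0// kker_ge0.
  rewrite -EFinM lee_fin mulrA ler_wpM2r ?powR_ge0//.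
  apply: le_trans (kf_ker kf z) _; rewrite -mulrA ler_wpM2l ?(ltW A0)//.
  rewrite ler_wpM2l ?powR_ge0//; case: (enorm _ < _)%R; first by rewrite mul1r.
  by rewrite mul0r.
rewrite intZl; last 3 first.
- by rewrite mulr_ge0 ?powR_ge0 ?(ltW A0).
- by meas.
- by move=> z; rewrite lee_fin mulr_ge0 ?powR_ge0.
rewrite lte_mul_pinfty// lee_fin mulr_ge0 ?powR_ge0//; exact: ltW.
Qed.

(** The kernel has mass 1, so Jensen costs no constant; only afterwards is it replaced by its
    explicit upper bound. *)
Lemma eop_jensen g c : measurable_fun setT g -> (T_mass s p g < +oo)%E ->
  ((`|eop s p g x - c| `^ p)%:E <=
   \int[leb]_z (A * (d x `^ (s - n.+1%:R) * ((enorm (z - x) < 4 * d x)%R%:R * wt s p z)) *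
      `|g z - c| `^ p)%:E)%E.
Proof.
move=> mg gfin; have mk := measurable_kker1 p x s1.
have k0 z : 0 <= kker s p x z by exact: kker_ge0.
apply: le_trans (jensen_mean c p1 mk mg k0 int_kker (kker_finite mg gfin)) _.
apply: le_int => z; first by rewrite lee_fin mulr_ge0 ?powR_ge0.
by rewrite lee_fin ler_wpM2r ?powR_ge0//; exact: kf_ker kf z.
Qed.

End kernel.

(** The boundary is null. It is discarded because [kernel_cross] requires a positive distance. *)
Lemma int_off_boundary (f : V -> \bar R) : measurable_fun setT f -> (forall x, 0 <= f x)%E ->
  (\int[leb]_y ((\1_(~` Omega) y)%:E * f y) =
   \int[leb]_y ((\1_(~` Omega) y * (0 < d y)%R%:R)%:E * f y))%E.
Proof.
move=> mf f0; apply: ge0_ae_eq_integral => //.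
- by meas.
- by meas.
- by move=> y _; rewrite mule_ge0.
- by move=> y _; rewrite mule_ge0// lee_fin mulr_ge0.
exists (boundary Omega); split; last 1 first.
- move=> y /= h; apply: contrapT => by0; apply: h => _.
  rewrite indicE; have [Oy|Oy] := pselect (Omega y).
    by rewrite memNset ?mul0r// => /(_ Oy).
  rewrite mem_set// mul1r; case: ltP => // dy; exfalso; apply: by0.
  by apply: (dist_eq0_boundary oO bd0 Oy); apply/eqP; rewrite eq_le dy dist_ge0.
- apply: measurableD; last by apply: open_measurable_rV; exact: open_interior.
  rewrite -[closure _]setCK; apply: measurableC; apply: open_measurable_rV.
  by rewrite openC; exact: closed_closure.
- exact: boundary_null Olip Obnd.
Qed.

Variables (s_lo p_lo p_hi : R).
Hypotheses (slo01 : 0 < s_lo < 1) (plo1 : 1 < p_lo) (plohi : p_lo <= p_hi).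

(** Jensen with the constant 0, then Tonelli: [kernel_mass] bounds the integral in x for each fixed
    z. *)
Lemma eop_Lp : exists2 C : R, 0 < C & forall s p g,
  s_lo <= s < 1 -> p_lo <= p <= p_hi -> measurable_fun setT g -> (T_mass s p g < +oo)%E ->
  (\int[leb]_x (\1_Omega x * `|eop s p g x| `^ p)%:E <= C%:E * T_mass s p g)%E.
Proof.
have [A A0 hA] := exists_kernel_facts Olip Obnd slo01 plo1 plohi.
have [C C0 hC] := kernel_mass Olip Obnd slo01 plo1 plohi.
exists (A * C); first by pos.
move=> s p g hs hp mg gfin; have /andP[slo s1] := hs; have /andP[plo phi] := hp.
have p1 : 1 < p := lt_le_trans plo1 plo.
have mw := measurable_wt Olip s p.
have w0 z : 0 <= wt s p z by exact: wt_ge0.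
pose c z := A * (wt s p z * `|g z| `^ p).
have c0 z : 0 <= c z by rewrite /c; pos.
have mc : measurable_fun setT c by rewrite /c; meas.
pose f z x := \1_Omega x * ((enorm (z - x) < 8 * d x)%R%:R * d x `^ (s - n.+1%:R)).
have f0 z x : 0 <= f z x by rewrite /f; pos.
apply: (@le_trans _ _ (\int[leb]_x \int[leb]_z ((c z)%:E * (f z x)%:E))%E).
  apply: le_int => x; first by pos.
  rewrite indicE; have [Ox|Ox] := pselect (Omega x); last first.
    by rewrite memNset// mul0r; apply: integral_ge0 => z _; rewrite -EFinM lee_fin mulr_ge0.
  rewrite mem_set// mul1r -[eop s p g x]subr0.
  apply: le_trans (eop_jensen A0 s1 p1 (hA s p x hs hp Ox) 0 mg gfin) _.
  apply: le_int => z; first by pos.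
  rewrite -EFinM lee_fin subr0 /c /f indicE mem_set// mul1r.
  have ind : ((enorm (z - x) < 4 * d x)%R%:R : R) <= (enorm (z - x) < 8 * d x)%R%:R.
    have dx := dist_gt0 oO bd0 Ox.
    case: (boolP (_ < 4 * _)%R) => // h.
    by rewrite (_ : _ < 8 * _)//; apply: lt_trans h _; rewrite ltr_pM2r// ltr_nat.
  rewrite [leLHS](_ : _ = A * (wt s p z * `|g z| `^ p) *
    ((enorm (z - x) < 4 * d x)%R%:R * d x `^ (s - n.+1%:R))); last by ring.
  apply: ler_wpM2l; first exact: (c0 z).
  by rewrite ler_wpM2r ?powR_ge0.
rewrite (@tonelli _ _ _ _ _ leb leb (fun x z => (c z)%:E * (f z x)%:E)%E); last 2 first.
- by rewrite /f; meas.
- by move=> x z; rewrite -EFinM lee_fin mulr_ge0.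
apply: (@le_trans _ _ (\int[leb]_z ((A * C)%:E * (wt s p z * `|g z| `^ p)%:E))%E).
  apply: le_int => z.
    by apply: integral_ge0 => x _; rewrite -EFinM lee_fin mulr_ge0.
  rewrite -EFinM mulrAC -/(c z); apply: int_scale_le => //.
  - by rewrite /f; meas.
  - by move=> x; rewrite lee_fin.
  move=> cz; apply: hC => // Oz; move: cz.
  by rewrite /c wt_in// mul0r mulr0 ltxx.
rewrite intZl//.
- by pos.
- by meas.
- by move=> z; pos.
Qed.

(** Jensen with the constant g y, then Tonelli brings the x-integral of [kernel_cross] innermost.
    The leading 1 - s cancels the 1 / (1 - s) in its bound. *)
Lemma eop_cross : exists2 C : R, 0 < C & forall s p g,
  s_lo <= s < 1 -> p_lo <= p <= p_hi -> measurable_fun setT g -> (T_mass s p g < +oo)%E ->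
  ((1 - s)%:E * \int[leb]_x \int[leb]_y ((\1_(~` Omega) y)%:E *
     (\1_Omega x * (`|eop s p g x - g y| `^ p * enorm (x - y) `^ (- (n.+1%:R + s * p))))%:E)
   <= C%:E * T_energy s p g)%E.
Proof.
have [A A0 hA] := exists_kernel_facts Olip Obnd slo01 plo1 plohi.
have [C C0 hC] := kernel_cross Olip Obnd slo01 plo1 plohi.
exists (A * C); first by pos.
move=> s p g hs hp mg gfin; have /andP[slo s1] := hs; have /andP[plo phi] := hp.
have p1 : 1 < p := lt_le_trans plo1 plo.
have mw := measurable_wt Olip s p; have mE := measurable_eop p s1 mg.
have mt := measurable_trk s p.
have w0 z : 0 <= wt s p z by exact: wt_ge0.
have s1' : 0 < 1 - s by rewrite subr_gt0.
pose c y z := A * (\1_(~` Omega) y * (0 < d y)%R%:R * (wt s p z * `|g z - g y| `^ p)).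
have c0 y z : 0 <= c y z by rewrite /c; pos.
have mc : measurable_fun setT (fun t : V * V => c t.1 t.2) by rewrite /c; meas.
pose f y z x := \1_Omega x * ((enorm (z - x) < 4 * d x)%R%:R * d x `^ (s - n.+1%:R) *
  enorm (x - y) `^ (- (n.+1%:R + s * p))).
have f0 y z x : 0 <= f y z x by rewrite /f; pos.
have aux (b e a x1 x2 w t : R) : b * e * (a * (x1 * (x2 * w)) * t) =
    a * (b * (w * t)) * (true%:R * (x2 * x1 * e)).
  by rewrite /=; ring.
have aux2 (a i w1 w2 t c1 k : R) : 0 <= a -> 0 <= c1 -> 0 <= w1 -> 0 <= w2 -> 0 <= t -> 0 <= k ->
    i <= 1 -> a * (i * (w2 * t)) * (c1 * w1 * k) <= a * c1 * (w1 * w2 * (t * k)).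
  move=> a0 b0 w10 w20 t0 k0 i1.
  rewrite [leLHS](_ : _ = i * (a * c1 * (w1 * w2 * (t * k)))); last by ring.
  by rewrite ler_piMl// !mulr_ge0.
apply: (@le_trans _ _ ((1 - s)%:E * \int[leb]_x \int[leb]_y \int[leb]_z
   ((c y z)%:E * (f y z x)%:E))%E).
  apply: lee_wpmul2l; first by pos.
  apply: le_int => x; first by pos.
  apply: (eq_le_trans (int_off_boundary (f := fun y => (\1_Omega x *
      (`|eop s p g x - g y| `^ p * enorm (x - y) `^ (- (n.+1%:R + s * p))))%:E) _ _)).
  - by meas.
  - by move=> y; pos.
  apply: le_int => y; first by pos.
  rewrite !indicE; have [Ox|Ox] := pselect (Omega x); last first.
    rewrite [x \in _]memNset// mul0r mule0.
    by apply: integral_ge0 => z _; rewrite -EFinM lee_fin mulr_ge0.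
  rewrite [x \in _]mem_set// mul1r -EFinM.
  set b := (y \in _)%:R * _; set e := enorm (x - y) `^ _.
  have b0 : 0 <= b by rewrite /b; pos.
  rewrite mulrCA mulrC EFinM.
  have be0 : (0 <= (b * e)%:E)%E by rewrite /e; pos.
  apply: le_trans (lee_wpmul2l be0 (eop_jensen A0 s1 p1 (hA s p x hs hp Ox) (g y) mg gfin)) _.
  rewrite -intZl; last 3 first.
  - by rewrite -lee_fin.
  - by meas.
  - by move=> z; pos.
  rewrite le_eqVlt; apply/orP; left; apply/eqP; apply: eq_integral => z _.
  rewrite -!EFinM /c /f !indicE (mem_set Ox) -/b -/e; congr EFin; exact: aux.
have mcf : measurable_fun setT (fun t : (V * V) * V => ((c t.1.2 t.2)%:E * (f t.1.2 t.2 t.1.1)%:E)%E).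
  apply: emeasurable_funM; last by rewrite /f; meas.
  by apply/measurable_EFinP; rewrite /c; meas.
rewrite (@tonelli3 _ _ _ _ _ _ _ leb leb leb (fun x y z => (c y z)%:E * (f y z x)%:E)%E)//; last first.
  by move=> x y z; rewrite -EFinM lee_fin mulr_ge0.
pose h y z := wt s p y * wt s p z * (`|g y - g z| `^ p * trk s p y z).
have h0 y z : 0 <= h y z by exact: mulr_ge0 (mulr_ge0 (w0 _) (w0 _)) (mulr_ge0 (powR_ge0 _ _) (trk_ge0 _ _ _ _)).
have mh : measurable_fun setT (fun t : V * V => h t.1 t.2).
  by rewrite /h; meas.
have s1i : 0 <= (1 - s)^-1 by rewrite invr_ge0 ltW.
apply: (@le_trans _ _ ((1 - s)%:E * \int[leb]_y \int[leb]_z ((A * (C / (1 - s)))%:E * (h y z)%:E))%E).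
  apply: lee_wpmul2l; first by pos.
  apply: le_int => y.
    by apply: integral_ge0 => z _; apply: integral_ge0 => x _; rewrite -EFinM lee_fin mulr_ge0.
  apply: le_int => z.
    by apply: integral_ge0 => x _; rewrite -EFinM lee_fin mulr_ge0.
  apply: (@le_trans _ _ (c y z * (C / (1 - s) * wt s p y * trk s p z y))%:E).
    apply: int_scale_le => //.
    - by rewrite /f; meas.
    - by move=> x; rewrite lee_fin.
    move=> cz.
    have Oz : ~ Omega z by move=> Oz; move: cz; rewrite /c (wt_in _ _ Oz) !(mul0r, mulr0) ltxx.
    have Oy : ~ Omega y.
      by move=> Oy; move: cz; rewrite /c indicE memNset ?mul0r ?mulr0 ?ltxx// => /(_ Oy).
    have dy : 0 < d y.
      by move: cz; rewrite /c; case: (ltP 0 (d y)) => // _; rewrite mulr0 mul0r mulr0 ltxx.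
    exact: hC.
  rewrite -EFinM lee_fin trk_sym /c /h distrC.
  have t0 : 0 <= trk s p y z by exact: powR_ge0.
  apply: aux2; [exact: ltW|by rewrite mulr_ge0 ?(ltW C0)|exact: w0|exact: w0|exact: powR_ge0|exact: t0|].
  by rewrite indicE; case: (_ \in _); case: (0 < _)%R; rewrite ?mulr1 ?mulr0.
have Cs : 0 <= A * (C / (1 - s)) by rewrite !mulr_ge0 ?(ltW A0) ?(ltW C0).
under eq_integral => y _.
  rewrite intZl//; last 2 first.
  - by apply/measurable_EFinP; exact: (measurable_slice y mh).
  - by move=> z; rewrite lee_fin.
  over.
rewrite intZl//; last 2 first.
- apply: (@measurable_int _ _ _ _ _ leb (fun y z => (h y z)%:E)); first exact/measurable_EFinP.
  by move=> y z; rewrite lee_fin.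
- by move=> y; apply: integral_ge0 => z _; rewrite lee_fin.
rewrite muleA -EFinM [X in (X%:E * _)%E](_ : _ = A * C)//.
by field; rewrite gt_eqF.
Qed.

(** Jensen in both variables leads to a fourfold integral; after exchanging the two pairs of
    variables, [kernel_far] applies. No factor 1 - s is spent, since |x - y| is bounded below by d x
    / 2. *)
Lemma eop_far : exists2 C : R, 0 < C & forall s p g,
  s_lo <= s < 1 -> p_lo <= p <= p_hi -> measurable_fun setT g -> (T_mass s p g < +oo)%E ->
  (\int[leb]_x \int[leb]_y (\1_Omega x * \1_Omega y * (d x <= 2 * enorm (x - y))%R%:R *
     (`|eop s p g x - eop s p g y| `^ p * enorm (x - y) `^ (- (n.+1%:R + s * p))))%:E
   <= C%:E * T_energy s p g)%E.
Proof.
have [A A0 hA] := exists_kernel_facts Olip Obnd slo01 plo1 plohi.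
have [C C0 hC] := kernel_far Olip slo01 plo1 plohi.
exists (A * A * C); first by pos.
move=> s p g hs hp mg gfin; have /andP[slo s1] := hs; have /andP[plo phi] := hp.
have /andP[slo0 slo1] := slo01.
have s0 : 0 < s := lt_le_trans slo0 slo.
have p1 : 1 < p := lt_le_trans plo1 plo.
have mw := measurable_wt Olip s p; have mE := measurable_eop p s1 mg.
have mt := measurable_trk s p.
have w0 z : 0 <= wt s p z by exact: wt_ge0.
pose c z w := A * A * (wt s p z * wt s p w * `|g z - g w| `^ p).
have c0 z w : 0 <= c z w by rewrite /c; pos.
pose f z w x y := \1_Omega x * \1_Omega y *
     ((d x <= 2 * enorm (x - y))%R%:R *
      ((enorm (z - x) < 4 * d x)%R%:R * d x `^ (s - n.+1%:R)) *
      ((enorm (w - y) < 4 * d y)%R%:R * d y `^ (s - n.+1%:R)) *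
      enorm (x - y) `^ (- (n.+1%:R + s * p))).
have f0 z w x y : 0 <= f z w x y by rewrite /f; pos.
have cf0 z w x y : (0 <= (c z w)%:E * (f z w x y)%:E)%E by rewrite -EFinM lee_fin mulr_ge0.
have aux (b e a x1 x2 w1 y1 y2 w2 t : R) : b * e * (a * (x1 * (x2 * w1))) * (a * (y1 * (y2 * w2)) * t) =
    a * a * (w1 * w2 * t) * (true%:R * true%:R * (b * (x2 * x1) * (y2 * y1) * e)).
  by rewrite /=; ring.
have aux2 (a w1 w2 t c1 k : R) : a * a * (w1 * w2 * t) * (c1 * k) = a * a * c1 * (w1 * w2 * (t * k)).
  by ring.
apply: (@le_trans _ _ (\int[leb]_x \int[leb]_y \int[leb]_z \int[leb]_w
   ((c z w)%:E * (f z w x y)%:E))%E).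
  apply: le_int => x; first by pos.
  apply: le_int => y; first by pos.
  have I0 : (0 <= \int[leb]_z \int[leb]_w ((c z w)%:E * (f z w x y)%:E))%E.
    by apply: integral_ge0 => z _; apply: integral_ge0.
  rewrite !indicE; have [Ox|Ox] := pselect (Omega x); last by rewrite (memNset Ox) !mul0r.
  have [Oy|Oy] := pselect (Omega y); last by rewrite (memNset Oy) mulr0 !mul0r.
  rewrite (mem_set Ox) (mem_set Oy) !mul1r.
  set b := (_ <= _)%R%:R; set e := enorm (x - y) `^ _.
  have b0 : 0 <= b by rewrite /b; pos.
  have e0 : 0 <= e by exact: powR_ge0.
  rewrite mulrCA mulrC EFinM.
  have be0 : (0 <= (b * e)%:E)%E by pos.
  (* Jensen at x with the value of the average at y as constant; a second application, at y with the
     constant g z, then removes that value. *)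
  apply: le_trans (lee_wpmul2l be0 (eop_jensen A0 s1 p1 (hA s p x hs hp Ox) (eop s p g y) mg gfin)) _.
  rewrite -intZl; last 3 first.
  - by rewrite -lee_fin.
  - by meas.
  - by move=> z; pos.
  apply: le_int => z; first by pos.
  set kx := A * (d x `^ _ * _).
  have kx0 : 0 <= kx by rewrite /kx; pos.
  rewrite -EFinM mulrA EFinM distrC.
  have bk0 : (0 <= (b * e * kx)%:E)%E by pos.
  apply: le_trans (lee_wpmul2l bk0 (eop_jensen A0 s1 p1 (hA s p y hs hp Oy) (g z) mg gfin)) _.
  rewrite -intZl; last 3 first.
  - by rewrite -lee_fin.
  - by meas.
  - by move=> w; pos.
  rewrite le_eqVlt; apply/orP; left; apply/eqP; apply: eq_integral => w _.
  rewrite -!EFinM /c /f !indicE (mem_set Ox) (mem_set Oy) -/b -/e (distrC (g z)) /kx.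
  by congr EFin; exact: aux.
have mcf : measurable_fun setT (fun t : ((V * V) * V) * V =>
    ((c t.1.2 t.2)%:E * (f t.1.2 t.2 t.1.1.1 t.1.1.2)%:E)%E).
  apply: emeasurable_funM; last by rewrite /f; meas.
  by apply/measurable_EFinP; rewrite /c; meas.
apply: (eq_le_trans (@tonelli4 _ _ _ _ _ _ _ _ _ leb leb leb leb (fun x y z w => (c z w)%:E * (f z w x y)%:E)%E mcf _)).
  by move=> x y z w; exact: cf0.
pose h z w := wt s p z * wt s p w * (`|g z - g w| `^ p * trk s p z w).
have h0 y z : 0 <= h y z by exact: mulr_ge0 (mulr_ge0 (w0 _) (w0 _)) (mulr_ge0 (powR_ge0 _ _) (trk_ge0 _ _ _ _)).
have mh : measurable_fun setT (fun t : V * V => h t.1 t.2).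
  by rewrite /h; meas.
have mf2 z w : measurable_fun setT (fun t : V * V => (f z w t.1 t.2)%:E) by rewrite /f; meas.
have AC : 0 <= A * A * C by rewrite !mulr_ge0 ?(ltW A0) ?(ltW C0).
apply: (@le_trans _ _ (\int[leb]_z \int[leb]_w ((A * A * C)%:E * (h z w)%:E))%E).
  apply: le_int => z.
    by apply: integral_ge0 => w _; apply: integral_ge0 => x _; apply: integral_ge0.
  apply: le_int => w.
    by apply: integral_ge0 => x _; apply: integral_ge0.
  apply: (@le_trans _ _ (c z w * (C * trk s p z w))%:E); last first.
    rewrite -EFinM lee_fin /c /h le_eqVlt; apply/orP; left; apply/eqP; exact: aux2.
  under eq_integral => x _.
    rewrite intZl//; last 2 first.
    - by rewrite /f; meas.
    - by move=> y; rewrite lee_fin.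
    over.
  apply: int_scale_le => //.
  - apply: (@measurable_int _ _ _ _ _ leb (fun x y => (f z w x y)%:E)) => //.
    by move=> x y; rewrite lee_fin.
  - by move=> x; apply: integral_ge0 => y _; rewrite lee_fin.
  move=> cz.
  have Oz : ~ Omega z by move=> Oz; move: cz; rewrite /c (wt_in _ _ Oz) !(mul0r, mulr0) ltxx.
  have Ow : ~ Omega w by move=> Ow; move: cz; rewrite /c (wt_in _ _ Ow) !(mul0r, mulr0) ltxx.
  have dz : 0 < d z.
    rewrite lt_neqAle eq_sym dist_ge0// andbT; apply/negP => /eqP dz.
    by move: cz; rewrite /c (wt_dist0 _ s0 dz) !(mul0r, mulr0) ltxx.
  exact: hC.
under eq_integral => y _.
  rewrite intZl//; last 2 first.
  - by apply/measurable_EFinP; exact: (measurable_slice y mh).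
  - by move=> z; rewrite lee_fin.
  over.
rewrite intZl//.
- apply: (@measurable_int _ _ _ _ _ leb (fun y z => (h y z)%:E)); first exact/measurable_EFinP.
  by move=> y z; rewrite lee_fin.
- by move=> y; apply: integral_ge0 => z _; rewrite lee_fin.
Qed.

End averaging_operator.

Lemma le_poweR {R : realType} (x y : \bar R) (r : R) :
  0 <= r -> (0 <= x -> x <= y -> x `^ r <= y `^ r)%E.
Proof.
move=> r0 x0 xy; apply: gt0_ler_poweR => //; rewrite in_itv/= leey andbT//.
exact: le_trans xy.
Qed.

Lemma powR_mulKV {R : realType} (N X p : R) : 0 < N -> 0 <= X ->
  N^-1 `^ p * (N * X) `^ p = X `^ p.
Proof.
move=> N0 X0; rewrite -powRM ?invr_ge0 ?mulr_ge0 ?(ltW N0)// mulKf// gt_eqF//.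
Qed.

Lemma powR_le_succ {R : realType} (A q P : R) : 0 < A -> 0 <= q -> q <= P -> A `^ q <= (A + 1) `^ P.
Proof.
move=> A0 q0 qP; apply: (@le_trans _ _ ((A + 1) `^ q)).
  by apply: ge0_ler_powR; rewrite ?nnegrE ?addr_ge0 ?(ltW A0)// lerDl.
by apply: ler_powR => //; rewrite lerDr ltW.
Qed.

(** * The averaging operator: pairs near the diagonal *)

Section near_diagonal.
Context {R : realType} {n : nat} (Omega : set 'rV[R]_n.+1).
Local Notation V := 'rV[R]_n.+1.
Local Notation d := (dist_bd Omega).
Local Notation leb := (@lebesgue_rV R n.+1).
Local Notation om := (@vball R n).
Local Notation wt := (wt Omega).
Local Notation kker := (kker Omega).
Local Notation kfun := (kfun Omega).
Local Notation kden := (kden Omega).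
Local Notation eop := (eop Omega).
Local Notation trk := (trk Omega).
Local Notation T_mass := (T_mass Omega).
Local Notation T_energy := (T_energy Omega).

Hypotheses (Olip : lipschitz_domain Omega) (Obnd : bounded_set Omega).
Let oO : open Omega. Proof. by have [] := Olip. Qed.
Let bd0 : boundary Omega !=set0. Proof. by have [] := Olip. Qed.
Let mO : measurable Omega := open_measurable_rV oO.
Let mcO : measurable (~` Omega) := measurableC mO.
Let om0 := @vball_gt0 R n.

(** Collects the powers of D = d x. Normalisation, Jensen mass and second kernel contribute (s - m -
    1) p, (m - s) (p - 1) and s - m, with m the dimension: in all -(p + 2 (m - s)). *)
Lemma near_coef (A D N del m s p P : R) : 0 < A -> 0 < D -> 0 < N -> 0 <= del ->
  1 < p -> p <= P -> N^-1 <= A * D `^ (s - m - 1) ->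
  N^-1 `^ p * ((5 * del) `^ p * ((A * D `^ (m - s)) `^ (p - 1) * (A * 2 `^ m * D `^ (s - m)))) <=
  5 `^ P * (A + 1) `^ P * (A + 1) `^ P * (A * 2 `^ m) * (del `^ p * D `^ (- (p + 2 * (m - s)))).
Proof.
move=> A0 D0 N0 del0 p1 pP hN.
have p0 : 0 <= p by lra.
have h1 : N^-1 `^ p <= A `^ p * D `^ ((s - m - 1) * p).
  rewrite [X in _ * X]powRrM -powRM ?(ltW A0) ?powR_ge0//.
  apply: ge0_ler_powR; rewrite ?nnegrE ?mulr_ge0 ?powR_ge0 ?invr_ge0//; exact: ltW.
have h2 : (A * D `^ (m - s)) `^ (p - 1) = A `^ (p - 1) * D `^ ((m - s) * (p - 1)).
  by rewrite powRM ?(ltW A0) ?powR_ge0// -powRrM.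
have a1 : A `^ p <= (A + 1) `^ P := powR_le_succ A0 (ltW (lt_trans ltr01 p1)) pP.
have a2 : A `^ (p - 1) <= (A + 1) `^ P.
  by apply: powR_le_succ => //; [rewrite subr_ge0 ltW|rewrite (le_trans _ pP)// gerBl].
have a3 : 5 `^ p <= 5 `^ P by apply: ler_powR => //; rewrite ler1n.
have eD : D `^ ((s - m - 1) * p) * D `^ ((m - s) * (p - 1)) * D `^ (s - m) = D `^ (- (p + 2 * (m - s))).
  by rewrite -!powR_add//; congr (D `^ _); ring.
have aux (x1 x2 y1 y2 y3 y4 z1 z2 z3 : R) :
    y1 * x1 * (y2 * z1 * (y3 * x2 * (y4 * z3))) = y2 * y1 * y3 * y4 * (z1 * (x1 * x2 * z3)).
  by ring.
rewrite h2 powRM ?ler0n//.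
apply: (@le_trans _ _ (A `^ p * D `^ ((s - m - 1) * p) *
    (5 `^ p * del `^ p * (A `^ (p - 1) * D `^ ((m - s) * (p - 1)) * (A * 2 `^ m * D `^ (s - m)))))).
  apply: ler_wpM2r h1; apply: mulr_ge0; first by pos.
  by apply: mulr_ge0; pos.
rewrite aux// eD; apply: ler_wpM2r; first by pos.
apply: ler_wpM2r; first by pos.
apply: (ler_pM _ _ _ a2); [by pos|by pos|].
by apply: (ler_pM _ _ a3 a1); pos.
Qed.

(** The radial exponent is a - d with a = p (1 - s). The factor 1 / a of the integral is absorbed by
    1 - s, leaving 1 / p < 1. *)
Lemma near_radial (s p P D : R) (x : V) : 0 < s < 1 -> 1 < p <= P -> 0 < D ->
  ((1 - s)%:E * \int[leb]_y ((2 * enorm (x - y) < D)%R%:R *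
     (enorm (x - y) `^ p * enorm (x - y) `^ (- (n.+1%:R + s * p))))%:E <=
   (om * 2 `^ (n.+1%:R + P) * (2 * (1 + P)) * D `^ (p - s * p))%:E)%E.
Proof.
move=> /andP[s0 s1] /andP[p1 pP] D0.
have s1' : 0 < 1 - s by lra. have p0 : 0 < p by lra.
pose a := p * (1 - s).
have a0 : 0 < a by rewrite /a mulr_gt0.
have aP : a <= P by apply: le_trans pP; rewrite /a ler_piMr//; lra.
have n1 : 1 <= n.+1%:R :> R by rewrite ler1n.
have D2 : 0 < D / 2 by rewrite divr_gt0.
have s1e : (0 <= (1 - s)%:E)%E by rewrite lee_fin ltW.
apply: (@le_trans _ _ ((1 - s)%:E * \int[leb]_y ((0 < enorm (y - x) < D / 2)%R%:R *
    enorm (y - x) `^ (a - n.+1%:R))%:E)%E).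
  apply: lee_wpmul2l => //; apply: le_int => y; first by pos.
  rewrite lee_fin (enormBC x y).
  have := enorm_ge0 (y - x); rewrite le_eqVlt => /predU1P[<-|xy0].
    by rewrite powR0 ?gt_eqF// mul0r mulr0; pos.
  rewrite xy0 -powR_add//= (_ : p + - (n.+1%:R + s * p) = a - n.+1%:R); last by rewrite /a; ring.
  by rewrite ltr_pdivlMr// [enorm _ * 2]mulrC.
apply: le_trans (lee_wpmul2l s1e (int_radial_small x a0 D2)) _.
rewrite -EFinM lee_fin.
have e1 : (1 - s) * (2 * (1 + a) / a) = 2 * (1 + a) / p.
  by rewrite /a; field; rewrite !gt_eqF.
have aux (x1 x2 x3 x4 x5 : R) : x1 * (x2 * x3 * x4 * x5) = x2 * x3 * (x1 * x4) * x5 by ring.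
rewrite aux e1.
have Da : D `^ (p - s * p) = D `^ a by congr (_ `^ _); rewrite /a; ring.
rewrite Da.
have b1 : 2 `^ `|n.+1%:R - a| <= 2 `^ (n.+1%:R + P) :> R.
  apply: ler_powR; first by rewrite ler1n.
  by rewrite ler_norml; apply/andP; split; lra.
have b2 : 2 * (1 + a) / p <= 2 * (1 + P).
  rewrite ler_pdivrMr//; apply: (@le_trans _ _ (2 * (1 + P) * 1)); first by lra.
  by rewrite ler_wpM2l; lra.
have b3 : (D / 2) `^ a <= D `^ a.
  apply: ge0_ler_powR; rewrite ?nnegrE ?ltW// ltr_pdivrMr// ltr_pMr// (natrD _ 1 1) ltrDl//.
have c1 : 0 <= 2 * (1 + a) / p by rewrite mulr_ge0 ?invr_ge0 ?mulr_ge0 ?addr_ge0 ?(ltW a0) ?(ltW p0).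
apply: ler_pM b3; [exact: mulr_ge0 (mulr_ge0 (ltW om0) (powR_ge0 _ _)) c1|exact: powR_ge0|].
apply: ler_pM b2 => //; first exact: mulr_ge0 (ltW om0) (powR_ge0 _ _).
by rewrite ler_wpM2l ?(ltW om0).
Qed.

(** The constant is 4 for the distance function, which is 1-Lipschitz, plus 1 for the norm. *)
Lemma kfun_lip x y z : `|kfun x z - kfun y z| <= 5 * enorm (x - y).
Proof.
have h1 := dist_lip bd0 x y; have h2 := dist_lip bd0 y x; rewrite (enormBC y x) in h2.
have t1 := enorm_tri x z y; have t2 := enorm_tri y z x; rewrite (enormBC y x) in t2.
have e0 := enorm_ge0 (x - y).
rewrite /kfun; case: (leP 0 (4 * d x - enorm (z - x))) => a1;
  case: (leP 0 (4 * d y - enorm (z - y))) => a2; rewrite ler_norml; apply/andP; split; lra.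
Qed.

(** Both bumps vanish at a z at least 8 d x away from x, because y is within d x / 2 of x and 4 d y
    <= 6 d x. *)
Lemma kfun_near x y z : 0 < d x -> 2 * enorm (x - y) < d x ->
  `|kfun x z - kfun y z| <= 5 * enorm (x - y) * (enorm (z - x) < 8 * d x)%R%:R.
Proof.
move=> dx xy; case: (ltP (enorm (z - x)) (8 * d x)) => hz; first by rewrite mulr1 kfun_lip.
have h2 := dist_lip bd0 y x; rewrite (enormBC y x) in h2.
have e0 := enorm_ge0 (x - y).
have t1 := enorm_tri y z x; rewrite (enormBC y x) in t1.
by rewrite mulr0 /kfun !max_l ?subrr ?normr0//; lra.
Qed.

Section pair.
Variables (A s p : R) (x y : V).
Hypotheses (A0 : 0 < A) (s1 : s < 1) (p1 : 1 < p) (Ox : Omega x) (Oy : Omega y).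
Hypotheses (kx : kernel_facts Omega A s p x) (ky : kernel_facts Omega A s p y).

Let bw (z : V) : R := (enorm (z - x) < 8 * d x)%R%:R * wt s p z.

Lemma kfun_mass_finite u g : kernel_facts Omega A s p u ->
  measurable_fun setT g -> (T_mass s p g < +oo)%E ->
  (\int[leb]_z (kfun u z * wt s p z * `|g z| `^ p)%:E < +oo)%E.
Proof.
move=> ku mg gfin; have dn := kf_den_gt0 ku.
have mk := measurable_kker1 Olip p u s1.
have := kker_finite Olip A0 s1 ku mg gfin => h.
rewrite (_ : (\int[leb]_z _)%E =
   (\int[leb]_z ((kden s p u)%:E * (kker s p u z * `|g z| `^ p)%:E))%E); last first.
  apply: eq_integral => z _; rewrite -EFinM /kker; congr EFin.
  by field; rewrite gt_eqF.
rewrite intZl.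
- by rewrite lte_mul_pinfty// lee_fin ltW.
- exact: ltW.
- by meas.
- by move=> z; rewrite lee_fin mulr_ge0 ?powR_ge0// kker_ge0.
Qed.

Lemma eopE u g : kernel_facts Omega A s p u ->
  measurable_fun setT g -> (T_mass s p g < +oo)%E ->
  eop s p g u = fine (\int[leb]_z (kfun u z * wt s p z * g z)%:E)%E / kden s p u.
Proof.
move=> ku mg gfin; have dn := kf_den_gt0 ku.
have mw := measurable_wt Olip s p.
have mk : measurable_fun setT (kfun u) by rewrite /kfun; meas.
have ik : leb.-integrable setT (fun z => (kfun u z * wt s p z * g z)%:E).
  apply: (integrable_weight (p := p)); first exact: ltW.
  - by meas.
  - by [].
  - by move=> z; rewrite mulr_ge0 ?kfun_ge0 ?wt_ge0.
  - by rewrite (kf_den ku) ltry.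
  - exact: kfun_mass_finite.
rewrite /eop (_ : (\int[leb]_z (kker s p u z * g z)%:E)%E =
  (\int[leb]_z ((kden s p u)^-1%:E * (kfun u z * wt s p z * g z)%:E))%E); last first.
  by apply: eq_integral => z _; rewrite -EFinM /kker; congr EFin; ring.
by rewrite integralZl// fineM ?integrable_fin_num//= mulrC.
Qed.

(** [mean_diff] estimates the difference of the two means by the difference of the bumps against the
    distance of g from its mean at y. Jensen raises this to the power p. The power |x - y|^p is
    gained from [kfun_near]. *)
Lemma eop_pair g P : 2 * enorm (x - y) < d x -> p <= P ->
  0 < s -> s - n.+1%:R <= 0 ->
  measurable_fun setT g -> (T_mass s p g < +oo)%E ->
  ((`|eop s p g x - eop s p g y| `^ p)%:E <=
   (5 `^ P * (A + 1) `^ P * (A + 1) `^ P * (A * 2 `^ n.+1%:R) *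
     (enorm (x - y) `^ p * d x `^ (- (p + 2 * (n.+1%:R - s)))))%:E *
   \int[leb]_z \int[leb]_w (bw z * (bw w * `|g z - g w| `^ p))%:E)%E.
Proof.
move=> xy pP s0 sn mg gfin.
have p0 : 0 < p := lt_trans ltr01 p1.
have dx := dist_gt0 oO bd0 Ox; have dy := dist_gt0 oO bd0 Oy.
have h1 := dist_lip bd0 x y; have h2 := dist_lip bd0 y x; rewrite (enormBC y x) in h2.
have e0 := enorm_ge0 (x - y).
have icmp w : ((enorm (w - y) < 4 * d y)%R%:R : R) <= (enorm (w - x) < 8 * d x)%R%:R.
  case: (ltP (enorm (w - y)) (4 * d y)) => hw//.
  have t1 := enorm_tri y w x; rewrite (enormBC y x) in t1.
  have h8 : enorm (w - x) < 8 * d x by lra.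
  by rewrite h8 lexx.
have dcmp : d y `^ (s - n.+1%:R) <= 2 `^ n.+1%:R * d x `^ (s - n.+1%:R).
  have dxy : d x <= 2 * d y by lra.
  have nse : 0 <= n.+1%:R - s by rewrite -oppr_le0 opprB.
  have := negpow_le dx dy (ltr0n _ 2) nse dxy; rewrite opprB => /le_trans; apply.
  apply: ler_wpM2r; first exact: powR_ge0.
  by apply: ler_powR; rewrite ?ler1n// gerBl ltW.
have mw := measurable_wt Olip s p.
have w0 z : 0 <= wt s p z by exact: wt_ge0.
have mbw : measurable_fun setT bw by rewrite /bw; meas.
have bw0 z : 0 <= bw z by rewrite /bw mulr_ge0.
have mk u : measurable_fun setT (kfun u) by rewrite /kfun; meas.
have mkw u : measurable_fun setT (fun z => kfun u z * wt s p z).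
  by apply: measurable_funM; [exact: mk|].
have kw0 u z : 0 <= kfun u z * wt s p z by rewrite mulr_ge0 ?kfun_ge0.
have Nx := kf_den_gt0 kx; have Ny := kf_den_gt0 ky.
set E1 := eop s p g x; set E2 := eop s p g y.
have h := @mean_diff _ _ _ leb _ _ g _ _ E1 E2 p p1 (mkw x) (mkw y) mg (kw0 x) (kw0 y) Nx Ny
  (kf_den kx) (kf_den ky) (kfun_mass_finite kx mg gfin) (kfun_mass_finite ky mg gfin)
  (eopE kx mg gfin) (eopE ky mg gfin).
pose J := (\int[leb]_z (bw z * `|g z - E2|)%:E)%E.
have J0 : (0 <= J)%E by apply: integral_ge0 => z _; rewrite lee_fin mulr_ge0.
have del0 : 0 <= 5 * enorm (x - y) by rewrite mulr_ge0.
have {}h : ((kden s p x * `|E1 - E2|)%:E <= (5 * enorm (x - y))%:E * J)%E.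
  apply: le_trans h _; rewrite /J -intZl; last 3 first.
  - exact: del0.
  - by meas.
  - by move=> z; rewrite lee_fin mulr_ge0.
  apply: le_int => z; first by rewrite lee_fin mulr_ge0.
  rewrite -EFinM lee_fin [leRHS]mulrA; apply: ler_wpM2r; first exact: normr_ge0.
  rewrite -mulrBl normrM (ger0_norm (w0 z)) /bw [leRHS]mulrA; apply: ler_wpM2r => //.
  exact: kfun_near.
have hp : (((kden s p x * `|E1 - E2|) `^ p)%:E <= ((5 * enorm (x - y)) `^ p)%:E *
    (((A * d x `^ (n.+1%:R - s)) `^ (p - 1))%:E * \int[leb]_z (bw z * `|g z - E2| `^ p)%:E))%E.
  apply: (@le_trans _ _ (((5 * enorm (x - y))%:E * J) `^ p)%E).
    rewrite -poweR_EFin; apply: le_poweR h; first exact: ltW.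
    by rewrite lee_fin; exact: mulr_ge0 (ltW Nx) (normr_ge0 _).
  rewrite poweRM//.
  rewrite poweR_EFin; apply: lee_wpmul2l; first by rewrite lee_fin powR_ge0.
  apply: jensen_powR => //.
  - by rewrite mulr_ge0 ?powR_ge0// ltW.
  - by meas.
  - exact: kf_mass kx.
have assoc4 (a1 a2 a3 a4 : R) : a1 * a2 * a3 * a4 = a1 * (a2 * (a3 * a4)) by ring.
pose c2 := A * 2 `^ n.+1%:R * d x `^ (s - n.+1%:R).
have c20 : 0 <= c2 by rewrite /c2 !mulr_ge0 ?powR_ge0// ltW.
have bw2 z w : 0 <= bw z * (bw w * `|g z - g w| `^ p).
  exact: mulr_ge0 (bw0 z) (mulr_ge0 (bw0 w) (powR_ge0 _ _)).
have aw z w : 0 <= A * (d y `^ (s - n.+1%:R) * ((enorm (w - y) < 4 * d y)%R%:R * wt s p w)) *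
    `|g w - g z| `^ p.
  apply: mulr_ge0 (powR_ge0 _ _); apply: mulr_ge0 (ltW A0) _.
  exact: mulr_ge0 (powR_ge0 _ _) (mulr_ge0 (ler0n _ _) (w0 w)).
have aux (b a t c b' : R) : 0 <= b -> 0 <= t -> a <= c * b' -> b * (a * t) <= c * (b * (b' * t)).
  move=> b0 t0 ac; rewrite [leRHS](_ : _ = b * (c * b' * t)); last by ring.
  by apply: ler_wpM2l => //; exact: ler_wpM2r.
have cmp w : A * (d y `^ (s - n.+1%:R) * ((enorm (w - y) < 4 * d y)%R%:R * wt s p w)) <= c2 * bw w.
  rewrite /c2 -[leRHS]mulrA -[leRHS]mulrA; apply: ler_wpM2l; first exact: ltW.
  rewrite [leRHS]mulrA; apply: ler_pM.
  - exact: powR_ge0.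
  - exact: mulr_ge0 (ler0n _ _) (w0 w).
  - exact: dcmp.
  apply: ler_wpM2r => //; exact: icmp.
set I := (\int[leb]_z \int[leb]_w _)%E.
have I0 : (0 <= I)%E.
  by apply: integral_ge0 => z _; apply: integral_ge0 => w _; rewrite lee_fin; exact: bw2.
have mI : measurable_fun setT (fun z => \int[leb]_w (bw z * (bw w * `|g z - g w| `^ p))%:E)%E.
  apply: (@measurable_int _ _ _ _ _ leb (fun z w => (bw z * (bw w * `|g z - g w| `^ p))%:E)).
    by meas.
  by move=> z w; rewrite lee_fin; exact: bw2.
(* Jensen at y with the constant g z trades the mean [E2] for the values of g, on the common ball
   about x. *)
have hI : (\int[leb]_z (bw z * `|g z - E2| `^ p)%:E <= c2%:E * I)%E.
  rewrite /I -intZl; last 3 first.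
  - exact: c20.
  - exact: mI.
  - by move=> z; apply: integral_ge0 => w _; rewrite lee_fin; exact: bw2.
  apply: le_int => z; first by rewrite lee_fin; exact: mulr_ge0 (bw0 z) (powR_ge0 _ _).
  rewrite EFinM distrC.
  have bz : (0 <= (bw z)%:E)%E by rewrite lee_fin.
  apply: le_trans (lee_wpmul2l bz (eop_jensen Olip A0 s1 p1 ky (g z) mg gfin)) _.
  rewrite -intZl; last 3 first.
  - exact: bw0.
  - by meas.
  - by move=> w; rewrite lee_fin; exact: aw.
  rewrite -intZl; last 3 first.
  - exact: c20.
  - by meas.
  - by move=> w; rewrite lee_fin; exact: bw2.
  apply: le_int => w; first by rewrite -EFinM lee_fin; exact: mulr_ge0 (bw0 z) (aw z w).
  rewrite -!EFinM lee_fin (distrC (g w)).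
  exact: aux (bw0 z) (powR_ge0 _ _) (cmp w).
have -> : `|E1 - E2| `^ p = (kden s p x)^-1 `^ p * (kden s p x * `|E1 - E2|) `^ p.
  by rewrite (powR_mulKV _ Nx (normr_ge0 _)).
rewrite EFinM.
have ninv : (0 <= ((kden s p x)^-1 `^ p)%:E)%E by rewrite lee_fin powR_ge0.
apply: le_trans (lee_wpmul2l ninv hp) _.
have m1 : (0 <= ((A * d x `^ (n.+1%:R - s)) `^ (p - 1))%:E)%E by rewrite lee_fin powR_ge0.
have m2 : (0 <= ((5 * enorm (x - y)) `^ p)%:E)%E by rewrite lee_fin powR_ge0.
apply: le_trans (lee_wpmul2l ninv (lee_wpmul2l m2 (lee_wpmul2l m1 hI))) _.
rewrite !muleA -!EFinM; apply: lee_wpmul2r => //; rewrite lee_fin [leLHS]assoc4.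
apply: (le_trans (near_coef A0 dx Nx e0 p1 pP (kf_den_inv kx))).
by rewrite le_eqVlt; apply/orP; left; apply/eqP; ring.
Qed.

End pair.

Variables (s_lo p_lo p_hi : R).
Hypotheses (slo01 : 0 < s_lo < 1) (plo1 : 1 < p_lo) (plohi : p_lo <= p_hi).

(** After [eop_pair] the variable y occurs only in a radial factor, which [near_radial] integrates
    with the help of 1 - s. The powers of d x then combine to the exponent of [kernel_near]. *)
Lemma eop_near : exists2 C : R, 0 < C & forall s p g,
  s_lo <= s < 1 -> p_lo <= p <= p_hi -> measurable_fun setT g -> (T_mass s p g < +oo)%E ->
  ((1 - s)%:E * \int[leb]_x \int[leb]_y (\1_Omega x * \1_Omega y * (2 * enorm (x - y) < d x)%R%:R *
     (`|eop s p g x - eop s p g y| `^ p * enorm (x - y) `^ (- (n.+1%:R + s * p))))%:E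
   <= C%:E * T_energy s p g)%E.
Proof.
have [A A0 hA] := exists_kernel_facts Olip Obnd slo01 plo1 plohi.
have [C C0 hC] := kernel_near Olip slo01 plo1 plohi.
pose K1 := 5 `^ p_hi * (A + 1) `^ p_hi * (A + 1) `^ p_hi * (A * 2 `^ n.+1%:R).
pose K2 := om * 2 `^ (n.+1%:R + p_hi) * (2 * (1 + p_hi)).
have phi0 : 0 < p_hi by apply: lt_le_trans plohi; apply: lt_trans plo1.
have K10 : 0 < K1 by rewrite /K1; pos.
have K20 : 0 < K2 by rewrite /K2; pos.
exists (K1 * K2 * C); first by pos.
move=> s p g hs hp mg gfin; have /andP[slo s1] := hs; have /andP[plo phi] := hp.
have /andP[slo0 slo1] := slo01.
have s0 : 0 < s := lt_le_trans slo0 slo.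
have s01 : 0 < s < 1 by rewrite s0.
have p1 : 1 < p := lt_le_trans plo1 plo.
have s1' : 0 <= 1 - s by rewrite subr_ge0 ltW.
have n1 : 1 <= n.+1%:R :> R by rewrite ler1n.
have sn : s - n.+1%:R <= 0 by lra.
have mw := measurable_wt Olip s p; have mE := measurable_eop Olip p s1 mg.
have mt := measurable_trk Omega s p.
have w0 z : 0 <= wt s p z by exact: wt_ge0.
pose c z w := K1 * K2 * (wt s p z * wt s p w * `|g z - g w| `^ p).
have c0 z w : 0 <= c z w by rewrite /c; pos.
pose f z w x := \1_Omega x * ((enorm (z - x) < 8 * d x)%R%:R * (enorm (w - x) < 8 * d x)%R%:R *
       d x `^ (- (s * p + 2 * (n.+1%:R - s)))).
have f0 z w x : 0 <= f z w x by rewrite /f; pos.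
have cf0 z w x : (0 <= (c z w)%:E * (f z w x)%:E)%E by rewrite -EFinM lee_fin mulr_ge0.
pose b x z := (enorm (z - x) < 8 * d x)%R%:R * wt s p z.
have b0 x z : 0 <= b x z by rewrite /b mulr_ge0.
pose I x := (\int[leb]_z \int[leb]_w (b x z * (b x w * `|g z - g w| `^ p))%:E)%E.
have mb x : measurable_fun setT (b x) by rewrite /b; meas.
have bI x z w : 0 <= b x z * (b x w * `|g z - g w| `^ p) by rewrite !mulr_ge0 ?powR_ge0.
have I0 x : (0 <= I x)%E.
  by apply: integral_ge0 => z _; apply: integral_ge0 => w _; rewrite lee_fin.
have aux (k1 k2 b1 b2 w1 w2 t q : R) : k1 * k2 * q * (b1 * w1 * (b2 * w2 * t)) =
    k1 * k2 * (w1 * w2 * t) * (true%:R * (b1 * b2 * q)).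
  by rewrite /=; ring.
have aux3 (q k t r : R) : q * (k * (t * r)) = k * r * (t * q) by ring.
have step x : ((1 - s)%:E * \int[leb]_y (\1_Omega x * \1_Omega y * (2 * enorm (x - y) < d x)%R%:R *
     (`|eop s p g x - eop s p g y| `^ p * enorm (x - y) `^ (- (n.+1%:R + s * p))))%:E <=
   \int[leb]_z \int[leb]_w ((c z w)%:E * (f z w x)%:E))%E.
  have [Ox|Ox] := pselect (Omega x); last first.
    rewrite integral0_eq ?mule0; last by move=> y _; rewrite indicE memNset// !mul0r.
    by apply: integral_ge0 => z _; apply: integral_ge0 => w _.
  have dx := dist_gt0 oO bd0 Ox.
  pose Q := K1 * d x `^ (- (p + 2 * (n.+1%:R - s))).
  have Q0 : 0 <= Q by rewrite /Q mulr_ge0 ?powR_ge0// ltW.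
  have QI : (0 <= Q%:E * I x)%E by rewrite mule_ge0// lee_fin.
  pose rad y := (2 * enorm (x - y) < d x)%R%:R *
     (enorm (x - y) `^ p * enorm (x - y) `^ (- (n.+1%:R + s * p))).
  have rad0 y : 0 <= rad y by rewrite /rad !mulr_ge0 ?powR_ge0.
  apply: (@le_trans _ _ ((1 - s)%:E * \int[leb]_y ((Q%:E * I x) * (rad y)%:E))%E).
    apply: lee_wpmul2l; first by rewrite lee_fin.
    apply: le_int => y; first by pos.
    rewrite [\1_Omega x]indicE (mem_set Ox) mul1r.
    have [Oy|Oy] := pselect (Omega y); last first.
      by rewrite indicE (memNset Oy) !mul0r mule_ge0// lee_fin.
    rewrite indicE (mem_set Oy) mul1r /rad.
    have [xy|_] := ltP (2 * enorm (x - y)) (d x); last by rewrite !mul0r mule0.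
    rewrite !mul1r EFinM muleC.
    have q0 : (0 <= (enorm (x - y) `^ (- (n.+1%:R + s * p)))%:E)%E by rewrite lee_fin powR_ge0.
    apply: le_trans (lee_wpmul2l q0 (eop_pair A0 s1 p1 Ox Oy (hA s p x hs hp Ox)
      (hA s p y hs hp Oy) xy phi s0 sn mg gfin)) _.
    rewrite -/(I x) -/K1 muleA [leRHS]muleAC -!EFinM; apply: lee_wpmul2r => //.
    rewrite lee_fin le_eqVlt; apply/orP; left; apply/eqP; rewrite /Q.
    exact: aux3.
  rewrite ge0_integralZl//; last 2 first.
  - by rewrite /rad; meas.
  - by move=> y _; rewrite lee_fin.
  have p1P : 1 < p <= p_hi by rewrite p1.
  rewrite muleCA; apply: le_trans (lee_wpmul2l QI (near_radial x s01 p1P dx)) _.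
  rewrite -/K2 muleAC -EFinM.
  have eQ : Q * (K2 * d x `^ (p - s * p)) = K1 * K2 * d x `^ (- (s * p + 2 * (n.+1%:R - s))).
    rewrite /Q mulrACA -powR_add//; congr (_ * _ `^ _); ring.
  rewrite eQ /I.
  have KK : 0 <= K1 * K2 * d x `^ (- (s * p + 2 * (n.+1%:R - s))).
    exact: mulr_ge0 (ltW (mulr_gt0 K10 K20)) (powR_ge0 _ _).
  rewrite -intZl//; last 2 first.
  - apply: (@measurable_int _ _ _ _ _ leb (fun z w => (b x z * (b x w * `|g z - g w| `^ p))%:E)).
      by have := mb x; move: (b x) => bx mbx; meas.
    by move=> z w; rewrite lee_fin.
  - by move=> z; apply: integral_ge0 => w _; rewrite lee_fin.
  apply: le_int => z.
    by rewrite mule_ge0 ?lee_fin//; apply: integral_ge0 => w _; rewrite lee_fin.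
  rewrite -intZl; last 3 first.
  - exact: KK.
  - by have := mb x; move: (b x) => bx mbx; meas.
  - by move=> w; rewrite lee_fin.
  apply: le_int => w; first by rewrite -EFinM lee_fin mulr_ge0.
  rewrite -!EFinM lee_fin /c /f /b indicE (mem_set Ox) le_eqVlt; apply/orP; left; apply/eqP.
  exact: aux.
have mcf : measurable_fun setT (fun t : (V * V) * V => ((c t.1.2 t.2)%:E * (f t.1.2 t.2 t.1.1)%:E)%E).
  apply: emeasurable_funM; last by rewrite /f; meas.
  by apply/measurable_EFinP; rewrite /c; meas.
apply: (@le_trans _ _ (\int[leb]_x \int[leb]_z \int[leb]_w ((c z w)%:E * (f z w x)%:E))%E).
  rewrite -intZl//; last 2 first.
  - apply: (@measurable_int _ _ _ _ _ leb (fun x y => (\1_Omega x * \1_Omega y * (2 * enorm (x - y) < d x)%R%:R *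
     (`|eop s p g x - eop s p g y| `^ p * enorm (x - y) `^ (- (n.+1%:R + s * p))))%:E)).
      by meas.
    by move=> x y; pos.
  - by move=> x; pos.
  apply: le_int => x; last exact: step.
  by rewrite mule_ge0 ?lee_fin//; pos.
apply: (eq_le_trans (@tonelli3 _ _ _ _ _ _ _ leb leb leb (fun x z w => (c z w)%:E * (f z w x)%:E)%E mcf _)).
  by move=> x z w; exact: cf0.
pose h z w := wt s p z * wt s p w * (`|g z - g w| `^ p * trk s p z w).
have h0 y z : 0 <= h y z by exact: mulr_ge0 (mulr_ge0 (w0 _) (w0 _)) (mulr_ge0 (powR_ge0 _ _) (trk_ge0 _ _ _ _ _)).
have mh : measurable_fun setT (fun t : V * V => h t.1 t.2) by rewrite /h; meas.
have KC : 0 <= K1 * K2 * C by exact: ltW (mulr_gt0 (mulr_gt0 K10 K20) C0).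
have aux2 (k w1 w2 t c1 q : R) : k * (w1 * w2 * t) * (c1 * q) = k * c1 * (w1 * w2 * (t * q)).
  by ring.
apply: (@le_trans _ _ (\int[leb]_z \int[leb]_w ((K1 * K2 * C)%:E * (h z w)%:E))%E).
  apply: le_int => z.
    by apply: integral_ge0 => w _; apply: integral_ge0 => x _.
  apply: le_int => w.
    by apply: integral_ge0 => x _.
  apply: (@le_trans _ _ (c z w * (C * trk s p z w))%:E); last first.
    by rewrite -EFinM lee_fin /c /h le_eqVlt; apply/orP; left; apply/eqP; exact: aux2.
  apply: int_scale_le => //.
  - by rewrite /f; meas.
  - by move=> x; rewrite lee_fin.
  move=> cz.
  have Oz : ~ Omega z by move=> Oz; move: cz; rewrite /c (wt_in _ _ Oz) !(mul0r, mulr0) ltxx.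
  have Ow : ~ Omega w by move=> Ow; move: cz; rewrite /c (wt_in _ _ Ow) !(mul0r, mulr0) ltxx.
  have dz : 0 < d z.
    rewrite lt_neqAle eq_sym dist_ge0// andbT; apply/negP => /eqP dz.
    by move: cz; rewrite /c (wt_dist0 _ s0 dz) !(mul0r, mulr0) ltxx.
  exact: hC.
under eq_integral => y _.
  rewrite intZl//; last 2 first.
  - by apply/measurable_EFinP; exact: (measurable_slice y mh).
  - by move=> z; rewrite lee_fin.
  over.
rewrite intZl//.
- apply: (@measurable_int _ _ _ _ _ leb (fun y z => (h y z)%:E)); first exact/measurable_EFinP.
  by move=> y z; rewrite lee_fin.
- by move=> y; apply: integral_ge0 => z _; rewrite lee_fin.
Qed.

End near_diagonal.

Lemma combine2 {R : realType} (a b : R) (x y : \bar R) : 0 <= a -> 0 <= b -> (0 <= x ->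
  0 <= y -> a%:E * x + b%:E * y <= (1 + a + b)%:E * (x + y))%E.
Proof.
move=> a0 b0 x0 y0; rewrite [leRHS]ge0_muleDr//.
by apply: leeD; apply: lee_wpmul2r => //; rewrite lee_fin; lra.
Qed.

Lemma combine3 {R : realType} (k c2 c3 c4 : R) (i2 i3 i4 e : \bar R) : 0 <= k <= 1 ->
  0 <= c2 -> 0 <= c3 -> 0 <= c4 -> (0 <= i2 -> 0 <= i3 -> 0 <= i4 -> 0 <= e ->
  k%:E * i2 <= c2%:E * e -> i3 <= c3%:E * e -> k%:E * i4 <= c4%:E * e ->
  k%:E * (i2 + i3 + i4) <= (c2 + c3 + c4)%:E * e)%E.
Proof.
move=> /andP[k0 k1] c20 c30 c40 i20 i30 i40 e0 h2 h3 h4.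
rewrite ge0_muleDr ?adde_ge0// ge0_muleDr// !EFinD ge0_muleDl ?adde_ge0 ?lee_fin//.
rewrite ge0_muleDl ?lee_fin//; apply: leeD h4; apply: leeD h2 _; apply: le_trans h3.
by rewrite gee_pMl ?lee_fin// ge0_fin_numE.
Qed.

(** * The norms as Lebesgue integrals; boundedness of the extension *)

Section function_spaces.
Context {R : realType} {n : nat} (Omega : set 'rV[R]_n.+1).
Local Notation V := 'rV[R]_n.+1.
Local Notation d := (dist_bd Omega).
Local Notation leb := (@lebesgue_rV R n.+1).
Local Notation wt := (wt Omega).
Local Notation rho := (rho Omega).
Local Notation eop := (eop Omega).
Local Notation trk := (trk Omega).
Local Notation T_mass := (T_mass Omega).
Local Notation T_energy := (T_energy Omega).

(** [g] is first set to 0 on [Omega], so the result depends only on its values outside and the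
    integrands are measurable on the whole space. *)
Definition ext (s p : R) (g : V -> R) (x : V) : R :=
  \1_Omega x * eop s p (g \_ (~` Omega)) x + (g \_ (~` Omega)) x.

Hypotheses (Olip : lipschitz_domain Omega) (Obnd : bounded_set Omega).
Let oO : open Omega. Proof. by have [] := Olip. Qed.
Let bd0 : boundary Omega !=set0. Proof. by have [] := Olip. Qed.
Let mO : measurable Omega := open_measurable_rV oO.
Let mcO : measurable (~` Omega) := measurableC mO.

Lemma restrict_out (g : V -> R) x : ~ Omega x -> (g \_ (~` Omega)) x = g x.
Proof. by move=> Ox; rewrite /patch mem_set. Qed.

Lemma restrict_in (g : V -> R) x : Omega x -> (g \_ (~` Omega)) x = 0.
Proof. by move=> Ox; rewrite /patch memNset// => /(_ Ox). Qed.

Lemma measurable_restrict_out (g : V -> R) :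
  measurable_fun (~` Omega) g -> measurable_fun setT (g \_ (~` Omega)).
Proof. by move/(measurable_restrictT g mcO). Qed.

Lemma int_mu_s s p (f : V -> \bar R) : s < 1 -> measurable_fun setT f ->
  (forall x, 0 <= f x)%E ->
  (\int[mu_s s p Omega]_(x in ~` Omega) f x = \int[leb]_x ((wt s p x)%:E * f x))%E.
Proof.
move=> s1 mf f0; have mw := measurable_wt Olip s p.
(* [mu_s] is a measure under the conditions s <= 1 and [Omega] measurable, so its measure structure
   is named with these proofs. *)
pose nu : {measure set V -> \bar R} :=
  Defs_mu_s__canonical__measure_function_Measure p (ltW s1) mO.
rewrite -[LHS]/(\int[nu]_(x in ~` Omega) f x)%E int_mkcond.
rewrite (@int_density _ _ _ leb nu (wt s p)) //.
- apply: eq_integral => x _; rewrite muleA -EFinM; congr (_%:E * _)%E.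
  have [Ox|Ox] := pselect (Omega x); first by rewrite wt_in// mul0r.
  by rewrite indicE mem_set// mulr1.
- by move=> x; exact: wt_ge0.
- by meas.
- by move=> x; rewrite mule_ge0.
Qed.

Lemma eq_int_mu_s s p (f1 f2 : V -> \bar R) : s < 1 -> (forall x, ~ Omega x -> f1 x = f2 x) ->
  (\int[mu_s s p Omega]_(x in ~` Omega) f1 x = \int[mu_s s p Omega]_(x in ~` Omega) f2 x)%E.
Proof.
move=> s1 h.
pose nu : {measure set V -> \bar R} :=
  Defs_mu_s__canonical__measure_function_Measure p (ltW s1) mO.
rewrite -[LHS]/(\int[nu]_(x in ~` Omega) f1 x)%E -[RHS]/(\int[nu]_(x in ~` Omega) f2 x)%E.
by apply: eq_integral => x; rewrite inE; exact: h.
Qed.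

Lemma T_massE s p (g : V -> R) : s < 1 -> measurable_fun (~` Omega) g ->
  (\int[mu_s s p Omega]_(x in ~` Omega) (`|g x| `^ p)%:E = T_mass s p (g \_ (~` Omega)))%E.
Proof.
move=> s1 /measurable_restrict_out mg.
transitivity (\int[mu_s s p Omega]_(x in ~` Omega) (`|(g \_ (~` Omega)) x| `^ p)%:E)%E.
  by apply: eq_int_mu_s => // x Ox; rewrite restrict_out.
move: (g \_ _) mg => h mh; by rewrite int_mu_s//; meas.
Qed.

Lemma T_energyE s p (g : V -> R) : s < 1 -> measurable_fun (~` Omega) g ->
  T_seminorm_pow s p Omega g = T_energy s p (g \_ (~` Omega)).
Proof.
move=> s1 /measurable_restrict_out mg; rewrite /T_seminorm_pow.
have mw := measurable_wt Olip s p; have mt := measurable_trk Omega s p.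
transitivity (\int[mu_s s p Omega]_(y in ~` Omega) \int[mu_s s p Omega]_(x in ~` Omega)
    (`|(g \_ (~` Omega)) y - (g \_ (~` Omega)) x| `^ p * trk s p y x)%:E)%E.
  apply: eq_int_mu_s => // y Oy; apply: eq_int_mu_s => // x Ox.
  rewrite !restrict_out// distrC; congr (_ * _)%:E.
  by rewrite /trk powRN enormBC /rho addrAC.
move: (g \_ _) mg => h mh.
transitivity (\int[mu_s s p Omega]_(y in ~` Omega) \int[leb]_x ((wt s p x)%:E *
    (`|h y - h x| `^ p * trk s p y x)%:E))%E.
  apply: eq_int_mu_s => // y _; apply: int_mu_s => //.
  - by have := measurable_slice y mt; move: (trk s p y) => t mt'; meas.
  - by move=> x; rewrite lee_fin mulr_ge0 ?powR_ge0.
have m2 : measurable_fun setT (fun t : V * V => (wt s p t.2)%:E *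
    (`|h t.1 - h t.2| `^ p * trk s p t.1 t.2)%:E)%E by meas.
have w0 x : 0 <= wt s p x by exact: wt_ge0.
have ge x y : (0 <= (wt s p x)%:E * (`|h y - h x| `^ p * trk s p y x)%:E)%E.
  by rewrite -EFinM lee_fin; exact: mulr_ge0 (w0 _) (mulr_ge0 (powR_ge0 _ _) (trk_ge0 _ _ _ _ _)).
rewrite int_mu_s//; last 2 first.
- exact: (@measurable_int _ _ _ _ _ leb (fun y x => (wt s p x)%:E *
    (`|h y - h x| `^ p * trk s p y x)%:E)%E m2 (fun y x => ge x y)).
- by move=> y; apply: integral_ge0.
apply: eq_integral => y _; rewrite -intZl//.
- by apply: eq_integral => x _; rewrite -!EFinM mulrA.
- have := measurable_slice y mt; move: (trk s p y) => t mt'.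
  by apply: emeasurable_funM; meas.
Qed.

Lemma T_normE s p (g : V -> R) : s < 1 -> measurable_fun (~` Omega) g ->
  T_norm s p Omega g =
  ((T_mass s p (g \_ (~` Omega)) + T_energy s p (g \_ (~` Omega))) `^ p^-1)%E.
Proof. by move=> s1 mg; rewrite /T_norm T_massE// T_energyE. Qed.

Lemma T_mass_ge0 s p g : s < 1 -> (0 <= T_mass s p g)%E.
Proof.
by move=> s1; apply: integral_ge0 => x _; rewrite lee_fin mulr_ge0 ?powR_ge0 ?wt_ge0.
Qed.

Lemma T_energy_ge0 s p g : s < 1 -> (0 <= T_energy s p g)%E.
Proof.
move=> s1; apply: integral_ge0 => x _; apply: integral_ge0 => y _; rewrite lee_fin.
exact: mulr_ge0 (mulr_ge0 (wt_ge0 _ _ _ s1) (wt_ge0 _ _ _ s1)) (mulr_ge0 (powR_ge0 _ _) (trk_ge0 _ _ _ _ _)).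
Qed.

Lemma poweR_finite (x : \bar R) (r : R) : 0 < r -> (x `^ r < +oo -> x < +oo)%E.
Proof. by move=> r0; case: x => [a||] //; rewrite ?ltry// poweRyr ?gt_eqF// ltxx. Qed.

Lemma finite_poweR (x : \bar R) (r : R) : (0 <= x -> x < +oo -> x `^ r < +oo)%E.
Proof. by case: x => [a||] // _ _; rewrite poweR_EFin ltry. Qed.

Lemma T_finite s p g : s < 1 -> 1 < p -> fs_mem (T_space s p Omega) g ->
  [/\ measurable_fun setT (g \_ (~` Omega)), (T_mass s p (g \_ (~` Omega)) < +oo)%E &
      (T_energy s p (g \_ (~` Omega)) < +oo)%E].
Proof.
move=> s1 p1 [mg]; rewrite T_normE// => /poweR_finite h.
have pi0 : 0 < p^-1 by rewrite invr_gt0 (lt_trans ltr01).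
have {}h := h pi0; split; first exact: measurable_restrict_out.
- by apply: le_lt_trans h; rewrite leeDl// T_energy_ge0.
- by apply: le_lt_trans h; rewrite leeDr// T_mass_ge0.
Qed.

Lemma V_energyE s p u :
  V_seminorm_pow s p Omega u = ((1 - s)%:E * \int[leb]_x \int[leb]_y
    (\1_Omega x * (`|u x - u y| `^ p * enorm (x - y) `^ (- (n.+1%:R + s * p))))%:E)%E.
Proof.
rewrite /V_seminorm_pow int_mkcond; congr (_ * _)%E; apply: eq_integral => x _.
rewrite indicE; case: (x \in Omega).
  by rewrite mul1e; apply: eq_integral => y _; rewrite mul1r powRN.
by rewrite mul0e integral0_eq// => y _; rewrite mul0r.
Qed.

Lemma measurable_ext s p g : s < 1 -> measurable_fun (~` Omega) g ->
  measurable_fun setT (ext s p g).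
Proof.
move=> s1 /measurable_restrict_out mg; have mE := measurable_eop Olip p s1 mg.
rewrite /ext; move: (eop s p _) mE => E mE; move: (g \_ _) mg => h mg; meas.
Qed.

(** The three summands match [eop_cross], [eop_far] and [eop_near]: y outside, y in [Omega] with d x
    <= 2 |x - y|, and y in [Omega] closer than that. *)
Lemma ext_split s p g x y :
  \1_Omega x * (`|ext s p g x - ext s p g y| `^ p * enorm (x - y) `^ (- (n.+1%:R + s * p))) =
  \1_(~` Omega) y * (\1_Omega x * (`|eop s p (g \_ (~` Omega)) x - (g \_ (~` Omega)) y| `^ p *
      enorm (x - y) `^ (- (n.+1%:R + s * p)))) +
  \1_Omega x * \1_Omega y * (d x <= 2 * enorm (x - y))%R%:R *
    (`|eop s p (g \_ (~` Omega)) x - eop s p (g \_ (~` Omega)) y| `^ p *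
      enorm (x - y) `^ (- (n.+1%:R + s * p))) +
  \1_Omega x * \1_Omega y * (2 * enorm (x - y) < d x)%R%:R *
    (`|eop s p (g \_ (~` Omega)) x - eop s p (g \_ (~` Omega)) y| `^ p *
      enorm (x - y) `^ (- (n.+1%:R + s * p))).
Proof.
rewrite /ext; have hin u : Omega u -> (g \_ (~` Omega)) u = 0 := restrict_in g (x := u).
move: (enorm _ `^ _) => e; move: (eop s p _) => E; move: (g \_ _) hin => h hin.
have [Ox|Ox] := pselect (Omega x); last first.
  have -> : \1_Omega x = 0 :> R by rewrite indicE memNset.
  by rewrite !(mul0r, mulr0) !addr0.
have -> : \1_Omega x = 1 :> R by rewrite indicE mem_set.
rewrite (hin _ Ox) addr0 !mul1r.
have [Oy|Oy] := pselect (Omega y).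
  have -> : \1_Omega y = 1 :> R by rewrite indicE mem_set.
  have -> : \1_(~` Omega) y = 0 :> R by rewrite indicE memNset// => /(_ Oy).
  by rewrite (hin _ Oy) addr0 !mul1r mul0r add0r; case: leP => _; rewrite ?mul1r ?mul0r ?addr0 ?add0r.
have -> : \1_Omega y = 0 :> R by rewrite indicE memNset.
have -> : \1_(~` Omega) y = 1 :> R by rewrite indicE mem_set.
by rewrite !mul1r !mul0r !addr0 add0r.
Qed.

Variables (s_lo p_lo p_hi : R).
Hypotheses (slo01 : 0 < s_lo < 1) (plo1 : 1 < p_lo) (plohi : p_lo <= p_hi).

Lemma ext_bound : exists2 C : R, 1 <= C & forall s p g,
  s_lo <= s < 1 -> p_lo <= p <= p_hi -> fs_mem (T_space s p Omega) g ->
  (\int[leb]_(x in Omega) (`|ext s p g x| `^ p)%:E + V_seminorm_pow s p Omega (ext s p g) <=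
   C%:E * (T_mass s p (g \_ (~` Omega)) + T_energy s p (g \_ (~` Omega))))%E.
Proof.
have [C1 C10 h1] := eop_Lp Olip Obnd slo01 plo1 plohi.
have [C2 C20 h2] := eop_cross Olip Obnd slo01 plo1 plohi.
have [C3 C30 h3] := eop_far Olip Obnd slo01 plo1 plohi.
have [C4 C40 h4] := eop_near Olip Obnd slo01 plo1 plohi.
exists (1 + C1 + (C2 + C3 + C4)); first by lra.
move=> s p g hs hp Tg; have /andP[slo s1] := hs; have /andP[plo phi] := hp.
have /andP[slo0 slo1] := slo01.
have p1 : 1 < p := lt_le_trans plo1 plo.
have s1e : 0 <= 1 - s <= 1 by apply/andP; split; lra.
have [mh hm he] := T_finite s1 p1 Tg.
have m0 := T_mass_ge0 p (g \_ (~` Omega)) s1.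
have e0 := T_energy_ge0 p (g \_ (~` Omega)) s1.
have b1 : (\int[leb]_(x in Omega) (`|ext s p g x| `^ p)%:E <= C1%:E * T_mass s p (g \_ (~` Omega)))%E.
  apply: le_trans (h1 s p _ hs hp mh hm); rewrite int_mkcond le_eqVlt; apply/orP; left; apply/eqP.
  apply: eq_integral => x _; rewrite -EFinM /ext !indicE.
  have [Ox|Ox] := pselect (Omega x); last by rewrite (memNset Ox) !mul0r.
  by rewrite (mem_set Ox) !mul1r restrict_in// addr0.
have b2 : (V_seminorm_pow s p Omega (ext s p g) <= (C2 + C3 + C4)%:E * T_energy s p (g \_ (~` Omega)))%E.
  have := h2 s p _ hs hp mh hm; have := h3 s p _ hs hp mh hm; have := h4 s p _ hs hp mh hm.
  have mE := measurable_eop Olip p s1 mh.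
  pose h := g \_ (~` Omega); pose E := eop s p h.
  pose F3 x y := (\1_Omega x * \1_Omega y * (d x <= 2 * enorm (x - y))%R%:R *
     (`|E x - E y| `^ p * enorm (x - y) `^ (- (n.+1%:R + s * p))))%:E.
  pose F4 x y := (\1_Omega x * \1_Omega y * (2 * enorm (x - y) < d x)%R%:R *
     (`|E x - E y| `^ p * enorm (x - y) `^ (- (n.+1%:R + s * p))))%:E.
  rewrite V_energyE -/h => g4 g3 g2; rewrite -/E -/h in mE mh.
  pose F2 x y := (\1_(~` Omega) y * (\1_Omega x *
     (`|E x - h y| `^ p * enorm (x - y) `^ (- (n.+1%:R + s * p)))))%:E.
  have {}g2 : ((1 - s)%:E * \int[leb]_x \int[leb]_y F2 x y <= C2%:E * T_energy s p h)%E.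
    have F2E : (\int[leb]_x \int[leb]_y F2 x y = \int[leb]_x \int[leb]_y ((\1_(~` Omega) y)%:E *
       (\1_Omega x * (`|E x - h y| `^ p * enorm (x - y) `^ (- (n.+1%:R + s * p))))%:E))%E.
      by apply: eq_integral => x _; apply: eq_integral => y _; rewrite /F2 EFinM.
    by rewrite F2E.
  have p2 x y : (0 <= F2 x y)%E by rewrite lee_fin !mulr_ge0 ?powR_ge0.
  have p3 x y : (0 <= F3 x y)%E by rewrite lee_fin !mulr_ge0 ?powR_ge0.
  have p4 x y : (0 <= F4 x y)%E by rewrite lee_fin !mulr_ge0 ?powR_ge0.
  have m2 : measurable_fun setT (fun t : V * V => F2 t.1 t.2) by rewrite /F2; meas.
  have m3 : measurable_fun setT (fun t : V * V => F3 t.1 t.2) by rewrite /F3; meas.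
  have m4 : measurable_fun setT (fun t : V * V => F4 t.1 t.2) by rewrite /F4; meas.
  have i2 := @measurable_int _ _ _ _ _ leb F2 m2 p2.
  have i3 := @measurable_int _ _ _ _ _ leb F3 m3 p3.
  have i4 := @measurable_int _ _ _ _ _ leb F4 m4 p4.
  have j2 x : (0 <= \int[leb]_y F2 x y)%E by apply: integral_ge0.
  have j3 x : (0 <= \int[leb]_y F3 x y)%E by apply: integral_ge0.
  have j4 x : (0 <= \int[leb]_y F4 x y)%E by apply: integral_ge0.
  rewrite [X in (_ * X <= _)%E](_ : _ = \int[leb]_x \int[leb]_y F2 x y +
     \int[leb]_x \int[leb]_y F3 x y + \int[leb]_x \int[leb]_y F4 x y)%E; last first.
    rewrite -ge0_integralD// -ge0_integralD//; last 2 first.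
    - by move=> x _; rewrite adde_ge0.
    - exact: emeasurable_funD.
    apply: eq_integral => x _.
    have s2 := measurable_slice x m2; have s3 := measurable_slice x m3.
    have s4 := measurable_slice x m4.
    rewrite -ge0_integralD// -ge0_integralD//; last 2 first.
    - by move=> y _; rewrite adde_ge0.
    - exact: emeasurable_funD.
    apply: eq_integral => y _; rewrite /F2 /F3 /F4 -!EFinD; congr EFin; exact: ext_split.
  apply: (combine3 s1e (ltW C20) (ltW C30) (ltW C40) _ _ _ e0 g2 g3 g4);
    apply: integral_ge0 => x _; [exact: j2|exact: j3|exact: j4].
apply: le_trans (leeD b1 b2) _.
by apply: combine2 => //; rewrite ?addr_ge0// ltW.
Qed.

End function_spaces.

(** Convexity of the power p at the points a / t and b / (1 - t). The choice t = 1 / 2 serves the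
    halving inequality; a t close to 1 makes the coefficient of a^p close to 1. *)
Lemma powR_conv {R : realType} (a b p t : R) : 0 <= a -> 0 <= b -> 1 <= p -> 0 < t < 1 ->
  (a + b) `^ p <= t `^ (1 - p) * a `^ p + (1 - t) `^ (1 - p) * b `^ p.
Proof.
move=> a0 b0 p1 /andP[t0 t1]; have t0' : 0 < 1 - t by lra.
have h : (t * (a / t) + (1 - t) * (b / (1 - t))) `^ p <=
    t * (a / t) `^ p + (1 - t) * (b / (1 - t)) `^ p.
  by apply: (convex_powR p1 (Itv01 _ _)) => //=;
    rewrite ?inE/= ?in_itv/= ?andbT ?mulr_ge0 ?invr_ge0//; lra.
have e (u c : R) : 0 < u -> 0 <= c -> u * (c / u) `^ p = u `^ (1 - p) * c `^ p.
  move=> u0 c0; rewrite powRM ?invr_ge0 ?(ltW u0)// powR_add// powRr1 ?(ltW u0)//.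
  by rewrite powRN -powR_inv1 ?(ltW u0)// -powRrM mulN1r powRN; ring.
rewrite !e// in h; move: h; rewrite (_ : t * (a / t) + _ = a + b)//.
by field; rewrite !gt_eqF.
Qed.

(** * A fractional Poincare inequality on balls *)

Section balls.
Context {R : realType} {n : nat}.
Local Notation V := 'rV[R]_n.+1.
Local Notation leb := (@lebesgue_rV R n.+1).
Local Notation om := (@vball R n).
Let om0 := @vball_gt0 R n.

Definition bind (c : V) (t : R) (y : V) : R := (enorm (y - c) < t)%R%:R.

Lemma bind_ge0 c t y : 0 <= bind c t y. Proof. exact: ler0n. Qed.

Lemma bind_le1 c t y : bind c t y <= 1.
Proof. by rewrite /bind; case: (_ < _)%R. Qed.

Lemma bind_mid c t y z : bind c t y * bind c t z <= bind c t (2^-1 *: z + 2^-1 *: y).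
Proof.
rewrite /bind; have [hy|_] := ltP (enorm (y - c)) t; last by rewrite mul0r.
have [hz|_] := ltP (enorm (z - c)) t; last by rewrite mulr0.
have -> : 2^-1 *: z + 2^-1 *: y - c = 2^-1 *: (z - c) + 2^-1 *: (y - c).
  by apply/rowP => i; rewrite !mxE; field.
have h : enorm (2^-1 *: (z - c) + 2^-1 *: (y - c)) < t.
  apply: le_lt_trans (enormD _ _) _; rewrite !enormZ ger0_norm ?invr_ge0//; lra.
by rewrite h mulr1.
Qed.

Section poincare.
Variables (u : V -> R) (c : V) (t p s : R).
Hypotheses (mu : measurable_fun setT u) (t0 : 0 < t) (p1 : 1 < p) (s01 : 0 < s < 1).

Let f (y z : V) : R := bind c t y * bind c t z * `|u y - u z| `^ p.
Let F (r : R) : \bar R := (\int[leb]_y \int[leb]_z (f y z * (enorm (y - z) < r)%R%:R)%:E)%E.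

Let f0 y z : 0 <= f y z.
Proof. by rewrite /f !mulr_ge0 ?powR_ge0 ?bind_ge0. Qed.

Let fsym y z : f y z = f z y.
Proof. by rewrite /f distrC (mulrC (bind c t y)). Qed.

Let mf : measurable_fun setT (fun x : V * V => f x.1 x.2).
Proof. by rewrite /f /bind; meas. Qed.

Let mid y z : 2^-1 *: z + 2^-1 *: y - y = 2^-1 *: (z - y) :> V.
Proof. by apply/rowP => i; rewrite !mxE; field. Qed.

(** Two points are compared through their midpoint, which stays in the ball and is less than r / 2
    from each. The power inequality costs 2^(p - 1) on each of two equal terms, and substituting the
    midpoint for one variable costs 2^d: in all 2^(p + d). *)
Let halving r : (F r <= (2 `^ (p + n.+1%:R))%:E * F (r / 2))%E.
Proof.
pose G (y m : V) := f y m * (enorm (y - m) < r / 2)%R%:R.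
have G0 y m : 0 <= G y m by rewrite /G mulr_ge0.
have mG : measurable_fun setT (fun x : V * V => G x.1 x.2) by rewrite /G; meas.
have Gsym y z : G y z = G z y by rewrite /G fsym enormBC.
have Fh : F (r / 2) = (\int[leb]_y \int[leb]_z (G y z)%:E)%E by [].
pose m (y z : V) : V := 2^-1 *: z + 2^-1 *: y.
have mm : measurable_fun setT (fun x : V * V => m x.1 x.2) by rewrite /m; meas.
have msym y z : m y z = m z y by rewrite /m addrC.
have mGm : measurable_fun setT (fun x : V * V => (G x.1 (m x.1 x.2))%:E).
  apply/measurable_EFinP; exact: (measurable_comp2 mG measurable_fst mm).
have h2 : 0 < 2^-1 :> R by rewrite invr_gt0.
have inner y : (\int[leb]_z (G y (m y z))%:E = (2 ^+ n.+1)%:E * \int[leb]_z (G y z)%:E)%E.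
  rewrite [in RHS](int_affine_rV (2^-1 *: y) h2); last 2 first.
  - by apply/measurable_EFinP; exact: (measurable_slice y mG).
  - by move=> z; rewrite lee_fin.
  by rewrite muleA -EFinM -exprMn mulfV// expr1n mul1e.
have I1 : (\int[leb]_y \int[leb]_z (G y (m y z))%:E = (2 ^+ n.+1)%:E * F (r / 2))%E.
  transitivity (\int[leb]_y ((2 ^+ n.+1)%:E * \int[leb]_z (G y z)%:E))%E.
    by apply: eq_integral => y _; rewrite inner.
  rewrite Fh; apply: intZl; first by rewrite exprn_ge0.
  - apply: (@measurable_int _ _ _ _ _ leb (fun y z => (G y z)%:E)); first exact/measurable_EFinP.
    by move=> y z; rewrite lee_fin.
  - by move=> y; apply: integral_ge0 => z _; rewrite lee_fin.
have I2 : (\int[leb]_y \int[leb]_z (G z (m y z))%:E = (2 ^+ n.+1)%:E * F (r / 2))%E.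
  rewrite -I1 (@tonelli _ _ _ _ _ leb leb (fun y z => (G z (m y z))%:E)); last 2 first.
  - apply/measurable_EFinP; exact: (measurable_comp2 mG measurable_snd mm).
  - by move=> y z; rewrite lee_fin.
  by apply: eq_integral => z _; apply: eq_integral => y _; rewrite msym.
have c20 : 0 <= 2 `^ (p - 1) :> R by exact: powR_ge0.
apply: (@le_trans _ _ (\int[leb]_y \int[leb]_z ((2 `^ (p - 1))%:E *
    ((G y (m y z))%:E + (G z (m y z))%:E)))%E).
  apply: le_int => y; first by apply: integral_ge0 => z _; rewrite lee_fin mulr_ge0.
  apply: le_int => z; first by rewrite lee_fin mulr_ge0.
  rewrite -EFinD -EFinM lee_fin.
  have [yzr|_] := ltP (enorm (y - z)) r; last by rewrite mulr0 mulr_ge0 ?addr_ge0.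
  rewrite mulr1 /G.
  have e1 : enorm (y - m y z) < r / 2.
    by rewrite enormBC /m mid enormZ ger0_norm ?invr_ge0// enormBC; lra.
  have e2 : enorm (z - m y z) < r / 2.
    by rewrite enormBC msym /m mid enormZ ger0_norm ?invr_ge0//; lra.
  rewrite e1 e2 !mulr1 /f.
  have bm := bind_mid c t y z; rewrite -/(m y z) in bm.
  set by_ := bind c t y; set bz := bind c t z; set bm_ := bind c t (m y z).
  have h : `|u y - u z| `^ p <= 2 `^ (p - 1) * (`|u y - u (m y z)| `^ p + `|u z - u (m y z)| `^ p).
    apply: (@le_trans _ _ ((`|u y - u (m y z)| + `|u z - u (m y z)|) `^ p)).
      apply: ge0_ler_powR; rewrite ?nnegrE ?addr_ge0//; first by rewrite ltW// (lt_trans ltr01).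
      by rewrite [`|u z - _|]distrC (le_trans _ (ler_normD _ _))// addrA subrK.
    have half : 0 < (2^-1 : R) < 1 by rewrite h2 invf_lt1// ltr1n.
    have := powR_conv (normr_ge0 (u y - u (m y z))) (normr_ge0 (u z - u (m y z))) (ltW p1) half.
    rewrite (_ : 1 - 2^-1 = 2^-1 :> R); last by field.
    rewrite -mulrDr -powR_inv1// -powRrM mulN1r opprB; exact.
  have p0 (a b : R) : 0 <= `|a| `^ b by exact: powR_ge0.
  move: (h) (p0 (u y - u z) p) (p0 (u y - u (m y z)) p) (p0 (u z - u (m y z)) p).
  move: (_ `^ p) (`|u y - u (m y z)| `^ p) (`|u z - u (m y z)| `^ p) => x x1 x2 hx x0 x10 x20.
  have y0 : 0 <= by_ by exact: bind_ge0.
  have z0 : 0 <= bz by exact: bind_ge0.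
  have y1 : by_ <= 1 by exact: bind_le1.
  have z1 : bz <= 1 by exact: bind_le1.
  have m0 : 0 <= bm_ by exact: bind_ge0.
  have bmm : by_ * bz <= by_ * bm_ /\ by_ * bz <= bz * bm_.
    move: bm y1 z1; rewrite -/by_ -/bz -/bm_ /by_ /bz /bind.
    by case: (_ < _)%R; case: (_ < _)%R; rewrite ?mul0r ?mulr0 ?mul1r ?mulr1.
  apply: (@le_trans _ _ (by_ * bz * (2 `^ (p - 1) * (x1 + x2)))).
    by rewrite ler_wpM2l ?mulr_ge0.
  rewrite mulrCA; apply: ler_wpM2l => //; rewrite mulrDr; case: bmm => b1 b2.
  by apply: lerD; apply: ler_wpM2r.
under eq_integral => y _.
  rewrite intZl//; last 2 first.
  - apply: emeasurable_funD; apply/measurable_EFinP.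
      exact: (measurable_slice (u := fun y z => G y (m y z)) y (measurable_comp2 mG measurable_fst mm)).
    have h := measurable_comp2 mG measurable_snd mm.
    exact: (measurable_slice (u := fun y z => G z (m y z)) y h).
  - by move=> z; rewrite -EFinD lee_fin addr_ge0.
  rewrite ge0_integralD//; last 4 first.
  - by move=> z _; rewrite lee_fin.
  - apply/measurable_EFinP; exact: (measurable_slice (u := fun y z => G y (m y z)) y (measurable_comp2 mG measurable_fst mm)).
  - by move=> z _; rewrite lee_fin.
  - apply/measurable_EFinP; exact: (measurable_slice (u := fun y z => G z (m y z)) y (measurable_comp2 mG measurable_snd mm)).
  over.
have i1 : measurable_fun setT (fun y => \int[leb]_z (G y (m y z))%:E)%E.
  by apply: (@measurable_int _ _ _ _ _ leb (fun y z => (G y (m y z))%:E)) => // y z; rewrite lee_fin.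
have i2 : measurable_fun setT (fun y => \int[leb]_z (G z (m y z))%:E)%E.
  apply: (@measurable_int _ _ _ _ _ leb (fun y z => (G z (m y z))%:E)).
    apply/measurable_EFinP; exact: (measurable_comp2 mG measurable_snd mm).
  by move=> y z; rewrite lee_fin.
have j1 y : (0 <= \int[leb]_z (G y (m y z))%:E)%E by apply: integral_ge0 => z _; rewrite lee_fin.
have j2 y : (0 <= \int[leb]_z (G z (m y z))%:E)%E by apply: integral_ge0 => z _; rewrite lee_fin.
rewrite intZl//; last 2 first.
- exact: emeasurable_funD i1 i2.
- by move=> y; rewrite adde_ge0.
rewrite (ge0_integralD leb measurableT (fun y _ => j1 y) i1 (fun y _ => j2 y) i2).
rewrite I1 I2 -ge0_muleDl ?lee_fin ?exprn_ge0// muleA -EFinD -EFinM.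
have e : 2 `^ (p - 1) * (2 ^+ n.+1 + 2 ^+ n.+1) = 2 `^ (p + n.+1%:R) :> R.
  by rewrite -mulr2n -mulr_natr powR_add// powR_inv1// powR_add// powR_mulrn//; field.
by rewrite e.
Qed.

Let Rt (k : nat) : R := 2 * t * 2^-1 ^+ k.

Let iterated k : (F (2 * t) <= ((2 `^ (p + n.+1%:R)) ^+ k)%:E * F (Rt k))%E.
Proof.
elim: k => [|k IH]; first by rewrite /Rt !expr0 mulr1 mul1e.
apply: (le_trans IH); rewrite exprSr EFinM -muleA; apply: lee_wpmul2l.
  by rewrite lee_fin exprn_ge0 ?powR_ge0.
have -> : Rt k.+1 = Rt k / 2 by rewrite /Rt exprSr mulrA.
exact: halving.
Qed.

Let Rt0 k : 0 < Rt k. Proof. by rewrite /Rt mulr_gt0 ?mulr_gt0// exprn_gt0// invr_gt0. Qed.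

Let geometric_below (a : R) K : 1 <= a -> \sum_(k < K) Rt k `^ (- a) <= Rt K `^ (- a).
Proof.
move=> a1; elim: K => [|K IH]; first by rewrite big_ord0 powR_ge0.
rewrite big_ord_recr/=; have -> : Rt K.+1 = Rt K * 2^-1 by rewrite /Rt exprSr mulrA.
have h2 : 2 <= 2^-1 `^ (- a) :> R.
  rewrite -[2^-1](@powR_inv1 _ 2)// -powRrM mulN1r opprK.
  by rewrite -[leLHS](@powRr1 _ 2)// ler_powR// ler1n.
rewrite powRM ?invr_ge0 ?(ltW (Rt0 K))//.
have x0 : 0 <= Rt K `^ (- a) by exact: powR_ge0.
apply: (@le_trans _ _ (Rt K `^ (- a) * 2)); first by lra.
by rewrite ler_wpM2l.
Qed.

(** For a pair at distance del, the weights of all scales above del add up to at most twice the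
    kernel at del: by [geometric_below] the smallest such scale dominates the others. *)
Let geometric_above (a del : R) K : 1 <= a -> 0 < del ->
  \sum_(k < K) (del < Rt k)%R%:R * Rt k `^ (- a) <= 2 * del `^ (- a).
Proof.
move=> a1 d0; elim: K => [|K IH]; first by rewrite big_ord0 mulr_ge0 ?powR_ge0.
rewrite big_ord_recr/=; have [dK|_] := ltP del (Rt K); last by rewrite mul0r addr0.
rewrite mul1r.
have h : Rt K `^ (- a) <= del `^ (- a).
  by rewrite !powRN lef_pV2 ?posrE ?powR_gt0// ge0_ler_powR ?nnegrE ?(ltW (Rt0 K)) ?(ltW d0) ?(ltW dK)//; lra.
have h' : \sum_(k < K) (del < Rt k)%R%:R * Rt k `^ (- a) <= Rt K `^ (- a).
  apply: le_trans (geometric_below K a1); apply: ler_sum => k _.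
  by rewrite ler_piMl ?powR_ge0//; case: (_ < _)%R.
by lra.
Qed.

(* The factor [1 - s] comes from summing the halving inequality over all dyadic
   scales: each scale costs only [2 ^ (- p (1 - s))]. *)
Lemma poincare_ball :
  (\int[leb]_y \int[leb]_z (bind c t y * bind c t z * `|u y - u z| `^ p)%:E <=
   (4 * p * (1 - s) * (2 * t) `^ (n.+1%:R + s * p))%:E *
   \int[leb]_y \int[leb]_z (bind c t y * bind c t z *
      (`|u y - u z| `^ p * enorm (y - z) `^ (- (n.+1%:R + s * p))))%:E)%E.
Proof.
have /andP[s0 s1] := s01; have p1' := p1; have p0 : 0 < p by lra.
have n1 : 1 <= n.+1%:R :> R by rewrite ler1n.
pose a := n.+1%:R + s * p.
have a1 : 1 <= a by rewrite /a; have : 0 <= s * p by [rewrite mulr_ge0; lra]; lra.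
set KK := (\int[leb]_y \int[leb]_z (_ * (_ * enorm _ `^ _))%:E)%E.
have KK0 : (0 <= KK)%E.
  by apply: integral_ge0 => y _; apply: integral_ge0 => z _; rewrite lee_fin !mulr_ge0 ?powR_ge0 ?bind_ge0.
have -> : (\int[leb]_y \int[leb]_z (bind c t y * bind c t z * `|u y - u z| `^ p)%:E = F (2 * t))%E.
  apply: eq_integral => y _; apply: eq_integral => z _; congr EFin; rewrite -/(f y z).
  rewrite /f /bind; have [hy|_] := ltP (enorm (y - c)) t; last by rewrite !mul0r.
  have [hz|_] := ltP (enorm (z - c)) t; last by rewrite !(mulr0, mul0r).
  have h : enorm (y - z) < 2 * t.
    by apply: le_lt_trans (enorm_tri c y z) _; rewrite (enormBC c z); lra.
  by rewrite h [RHS]mulr1.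
pose y0 := p * (1 - s); have yp : 0 < y0 by rewrite /y0 mulr_gt0//; lra.
pose th : R := 2^-1 `^ y0; have /andP[th0 th1] := half_pow_lt1 yp.
have th01 : 0 <= th < 1 by rewrite th0.
(* Finitely many scales suffice: with th^K < 1 / 2 the partial sum already exceeds half of 1 / (1 -
   th). *)
have [K hK] : exists K, th ^+ K < 2^-1 by apply: exists_geom_lt; rewrite ?invr_gt0.
have F0 r : (0 <= F r)%E.
  by apply: integral_ge0 => y _; apply: integral_ge0 => z _; rewrite lee_fin mulr_ge0.
(* Each halving loses 2^(p + d) while the weight of the scale gains 2^a with a = d + s p; the
   balance is th = 2^(-p (1 - s)). *)
have step k : (((2 * t) `^ (- a) * th ^+ k)%:E * F (2 * t) <= (Rt k `^ (- a))%:E * F (Rt k))%E.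
  have c0 : (0 <= ((2 * t) `^ (- a) * th ^+ k)%:E)%E by rewrite lee_fin mulr_ge0 ?powR_ge0 ?exprn_ge0.
  apply: le_trans (lee_wpmul2l c0 (iterated k)) _; rewrite muleA -EFinM.
  apply: lee_wpmul2r (F0 _) _ _ _; rewrite lee_fin le_eqVlt; apply/orP; left; apply/eqP.
  rewrite -mulrA -exprMn /Rt.
  have nn1 : 0 <= 2 * t by rewrite mulr_ge0// ltW.
  have nn2 : 0 <= 2^-1 ^+ k :> R by rewrite exprn_ge0// invr_ge0.
  rewrite (powRM _ nn1 nn2); congr (_ * _).
  rewrite -[in RHS]powR_mulrn ?invr_ge0// powRAC powR_mulrn ?powR_ge0//; congr (_ ^+ k).
  rewrite /th -(@powR_inv1 _ 2)// -!powRrM !mulN1r -powR_add//; congr (_ `^ _).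
  by rewrite /y0 /a; ring.
have total : (((2 * t) `^ (- a) * \sum_(k < K) th ^+ k)%R%:E * F (2 * t) <= 2%:E * KK)%E.
  rewrite mulr_sumr -sumEFin ge0_sume_distrl; last first.
    by move=> k _; rewrite lee_fin mulr_ge0 ?powR_ge0 ?exprn_ge0.
  apply: (@le_trans _ _ (\sum_(k < K) ((Rt k `^ (- a))%:E * F (Rt k)))%E).
    by apply: lee_sum => k _; exact: step.
  have mfk k : measurable_fun setT (fun x : V * V => f x.1 x.2 * (enorm (x.1 - x.2) < Rt k)%R%:R).
    by have := mf => mf'; meas.
  have fk0 k y z : 0 <= f y z * (enorm (y - z) < Rt k)%R%:R by rewrite mulr_ge0.
  pose g k y z := ((Rt k `^ (- a))%:E * (f y z * (enorm (y - z) < Rt k)%R%:R)%:E)%E.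
  have g0 k y z : (0 <= g k y z)%E by rewrite /g mule_ge0 ?lee_fin ?powR_ge0.
  have mg k : measurable_fun setT (fun x : V * V => g k x.1 x.2).
    by have := mfk k => mf'; rewrite /g; apply: emeasurable_funM; [meas|exact/measurable_EFinP].
  have E1 k : ((Rt k `^ (- a))%:E * F (Rt k) = \int[leb]_y \int[leb]_z g k y z)%E.
    rewrite /F -intZl ?powR_ge0//; last 2 first.
    - apply: (@measurable_int _ _ _ _ _ leb (fun y z => (f y z * (enorm (y - z) < Rt k)%R%:R)%:E)).
        by apply/measurable_EFinP; exact: mfk.
      by move=> y z; rewrite lee_fin.
    - by move=> y; apply: integral_ge0 => z _; rewrite lee_fin.
    apply: eq_integral => y _; rewrite -intZl ?powR_ge0//.
    - apply/measurable_EFinP.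
      exact: (measurable_slice (u := fun y z => f y z * (enorm (y - z) < Rt k)%R%:R) y (mfk k)).
    - by move=> z; rewrite lee_fin.
  under eq_bigr do rewrite E1.
  rewrite -ge0_integral_sum//; last 2 first.
  - by move=> k; apply: (@measurable_int _ _ _ _ _ leb (g k)).
  - by move=> k y _; apply: integral_ge0.
  have b0 y : (0 <= \sum_(k < K) \int[leb]_z g k y z)%E.
    by apply: sume_ge0 => k _; apply: integral_ge0.
  have q0 y z : 0 <= bind c t y * bind c t z * (`|u y - u z| `^ p * enorm (y - z) `^ (- a)).
    by rewrite !mulr_ge0 ?powR_ge0 ?bind_ge0.
  have mq : measurable_fun setT (fun x : V * V =>
      bind c t x.1 * bind c t x.2 * (`|u x.1 - u x.2| `^ p * enorm (x.1 - x.2) `^ (- a))).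
    by rewrite /bind; meas.
  rewrite /KK -intZl//; last 2 first.
  - apply: (@measurable_int _ _ _ _ _ leb (fun y z => (bind c t y * bind c t z *
      (`|u y - u z| `^ p * enorm (y - z) `^ (- a)))%:E)); first exact/measurable_EFinP.
    by move=> y z; rewrite lee_fin.
  - by move=> y; apply: integral_ge0 => z _; rewrite lee_fin.
  apply: le_int => // y; rewrite -intZl//; last 2 first.
  - apply/measurable_EFinP; exact: (measurable_slice (u := fun y z => bind c t y * bind c t z *
      (`|u y - u z| `^ p * enorm (y - z) `^ (- a))) y mq).
  - by move=> z; rewrite lee_fin.
  rewrite -ge0_integral_sum//; last first.
  - by move=> k; exact: (measurable_slice y (mg k)).
  apply: le_int => z; first by apply: sume_ge0.
  rewrite /g; under eq_bigr do rewrite -EFinM.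
  rewrite sumEFin lee_fin.
  rewrite (_ : \sum_(k < K) _ = f y z * \sum_(k < K) ((enorm (y - z) < Rt k)%R%:R * Rt k `^ (- a))); last first.
    by rewrite mulr_sumr; apply: eq_bigr => k _; ring.
  rewrite /f -mulrA (mulrCA 2); apply: ler_wpM2l; first by rewrite mulr_ge0 ?bind_ge0.
  have := enorm_ge0 (y - z); rewrite le_eqVlt => /predU1P[e|yz].
    have /eqP : enorm (y - z) == 0 by rewrite -e.
    rewrite (mulrC (`|_| `^ p)); move/eqP; rewrite enorm_eq0 subr_eq0 => /eqP ->.
    by rewrite (subrr (u z)) normr0 powR0 ?gt_eqF// mul0r !mulr0.
  by rewrite mulrCA; apply: ler_wpM2l; [exact: powR_ge0|exact: geometric_above].
(* The sum over scales is at least 1 / (2 p (1 - s)); dividing by it gives the factor p (1 - s) of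
   the claim. *)
have geo : (2 * y0)^-1 <= \sum_(k < K) th ^+ k.
  have e : (1 - th) * \sum_(k < K) th ^+ k = 1 - th ^+ K.
    by have := subrX1 th K; rewrite -opprB => h; lra.
  have t10 : 0 < 1 - th by rewrite subr_gt0.
  apply: (@le_trans _ _ (2^-1 * (1 - th)^-1)).
    by rewrite invfM ler_wpM2l ?invr_ge0// geom_ratio_ge.
  by rewrite ler_pdivrMr// mulrC e; lra.
have fin : (((2 * y0)^-1 * (2 * t) `^ (- a))%:E * F (2 * t) <= 2%:E * KK)%E.
  apply: le_trans total; apply: lee_wpmul2r (F0 _) _ _ _; rewrite lee_fin mulrC.
  by rewrite ler_wpM2l ?powR_ge0.
have inv0 : (0 <= (2 * y0 * (2 * t) `^ a)%:E)%E by rewrite lee_fin; exact: mulr_ge0 (mulr_ge0 (ler0n _ 2) (ltW yp)) (powR_ge0 _ _).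
have := lee_wpmul2l inv0 fin; rewrite !muleA -!EFinM.
rewrite (_ : 2 * y0 * (2 * t) `^ a * _ = 1); last first.
  have nz1 : 2 * y0 != 0 by rewrite mulf_neq0// gt_eqF.
  have nz2 : (2 * t) `^ a != 0 by rewrite gt_eqF// powR_gt0// mulr_gt0.
  by rewrite powRN mulrACA (mulfV nz1) (mulfV nz2) mulr1.
rewrite mul1e => /le_trans; apply; apply: lee_wpmul2r => //.
by rewrite lee_fin /y0 -/a le_eqVlt; apply/orP; left; apply/eqP; ring.
Qed.

End poincare.
End balls.

(** * Series of nonnegative terms *)

Section nonnegative_series.
Context {R : realType}.
Local Open Scope ereal_scope.

Lemma nneseries_le_bound (f : nat -> \bar R) (B : \bar R) : (forall i, 0 <= f i) ->
  (forall m, \sum_(0 <= i < m) f i <= B) -> \sum_(i <oo) f i <= B.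
Proof.
move=> f0 h; apply: lime_le; first by apply: is_cvg_nneseries.
by near=> m; exact: h.
Unshelve. all: by end_near. Qed.

Lemma nneseries_finite (f : nat -> \bar R) m : (forall i, 0 <= f i) ->
  (forall i, (m <= i)%N -> f i = 0) -> \sum_(i <oo) f i = \sum_(0 <= i < m) f i.
Proof.
move=> f0 fm; rewrite (@nneseries_split _ f 0%N m)//.
rewrite [X in _ + X](_ : _ = 0) ?adde0// add0n.
by apply: eseries0 => i mi _; exact: fm.
Qed.

Lemma nneseries_ge_term (f : nat -> \bar R) m : (forall i, 0 <= f i) ->
  f m <= \sum_(i <oo) f i.
Proof.
move=> f0; rewrite (@nneseriesD1 _ f m xpredT)// leeDl// nneseries_ge0//.
Qed.

(** Induction over initial segments: the last term of a segment is passed on with factor th / (1 -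
    th), and together with its own occurrence this gives 1 + th / (1 - th) = 1 / (1 - th), so the
    constant does not grow. *)
Lemma chain_sum (th C : R) (P a : nat -> \bar R) J : (0 <= th < 1)%R -> (0 <= C)%R ->
  (forall j, 0 <= P j) -> (forall j, 0 <= a j) ->
  (forall j, (j < J)%N -> P j <= th%:E * P j.+1 + C%:E * a j) ->
  \sum_(0 <= j < J.+1) P j <=
    ((1 - th)^-1)%:E * (P J + C%:E * \sum_(0 <= j < J) a j).
Proof.
move=> /andP[th0 th1] C0 P0 a0 step.
have K0 : (0 < 1 - th)%R by rewrite subr_gt0.
have Kinv : (0 <= (1 - th)^-1)%R by rewrite invr_ge0 ltW.
have Ca j : 0 <= C%:E * \sum_(0 <= i < j) a i by rewrite mule_ge0 ?lee_fin ?sume_ge0.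
have K1 : (1 <= (1 - th)^-1)%R by rewrite invf_ge1//; lra.
have Ke : 0 <= ((1 - th)^-1)%:E by rewrite lee_fin.
suff H j : (j <= J)%N -> \sum_(0 <= i < j.+1) P i <=
    ((1 - th)^-1)%:E * (P j + C%:E * \sum_(0 <= i < j) a i) by exact: H.
elim: j => [|j IH] jJ.
  rewrite big_nat1 big_geq// mule0 adde0 -[leLHS]mul1e; apply: lee_wpmul2r => //.
apply: (@le_trans _ _ (((1 - th)^-1)%:E * (th%:E * P j.+1 + C%:E * a j +
    C%:E * \sum_(0 <= i < j) a i) + P j.+1)).
  rewrite big_nat_recr//=; apply: leeD => //; apply: le_trans (IH (ltnW jJ)) _.
  by apply: lee_wpmul2l => //; apply: leeD => //; exact: step.
rewrite [in leRHS]big_nat_recr//= -addeA -ge0_muleDr ?sume_ge0// [a j + _]addeC.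
set S := C%:E * _.
have S0 : 0 <= S by rewrite /S mule_ge0 ?lee_fin ?adde_ge0 ?sume_ge0.
have tP : 0 <= th%:E * P j.+1 by rewrite mule_ge0.
rewrite !ge0_muleDr// addeAC; apply: leeD => //; rewrite muleA -EFinM.
rewrite -[X in _ + X]mul1e -ge0_muleDl ?lee_fin ?mulr_ge0// -EFinD; apply: lee_wpmul2r => //.
by rewrite lee_fin le_eqVlt; apply/orP; left; apply/eqP; field; rewrite gt_eqF.
Qed.

End nonnegative_series.

(** * Averages over balls *)

Section ball_averages.
Context {R : realType} {n : nat}.
Local Notation V := 'rV[R]_n.+1.
Local Notation leb := (@lebesgue_rV R n.+1).
Local Notation om := (@vball R n).
Let om0 := @vball_gt0 R n.
Local Open Scope ereal_scope.

Definition avg (c : V) (t : R) (f : V -> \bar R) : \bar R :=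
  ((om * t ^+ n.+1)^-1)%:E * \int[leb]_y ((bind c t y)%:E * f y).

Let vol0 (t : R) : (0 < t)%R -> (0 < om * t ^+ n.+1)%R.
Proof. by move=> t0; rewrite mulr_gt0 ?exprn_gt0. Qed.

Let volinv (t : R) : (0 < t)%R -> 0 <= ((om * t ^+ n.+1)^-1)%:E.
Proof. by move=> t0; rewrite lee_fin invr_ge0 ltW// vol0. Qed.

Lemma measurable_bind (c : V) (t : R) : measurable_fun setT (bind c t).
Proof. by rewrite /bind; meas. Qed.

Let b0 c t (f : V -> \bar R) y : 0 <= f y -> 0 <= (bind c t y)%:E * f y.
Proof. by move=> f0; rewrite mule_ge0// lee_fin bind_ge0. Qed.

Lemma avg_ge0 c t f : (0 < t)%R -> (forall y, 0 <= f y) -> 0 <= avg c t f.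
Proof. by move=> t0 f0; rewrite mule_ge0 ?volinv// integral_ge0// => y _; exact: b0. Qed.

Lemma avg_cst c t k : (0 < t)%R -> 0 <= k -> avg c t (fun=> k) = k.
Proof.
move=> t0 k0; rewrite /avg ge0_integralZr//.
- rewrite (_ : \int[leb]_y (bind c t y)%:E = (om * t ^+ n.+1)%:E); last exact: int_eball.
  by rewrite muleA -EFinM mulVf ?mul1e// gt_eqF// vol0.
- by apply/measurable_EFinP; exact: measurable_bind.
- by move=> y _; rewrite lee_fin bind_ge0.
Qed.

Lemma le_avg c t f g : (0 < t)%R -> (forall y, 0 <= f y) ->
  (forall y, (enorm (y - c) < t)%R -> f y <= g y) -> avg c t f <= avg c t g.
Proof.
move=> t0 f0 fg; apply: lee_wpmul2l; first exact: volinv.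
apply: le_int => y; first exact: b0.
by rewrite /bind; case: ltP => [/fg h|_]; rewrite ?mul1e// !mul0e.
Qed.

Lemma avg_ge_cst c t k g : (0 < t)%R -> 0 <= k ->
  (forall y, (enorm (y - c) < t)%R -> k <= g y) -> k <= avg c t g.
Proof.
by move=> t0 k0 kg; rewrite -[leLHS](avg_cst c t0 k0); exact: le_avg.
Qed.

Lemma avgD c t f g : (0 < t)%R -> measurable_fun setT f -> measurable_fun setT g ->
  (forall y, 0 <= f y) -> (forall y, 0 <= g y) ->
  avg c t (fun y => f y + g y) = avg c t f + avg c t g.
Proof.
move=> t0 mf mg f0 g0; have mb := measurable_bind c t.
rewrite /avg -ge0_muleDr; last 2 first.
- by apply: integral_ge0 => y _; exact: b0.
- by apply: integral_ge0 => y _; exact: b0.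
rewrite -ge0_integralD//.
- by congr (_ * _); apply: eq_integral => y _; rewrite ge0_muleDr.
- by move=> y _; exact: b0.
- by meas.
- by move=> y _; exact: b0.
- by meas.
Qed.

Lemma avgZ c t k f : (0 < t)%R -> (0 <= k)%R -> measurable_fun setT f ->
  (forall y, 0 <= f y) -> avg c t (fun y => k%:E * f y) = k%:E * avg c t f.
Proof.
move=> t0 k0 mf f0; have mb := measurable_bind c t.
rewrite /avg [RHS]muleCA; congr (_ * _); rewrite -intZl//.
- by apply: eq_integral => y _; rewrite muleCA.
- by meas.
- by move=> y; exact: b0.
Qed.

Lemma measurable_avg d (T : measurableType d) (c : T -> V) t (f : T -> V -> \bar R) :
  measurable_fun setT c -> measurable_fun setT (fun x : T * V => f x.1 x.2) ->
  (forall x y, 0 <= f x y) -> measurable_fun setT (fun x => avg (c x) t (f x)).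
Proof.
move=> mc mf f0; rewrite /avg; apply: emeasurable_funM; first exact: measurable_cst.
apply: (@measurable_int _ _ _ _ _ leb (fun x y => (bind (c x) t y)%:E * f x y)).
  by rewrite /bind; apply: emeasurable_funM => //; meas.
by move=> x y; exact: b0.
Qed.

Lemma avg_le_int (c : V) (t : R) f (A : V -> R) : (0 < t)%R -> (forall y, 0 <= f y) ->
  (forall y, (enorm (y - c) < t)%R -> (1 <= A y)%R) -> (forall y, 0 <= A y)%R ->
  avg c t f <= ((om * t ^+ n.+1)^-1)%:E * \int[leb]_y ((A y)%:E * f y).
Proof.
move=> t0 f0 A1 A0; apply: lee_wpmul2l; first exact: volinv.
apply: le_int => y; first exact: b0.
apply: lee_wpmul2r => //; rewrite lee_fin /bind; case: ltP => // h; exact: A1.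
Qed.

(** Both indicators are replaced by one weight [A] that is at least 1 on both balls, so that
    averages over different pairs of balls are controlled by the same double integral. *)
Lemma avg_avg_le c1 t1 c2 t2 (A : V -> R) (h : V -> V -> R) :
  (0 < t1)%R -> (0 < t2)%R -> (forall y z, 0 <= h y z)%R ->
  measurable_fun setT (fun x : V * V => h x.1 x.2) -> measurable_fun setT A ->
  (forall y, 0 <= A y)%R ->
  (forall y, (enorm (y - c1) < t1)%R -> (1 <= A y)%R) ->
  (forall y, (enorm (y - c2) < t2)%R -> (1 <= A y)%R) ->
  avg c1 t1 (fun y => avg c2 t2 (fun z => (h y z)%:E)) <=
  ((om * t1 ^+ n.+1)^-1 * (om * t2 ^+ n.+1)^-1)%:E *
    \int[leb]_y \int[leb]_z (A y * A z * h y z)%:E.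
Proof.
move=> t10 t20 h0 mh mA A0 A1 A2.
have hz y z : 0 <= (h y z)%:E by rewrite lee_fin.
have mAh : measurable_fun setT (fun x : V * V => (A x.1 * A x.2 * h x.1 x.2)%:E) by meas.
have Ah0 y z : 0 <= (A y * A z * h y z)%:E by rewrite lee_fin !mulr_ge0.
apply: le_trans (avg_le_int t10 _ A1 A0) _.
  by move=> y; apply: avg_ge0.
rewrite EFinM -muleA; apply: lee_wpmul2l; first exact: volinv.
rewrite -intZl; last 3 first.
- by rewrite invr_ge0 ltW// vol0.
- exact: (@measurable_int _ _ _ _ _ leb (fun y z => (A y * A z * h y z)%:E) mAh Ah0).
- by move=> y; apply: integral_ge0.
apply: le_int => y; first by rewrite mule_ge0 ?lee_fin// avg_ge0.
have Ay : 0 <= (A y)%:E by rewrite lee_fin.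
apply: le_trans (lee_wpmul2l Ay (avg_le_int (c := c2) t20 (hz y) A2 A0)) _.
rewrite muleCA; apply: lee_wpmul2l; first exact: volinv.
have mhy := measurable_slice y mh.
rewrite -intZl//; last 2 first.
- by move: (h y) mhy => hy mhy; meas.
- by move=> z; rewrite mule_ge0// lee_fin.
apply: le_int => z; first by rewrite !mule_ge0 ?lee_fin.
by rewrite -!EFinM mulrA.
Qed.

End ball_averages.

(** [powR_conv] with t = lam^(-1 / (p_hi - 1)): then t^(1 - p) <= lam for all p <= p_hi at once. *)
Lemma powR_almost_additive {R : realType} (lam p_hi : R) : 1 < lam -> 1 < p_hi ->
  exists2 C : R, 0 < C & forall p a b : R, 1 < p <= p_hi -> 0 <= a -> 0 <= b ->
  (a + b) `^ p <= lam * a `^ p + C * b `^ p.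
Proof.
move=> lam1 P1; have lam0 : 0 < lam by lra.
have P0 : 0 < p_hi - 1 by lra.
pose t := lam `^ (- (p_hi - 1)^-1).
have t0 : 0 < t by exact: powR_gt0.
have t1 : t < 1.
  have i0 : 0 < (p_hi - 1)^-1 by rewrite invr_gt0.
  rewrite /t powRN invf_lt1 ?powR_gt0// /powR gt_eqF// -[ltLHS]expR0 ltr_expR.
  by rewrite mulr_gt0// ln_gt0.
have t2 : 0 < 1 - t by lra.
exists ((1 - t) `^ (1 - p_hi)); first exact: powR_gt0.
move=> p a b /andP[p1 pP] a0 b0; have p10 : 0 <= p - 1 by lra.
have t01 : 0 < t < 1 by rewrite t0.
apply: le_trans (powR_conv a0 b0 (ltW p1) t01) _; apply: lerD; apply: ler_wpM2r; rewrite ?powR_ge0//.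
  rewrite /t -powRrM -[leRHS](powRr1 (ltW lam0)); apply: ler_powR; first exact: ltW.
  rewrite mulNr -mulrN opprB mulrC ler_pdivrMr//; lra.
by rewrite ger_powR ?t2//=; lra.
Qed.

(** * Averages at geometric scales in one chart *)

Section chart.
Context {R : realType} {n : nat} (Omega : set 'rV[R]_n.+1).
Local Notation V := 'rV[R]_n.+1.
Local Notation d := (dist_bd Omega).
Local Notation leb := (@lebesgue_rV R n.+1).
Local Notation om := (@vball R n).
Local Notation wt := (wt Omega).
Hypotheses (Olip : lipschitz_domain Omega) (Obnd : bounded_set Omega).
Let oO : open Omega. Proof. by have [] := Olip. Qed.
Let bd0 : boundary Omega !=set0. Proof. by have [] := Olip. Qed.
Let mO : measurable Omega := open_measurable_rV oO.
Let mcO : measurable (~` Omega) := measurableC mO.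
Let om0 := @vball_gt0 R n.

Variables (z v : V) (r M : R).
Hypotheses (r0 : 0 < r) (M0 : 0 < M) (vM : enorm v <= M) (cc : cone_chart Omega r z v).

(** Chosen so that (1 - q) M <= 1: consecutive shifted centres are at most t_j apart, and the next
    ball lies in the triple of the current one. *)
Definition cratio : R := M / (M + 1).
Local Notation q := cratio.
Definition scale (j : nat) : R := r * q ^+ j.
Local Notation tt := scale.

Lemma cratio01 : 0 < q < 1.
Proof.
have h := M0; have M1 : 0 < M + 1 by lra.
by rewrite /cratio divr_gt0//= ltr_pdivrMr//; lra.
Qed.

Lemma cratio_step : (1 - q) * M <= 1.
Proof.
have h := M0; have M1 : 0 < M + 1 by lra.
have -> : 1 - q = (M + 1)^-1 by rewrite /cratio; field; rewrite gt_eqF.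
by rewrite mulrC ler_pdivrMr//; lra.
Qed.

Lemma scale_gt0 j : 0 < tt j.
Proof. by have /andP[q0 _] := cratio01; rewrite /scale mulr_gt0 ?exprn_gt0. Qed.

Lemma scaleS j : tt j.+1 = q * tt j.
Proof. by rewrite /scale exprS mulrCA. Qed.

Lemma scale_leS j : tt j.+1 <= tt j.
Proof.
have /andP[_ q1] := cratio01; rewrite scaleS ler_piMl// ltW//; exact: scale_gt0.
Qed.

Lemma scale_le_r j : tt j <= r.
Proof.
elim: j => [|j IH]; first by rewrite /scale expr0 mulr1.
exact: le_trans (scale_leS j) IH.
Qed.

Definition shift (j : nat) (x : V) : V := x + tt j *: v.

(** A point within t_j of the triple ball is less than 3 t_j + t_j from the shifted point, which is
    the room 4 t allowed by [cone_chart]. *)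
Lemma cone_in j x y : ~ Omega x -> enorm (x - z) < 3 * r -> d x < tt j ->
  enorm (y - shift j x) < 3 * tt j ->
  [/\ Omega y, tt j <= d y & enorm (x - y) <= (M + 3) * tt j].
Proof.
move=> Ox xz dx hy; have t0 := scale_gt0 j; have tr := scale_le_r j; have r0' := r0.
have [y0 Oy0 xy0] := dist_lt_in oO bd0 dx.
have key w : enorm (y - w) < tt j -> Omega w.
  move=> yw; have e : w = x + tt j *: v + (w - shift j x) by rewrite /shift addrC subrK.
  have h4 : enorm (w - shift j x) <= 4 * tt j.
    by have := enorm_tri y w (shift j x); rewrite (enormBC w y); lra.
  rewrite e; have [] := @cc x (tt j) (w - shift j x) _ _ h4; [lra|by rewrite t0|].
  by move=> h _; apply: (h y0 Oy0); lra.
split; first by apply: key; rewrite subrr enorm0.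
- exact: (dist_ge_ball_in oO bd0).
- have -> : x - y = - (tt j *: v) - (y - shift j x).
    by rewrite /shift; apply/rowP => i; rewrite !mxE; ring.
  apply: le_trans (enormB _ _) _; rewrite enormN enormZ gtr0_norm//.
  have : tt j * enorm v <= tt j * M by rewrite ler_wpM2l// ltW.
  by have := hy; lra.
Qed.

Lemma shift_next j x y : enorm (y - shift j.+1 x) < tt j.+1 -> enorm (y - shift j x) < 3 * tt j.
Proof.
move=> h; have t0 := scale_gt0 j; have tS := scale_leS j.
have := enorm_tri (shift j.+1 x) y (shift j x).
have -> : shift j.+1 x - shift j x = ((q - 1) * tt j) *: v.
  by rewrite /shift scaleS; apply/rowP => i; rewrite !mxE; ring.
have /andP[q0 q1] := cratio01.
rewrite enormZ normrM (gtr0_norm t0) ltr0_norm; last by lra.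
have e : (1 - q) * enorm v <= 1.
  by apply: le_trans cratio_step; rewrite ler_wpM2l//; lra.
have : (1 - q) * enorm v * tt j <= 1 * tt j by rewrite ler_wpM2r// ltW.
have -> : - (q - 1) * tt j * enorm v = (1 - q) * enorm v * tt j by ring.
lra.
Qed.

Lemma shift_pair j x x' y : enorm (x - x') < tt j -> enorm (y - shift j x') < tt j ->
  enorm (y - shift j x) < 3 * tt j.
Proof.
move=> xx h; have t0 := scale_gt0 j.
have := enorm_tri (shift j x') y (shift j x).
have -> : shift j x' - shift j x = x' - x.
  by rewrite /shift; apply/rowP => i; rewrite !mxE; ring.
rewrite (enormBC x' x); lra.
Qed.

Section fields.
Variables (s p : R) (u : V -> R).
Hypotheses (mu : measurable_fun setT u).
Local Notation a := (n.+1%:R + s * p).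

Definition near_avg (j : nat) (x : V) : \bar R :=
  avg (shift j x) (tt j) (fun y => (`|u x - u y| `^ p)%:E).

Definition hat (j : nat) (x y : V) : R := bind (shift j x) (3 * tt j) y.

(** The tripled ball contains both the next ball of the same point and the current ball of any point
    closer than t_j, so one oscillation serves [near_avg_step] and [pair_split]. *)
Definition osc (j : nat) (x : V) : \bar R :=
  (((tt j ^+ n.+1 * tt j ^+ n.+1)^-1)%:E *
   \int[leb]_y \int[leb]_w (hat j x y * hat j x w * `|u y - u w| `^ p)%:E)%E.

Lemma near_avg_ge0 j x : (0 <= near_avg j x)%E.
Proof. by apply: avg_ge0; [exact: scale_gt0|move=> y; rewrite lee_fin powR_ge0]. Qed.

Lemma osc_ge0 j x : (0 <= osc j x)%E.
Proof.
apply: mule_ge0; first by rewrite lee_fin invr_ge0 mulr_ge0// exprn_ge0// ltW// scale_gt0.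
apply: integral_ge0 => y _; apply: integral_ge0 => w _.
by rewrite lee_fin !mulr_ge0 ?powR_ge0 ?bind_ge0.
Qed.

Lemma measurable_shift j : measurable_fun setT (shift j).
Proof. by rewrite /shift; meas. Qed.

Lemma measurable_near_avg j : measurable_fun setT (near_avg j).
Proof.
apply: (measurable_avg (tt j) (f := fun x y => (`|u x - u y| `^ p)%:E)).
- exact: measurable_shift.
- by meas.
- by move=> x y; rewrite lee_fin powR_ge0.
Qed.

Lemma measurable_osc j : measurable_fun setT (osc j).
Proof.
have ms := measurable_shift j.
have h0 x y w : (0 <= (hat j x y * hat j x w * `|u y - u w| `^ p)%:E)%E.
  by rewrite lee_fin !mulr_ge0 ?powR_ge0 ?bind_ge0.
apply: emeasurable_funM; first exact: measurable_cst.
apply: (@measurable_int _ _ _ _ _ leb (fun x y => \int[leb]_w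
    (hat j x y * hat j x w * `|u y - u w| `^ p)%:E)%E); last first.
  by move=> x y; apply: integral_ge0.
apply: (@measurable_int _ _ _ _ _ leb (fun (t : V * V) w =>
    (hat j t.1 t.2 * hat j t.1 w * `|u t.2 - u w| `^ p)%:E)%E); last first.
  by move=> t w; exact: h0.
by rewrite /hat /bind; meas.
Qed.

Let tpos j : 0 < tt j ^+ n.+1. Proof. by rewrite exprn_gt0// scale_gt0. Qed.

Let osc_avg j x c1 t1 c2 t2 k : 0 < t1 -> 0 < t2 ->
  (forall y, enorm (y - c1) < t1 -> enorm (y - shift j x) < 3 * tt j) ->
  (forall y, enorm (y - c2) < t2 -> enorm (y - shift j x) < 3 * tt j) ->
  (om * t1 ^+ n.+1)^-1 * (om * t2 ^+ n.+1)^-1 <= k * (tt j ^+ n.+1 * tt j ^+ n.+1)^-1 ->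
  (avg c1 t1 (fun y => avg c2 t2 (fun w => (`|u y - u w| `^ p)%:E)) <= k%:E * osc j x)%E.
Proof.
move=> t10 t20 h1 h2 hk.
have hat1 y : enorm (y - shift j x) < 3 * tt j -> 1 <= hat j x y.
  by rewrite /hat /bind => ->.
apply: le_trans (avg_avg_le (A := hat j x) (h := fun y w => `|u y - u w| `^ p) t10 t20 _ _ _ _ _ _) _.
- by move=> y w; exact: powR_ge0.
- by meas.
- exact: measurable_bind.
- by move=> y; exact: bind_ge0.
- by move=> y /h1; exact: hat1.
- by move=> y /h2; exact: hat1.
rewrite /osc muleA -EFinM; apply: lee_wpmul2r; last by rewrite lee_fin.
apply: integral_ge0 => y _; apply: integral_ge0 => w _.
by rewrite lee_fin !mulr_ge0 ?powR_ge0 ?bind_ge0.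
Qed.

(** A point y' of the next ball is inserted between x and y, and both are averaged: the difference
    of x and y' yields the next average with factor [lam], that of y' and y an oscillation. *)
Lemma near_avg_step (lam C : R) j x : 0 <= lam -> 0 <= C ->
  (forall a b : R, 0 <= a -> 0 <= b -> (a + b) `^ p <= lam * a `^ p + C * b `^ p) -> 0 <= p ->
  (near_avg j x <= lam%:E * near_avg j.+1 x +
     (C * (om * om * q ^+ n.+1)^-1)%:E * osc j x)%E.
Proof.
move=> lam0 C0 hC p0; have tj := scale_gt0 j; have tS := scale_gt0 j.+1.
have /andP[q0 q1] := cratio01.
have N0 := near_avg_ge0 j x.
have lame : (0 <= lam%:E)%E by rewrite lee_fin.
have Ce : (0 <= C%:E)%E by rewrite lee_fin.
have f0 (x' : V) y : (0 <= (`|u x' - u y| `^ p)%:E)%E by rewrite lee_fin powR_ge0.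
have mf (x' : V) : measurable_fun setT (fun y => (`|u x' - u y| `^ p)%:E) by meas.
have mavg : measurable_fun setT (fun y' => avg (shift j x) (tt j) (fun y => (`|u y' - u y| `^ p)%:E)).
  apply: (measurable_avg (c := fun=> shift j x) (tt j) (f := fun x y => (`|u x - u y| `^ p)%:E)).
  - exact: measurable_cst.
  - by meas.
  - by move=> *.
have avg0 y' : (0 <= avg (shift j x) (tt j) (fun y => (`|u y' - u y| `^ p)%:E))%E by apply: avg_ge0.
have step y' : (near_avg j x <= lam%:E * (`|u x - u y'| `^ p)%:E +
    C%:E * avg (shift j x) (tt j) (fun y => (`|u y' - u y| `^ p)%:E))%E.
  have c0 : (0 <= lam%:E * (`|u x - u y'| `^ p)%:E)%E by exact: mule_ge0 lame (f0 x y').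
  rewrite -avgZ// -[X in (X + _)%E](avg_cst (shift j x) tj c0) -avgD//; last 2 first.
  - by apply: emeasurable_funM; [exact: measurable_cst|exact: mf].
  - by move=> y; exact: mule_ge0 Ce (f0 y' y).
  apply: le_avg => // y _; rewrite -!EFinM -EFinD lee_fin.
  apply: le_trans (hC _ _ (normr_ge0 _) (normr_ge0 _)).
  apply: ge0_ler_powR; rewrite ?nnegrE ?addr_ge0//.
  by rewrite (le_trans _ (ler_normD _ _))// addrA subrK.
apply: le_trans (avg_ge_cst (c := shift j.+1 x) tS N0 (fun y _ => step y)) _.
rewrite avgD//; last 4 first.
- by apply: emeasurable_funM; [exact: measurable_cst|exact: mf].
- by apply: emeasurable_funM; [exact: measurable_cst|exact: mavg].
- by move=> y; exact: mule_ge0 lame (f0 x y).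
- by move=> y; exact: mule_ge0 Ce (avg0 y).
rewrite (avgZ (shift j.+1 x) tS lam0 (mf x) (f0 x)) (avgZ (shift j.+1 x) tS C0 mavg avg0).
apply: leeD; first exact: lexx.
rewrite EFinM -muleA; apply: lee_wpmul2l; first exact: Ce.
apply: osc_avg => //.
- exact: shift_next.
- by move=> y; have := tj; lra.
rewrite scaleS exprMn le_eqVlt; apply/orP; left; apply/eqP.
have tn := tpos j; have qn : 0 < q ^+ n.+1 by rewrite exprn_gt0.
by field; rewrite !gt_eqF//; exact: om0.
Qed.

Lemma powR_add3 (a1 a2 a3 : R) : 1 <= p -> 0 <= a1 -> 0 <= a2 -> 0 <= a3 ->
  (a1 + a2 + a3) `^ p <= 4 `^ p * (a1 `^ p + a2 `^ p + a3 `^ p).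
Proof.
move=> p1 h1 h2 h3; have p0 : 0 <= p by lra.
apply: le_trans (powR_add_le (addr_ge0 h1 h2) h3 p1) _.
have h := powR_add_le h1 h2 p1.
have e : 4 `^ p = 2 `^ p * 2 `^ p :> R by rewrite -powRM//; congr (_ `^ _); ring.
have c1 : 1 <= 2 `^ p :> R by rewrite -[leLHS](powRr0 2) ler_powR// ler1n.
have x3 := powR_ge0 a3 p.
rewrite e -mulrA; apply: ler_wpM2l; first exact: powR_ge0.
rewrite mulrDr; apply: lerD => //; by rewrite ler_peMl.
Qed.

(** Two outer points are joined through the shifted balls of x and of x'; the middle difference runs
    between two balls inside the tripled ball of x. *)
Lemma pair_split j x x' : 1 <= p -> enorm (x - x') < tt j ->
  ((`|u x - u x'| `^ p)%:E <= (4 `^ p)%:E *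
    (near_avg j x + ((om * om)^-1)%:E * osc j x + near_avg j x'))%E.
Proof.
move=> p1 xx; have tj := scale_gt0 j; have p0 : 0 <= p by lra.
have f0 (y' : V) y : (0 <= (`|u y' - u y| `^ p)%:E)%E by rewrite lee_fin powR_ge0.
have mf (y' : V) : measurable_fun setT (fun y => (`|u y' - u y| `^ p)%:E) by meas.
have p40 : 0 <= 4 `^ p :> R by exact: powR_ge0.
have oscb : (avg (shift j x) (tt j) (fun y => avg (shift j x') (tt j) (fun y' => (`|u y - u y'| `^ p)%:E))
    <= ((om * om)^-1)%:E * osc j x)%E.
  apply: (osc_avg tj tj).
  - by move=> y; lra.
  - by move=> y; exact: shift_pair.
  - have tn := tpos j; rewrite le_eqVlt; apply/orP; left; apply/eqP.
    by field; rewrite !gt_eqF//; exact: om0.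
have tri y y' : `|u x - u x'| `^ p <=
    4 `^ p * (`|u x - u y| `^ p + `|u y - u y'| `^ p + `|u y' - u x'| `^ p).
  apply: le_trans (powR_add3 p1 (normr_ge0 _) (normr_ge0 _) (normr_ge0 _)).
  apply: ge0_ler_powR; rewrite ?nnegrE ?addr_ge0//.
  have -> : u x - u x' = (u x - u y) + (u y - u y') + (u y' - u x') by ring.
  by rewrite (le_trans (ler_normD _ _))// lerD2r ler_normD.
set c := shift j x; set c' := shift j x'.
have mavg : measurable_fun setT (fun y => avg c' (tt j) (fun y' => (`|u y - u y'| `^ p)%:E)).
  apply: (measurable_avg (c := fun=> c') (tt j) (f := fun x y => (`|u x - u y| `^ p)%:E)).
  - exact: measurable_cst.
  - by meas.
  - by move=> *.
have N0 := near_avg_ge0 j x'.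
have avg0 y : (0 <= avg c' (tt j) (fun y' => (`|u y - u y'| `^ p)%:E))%E by apply: avg_ge0.
have nsym : near_avg j x' = avg c' (tt j) (fun y' => (`|u y' - u x'| `^ p)%:E).
  by rewrite /near_avg; congr avg; apply/funext => y'; rewrite distrC.
have mf' : measurable_fun setT (fun y => (`|u y - u x'| `^ p)%:E) by meas.
have f0' y : (0 <= (`|u y - u x'| `^ p)%:E)%E by rewrite lee_fin powR_ge0.
have step y : ((`|u x - u x'| `^ p)%:E <= (4 `^ p)%:E * ((`|u x - u y| `^ p)%:E +
    avg c' (tt j) (fun y' => (`|u y - u y'| `^ p)%:E) + near_avg j x'))%E.
  apply: (@le_trans _ _ (avg c' (tt j) (fun y' => (4 `^ p)%:E * ((`|u x - u y| `^ p)%:E +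
      (`|u y - u y'| `^ p)%:E + (`|u y' - u x'| `^ p)%:E))%E)).
    apply: (avg_ge_cst tj (f0 x x')) => y' _; rewrite -!EFinD -EFinM lee_fin; exact: tri.
  have m1 : measurable_fun setT (fun y' => (`|u x - u y| `^ p)%:E + (`|u y - u y'| `^ p)%:E)%E.
    by apply: emeasurable_funD (mf y); exact: measurable_cst.
  have m2 : measurable_fun setT (fun y' => (`|u x - u y| `^ p)%:E + (`|u y - u y'| `^ p)%:E +
      (`|u y' - u x'| `^ p)%:E)%E by exact: emeasurable_funD m1 mf'.
  have g1 y' : (0 <= (`|u x - u y| `^ p)%:E + (`|u y - u y'| `^ p)%:E)%E by rewrite adde_ge0.
  rewrite (avgZ c' tj p40 m2); last by move=> y'; rewrite adde_ge0.
  rewrite nsym; apply: lee_wpmul2l; first by rewrite lee_fin.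
  apply: (eq_le_trans (avgD c' tj m1 mf' g1 f0')); apply: leeD; last exact: lexx.
  apply: (eq_le_trans (avgD c' tj (measurable_cst _) (mf y) (fun=> f0 x y) (f0 y))).
  by rewrite (avg_cst c' tj (f0 x y)); exact: lexx.
apply: le_trans (avg_ge_cst (c := c) tj (f0 x x') (fun y _ => step y)) _.
have n1 : measurable_fun setT (fun y => (`|u x - u y| `^ p)%:E +
    avg c' (tt j) (fun y' => (`|u y - u y'| `^ p)%:E))%E by exact: emeasurable_funD (mf x) mavg.
have h1 y : (0 <= (`|u x - u y| `^ p)%:E + avg c' (tt j) (fun y' => (`|u y - u y'| `^ p)%:E))%E.
  exact: adde_ge0 (f0 x y) (avg0 y).
have n2 := emeasurable_funD n1 (measurable_cst (near_avg j x')).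
have h2 y := adde_ge0 (h1 y) N0.
apply: (eq_le_trans (avgZ c tj p40 n2 h2)); apply: lee_wpmul2l; first by rewrite lee_fin.
apply: (eq_le_trans (avgD c tj n1 (measurable_cst (near_avg j x')) h1 (fun=> N0))).
apply: leeD; last by rewrite (avg_cst c tj N0); exact: lexx.
apply: (eq_le_trans (avgD c tj (mf x) mavg (f0 x) avg0)); apply: leeD; first exact: lexx.
exact: oscb.
Qed.

End fields.
End chart.

(** * The terminal scale and the sum of oscillations *)

Section chart_sums.
Context {R : realType} {n : nat} (Omega : set 'rV[R]_n.+1).
Local Notation V := 'rV[R]_n.+1.
Local Notation d := (dist_bd Omega).
Local Notation leb := (@lebesgue_rV R n.+1).
Local Notation om := (@vball R n).
Local Notation wt := (wt Omega).
Hypotheses (Olip : lipschitz_domain Omega) (Obnd : bounded_set Omega).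
Let oO : open Omega. Proof. by have [] := Olip. Qed.
Let bd0 : boundary Omega !=set0. Proof. by have [] := Olip. Qed.
Let mO : measurable Omega := open_measurable_rV oO.
Let mcO : measurable (~` Omega) := measurableC mO.
Let om0 := @vball_gt0 R n.

Definition vker (s p : R) (u : V -> R) (x y : V) : R :=
  `|u x - u y| `^ p * enorm (x - y) `^ (- (n.+1%:R + s * p)).

Lemma vker_ge0 s p u x y : 0 <= vker s p u x y.
Proof. by rewrite /vker mulr_ge0 ?powR_ge0. Qed.

Lemma measurable_vker s p u : measurable_fun setT u ->
  measurable_fun setT (fun t : V * V => vker s p u t.1 t.2).
Proof. by move=> mu; rewrite /vker; meas. Qed.

Definition V_inside (s p : R) (u : V -> R) : \bar R :=
  (\int[leb]_y \int[leb]_w (\1_Omega y * \1_Omega w * vker s p u y w)%:E)%E.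

Definition V_across (s p : R) (u : V -> R) : \bar R :=
  (\int[leb]_x \int[leb]_y (\1_(~` Omega) x * (\1_Omega y * vker s p u x y))%:E)%E.

Variables (z v : V) (r M : R).
Hypotheses (r0 : 0 < r) (M0 : 0 < M) (vM : enorm v <= M) (cc : cone_chart Omega r z v).
Local Notation q := (cratio M).
Local Notation tt := (scale r M).
Local Notation shift := (shift v r M).
Local Notation near_avg := (near_avg v r M).
Local Notation osc := (osc v r M).
Local Notation hat := (hat v r M).

(** The pairs treated in a chart have their first point within 2 r of z and the second less than r
    from the first; the radius 3 r accommodates both. *)
Definition collar (x : V) : R := \1_(~` Omega) x * (enorm (x - z) < 3 * r)%R%:R.
Definition below (j : nat) (x : V) : R := collar x * (d x < tt j)%R%:R.
(** The layer containing x determines its terminal scale, the smallest t_j above d x. *)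
Definition layer (j : nat) (x : V) : R := collar x * (tt j.+1 <= d x < tt j)%R%:R.

Lemma collar_ge0 x : 0 <= collar x.
Proof. by rewrite /collar mulr_ge0. Qed.

Lemma below_ge0 j x : 0 <= below j x.
Proof. by rewrite /below mulr_ge0 ?collar_ge0. Qed.

Lemma layer_ge0 j x : 0 <= layer j x.
Proof. by rewrite /layer mulr_ge0 ?collar_ge0. Qed.

Lemma measurable_below j : measurable_fun setT (below j).
Proof. by rewrite /below /collar; meas. Qed.

Lemma measurable_layer j : measurable_fun setT (layer j).
Proof. by rewrite /layer /collar; meas. Qed.

Lemma belowP j x : below j x = 0 \/
  below j x = 1 /\ [/\ ~ Omega x, enorm (x - z) < 3 * r & d x < tt j].
Proof.
rewrite /below /collar; have [Ox|Ox] := pselect (Omega x).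
  by left; rewrite indicE memNset ?mul0r// => /(_ Ox).
have [xz|_] := ltP (enorm (x - z)) (3 * r); last by left; rewrite mulr0 mul0r.
have [dx|_] := ltP (d x) (tt j); last by left; rewrite mulr0.
by right; split => //; rewrite indicE mem_set// !mulr1.
Qed.

Lemma layerP j x : layer j x = 0 \/
  layer j x = 1 /\ [/\ ~ Omega x, enorm (x - z) < 3 * r, tt j.+1 <= d x & d x < tt j].
Proof.
rewrite /layer /collar; have [Ox|Ox] := pselect (Omega x).
  by left; rewrite indicE memNset ?mul0r// => /(_ Ox).
have [xz|_] := ltP (enorm (x - z)) (3 * r); last by left; rewrite mulr0 mul0r.
have [dx|_] := ltP (d x) (tt j); last by left; rewrite andbF mulr0.
have [dx'|_] := leP (tt j.+1) (d x); last by left; rewrite mulr0.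
by right; split => //; rewrite indicE mem_set// !mulr1.
Qed.

Variables (s_lo p_lo p_hi : R).
Hypotheses (slo01 : 0 < s_lo < 1) (plo1 : 1 < p_lo) (plohi : p_lo <= p_hi).

Let t0 j : 0 < tt j. Proof. exact: scale_gt0. Qed.

Let dim1 : 1 <= n.+1%:R :> R. Proof. by rewrite ler1n. Qed.

Lemma terminal_coef (s p t dx : R) : s_lo <= s < 1 -> p_lo <= p <= p_hi ->
  0 < t -> q * t <= dx ->
  (1 - s) * dx `^ (- s) * t `^ (- (s * (p - 1))) * ((om * t ^+ n.+1)^-1 *
     ((M + 3) * t) `^ (n.+1%:R + s * p)) <=
  q^-1 * om^-1 * (M + 3) `^ (n.+1%:R + p_hi) * (1 - s).
Proof.
have h1 := slo01; have h2 := plo1; have h3 := plohi; have h4 := M0; have h5 := dim1.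
move=> /andP[slo s1] /andP[plo phi] tp qt; have /andP[s_lo0 _] := h1.
have s0 : 0 < s by lra. have s1' : 0 <= 1 - s by lra.
have M3 : 1 <= M + 3 by lra. have M3' : 0 <= M + 3 by lra.
have sp : s * p <= p_hi.
  apply: le_trans phi; rewrite -[leRHS]mul1r; apply: ler_wpM2r; lra.
have /andP[q0 q1] := cratio01 M0.
have qt0 : 0 < q * t by rewrite mulr_gt0.
have dx0 : 0 < dx by exact: lt_le_trans qt.
have e1 : dx `^ (- s) <= q^-1 * t `^ (- s).
  apply: (@le_trans _ _ ((q * t) `^ (- s))).
    have qd : q * t <= 1 * dx by rewrite mul1r.
    have := negpow_le qt0 dx0 ltr01 (ltW s0) qd.
    by rewrite powR1 mul1r.
  rewrite powRM ?(ltW q0) ?(ltW tp)//; apply: ler_wpM2r; first exact: powR_ge0.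
  by rewrite -(powR_inv1 (ltW q0)) ger_powR ?q0 ?ltW//; lra.
have e2 : (M + 3) `^ (n.+1%:R + s * p) <= (M + 3) `^ (n.+1%:R + p_hi).
  by apply: ler_powR => //; lra.
have e3 : t `^ (- s) * t `^ (- (s * (p - 1))) * t `^ (n.+1%:R + s * p) = t ^+ n.+1.
  rewrite -!powR_add// -[RHS](powR_mulrn _ (ltW tp)); congr (_ `^ _); ring.
have tn : 0 < t ^+ n.+1 by rewrite exprn_gt0.
have aux (a1 a2 a3 a4 a5 a6 : R) : a1 * a2 * a3 * (a4 * (a5 * a6)) = a1 * (a4 * a5) * (a2 * a3 * a6).
  by ring.
rewrite powRM ?(ltW tp)// aux.
set A := (M + 3) `^ _ in e2 *; set B := (M + 3) `^ _ in e2 *.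
have A0 : 0 <= A by exact: powR_ge0.
apply: (@le_trans _ _ ((1 - s) * ((om * t ^+ n.+1)^-1 * B) * (q^-1 * t ^+ n.+1))).
  apply: ler_pM.
  - by rewrite !mulr_ge0 ?invr_ge0 ?mulr_ge0 ?(ltW om0) ?(ltW tn).
  - by rewrite !mulr_ge0 ?powR_ge0.
  - apply: ler_wpM2l => //; apply: ler_wpM2l => //.
    by rewrite invr_ge0 mulr_ge0 ?(ltW om0) ?(ltW tn).
  - have aux3 (k a b c : R) : k * (a * b * c) = k * a * b * c by ring.
    rewrite -e3 aux3; apply: ler_wpM2r; first exact: powR_ge0.
    by apply: ler_wpM2r; first exact: powR_ge0.
rewrite le_eqVlt; apply/orP; left; apply/eqP.
by field; rewrite !gt_eqF.
Qed.

(** On the layer, d x is comparable to t_j, and |x - y| is at most (M + 3) t_j for y in the shifted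
    ball. The powers -s of d x, -s (p - 1) and -d of t_j therefore combine to the kernel of
    [V_space], and the factor 1 - s of the density survives. *)
Lemma terminal_bound s p u j x : s_lo <= s < 1 -> p_lo <= p <= p_hi -> measurable_fun setT u ->
  ((wt s p x)%:E * ((layer j x * tt j `^ (- (s * (p - 1))))%:E * near_avg p u j x) <=
   (q^-1 * om^-1 * (M + 3) `^ (n.+1%:R + p_hi) * (1 - s))%:E *
   ((layer j x)%:E * \int[leb]_y (\1_Omega y * vker s p u x y)%:E))%E.
Proof.
move=> hs hp mu; have /andP[slo s1] := hs; have /andP[plo phi] := hp.
have /andP[s_lo0 _] := slo01.
have s0 : 0 < s := lt_le_trans s_lo0 slo.
have p1 : 1 < p := lt_le_trans plo1 plo.
have p0 : 0 < p := lt_trans ltr01 p1.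
have [->|[-> [Ox xz dx1 dx2]]] := layerP j x.
  by rewrite mul0r !mul0e !mule0.
rewrite mul1r mul1e.
have tj := t0 j; have aa : 0 <= n.+1%:R + s * p by rewrite addr_ge0// mulr_ge0// ltW.
set W := (\int[leb]_y _)%E.
have v0 y : 0 <= \1_Omega y * vker s p u x y by rewrite mulr_ge0 ?vker_ge0.
have W0 : (0 <= W)%E by apply: integral_ge0 => y _; rewrite lee_fin.
have mv := measurable_slice x (measurable_vker s p mu).
pose B := ((M + 3) * tt j) `^ (n.+1%:R + s * p).
have B0 : 0 <= B by exact: powR_ge0.
have hN : (near_avg p u j x <= ((om * tt j ^+ n.+1)^-1 * B)%:E * W)%E.
  rewrite EFinM -muleA /near_avg /avg; apply: lee_wpmul2l.
    by rewrite lee_fin invr_ge0 mulr_ge0 ?exprn_ge0 ?(ltW om0) ?(ltW tj).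
  rewrite /W -intZl//; last by move: (vker s p u x) mv => vx mv; meas.
  apply: le_int => y; first by rewrite mule_ge0 ?lee_fin ?bind_ge0 ?powR_ge0.
  rewrite -!EFinM lee_fin /bind; case: ltP => hy; last by rewrite mul0r mulr_ge0.
  have y3 : enorm (y - shift j x) < 3 * tt j.
    by apply: lt_le_trans hy _; rewrite ler_peMl ?ler1n// ltW.
  have [Oy _ xy] := cone_in Olip r0 M0 vM cc Ox xz dx2 y3.
  rewrite mul1r indicE mem_set// mul1r /vker mulrCA ler_peMr ?powR_ge0//.
  have xy0 : 0 < enorm (x - y).
    rewrite enormBC; apply: lt_le_trans (dist_cross_in oO bd0 Oy Ox); exact: (dist_gt0 oO bd0).
  rewrite powRN ler_pdivlMr ?powR_gt0// mul1r; apply: ge0_ler_powR => //.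
  - by rewrite nnegrE ltW.
  - by rewrite nnegrE mulr_ge0 ?addr_ge0 ?(ltW M0) ?(ltW tj).
have w0 : 0 <= wt s p x by exact: wt_ge0.
have wle : wt s p x <= (1 - s) * d x `^ (- s) by apply: wt_le; rewrite ?s0// ltW.
have c1 : (0 <= (tt j `^ (- (s * (p - 1))))%:E)%E by rewrite lee_fin powR_ge0.
have c2 : (0 <= (wt s p x)%:E)%E by rewrite lee_fin.
apply: le_trans (lee_wpmul2l c2 (lee_wpmul2l c1 hN)) _.
rewrite !muleA -!EFinM; apply: lee_wpmul2r => //; rewrite lee_fin.
have qtd : q * tt j <= d x by rewrite -scaleS.
apply: le_trans (terminal_coef hs hp tj qtd).
apply: ler_wpM2r; first by rewrite mulr_ge0 ?invr_ge0 ?mulr_ge0 ?exprn_ge0 ?(ltW om0) ?(ltW tj).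
by apply: ler_wpM2r => //; exact: powR_ge0.
Qed.

Lemma scale_sum (D : R) m : 0 < D ->
  \sum_(0 <= j < m) (tt j <= D)%R%:R * tt j <= D / (1 - q).
Proof.
move=> D0; have /andP[q0 q1] := cratio01 M0; have q1' : 0 < 1 - q by rewrite subr_gt0.
(* Subtracting the minimum makes the bound inductive: the term t_m is paid by the drop from t_m to q
   t_m. *)
suff h : \sum_(0 <= j < m) (tt j <= D)%R%:R * tt j <= (D - Num.min D (tt m)) / (1 - q).
  apply: le_trans h _; apply: ler_wpM2r; first by rewrite invr_ge0 ltW.
  by rewrite gerBl le_min (ltW D0) (ltW (t0 m)).
elim: m => [|m IH].
  by rewrite big_geq// divr_ge0 ?(ltW q1')// subr_ge0 ge_min lexx.
rewrite big_nat_recr//=; apply: le_trans (lerD IH (lexx _)) _.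
rewrite ler_pdivlMr// mulrDl divfK ?gt_eqF// scaleS.
have tm := t0 m; have qtm : q * tt m <= tt m by rewrite ler_piMl// ltW.
case: (leP (tt m) D) => h.
  rewrite mul1r (min_r (le_trans qtm h)).
  by rewrite le_eqVlt; apply/orP; left; apply/eqP; ring.
by rewrite !mul0r addr0 subrr subr_ge0 ge_min lexx.
Qed.

Lemma osc_coef (s p t : R) : s_lo <= s < 1 -> p_lo <= p <= p_hi -> 0 < t ->
  t `^ (- (s * (p - 1))) * ((t ^+ n.+1 * t ^+ n.+1)^-1 *
     (4 * p * (1 - s) * (2 * (3 * t)) `^ (n.+1%:R + s * p))) <=
  4 * p_hi * 6 `^ (n.+1%:R + p_hi) * (1 - s) * t `^ (s - n.+1%:R).
Proof.
have h1 := slo01; have h2 := plo1; have h3 := plohi; have h5 := dim1.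
move=> /andP[slo s1] /andP[plo phi] tp; have /andP[s_lo0 _] := h1.
have s0 : 0 < s by lra. have s1' : 0 <= 1 - s by lra.
have sp : s * p <= p_hi.
  apply: le_trans phi; rewrite -[leRHS]mul1r; apply: ler_wpM2r; lra.
have c1 : 4 * p <= 4 * p_hi by lra. have c2 : 0 <= 4 * p by lra.
have e6 : 6 `^ (n.+1%:R + s * p) <= 6 `^ (n.+1%:R + p_hi) :> R.
  by apply: ler_powR; [rewrite ler1n|lra].
have e3 : t `^ (- (s * (p - 1))) * t `^ (n.+1%:R + s * p) * (t ^+ n.+1 * t ^+ n.+1)^-1 =
    t `^ (s - n.+1%:R).
  have -> : t ^+ n.+1 * t ^+ n.+1 = t `^ (n.+1%:R + n.+1%:R).
    by rewrite powR_add// powR_mulrn// ltW.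
  by rewrite -powRN -!powR_add//; congr (_ `^ _); ring.
have aux (a1 a2 a3 a4 a5 a6 : R) : a1 * (a2 * (a3 * a4 * (a5 * a6))) = a3 * a5 * a4 * (a1 * a6 * a2).
  by ring.
have -> : 2 * (3 * t) = 6 * t by ring.
rewrite powRM ?(ltW tp)// aux e3; apply: ler_wpM2r; first exact: powR_ge0.
by apply: ler_wpM2r => //; apply: ler_pM => //; exact: powR_ge0.
Qed.

Definition inside (s p : R) (u : V -> R) (y : V) : \bar R :=
  (\int[leb]_w (\1_Omega y * \1_Omega w * vker s p u y w)%:E)%E.

Lemma indic_vker_ge0 s p u y w : 0 <= \1_Omega y * \1_Omega w * vker s p u y w.
Proof. by apply: mulr_ge0; [rewrite mulr_ge0|exact: vker_ge0]. Qed.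

Lemma inside_ge0 s p u y : (0 <= inside s p u y)%E.
Proof. by apply: integral_ge0 => w _; rewrite lee_fin indic_vker_ge0. Qed.

Lemma inside_out s p u y : ~ Omega y -> inside s p u y = 0%E.
Proof.
move=> Oy; rewrite /inside; under eq_integral do rewrite indicE memNset// !mul0r.
exact: integral0.
Qed.

Lemma measurable_inside s p u : measurable_fun setT u -> measurable_fun setT (inside s p u).
Proof.
move=> mu; have mv := measurable_vker s p mu.
apply: (@measurable_int _ _ _ _ _ leb (fun y w => (\1_Omega y * \1_Omega w * vker s p u y w)%:E)).
  by meas.
by move=> y w; rewrite lee_fin indic_vker_ge0.
Qed.

(** The factor (M + 4) t_j / d y is at least 1 where it is used, because d y <= |x - y| < (M + 4)
    t_j. It is inserted so that, for fixed y, the sum over the scales t_j <= d y is controlled by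
    [scale_sum]. *)
Definition osc_weight (s : R) (j : nat) (x y : V) : R :=
  ((enorm (x - y) < (M + 4) * tt j)%R%:R * d x `^ (- s)) *
  ((tt j <= d y)%R%:R * ((M + 4) * tt j * d y `^ (-1))).

Lemma osc_weight_ge0 s j x y : 0 <= osc_weight s j x y.
Proof.
have dy := dist_ge0 bd0 y; have tj := ltW (t0 j); have M4 : 0 <= M + 4 by rewrite addr_ge0// ltW.
apply: mulr_ge0; first by rewrite mulr_ge0 ?powR_ge0.
by apply: mulr_ge0 => //; apply: mulr_ge0; [exact: mulr_ge0 M4 tj|exact: powR_ge0].
Qed.

Lemma measurable_osc_weight s j :
  measurable_fun setT (fun t : V * V => osc_weight s j t.1 t.2).
Proof. by rewrite /osc_weight; meas. Qed.

(** The Poincare inequality on the ball of radius 3 t_j, which [cone_in] places in [Omega]; the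
    inner variable is then released to all of [Omega], and the outer one keeps [osc_weight]. *)
Lemma osc_pointwise s p u j x : s_lo <= s < 1 -> p_lo <= p <= p_hi -> measurable_fun setT u ->
  ((wt s p x)%:E * ((below j x * tt j `^ (- (s * (p - 1))))%:E * osc p u j x) <=
   ((1 - s) * (4 * p_hi * 6 `^ (n.+1%:R + p_hi) * (1 - s) * tt j `^ (s - n.+1%:R)))%:E *
   \int[leb]_y ((osc_weight s j x y)%:E * inside s p u y))%E.
Proof.
move=> hs hp mu; have /andP[slo s1] := hs; have /andP[plo phi] := hp.
have /andP[s_lo0 _] := slo01.
have s0 : 0 < s := lt_le_trans s_lo0 slo.
have p1 : 1 < p := lt_le_trans plo1 plo.
have s01 : 0 < s < 1 by rewrite s0.
have s1' : 0 <= 1 - s by rewrite subr_ge0 ltW.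
have ph0 : 0 <= p_hi by apply: le_trans phi; rewrite (le_trans ler01)// ltW.
have tj := t0 j; have tj3 : 0 < 3 * tt j by rewrite mulr_gt0.
have mv := measurable_vker s p mu; have mi := measurable_inside s p mu.
have mo := measurable_osc_weight s j.
have W0 y : (0 <= (osc_weight s j x y)%:E * inside s p u y)%E.
  by rewrite mule_ge0 ?inside_ge0// lee_fin osc_weight_ge0.
set RI := (\int[leb]_y (_ * inside s p u y))%E.
have RI0 : (0 <= RI)%E by exact: integral_ge0.
have [->|[-> [Ox xz dx]]] := belowP j x.
  rewrite mul0r !mul0e mule0; apply: mule_ge0 => //; rewrite lee_fin.
  by rewrite !mulr_ge0 ?powR_ge0.
rewrite mul1r /osc.
set I0 := (\int[leb]_y \int[leb]_w _)%E.
pose I1 := (\int[leb]_y \int[leb]_w (hat j x y * hat j x w * vker s p u y w)%:E)%E.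
have h0 y w : 0 <= hat j x y * hat j x w * vker s p u y w.
  exact: mulr_ge0 (mulr_ge0 (bind_ge0 _ _ _) (bind_ge0 _ _ _)) (vker_ge0 _ _ _ _ _).
have mh : measurable_fun setT (fun t : V * V => (hat j x t.1 * hat j x t.2 * vker s p u t.1 t.2)%:E).
  by rewrite /hat /bind; meas.
have I10 : (0 <= I1)%E by apply: integral_ge0 => y _; apply: integral_ge0 => w _; rewrite lee_fin.
have e1 : (I0 <= (4 * p * (1 - s) * (2 * (3 * tt j)) `^ (n.+1%:R + s * p))%:E * I1)%E.
  exact: (poincare_ball (shift j x) mu tj3 p1 s01).
have e2 : ((d x `^ (- s))%:E * I1 <= RI)%E.
  have h0e y w : (0 <= (hat j x y * hat j x w * vker s p u y w)%:E)%E by rewrite lee_fin.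
  have mi1 := @measurable_int _ _ _ _ _ leb (fun y w => (hat j x y * hat j x w * vker s p u y w)%:E) mh h0e.
  have i10 y : (0 <= \int[leb]_w (hat j x y * hat j x w * vker s p u y w)%:E)%E by exact: integral_ge0.
  rewrite /I1 -(intZl leb (powR_ge0 _ _) mi1 i10).
  apply: le_int => y.
    by apply: mule_ge0; [rewrite lee_fin powR_ge0|apply: integral_ge0 => w _; rewrite lee_fin].
  have [hy|hy] := ltP (enorm (y - shift j x)) (3 * tt j); last first.
    rewrite (_ : (\int[leb]_w _ = 0)%E) ?mule0//.
    by apply: integral0_eq => w _; rewrite /hat /bind ltNge hy !mul0r.
  have [Oy tdy xy] := cone_in Olip r0 M0 vM cc Ox xz dx hy.
  have xy' : enorm (x - y) < (M + 4) * tt j.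
    by apply: le_lt_trans xy _; rewrite ltr_pM2r// ltrD2l ltr_nat.
  have dy0 := dist_gt0 oO bd0 Oy.
  have dyx : d y <= enorm (x - y) by rewrite enormBC; exact: dist_cross_in.
  apply: lee_pmul.
  - by rewrite lee_fin powR_ge0.
  - by apply: integral_ge0 => w _; rewrite lee_fin.
  - rewrite lee_fin /osc_weight xy' tdy mul1r mul1r powR_inv1 ?(ltW dy0)// ler_peMr ?powR_ge0// ler_pdivlMr// mul1r.
    exact: le_trans dyx (ltW xy').
  - apply: le_int => w; first by rewrite lee_fin.
    rewrite lee_fin; apply: ler_wpM2r; first exact: vker_ge0.
    rewrite indicE mem_set// mul1r /hat /bind hy mul1r.
    case: ltP => // hw; have [Ow _ _] := cone_in Olip r0 M0 vM cc Ox xz dx hw.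
    by rewrite indicE mem_set.
have wle : wt s p x <= (1 - s) * d x `^ (- s) by apply: wt_le; rewrite ?s0// ltW.
have w0 : 0 <= wt s p x by exact: wt_ge0.
have k := osc_coef hs hp tj.
set c1 := tt j `^ _ in k *; set c2 := (_ * _)^-1 in k *; set c3 := 4 * p * _ * _ in k e1 *.
have c10 : 0 <= c1 by exact: powR_ge0.
have c20 : 0 <= c2 by rewrite invr_ge0 mulr_ge0 ?exprn_ge0// ltW.
set K := 4 * p_hi * _ * _ * _ in k *.
have K0 : 0 <= K by rewrite /K !mulr_ge0 ?powR_ge0.
have c30 : 0 <= c3.
  apply: mulr_ge0; last exact: powR_ge0.
  by apply: mulr_ge0 => //; rewrite mulr_ge0// ltW// (lt_trans ltr01).
have w0e : (0 <= (wt s p x)%:E)%E by rewrite lee_fin.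
have c1e : (0 <= c1%:E)%E by rewrite lee_fin.
have c2e : (0 <= c2%:E)%E by rewrite lee_fin.
apply: le_trans (lee_wpmul2l w0e (lee_wpmul2l c1e (lee_wpmul2l c2e e1))) _.
rewrite !muleA -!EFinM.
have aux (a b1 b2 b3 : R) : a * b1 * b2 * b3 = a * (b1 * (b2 * b3)) by ring.
rewrite aux; apply: (@le_trans _ _ (((1 - s) * d x `^ (- s) * K)%:E * I1)%E).
  apply: lee_wpmul2r => //; rewrite lee_fin; apply: ler_pM => //.
  exact: mulr_ge0 c10 (mulr_ge0 c20 c30).
have aux2 (a b k' : R) : a * b * k' = a * k' * b by ring.
rewrite aux2 EFinM -muleA; apply: lee_wpmul2l => //; rewrite lee_fin; exact: mulr_ge0.
Qed.

Lemma below_term_ge0 s p e j x (f : \bar R) : s < 1 -> (0 <= f)%E ->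
  (0 <= (wt s p x)%:E * ((below j x * tt j `^ e)%:E * f))%E.
Proof.
move=> s1 f0; apply: mule_ge0; first by rewrite lee_fin wt_ge0.
by apply: mule_ge0 => //; rewrite lee_fin; exact: mulr_ge0 (below_ge0 _ _) (powR_ge0 _ _).
Qed.

(** Tonelli lets [ball_weight_unif] integrate in x and [scale_sum] sum over j for fixed y. One
    factor 1 - s comes from [mu_s] and one from the Poincare inequality; the integral of the weight
    consumes one of them. *)
Lemma exists_osc_bound : exists2 C : R, 0 < C &
  forall s p u, s_lo <= s < 1 -> p_lo <= p <= p_hi -> measurable_fun setT u ->
  (\sum_(j <oo) \int[leb]_x ((wt s p x)%:E *
      ((below j x * tt j `^ (- (s * (p - 1))))%:E * osc p u j x)) <=
   (C * (1 - s))%:E * V_inside s p u)%E.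
Proof.
have h1 := slo01; have h2 := plo1; have h3 := plohi.
have M4 : 1 <= M + 4 by have := M0; lra.
have M40 : 0 < M + 4 by lra.
have /andP[q0 q1] := cratio01 M0; have q1' : 0 < 1 - q by rewrite subr_gt0.
have [C1 C10 hC1] := ball_weight_unif Olip Obnd ((M + 4) * r).
have [K defK K0] : exists2 K, K = 4 * p_hi * 6 `^ (n.+1%:R + p_hi) & 0 < K.
  by eexists; first reflexivity; rewrite !mulr_gt0 ?powR_gt0//; lra.
pose C := K * C1 * (M + 4) ^+ n.+1 * (M + 4) / (1 - q).
have C0 : 0 < C.
  apply: divr_gt0 => //; apply: mulr_gt0 => //; apply: mulr_gt0; last by rewrite exprn_gt0.
  exact: mulr_gt0.
exists C => // s p u hs hp mu; have /andP[slo s1] := hs; have /andP[s_lo0 _] := slo01.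
have s0 : 0 < s by lra.
have s01 : 0 < s < 1 by rewrite s0.
have s1' : 0 < 1 - s by rewrite subr_gt0.
have mi := measurable_inside s p mu.
have i0 := inside_ge0 s p u.
have ow0 := osc_weight_ge0 s.
pose k j := (1 - s) * (K * (1 - s) * tt j `^ (s - n.+1%:R)).
have k0 j : 0 <= k j.
  apply: mulr_ge0 (ltW s1') _; apply: mulr_ge0; last exact: powR_ge0.
  exact: mulr_ge0 (ltW K0) (ltW s1').
pose c j y := k j * ((tt j <= d y)%R%:R * ((M + 4) * tt j * d y `^ (-1)) *
   (C1 * ((M + 4) * tt j) `^ (n.+1%:R - s) / (1 - s))).
have dy0 y := dist_ge0 bd0 y.
have c0 j y : 0 <= c j y.
  have tj := ltW (t0 j); apply: mulr_ge0 (k0 j) _; apply: mulr_ge0.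
    apply: mulr_ge0 => //; apply: mulr_ge0; last exact: powR_ge0.
    exact: mulr_ge0 (ltW M40) tj.
  by apply: divr_ge0; [exact: mulr_ge0 (ltW C10) (powR_ge0 _ _)|exact: ltW].
have mc j : measurable_fun setT (c j) by rewrite /c; meas.
have ci0 j y : (0 <= (c j y)%:E * inside s p u y)%E by rewrite mule_ge0 ?lee_fin.
have mci j : measurable_fun setT (fun y => (c j y)%:E * inside s p u y)%E.
  by have := mc j; move: (c j) => cj mcj; meas.
have term j : (\int[leb]_x ((wt s p x)%:E *
      ((below j x * tt j `^ (- (s * (p - 1))))%:E * osc p u j x)) <=
    \int[leb]_y ((c j y)%:E * inside s p u y))%E.
  have mo := measurable_osc_weight s j.
  have g0 x y : (0 <= (osc_weight s j x y)%:E * inside s p u y)%E.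
    by rewrite mule_ge0 ?lee_fin.
  have mg : measurable_fun setT (fun t : V * V => (osc_weight s j t.1 t.2)%:E * inside s p u t.2)%E.
    by meas.
  have mg' : measurable_fun setT (fun t : V * V => (osc_weight s j t.2 t.1)%:E * inside s p u t.1)%E.
    by meas.
  apply: (@le_trans _ _ (\int[leb]_x ((k j)%:E * \int[leb]_y ((osc_weight s j x y)%:E * inside s p u y)))%E).
    apply: le_int => x; first by apply: below_term_ge0 s1 _; exact: osc_ge0.
    rewrite /k defK; exact: (osc_pointwise j x hs hp mu).
  rewrite intZl//; last 2 first.
  - exact: (@measurable_int _ _ _ _ _ leb (fun x y => (osc_weight s j x y)%:E * inside s p u y)%E mg g0).
  - by move=> x; exact: integral_ge0.
  rewrite (@tonelli _ _ _ _ _ leb leb (fun x y => ((osc_weight s j x y)%:E * inside s p u y)%E) mg g0).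
  rewrite -intZl//; last 2 first.
  - exact: (@measurable_int _ _ _ _ _ leb (fun y x => (osc_weight s j x y)%:E * inside s p u y)%E mg' (fun y x => g0 x y)).
  - by move=> y; exact: integral_ge0.
  apply: le_int => y.
    by apply: mule_ge0; [rewrite lee_fin|exact: integral_ge0].
  rewrite ge0_integralZr//; last 2 first.
  - apply/measurable_EFinP; exact: (measurable_comp2 mo (@measurable_id _ _ _) (measurable_cst y)).
  - by move=> x _; rewrite lee_fin.
  rewrite muleA; apply: lee_wpmul2r => //; rewrite /c [leRHS]EFinM; apply: lee_wpmul2l; first by rewrite lee_fin.
  rewrite /osc_weight; under eq_integral do rewrite mulrC EFinM.
  have f0 : 0 <= (tt j <= d y)%R%:R * ((M + 4) * tt j * d y `^ (-1)).
    have tj := ltW (t0 j); apply: mulr_ge0 => //; apply: mulr_ge0; last exact: powR_ge0.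
    exact: mulr_ge0 (ltW M40) tj.
  rewrite intZl//; last 2 first.
  - by meas.
  - by move=> x; rewrite lee_fin mulr_ge0 ?powR_ge0.
  rewrite [leRHS]EFinM; apply: lee_wpmul2l; first by rewrite lee_fin.
  apply: hC1 => //; rewrite mulr_gt0//= ler_pM2l//; exact: scale_le_r.
apply: nneseries_le_bound => [j|m].
  by apply: integral_ge0 => x _; apply: below_term_ge0 s1 _; exact: osc_ge0.
apply: (@le_trans _ _ (\sum_(0 <= j < m) \int[leb]_y ((c j y)%:E * inside s p u y))%E).
  by apply: lee_sum => j _; exact: term.
rewrite -ge0_integral_sum//.
have Ks : 0 <= C * (1 - s) by rewrite mulr_ge0// ltW.
rewrite /V_inside -intZl//.
apply: le_int => y; first exact: sume_ge0.
rewrite -ge0_sume_distrl; last by move=> j _; rewrite lee_fin.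
rewrite sumEFin.
have [Oy|Oy] := pselect (Omega y); last first.
  by rewrite (inside_out s p u Oy) mule0; apply: mule_ge0; [rewrite lee_fin|exact: inside_ge0].
apply: lee_wpmul2r => //; rewrite lee_fin.
have yp := dist_gt0 oO bd0 Oy.
(* The powers s - d of t_j from the Poincare inequality and d - s from the weight cancel; only t_j /
   d y remains to be summed. *)
apply: (@le_trans _ _ (\sum_(0 <= j < m) (K * (1 - s) * C1 * (M + 4) ^+ n.+1 * (M + 4) / d y) *
    ((tt j <= d y)%R%:R * tt j))).
  apply: ler_sum => j _; have tj := t0 j.
  have e1 : ((M + 4) * tt j) `^ (n.+1%:R - s) <= (M + 4) ^+ n.+1 * tt j `^ (n.+1%:R - s).
    rewrite powRM ?(ltW M40) ?(ltW tj)//; apply: ler_wpM2r; first exact: powR_ge0.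
    by rewrite -powR_mulrn ?(ltW M40)// ler_powR// gerBl ltW.
  have e2 : tt j `^ (s - n.+1%:R) * tt j `^ (n.+1%:R - s) = 1.
    by rewrite -powR_add// (_ : s - _ + _ = 0) ?powRr0//; ring.
  have aux (a K' b X L t dd Cc Y : R) : a != 0 ->
     a * (K' * a * X) * (b * (L * t * dd) * (Cc * Y / a)) = K' * a * Cc * L * dd * (b * t) * (X * Y).
    by move=> a0; field.
  rewrite /c /k powR_inv1 ?(ltW yp)// aux; last by rewrite gt_eqF.
  set b := (_ <= _)%R%:R.
  have b0 : 0 <= b by [].
  apply: (@le_trans _ _ (K * (1 - s) * C1 * (M + 4) / d y * (b * tt j) *
      (tt j `^ (s - n.+1%:R) * ((M + 4) ^+ n.+1 * tt j `^ (n.+1%:R - s))))).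
    apply: ler_wpM2l.
      exact: mulr_ge0 (divr_ge0 (mulr_ge0 (mulr_ge0 (mulr_ge0 (ltW K0) (ltW s1')) (ltW C10))
        (ltW M40)) (ltW yp)) (mulr_ge0 b0 (ltW tj)).
    by apply: ler_wpM2l => //; exact: powR_ge0.
  rewrite (mulrCA (tt j `^ _)) e2 mulr1 le_eqVlt; apply/orP; left; apply/eqP; ring.
rewrite -mulr_sumr.
apply: (@le_trans _ _ (K * (1 - s) * C1 * (M + 4) ^+ n.+1 * (M + 4) / d y * (d y / (1 - q)))).
  apply: ler_wpM2l; last exact: scale_sum.
  by rewrite !mulr_ge0 ?invr_ge0 ?exprn_ge0 ?(ltW K0) ?(ltW s1') ?(ltW C10) ?(ltW M40) ?(ltW yp).
rewrite /C le_eqVlt; apply/orP; left; apply/eqP; field.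
by rewrite !gt_eqF.
Qed.

End chart_sums.

Lemma combine_scaled {R : realType} (k a b c e : R) (x y : \bar R) :
  0 <= k -> 0 <= a -> 0 <= b -> 0 <= c -> 0 <= e -> (0 <= x)%E -> (0 <= y)%E ->
  (k%:E * ((a * e)%:E * y + c%:E * ((b * e)%:E * x)) <= (k * (1 + a + c * b) * e)%:E * (x + y))%E.
Proof.
move=> k0 a0 b0 c0 e0 x0 y0; rewrite addeC muleA -EFinM.
rewrite (_ : k * (1 + a + c * b) * e = k * e * (1 + c * b + a)); last by ring.
rewrite [in leRHS]EFinM -[leRHS]muleA.
apply: (@le_trans _ _ ((k * e)%:E * ((c * b)%:E * x + a%:E * y))%E); last first.
  apply: lee_wpmul2l; first by rewrite lee_fin mulr_ge0.
  by apply: combine2 => //; exact: mulr_ge0.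
rewrite !ge0_muleDr ?mule_ge0// ?lee_fin ?mulr_ge0//.
rewrite !muleA -!EFinM; apply: leeD; rewrite le_eqVlt; apply/orP; left; apply/eqP;
  by congr (_%:E * _)%E; ring.
Qed.

Lemma cascade_step {R : realType} (a w w' lam th C : R) (N N' o : \bar R) :
  0 <= a -> 0 <= w -> 0 <= lam -> 0 <= C -> (0 <= N')%E -> (0 <= o)%E ->
  w * lam <= th * w' -> (N <= lam%:E * N' + C%:E * o)%E ->
  (a%:E * (w%:E * N) <= th%:E * (a%:E * (w'%:E * N')) + C%:E * (a%:E * (w%:E * o)))%E.
Proof.
move=> a0 w0 l0 C0 N0 o0 hw hN.
have ae : (0 <= a%:E)%E by rewrite lee_fin.
have we : (0 <= w%:E)%E by rewrite lee_fin.
have le : (0 <= lam%:E * N')%E by rewrite mule_ge0.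
have ce : (0 <= C%:E * o)%E by rewrite mule_ge0.
apply: le_trans (lee_wpmul2l ae (lee_wpmul2l we hN)) _.
rewrite (ge0_muleDr _ le ce) ge0_muleDr ?mule_ge0//; apply: leeD.
  rewrite !muleA -!EFinM; apply: lee_wpmul2r => //; rewrite lee_fin.
  have -> : th * a * w' = a * (th * w') by ring.
  by rewrite -mulrA; apply: ler_wpM2l.
by rewrite !muleA -!EFinM (_ : a * w * C = C * a * w)//; ring.
Qed.

(** * The cascade of averages down to the terminal scale *)

Section chart_master.
Context {R : realType} {n : nat} (Omega : set 'rV[R]_n.+1).
Local Notation V := 'rV[R]_n.+1.
Local Notation d := (dist_bd Omega).
Local Notation leb := (@lebesgue_rV R n.+1).
Local Notation om := (@vball R n).
Local Notation wt := (wt Omega).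
Hypotheses (Olip : lipschitz_domain Omega) (Obnd : bounded_set Omega).
Let oO : open Omega. Proof. by have [] := Olip. Qed.
Let bd0 : boundary Omega !=set0. Proof. by have [] := Olip. Qed.
Let mO : measurable Omega := open_measurable_rV oO.
Let mcO : measurable (~` Omega) := measurableC mO.
Let om0 := @vball_gt0 R n.

Variables (z v : V) (r M : R).
Hypotheses (r0 : 0 < r) (M0 : 0 < M) (vM : enorm v <= M) (cc : cone_chart Omega r z v).
Local Notation q := (cratio M).
Local Notation tt := (scale r M).
Local Notation near_avg := (near_avg v r M).
Local Notation osc := (osc v r M).
Local Notation below := (below Omega z r M).
Local Notation layer := (layer Omega z r M).
Variables (s_lo p_lo p_hi : R).
Hypotheses (slo01 : 0 < s_lo < 1) (plo1 : 1 < p_lo) (plohi : p_lo <= p_hi).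

Let t0 j : 0 < tt j. Proof. exact: scale_gt0. Qed.

Lemma scale_le i j : (i <= j)%N -> tt j <= tt i.
Proof.
move=> /subnK <-; elim: (j - i)%N => // k IH.
exact: le_trans (scale_leS r0 M0 _) IH.
Qed.

Lemma scale_exists x : 0 < d x < r -> exists J, tt J.+1 <= d x < tt J.
Proof.
move=> dx; have [J hJ] := geom_scale (cratio01 M0) dx.
by exists J; rewrite /scale ![r * _]mulrC.
Qed.

Section terms.
Variables (s p : R) (u : V -> R).
Hypotheses (hs : s_lo <= s < 1) (hp : p_lo <= p <= p_hi) (mu : measurable_fun setT u).
Let s1 : s < 1. Proof. by case/andP: hs. Qed.
Let s0 : 0 < s.
Proof. by case/andP: hs => h _; case/andP: slo01 => h' _; exact: lt_le_trans h. Qed.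
Let p1 : 1 < p. Proof. by case/andP: hp => h _; exact: lt_le_trans h. Qed.

Definition near_term (j : nat) (x : V) : \bar R :=
  ((wt s p x)%:E * ((below j x * tt j `^ (- (s * (p - 1))))%:E * near_avg p u j x))%E.

Definition osc_term (j : nat) (x : V) : \bar R :=
  ((wt s p x)%:E * ((below j x * tt j `^ (- (s * (p - 1))))%:E * osc p u j x))%E.

Definition layer_term (j : nat) (x : V) : \bar R :=
  ((wt s p x)%:E * ((layer j x * tt j `^ (- (s * (p - 1))))%:E * near_avg p u j x))%E.

Lemma near_term_ge0 j x : (0 <= near_term j x)%E.
Proof. by apply: below_term_ge0 => //; exact: near_avg_ge0. Qed.

Lemma osc_term_ge0 j x : (0 <= osc_term j x)%E.
Proof. by apply: below_term_ge0 => //; exact: osc_ge0. Qed.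

Lemma layer_term_ge0 j x : (0 <= layer_term j x)%E.
Proof.
apply: mule_ge0; first by rewrite lee_fin wt_ge0.
apply: mule_ge0; last exact: near_avg_ge0.
by rewrite lee_fin; exact: mulr_ge0 (layer_ge0 _ _ _ _ _ _) (powR_ge0 _ _).
Qed.

Lemma measurable_near_term j : measurable_fun setT (near_term j).
Proof.
have mw := measurable_wt Olip s p; have mb := measurable_below Olip z r M j.
have mN := measurable_near_avg v r M p mu j.
rewrite /near_term; move: (wt s p) mw (below j) mb (near_avg p u j) mN => w mw b mb N mN.
by meas.
Qed.

Lemma measurable_osc_term j : measurable_fun setT (osc_term j).
Proof.
have mw := measurable_wt Olip s p; have mb := measurable_below Olip z r M j.
have mN := measurable_osc v r M p mu j.
rewrite /osc_term; move: (wt s p) mw (below j) mb (osc p u j) mN => w mw b mb N mN.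
by meas.
Qed.

Lemma measurable_layer_term j : measurable_fun setT (layer_term j).
Proof.
have mw := measurable_wt Olip s p; have mb := measurable_layer Olip z r M j.
have mN := measurable_near_avg v r M p mu j.
rewrite /layer_term; move: (wt s p) mw (layer j) mb (near_avg p u j) mN => w mw b mb N mN.
by meas.
Qed.

(* The weight [t_j ^ (- s (p - 1))] gains [q ^ (s (p - 1))] from one scale to the
   next, which beats the factor [lam] lost in [near_avg_step]. *)
Lemma near_series_le (lam th C : R) x : 0 <= lam -> 0 < th < 1 -> 0 <= C ->
  lam * q `^ (s * (p - 1)) <= th ->
  (forall a b : R, 0 <= a -> 0 <= b -> (a + b) `^ p <= lam * a `^ p + C * b `^ p) ->
  (\sum_(j <oo) near_term j x <= ((1 - th)^-1)%:E * (\sum_(j <oo) layer_term j x +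
     (C * (om * om * q ^+ n.+1)^-1)%:E * \sum_(j <oo) osc_term j x))%E.
Proof.
move=> lam0 /andP[th0 th1] C0 hth hC; have /andP[q0 q1] := cratio01 M0.
set C' := C * _.
have C'0 : 0 <= C'.
  apply: divr_ge0 => //; apply: mulr_ge0; last by rewrite exprn_ge0// ltW.
  exact: mulr_ge0 (ltW om0) (ltW om0).
have L0 : (0 <= \sum_(j <oo) layer_term j x)%E.
  by apply: nneseries_ge0 => j _ _; exact: layer_term_ge0.
have O0 : (0 <= \sum_(j <oo) osc_term j x)%E.
  by apply: nneseries_ge0 => j _ _; exact: osc_term_ge0.
have th1' : 0 <= (1 - th)^-1 by rewrite invr_ge0 subr_ge0 ltW.
have R0 : (0 <= ((1 - th)^-1)%:E * (\sum_(j <oo) layer_term j x +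
     C'%:E * \sum_(j <oo) osc_term j x))%E.
  by apply: mule_ge0; [rewrite lee_fin|apply: adde_ge0 => //; rewrite mule_ge0].
have zero : (forall j, near_term j x = 0%E) -> (\sum_(j <oo) near_term j x <= ((1 - th)^-1)%:E *
    (\sum_(j <oo) layer_term j x + C'%:E * \sum_(j <oo) osc_term j x))%E.
  by move=> h; rewrite eseries0.
have [wx0|wx0] := eqVneq (wt s p x) 0.
  by apply: zero => j; rewrite /near_term wx0 mul0e.
have [Ox|Ox] := pselect (Omega x); first by rewrite wt_in ?eqxx in wx0.
have dx0 : 0 < d x.
  rewrite lt_neqAle dist_ge0// andbT eq_sym; apply: contra_neq wx0 => dx.
  exact: wt_dist0 s0 dx.
have [xz|xz] := ltP (enorm (x - z)) (3 * r); last first.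
  by apply: zero => j; rewrite /near_term /below /collar ltNge xz mulr0 !mul0r !mul0e mule0.
have [dr|dr] := ltP (d x) r; last first.
  apply: zero => j; rewrite /near_term /below.
  by rewrite ltNge (le_trans (scale_le_r r0 M0 j) dr) mulr0 mul0r !mul0e mule0.
have dxr : 0 < d x < r by rewrite dx0.
(* J is the terminal scale of x. Beyond it [below] vanishes, so the series is a finite chain ending
   in the layer term J. *)
have [J /andP[hJ1 hJ2]] := scale_exists dxr.
have bJ j : (j <= J)%N -> below j x = 1.
  move=> jJ; rewrite /below /collar xz (lt_le_trans hJ2 (scale_le jJ)) !mulr1.
  by rewrite indicE mem_set.
rewrite (@nneseries_finite _ _ J.+1); last 2 first.
- by move=> j; exact: near_term_ge0.
- move=> j jJ; rewrite /near_term /below.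
  by rewrite ltNge (le_trans (scale_le jJ) hJ1) mulr0 mul0r !mul0e mule0.
have th01 : 0 <= th < 1 by rewrite (ltW th0).
apply: le_trans (chain_sum (th := th) (C := C') (a := fun j => osc_term j x) th01 C'0 _ _ _) _.
- by move=> j; exact: near_term_ge0.
- by move=> j; exact: osc_term_ge0.
- move=> j jJ; rewrite /near_term /osc_term (bJ _ jJ) (bJ _ (ltnW jJ)) !mul1r.
  have p0 : 0 <= p by rewrite (le_trans ler01)// ltW.
  apply: (cascade_step _ _ lam0 C'0 _ _ _ (near_avg_step r0 M0 vM mu j x lam0 C0 hC p0)).
  + exact: wt_ge0.
  + exact: powR_ge0.
  + exact: near_avg_ge0.
  + exact: osc_ge0.
  + have tj := t0 j; rewrite scaleS powRM ?(ltW q0) ?(ltW tj)//.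
    rewrite mulrA mulrC; apply: ler_wpM2r; first exact: powR_ge0.
    by rewrite powRN ler_pdivlMr// powR_gt0.
apply: lee_wpmul2l; first by rewrite lee_fin.
apply: leeD.
  have -> : near_term J x = layer_term J x.
    rewrite /near_term /layer_term bJ// /layer /collar xz hJ1 hJ2 !mulr1.
    by rewrite indicE mem_set.
  by apply: (nneseries_ge_term (f := fun j => layer_term j x)) => j; exact: layer_term_ge0.
apply: lee_wpmul2l; first by rewrite lee_fin.
by apply: nneseries_lim_ge => j _ _; exact: osc_term_ge0.
Qed.

(** The layers are disjoint, so at most one term is nonzero and the pointwise bound passes to the
    series without loss. *)
Lemma layer_series_le (K : R) x : 0 <= K ->
  (forall j, layer_term j x <= K%:E * ((layer j x)%:E * \int[leb]_y (\1_Omega y * vker s p u x y)%:E))%E ->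
  (\sum_(j <oo) layer_term j x <=
   K%:E * \int[leb]_y (\1_(~` Omega) x * (\1_Omega y * vker s p u x y))%:E)%E.
Proof.
move=> K0 hK.
have v0 y : (0 <= (\1_Omega y * vker s p u x y)%:E)%E.
  by rewrite lee_fin; apply: mulr_ge0 => //; exact: vker_ge0.
have W0 : (0 <= \int[leb]_y (\1_Omega y * vker s p u x y)%:E)%E by exact: integral_ge0.
rewrite (eq_eseriesr (g := fun j => ((layer j x != 0)%R%:R%:E * layer_term j x)%E)); last first.
  move=> j _; case: eqVneq => [h|_] /=; last by rewrite mul1e.
  by rewrite /layer_term h mul0r !mul0e mule0.
apply: nneseries_exclusive.
- have aux i j : layer i x != 0 -> layer j x != 0 -> (i <= j)%N.
    move=> hi hj; rewrite leqNgt; apply/negP => ji.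
    have [hi'|[_ [_ _ hi1 hi2]]] := layerP Omega z r M i x; first by rewrite hi' eqxx in hi.
    have [hj'|[_ [_ _ hj1 hj2]]] := layerP Omega z r M j x; first by rewrite hj' eqxx in hj.
    by have := scale_le ji; lra.
  by move=> i j hi hj; apply/eqP; rewrite eqn_leq !aux.
- apply: mule_ge0; first by rewrite lee_fin.
  apply: integral_ge0 => y _; rewrite lee_fin; apply: mulr_ge0 => //.
  by apply: mulr_ge0 => //; exact: vker_ge0.
- move=> j hj; rewrite layer_term_ge0/=; apply: le_trans (hK j) _.
  have [hj'|[-> [Ox _ _ _]]] := layerP Omega z r M j x; first by rewrite hj' eqxx in hj.
  rewrite mul1e; apply: lee_wpmul2l; first by rewrite lee_fin.
  apply: le_int => // y; rewrite lee_fin (_ : \1_(~` Omega) x = 1) ?mul1r//.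
  by rewrite indicE mem_set.
Qed.

End terms.

(** The integrated form of [near_series_le]: the terminal layers are paid by the interaction across
    the boundary, the oscillations by the energy inside. *)
Lemma exists_master_bound : exists2 C : R, 0 < C &
  forall s p u, s_lo <= s < 1 -> p_lo <= p <= p_hi -> measurable_fun setT u ->
  (\sum_(j <oo) \int[leb]_x near_term s p u j x <=
   (C * (1 - s))%:E * (V_inside Omega s p u + V_across Omega s p u))%E.
Proof.
have h1 := slo01; have h2 := plo1; have h3 := plohi.
have /andP[q0 q1] := cratio01 M0.
have [Co Co0 hCo] := exists_osc_bound Olip Obnd r0 M0 vM cc slo01 plo1 plohi.
(* Half of the smallest possible gain s (p - 1): with lam = q^(-eps), the gain minus the loss still
   leaves the contraction th = q^eps. *)
pose eps := s_lo * (p_lo - 1) / 2.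
have eps0 : 0 < eps by rewrite /eps divr_gt0// mulr_gt0; lra.
pose lam := q `^ (- eps); pose th := q `^ eps.
have th0 : 0 < th by exact: powR_gt0.
have th1 : th < 1.
  rewrite /th /powR gt_eqF// -[ltRHS]expR0 ltr_expR pmulr_rlt0// ln_lt0//.
  by rewrite q0.
have lam1 : 1 < lam by rewrite /lam powRN invf_gt1// powR_gt0.
have ph1 : 1 < p_hi by lra.
have [C1 C10 hC1] := powR_almost_additive lam1 ph1.
pose Ct := q^-1 * om^-1 * (M + 3) `^ (n.+1%:R + p_hi).
have M3 : 0 < M + 3 by have := M0; lra.
have Ct0 : 0 < Ct by rewrite /Ct !mulr_gt0 ?invr_gt0 ?powR_gt0//; exact: om0.
pose C2 := C1 * (om * om * q ^+ n.+1)^-1.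
have C20 : 0 < C2 by rewrite /C2 mulr_gt0// invr_gt0 !mulr_gt0 ?exprn_gt0//; exact: om0.
have K0 : 0 < (1 - th)^-1 by rewrite invr_gt0; lra.
exists ((1 - th)^-1 * (1 + Ct + C2 * Co)).
  by rewrite mulr_gt0// !addr_gt0// mulr_gt0.
move=> s p u hs hp mu; have /andP[slo s1] := hs; have /andP[plo phi] := hp.
have s0 : 0 < s by lra.
have p1 : 1 < p by lra.
have s1' : 0 < 1 - s by lra.
have hth : lam * q `^ (s * (p - 1)) <= th.
  rewrite /lam /th -powR_add// ger_powR ?q0 ?(ltW q1)//.
  have : s_lo * (p_lo - 1) <= s * (p - 1).
    apply: ler_pM => //; last by rewrite lerD2r.
      by case/andP: h1 => /ltW.
    by rewrite subr_ge0 ltW.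
  by rewrite /eps; lra.
have hC a b : 0 <= a -> 0 <= b -> (a + b) `^ p <= lam * a `^ p + C1 * b `^ p.
  by move=> a0 b0; apply: hC1 => //; rewrite p1.
have nt0 j x : (0 <= near_term s p u j x)%E by apply: near_term_ge0.
have ot0 j x : (0 <= osc_term s p u j x)%E by apply: osc_term_ge0.
have lt0 j x : (0 <= layer_term s p u j x)%E by apply: layer_term_ge0.
have mnt j : measurable_fun setT (near_term s p u j) by apply: measurable_near_term.
have mot j : measurable_fun setT (osc_term s p u j) by apply: measurable_osc_term.
have mlt j : measurable_fun setT (layer_term s p u j) by apply: measurable_layer_term.
have mS (f : nat -> V -> \bar R) : (forall j, measurable_fun setT (f j)) -> (forall j x, 0 <= f j x)%E ->
    measurable_fun setT (fun x : V => \sum_(j <oo) f j x)%E.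
  by move=> mf f0; apply: (@ge0_emeasurable_sum _ _ _ _ f xpredT).
have S0 (f : nat -> V -> \bar R) : (forall j x, 0 <= f j x)%E -> forall x : V, (0 <= \sum_(j <oo) f j x)%E.
  by move=> f0 x; apply: nneseries_ge0.
have th01 : 0 < th < 1 by rewrite th0.
rewrite -integral_nneseries//.
have mb : measurable_fun setT (fun x => \sum_(j <oo) layer_term s p u j x +
     C2%:E * \sum_(j <oo) osc_term s p u j x)%E.
  apply: emeasurable_funD; first exact: mS.
  by apply: emeasurable_funM; [exact: measurable_cst|exact: mS].
have b0 x : (0 <= \sum_(j <oo) layer_term s p u j x + C2%:E * \sum_(j <oo) osc_term s p u j x)%E.
  apply: adde_ge0; first exact: S0.
  by apply: mule_ge0; [rewrite lee_fin ltW|exact: S0].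
apply: (@le_trans _ _ (\int[leb]_x (((1 - th)^-1)%:E * (\sum_(j <oo) layer_term s p u j x +
     C2%:E * \sum_(j <oo) osc_term s p u j x)))%E).
  apply: le_int => x; first exact: S0.
  by apply: (near_series_le hs hp mu x _ th01 _ hth hC); rewrite ltW// (lt_trans ltr01).
rewrite intZl// ?(ltW K0)// ge0_integralD//; last 4 first.
- by move=> x _; exact: S0.
- exact: mS.
- by move=> x _; apply: mule_ge0; [rewrite lee_fin ltW|exact: S0].
- by apply: emeasurable_funM; [exact: measurable_cst|exact: mS].
rewrite intZl ?(ltW C20)//; last 2 first.
- exact: mS.
- by move=> x; exact: S0.
have VI0 : (0 <= V_inside Omega s p u)%E by apply: integral_ge0 => y _; exact: inside_ge0.
have va0 x : (0 <= \int[leb]_y (\1_(~` Omega) x * (\1_Omega y * vker s p u x y))%:E)%E.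
  apply: integral_ge0 => y _; rewrite lee_fin; apply: mulr_ge0 => //.
  by apply: mulr_ge0 => //; exact: vker_ge0.
have VA0 : (0 <= V_across Omega s p u)%E by exact: integral_ge0.
have I1 : (\int[leb]_x (\sum_(j <oo) layer_term s p u j x) <= (Ct * (1 - s))%:E * V_across Omega s p u)%E.
  have mv := measurable_vker s p mu.
  rewrite /V_across -intZl; last 3 first.
  - by rewrite mulr_ge0 ?ltW.
  - apply: (@measurable_int _ _ _ _ _ leb (fun x y => (\1_(~` Omega) x * (\1_Omega y * vker s p u x y))%:E)).
      by meas.
    move=> x y; rewrite lee_fin; apply: mulr_ge0 => //.
    by apply: mulr_ge0 => //; exact: vker_ge0.
  - by [].
  apply: le_int => x; first exact: S0.
  apply: layer_series_le => //; first by rewrite mulr_ge0 ?ltW.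
  by move=> j; exact: (terminal_bound Olip r0 M0 vM cc slo01 plo1 plohi j x hs hp mu).
have I2 : (\int[leb]_x (\sum_(j <oo) osc_term s p u j x) <= (Co * (1 - s))%:E * V_inside Omega s p u)%E.
  apply: (eq_le_trans (integral_nneseries leb measurableT mot (fun j x _ => ot0 j x))).
  exact: hCo.
have C2e : (0 <= C2%:E)%E by rewrite lee_fin ltW.
have Ke : (0 <= ((1 - th)^-1)%:E)%E by rewrite lee_fin ltW.
apply: le_trans (lee_wpmul2l Ke (leeD I1 (lee_wpmul2l C2e I2))) _.
exact: (combine_scaled (ltW K0) (ltW Ct0) (ltW Co0) (ltW C20) (ltW s1') VI0 VA0).
Qed.

End chart_master.

Lemma int2_nneseries d1 d2 (T1 : measurableType d1) (T2 : measurableType d2) (R : realType)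
  (m1 : {sigma_finite_measure set T1 -> \bar R}) (m2 : {sigma_finite_measure set T2 -> \bar R})
  (f : nat -> T1 -> T2 -> \bar R) :
  (forall j, measurable_fun setT (fun t => f j t.1 t.2)) -> (forall j x y, 0 <= f j x y)%E ->
  (\int[m1]_x \int[m2]_y \sum_(j <oo) f j x y = \sum_(j <oo) \int[m1]_x \int[m2]_y f j x y)%E.
Proof.
move=> mf f0; rewrite -integral_nneseries//; last 2 first.
- by move=> j; apply: (@measurable_int _ _ _ _ _ m2 (f j)).
- by move=> j x _; exact: integral_ge0.
apply: eq_integral => x _; rewrite integral_nneseries//.
by move=> j; exact: (measurable_slice x (mf j)).
Qed.

Lemma pair_algebra {R : realType} (w w' D T P k b c K : R) (N o N' : \bar R) :
  0 <= w -> 0 <= w' -> 0 <= D -> 0 <= P -> 0 <= k -> 0 <= b -> 0 <= c -> 0 <= K ->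
  (0 <= N)%E -> (0 <= o)%E -> (0 <= N')%E -> T <= K * (k * b) ->
  (D%:E <= P%:E * (N + c%:E * o + N'))%E ->
  ((w * w' * (D * T))%:E <= (P * K)%:E * ((k * w')%:E * (w%:E * (b%:E * N) +
     c%:E * (w%:E * (b%:E * o))) + (k * w)%:E * (w'%:E * (b%:E * N'))))%E.
Proof.
move=> w0 w'0 D0 P0 k0 b0 c0 K0 N0 o0 N'0 hT hD.
have co0 : (0 <= c%:E * o)%E by rewrite mule_ge0.
have h1 : w * w' * (D * T) <= w * w' * (K * (k * b)) * D.
  have -> : w * w' * (K * (k * b)) * D = w * w' * (D * (K * (k * b))) by ring.
  by apply: ler_wpM2l; [exact: mulr_ge0|exact: ler_wpM2l].
have h2 : (0 <= (w * w' * (K * (k * b)))%:E)%E by rewrite lee_fin !mulr_ge0.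
apply: (@le_trans _ _ ((w * w' * (K * (k * b)))%:E * D%:E)%E); first by rewrite -EFinM lee_fin.
apply: le_trans (lee_wpmul2l h2 hD) _.
rewrite (ge0_muleDr P%:E) ?adde_ge0// (ge0_muleDr P%:E)//.
rewrite ge0_muleDr ?adde_ge0 ?mule_ge0// ge0_muleDr ?mule_ge0//.
have a1 : (0 <= w%:E * (b%:E * N))%E by rewrite !mule_ge0.
have a2 : (0 <= c%:E * (w%:E * (b%:E * o)))%E by rewrite !mule_ge0.
have a3 : (0 <= w'%:E * (b%:E * N'))%E by rewrite !mule_ge0.
rewrite [in leRHS]ge0_muleDr ?mule_ge0 ?adde_ge0 ?lee_fin ?mulr_ge0//.
rewrite [in leRHS](ge0_muleDr (k * w')%:E) ?mule_ge0 ?lee_fin//.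
rewrite [in leRHS]ge0_muleDr ?mule_ge0 ?lee_fin ?mulr_ge0//.
rewrite !muleA -!EFinM le_eqVlt; apply/orP; left; apply/eqP.
by congr (_ + _ + _)%E; congr (_%:E * _)%E; ring.
Qed.

(** * Pairs of outer points in one chart *)

Section chart_trace.
Context {R : realType} {n : nat} (Omega : set 'rV[R]_n.+1).
Local Notation V := 'rV[R]_n.+1.
Local Notation d := (dist_bd Omega).
Local Notation leb := (@lebesgue_rV R n.+1).
Local Notation om := (@vball R n).
Local Notation wt := (wt Omega).
Local Notation rho := (rho Omega).
Local Notation trk := (trk Omega).
Hypotheses (Olip : lipschitz_domain Omega) (Obnd : bounded_set Omega).
Let oO : open Omega. Proof. by have [] := Olip. Qed.
Let bd0 : boundary Omega !=set0. Proof. by have [] := Olip. Qed.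
Let mO : measurable Omega := open_measurable_rV oO.
Let mcO : measurable (~` Omega) := measurableC mO.
Let om0 := @vball_gt0 R n.

Definition Lp_pow (p : R) (u : V -> R) : \bar R :=
  (\int[leb]_y (\1_Omega y * `|u y| `^ p)%:E)%E.

Lemma Lp_pow_ge0 p u : (0 <= Lp_pow p u)%E.
Proof. by apply: integral_ge0 => y _; rewrite lee_fin mulr_ge0 ?powR_ge0. Qed.

(** Compares u x with the values of [u] in a ball of [Omega]; this is how the L^p norm on [Omega]
    enters the trace estimate. *)
Lemma mass_split (p : R) (u : V -> R) c t x : 1 <= p -> 0 < t -> measurable_fun setT u ->
  (forall y, enorm (y - c) < t -> Omega y) ->
  ((`|u x| `^ p)%:E <= (2 `^ p)%:E * (avg c t (fun y => (`|u x - u y| `^ p)%:E) +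
     ((om * t ^+ n.+1)^-1)%:E * Lp_pow p u))%E.
Proof.
move=> p1 t0 mu hO; have p0 : 0 <= p by exact: le_trans p1.
have f0 y : (0 <= (`|u x - u y| `^ p)%:E)%E by rewrite lee_fin powR_ge0.
have g0 y : (0 <= (`|u y| `^ p)%:E)%E by rewrite lee_fin powR_ge0.
have mf : measurable_fun setT (fun y => (`|u x - u y| `^ p)%:E) by meas.
have mg : measurable_fun setT (fun y => (`|u y| `^ p)%:E) by meas.
have mfg := emeasurable_funD mf mg.
have step y : ((`|u x| `^ p)%:E <= (2 `^ p)%:E * ((`|u x - u y| `^ p)%:E + (`|u y| `^ p)%:E))%E.
  rewrite -EFinD -EFinM lee_fin; apply: le_trans (powR_add_le (normr_ge0 _) (normr_ge0 _) p1).
  apply: ge0_ler_powR; rewrite ?nnegrE ?addr_ge0//.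
  by rewrite (le_trans _ (ler_normD _ _))// subrK.
apply: le_trans (avg_ge_cst (c := c) t0 (g0 x) (fun y _ => step y)) _.
apply: (eq_le_trans (avgZ c t0 (powR_ge0 _ _) mfg (fun y => adde_ge0 (f0 y) (g0 y)))).
apply: lee_wpmul2l; first by rewrite lee_fin powR_ge0.
apply: (eq_le_trans (avgD c t0 mf mg f0 g0)); apply: leeD; first exact: lexx.
have A1 y : enorm (y - c) < t -> 1 <= \1_Omega y :> R by move=> /hO Oy; rewrite indicE mem_set.
exact: (avg_le_int t0 g0 A1).
Qed.

Variables (z v : V) (r M : R).
Hypotheses (r0 : 0 < r) (M0 : 0 < M) (vM : enorm v <= M) (cc : cone_chart Omega r z v).
Local Notation q := (cratio M).
Local Notation tt := (scale r M).
Local Notation near_avg := (near_avg v r M).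
Local Notation osc := (osc v r M).
Local Notation below := (below Omega z r M).
Local Notation near_term := (near_term Omega z v r M).
Local Notation osc_term := (osc_term Omega z v r M).
Variables (s_lo p_lo p_hi : R).
Hypotheses (slo01 : 0 < s_lo < 1) (plo1 : 1 < p_lo) (plohi : p_lo <= p_hi).

Let t0 j : 0 < tt j. Proof. exact: scale_gt0. Qed.

(** Its integral in y is bounded uniformly in s, p, j and x, since the [mu_s]-mass of a ball of
    radius t is O(t^(d - s)). This reduces double integrals over pairs to the single integrals of
    the cascade. *)
Definition pair_ker (s p : R) (j : nat) (x y : V) : R :=
  tt j `^ (s - n.+1%:R) * ((enorm (x - y) < tt j)%R%:R * wt s p y).

Lemma pair_ker_ge0 s p j x y : s < 1 -> 0 <= pair_ker s p j x y.
Proof.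
move=> s1; apply: mulr_ge0; first exact: powR_ge0.
by apply: mulr_ge0 => //; exact: wt_ge0.
Qed.

Lemma measurable_pair_ker s p j :
  measurable_fun setT (fun t : V * V => pair_ker s p j t.1 t.2).
Proof. by have mw := measurable_wt Olip s p; rewrite /pair_ker; meas. Qed.

Lemma exists_pair_ker_mass : exists2 C : R, 0 < C &
  forall s p j x, s_lo <= s < 1 -> p_lo <= p <= p_hi ->
  (\int[leb]_y (pair_ker s p j x y)%:E <= C%:E)%E.
Proof.
have [C C0 hC] := ball_weight_unif Olip Obnd r.
exists C => // s p j x /andP[slo s1] /andP[plo phi].
have h1 := slo01; have h2 := plo1.
have s0 : 0 < s by lra. have p1 : 1 <= p by lra. have s1' : 0 < 1 - s by lra.
have s01 : 0 < s < 1 by rewrite s0.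
have mw := measurable_wt Olip s p.
have tj := t0 j; have tj' : 0 < tt j <= r by rewrite tj scale_le_r.
pose k := tt j `^ (s - n.+1%:R) * (1 - s).
have k0 : 0 <= k by apply: mulr_ge0 (powR_ge0 _ _) (ltW s1').
apply: (@le_trans _ _ (\int[leb]_y (k%:E * ((enorm (y - x) < tt j)%R%:R * d y `^ (- s))%:E))%E).
  apply: le_int => y; first by rewrite lee_fin pair_ker_ge0.
  rewrite -EFinM lee_fin /pair_ker /k enormBC -mulrA; apply: ler_wpM2l; first exact: powR_ge0.
  by rewrite [leRHS]mulrCA; apply: ler_wpM2l => //; apply: wt_le.
rewrite intZl//; last 2 first.
- by meas.
- by move=> y; rewrite lee_fin mulr_ge0 ?powR_ge0.
have ke : (0 <= k%:E)%E by rewrite lee_fin.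
apply: le_trans (lee_wpmul2l ke (hC s (tt j) x s01 tj')) _.
rewrite -EFinM lee_fin /k.
have e : tt j `^ (s - n.+1%:R) * tt j `^ (n.+1%:R - s) = 1.
  by rewrite -powR_add// (_ : s - _ + _ = 0) ?powRr0//; ring.
have aux (X Y a b : R) : a != 0 -> X * a * (b * Y / a) = b * (X * Y) by move=> a0; field.
by rewrite aux ?e ?mulr1// gt_eqF.
Qed.

Lemma int_pair_ker s p j (C : R) (F : V -> \bar R) : s < 1 -> 0 <= C ->
  (forall x, \int[leb]_y (pair_ker s p j x y)%:E <= C%:E)%E ->
  measurable_fun setT F -> (forall x, 0 <= F x)%E ->
  (\int[leb]_x \int[leb]_y ((pair_ker s p j x y)%:E * F x) <= C%:E * \int[leb]_x F x)%E.
Proof.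
move=> s1 C0 hC mF F0; rewrite -intZl//; apply: le_int => x.
  by apply: integral_ge0 => y _; apply: mule_ge0 => //; rewrite lee_fin pair_ker_ge0.
rewrite ge0_integralZr//; last 2 first.
- by apply/measurable_EFinP; exact: (measurable_slice x (measurable_pair_ker s p j)).
- by move=> y _; rewrite lee_fin pair_ker_ge0.
exact: lee_wpmul2r.
Qed.

Definition near_pair (s p : R) (u : V -> R) (x y : V) : R :=
  (rho x y < r)%R%:R * (enorm (x - z) < 2 * r)%R%:R *
  (wt s p x * wt s p y * (`|u x - u y| `^ p * trk s p x y)).

Definition pair_bound (K s p : R) (u : V -> R) (j : nat) (x y : V) : \bar R :=
  (K%:E * ((pair_ker s p j x y)%:E * (near_term s p u j x + ((om * om)^-1)%:E * osc_term s p u j x) +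
     (pair_ker s p j y x)%:E * near_term s p u j y))%E.

Definition pair_const : R :=
  4 `^ p_hi * (q * Num.min 1 r^-1) `^ (- (n.+1%:R + p_hi)).

Lemma rho_parts x y t : rho x y < t -> [/\ d x < t, d y < t & enorm (x - y) < t].
Proof.
have dx0 := dist_ge0 bd0 x; have dy0 := dist_ge0 bd0 y; have xy0 := enorm_ge0 (x - y).
by rewrite /rho => h; split; lra.
Qed.

Lemma rho_gt0 x y : 0 < d x -> 0 < rho x y.
Proof.
have dy0 := dist_ge0 bd0 y; have xy0 := enorm_ge0 (x - y).
by rewrite /rho => h; lra.
Qed.

(** The trace exponent splits as (d - s) + s (p - 1): the first power normalises [pair_ker], the
    second is the weight in [near_term]. *)
Lemma trk_scale_le s p x y J : s_lo <= s < 1 -> p_lo <= p <= p_hi -> tt J.+1 <= rho x y ->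
  trk s p x y <= (q * Num.min 1 r^-1) `^ (- (n.+1%:R + p_hi)) *
    (tt J `^ (s - n.+1%:R) * tt J `^ (- (s * (p - 1)))).
Proof.
move=> hs hp hJ1; have /andP[slo s1] := hs; have /andP[plo phi] := hp.
have h1 := slo01; have h2 := plo1; have h3 := plohi.
have s0 : 0 < s by lra. have p1 : 1 < p by lra.
have /andP[q0 q1] := cratio01 M0.
have tJ := t0 J; have tJr := scale_le_r r0 M0 J.
have rp : 0 < rho x y by exact: lt_le_trans (t0 J.+1) hJ1.
pose e := n.+1%:R + s * (p - 2).
have he : e = n.+1%:R + s * (p - 2) by [].
have n1 : 1 <= n.+1%:R :> R by rewrite ler1n.
have e0 : 0 <= e.
  apply: (le_trans _ (trace_exponent_ge (n := n) slo01 plo1 plohi hs hp)).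
  by rewrite le_min ler01 subr_ge0 ltW.
have eE : e <= n.+1%:R + p_hi.
  have : s * (p - 2) <= p_hi.
    have [p2|p2] := leP 2 p.
      apply: (@le_trans _ _ (1 * (p - 2))); last by lra.
      by apply: ler_wpM2r; lra.
    have : s * (p - 2) <= 0 by rewrite mulr_ge0_le0 ?(ltW s0)// subr_le0 ltW.
    lra.
  by rewrite he; lra.
(* Accounts for the truncation in the trace kernel: kap t_J lies below both rho x y and 1. *)
pose kap := q * Num.min 1 r^-1.
have m0 : 0 < Num.min 1 r^-1 by rewrite lt_min ltr01 invr_gt0.
have m1 : Num.min 1 r^-1 <= 1 by rewrite ge_min lexx.
have mr : Num.min 1 r^-1 * r <= 1.
  by rewrite -ler_pdivlMr// mul1r ge_min lexx orbT.
have kap0 : 0 < kap by rewrite mulr_gt0.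
have kap1 : kap <= 1 by rewrite /kap -[leRHS]mulr1; apply: ler_pM; rewrite ?(ltW q0) ?(ltW m0) ?(ltW q1).
have kr : kap * tt J <= rho x y.
  apply: le_trans hJ1; rewrite scaleS /kap -mulrA; apply: ler_wpM2l; first exact: ltW.
  by rewrite ler_piMl// ltW.
have k1 : kap * tt J <= 1.
  apply: le_trans mr; rewrite /kap mulrAC mulrC; apply: ler_wpM2l; first exact: ltW.
  by apply: le_trans tJr; rewrite ler_piMl// ltW.
have kt0 : 0 < kap * tt J by exact: mulr_gt0.
rewrite -/kap -powR_add// (_ : s - n.+1%:R - s * (p - 1) = - e); last by rewrite he; ring.
have le1 : kap * tt J <= 1 * Num.min (rho x y) 1 by rewrite mul1r le_min kr.
have mn0 : 0 < Num.min (rho x y) 1 by rewrite lt_min ltr01 rp.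
have := negpow_le kt0 mn0 ltr01 e0 le1; rewrite powR1 mul1r => /le_trans; apply.
rewrite powRM ?(ltW kap0) ?(ltW tJ)//; apply: ler_wpM2r; first exact: powR_ge0.
by rewrite ger_powR ?kap0 ?kap1//; lra.
Qed.

(** Only the scale J with t_(J + 1) <= rho x y < t_J is needed for a given pair; the full series
    makes the bound free of J, so that it can be integrated term by term. *)
Lemma near_pair_le s p u x y : s_lo <= s < 1 -> p_lo <= p <= p_hi -> measurable_fun setT u ->
  ((near_pair s p u x y)%:E <= \sum_(j <oo) pair_bound pair_const s p u j x y)%E.
Proof.
move=> hs hp mu; have /andP[slo s1] := hs; have /andP[plo phi] := hp.
have h1 := slo01; have h2 := plo1; have h3 := plohi.
have s0 : 0 < s by lra. have p1 : 1 < p by lra.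
have nt0 j x' : (0 <= near_term s p u j x')%E by apply: near_term_ge0 hs _ _.
have ot0 j x' : (0 <= osc_term s p u j x')%E by apply: osc_term_ge0 hs _ _.
have pk0 j x' y' : (0 <= (pair_ker s p j x' y')%:E)%E by rewrite lee_fin pair_ker_ge0.
have om2 : (0 <= ((om * om)^-1)%:E)%E by rewrite lee_fin invr_ge0 mulr_ge0// ltW.
have K0 : 0 <= pair_const by exact: mulr_ge0 (powR_ge0 _ _) (powR_ge0 _ _).
have pb0 j : (0 <= pair_bound pair_const s p u j x y)%E.
  apply: mule_ge0; first by rewrite lee_fin.
  by apply: adde_ge0; apply: mule_ge0 => //; apply: adde_ge0 => //; exact: mule_ge0.
have S0 : (0 <= \sum_(j <oo) pair_bound pair_const s p u j x y)%E by exact: nneseries_ge0.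
have zero : near_pair s p u x y = 0 ->
    ((near_pair s p u x y)%:E <= \sum_(j <oo) pair_bound pair_const s p u j x y)%E.
  by move=> ->.
have [hr|hr] := ltP (rho x y) r; last by apply: zero; rewrite /near_pair ltNge hr !mul0r.
have [hz|hz] := ltP (enorm (x - z)) (2 * r); last first.
  by apply: zero; rewrite /near_pair [(enorm _ < _)%R]ltNge hz mulr0 mul0r.
have [wx|wx] := eqVneq (wt s p x) 0; first by apply: zero; rewrite /near_pair wx !(mul0r, mulr0).
have [wy|wy] := eqVneq (wt s p y) 0; first by apply: zero; rewrite /near_pair wy !(mul0r, mulr0).
have [Ox|Ox] := pselect (Omega x); first by rewrite wt_in ?eqxx in wx.
have [Oy|Oy] := pselect (Omega y); first by rewrite wt_in ?eqxx in wy.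
have dx0 := dist_ge0 bd0 x; have dy0 := dist_ge0 bd0 y; have xy0 := enorm_ge0 (x - y).
have dxp : 0 < d x.
  rewrite lt_neqAle dist_ge0// andbT eq_sym; apply: contra_neq wx => dx.
  exact: wt_dist0 s0 dx.
have rp : 0 < rho x y < r by rewrite hr andbT rho_gt0.
have /andP[q0 q1] := cratio01 M0.
have [J hJ] := geom_scale (cratio01 M0) rp.
have /andP[hJ1 hJ2] : tt J.+1 <= rho x y < tt J by rewrite /scale ![r * _]mulrC.
have tJ := t0 J; have tJr := scale_le_r r0 M0 J.
have [dxJ dyJ xyJ] := rho_parts hJ2.
have bx : below J x = 1.
  rewrite /below /collar dxJ indicE mem_set// mul1r mulr1.
  by rewrite (lt_le_trans hz)// ler_wpM2r ?(ltW r0)// ler_nat.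
have by_ : below J y = 1.
  rewrite /below /collar dyJ indicE mem_set// mul1r mulr1.
  rewrite (_ : enorm (y - z) < 3 * r)//.
  apply: le_lt_trans (enorm_tri x y z) _; rewrite (enormBC y x) (_ : 3 * r = r + 2 * r); last by ring.
  by apply: ltrD => //; exact: lt_le_trans xyJ tJr.
apply: le_trans (nneseries_ge_term (f := fun j => pair_bound pair_const s p u j x y) J pb0).
have aux (a : R) : 1 * 1 * a = a by ring.
have one_mul (a b : R) : a = 1 -> a * b = b by move=> ->; rewrite mul1r.
have np : near_pair s p u x y = wt s p x * wt s p y * (`|u x - u y| `^ p * trk s p x y).
  by rewrite /near_pair hr hz; exact: aux.
have kx : pair_ker s p J x y = tt J `^ (s - n.+1%:R) * wt s p y.
  by rewrite /pair_ker xyJ; congr (_ * _); exact: mul1r.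
have ky : pair_ker s p J y x = tt J `^ (s - n.+1%:R) * wt s p x.
  by rewrite /pair_ker enormBC xyJ; congr (_ * _); exact: mul1r.
have nx : near_term s p u J x = ((wt s p x)%:E * ((tt J `^ (- (s * (p - 1))))%:E * near_avg p u J x))%E.
  exact: (congr1 (fun a => ((wt s p x)%:E * (a%:E * near_avg p u J x))%E) (one_mul _ (tt J `^ (- (s * (p - 1)))) bx)).
have ny : near_term s p u J y = ((wt s p y)%:E * ((tt J `^ (- (s * (p - 1))))%:E * near_avg p u J y))%E.
  exact: (congr1 (fun a => ((wt s p y)%:E * (a%:E * near_avg p u J y))%E) (one_mul _ (tt J `^ (- (s * (p - 1)))) by_)).
have ox : osc_term s p u J x = ((wt s p x)%:E * ((tt J `^ (- (s * (p - 1))))%:E * osc p u J x))%E.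
  exact: (congr1 (fun a => ((wt s p x)%:E * (a%:E * osc p u J x))%E) (one_mul _ (tt J `^ (- (s * (p - 1)))) bx)).
rewrite np /pair_bound kx ky nx ny ox.
have hT := trk_scale_le hs hp hJ1.
have hD : ((`|u x - u y| `^ p)%:E <= (4 `^ p)%:E * (near_avg p u J x +
    ((om * om)^-1)%:E * osc p u J x + near_avg p u J y))%E.
  by apply: pair_split => //; exact: ltW.
have h4 : 4 `^ p <= 4 `^ p_hi :> R by apply: ler_powR => //; rewrite ler1n.
have N0 x' : (0 <= near_avg p u J x')%E by exact: near_avg_ge0.
have o0 : (0 <= osc p u J x)%E by exact: osc_ge0.
have hD' : ((`|u x - u y| `^ p)%:E <= (4 `^ p_hi)%:E * (near_avg p u J x +
    ((om * om)^-1)%:E * osc p u J x + near_avg p u J y))%E.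
  apply: le_trans hD _; apply: lee_wpmul2r; last by rewrite lee_fin.
  by rewrite !adde_ge0// mule_ge0.
have c0 : 0 <= (om * om)^-1 by rewrite invr_ge0 mulr_ge0// ltW.
exact: (pair_algebra (wt_ge0 Omega p x s1) (wt_ge0 Omega p y s1) (powR_ge0 _ _) (powR_ge0 _ _)
  (powR_ge0 _ _) (powR_ge0 _ _) c0 (powR_ge0 _ _) (N0 x) o0 (N0 y) hT hD').
Qed.

(** In each term [pair_ker] integrates out the variable on which the rest does not depend, after
    Tonelli for the term in y. What remains are the sums of [exists_master_bound] and
    [exists_osc_bound]. *)
Lemma exists_near_pair_bound : exists2 C : R, 0 < C &
  forall s p u, s_lo <= s < 1 -> p_lo <= p <= p_hi -> measurable_fun setT u ->
  (\int[leb]_x \int[leb]_y (near_pair s p u x y)%:E <=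
   (C * (1 - s))%:E * (V_inside Omega s p u + V_across Omega s p u))%E.
Proof.
have [Cm Cm0 hCm] := exists_master_bound Olip Obnd r0 M0 vM cc slo01 plo1 plohi.
have [Co Co0 hCo] := exists_osc_bound Olip Obnd r0 M0 vM cc slo01 plo1 plohi.
have [Ck Ck0 hCk] := exists_pair_ker_mass.
have /andP[q0 q1] := cratio01 M0.
have [K defK K0] : exists2 K, K = pair_const & 0 < K.
  eexists; first reflexivity; apply: mulr_gt0; apply: powR_gt0 => //.
  by apply: mulr_gt0 => //; rewrite lt_min ltr01 invr_gt0.
have [c defc c0] : exists2 c, c = (om * om)^-1 & 0 < c.
  by eexists; first reflexivity; rewrite invr_gt0 mulr_gt0.
exists (K * (Ck * (2 * Cm + c * Co))).
  by apply: mulr_gt0 => //; apply: mulr_gt0 => //; apply: addr_gt0; apply: mulr_gt0.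
move=> s p u hs hp mu; have /andP[slo s1] := hs.
have s1' : 0 <= 1 - s by rewrite subr_ge0 ltW.
have nt0 j x' : (0 <= near_term s p u j x')%E by apply: near_term_ge0 hs _ _.
have ot0 j x' : (0 <= osc_term s p u j x')%E by apply: osc_term_ge0 hs _ _.
have mn j : measurable_fun setT (near_term s p u j) by apply: measurable_near_term.
have mo j : measurable_fun setT (osc_term s p u j) by apply: measurable_osc_term.
have pk0 j x' y' : (0 <= (pair_ker s p j x' y')%:E)%E by rewrite lee_fin pair_ker_ge0.
have mpk := measurable_pair_ker s p.
have ce : (0 <= c%:E)%E by rewrite lee_fin ltW.
have Ke : (0 <= K%:E)%E by rewrite lee_fin ltW.
pose F j x := (near_term s p u j x + c%:E * osc_term s p u j x)%E.
have F0 j x : (0 <= F j x)%E by rewrite /F adde_ge0// mule_ge0.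
have mF j : measurable_fun setT (F j).
  by apply: emeasurable_funD => //; apply: emeasurable_funM => //; exact: measurable_cst.
have mP1 j : measurable_fun setT (fun t : V * V => (pair_ker s p j t.1 t.2)%:E * F j t.1)%E.
  by have := mF j; have := mpk j; move: (F j) (pair_ker s p j) => f k mk mf; meas.
have mP2 j : measurable_fun setT (fun t : V * V => (pair_ker s p j t.2 t.1)%:E * near_term s p u j t.2)%E.
  by have := mn j; have := mpk j; move: (near_term s p u j) (pair_ker s p j) => f k mk mf; meas.
have P10 j x y : (0 <= (pair_ker s p j x y)%:E * F j x)%E by exact: mule_ge0.
have P20 j x y : (0 <= (pair_ker s p j y x)%:E * near_term s p u j y)%E by exact: mule_ge0.
apply: (@le_trans _ _ (\int[leb]_x \int[leb]_y \sum_(j <oo) pair_bound pair_const s p u j x y)%E).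
  have np0 x y : (0 <= (near_pair s p u x y)%:E)%E.
    rewrite lee_fin; apply: mulr_ge0; first exact: mulr_ge0.
    exact: mulr_ge0 (mulr_ge0 (wt_ge0 _ _ _ s1) (wt_ge0 _ _ _ s1)) (mulr_ge0 (powR_ge0 _ _) (trk_ge0 _ _ _ _ _)).
  apply: le_int => x; first exact: integral_ge0.
  by apply: le_int => y //; exact: near_pair_le.
have pbE j x y : pair_bound pair_const s p u j x y =
    (K%:E * ((pair_ker s p j x y)%:E * F j x + (pair_ker s p j y x)%:E * near_term s p u j y))%E.
  by rewrite /pair_bound -defK -defc.
have mpb j : measurable_fun setT (fun t : V * V => pair_bound pair_const s p u j t.1 t.2).
  under eq_fun do rewrite pbE.
  by apply: emeasurable_funM; [exact: measurable_cst|exact: emeasurable_funD (mP1 j) (mP2 j)].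
have pb0 j x y : (0 <= pair_bound pair_const s p u j x y)%E.
  by rewrite pbE; apply: mule_ge0 => //; exact: adde_ge0.
rewrite (int2_nneseries leb leb mpb pb0).
have term j : (\int[leb]_x \int[leb]_y pair_bound pair_const s p u j x y <=
    (K * Ck)%:E * (2%:E * \int[leb]_x near_term s p u j x + c%:E * \int[leb]_x osc_term s p u j x))%E.
  have mi1 : measurable_fun setT (fun x => \int[leb]_y ((pair_ker s p j x y)%:E * F j x))%E.
    exact: (@measurable_int _ _ _ _ _ leb (fun x y => (pair_ker s p j x y)%:E * F j x)%E (mP1 j) (P10 j)).
  have mi2 : measurable_fun setT (fun x => \int[leb]_y ((pair_ker s p j y x)%:E * near_term s p u j y))%E.
    exact: (@measurable_int _ _ _ _ _ leb (fun x y => (pair_ker s p j y x)%:E * near_term s p u j y)%E (mP2 j) (P20 j)).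
  have i10 x : (0 <= \int[leb]_y ((pair_ker s p j x y)%:E * F j x))%E by apply: integral_ge0 => y _; exact: P10.
  have i20 x : (0 <= \int[leb]_y ((pair_ker s p j y x)%:E * near_term s p u j y))%E.
    by apply: integral_ge0 => y _; exact: P20.
  rewrite (_ : \int[leb]_x \int[leb]_y _ = \int[leb]_x (K%:E *
     (\int[leb]_y ((pair_ker s p j x y)%:E * F j x) +
      \int[leb]_y ((pair_ker s p j y x)%:E * near_term s p u j y))))%E; last first.
    apply: eq_integral => x _; under eq_integral do rewrite pbE.
    have m1 := measurable_slice (u := fun x y => (pair_ker s p j x y)%:E * F j x)%E x (mP1 j).
    have m2 := measurable_slice (u := fun x y => (pair_ker s p j y x)%:E * near_term s p u j y)%E x (mP2 j).
    apply: (etrans (intZl leb (ltW K0) (emeasurable_funD m1 m2)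
      (fun y => adde_ge0 (P10 j x y) (P20 j x y)))); congr (_ * _)%E.
    exact: (ge0_integralD leb measurableT (fun y _ => P10 j x y) m1 (fun y _ => P20 j x y) m2).
  rewrite (intZl leb (ltW K0) (emeasurable_funD mi1 mi2) (fun x => adde_ge0 (i10 x) (i20 x))).
  rewrite (ge0_integralD leb measurableT (fun x _ => i10 x) mi1 (fun x _ => i20 x) mi2).
  rewrite (@tonelli _ _ _ _ _ leb leb (fun x y => (pair_ker s p j y x)%:E * near_term s p u j y)%E (mP2 j) (P20 j)).
  have hk x : (\int[leb]_y (pair_ker s p j x y)%:E <= Ck%:E)%E by exact: hCk.
  rewrite EFinM -muleA; apply: lee_wpmul2l => //.
  apply: le_trans (leeD (int_pair_ker s1 (ltW Ck0) hk (mF j) (F0 j))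
    (int_pair_ker s1 (ltW Ck0) hk (mn j) (nt0 j))) _.
  have mco : measurable_fun setT (fun x => c%:E * osc_term s p u j x)%E.
    by apply: emeasurable_funM => //; exact: measurable_cst.
  have co0 x : (0 <= c%:E * osc_term s p u j x)%E by exact: mule_ge0.
  rewrite (ge0_integralD leb measurableT (fun x _ => nt0 j x) (mn j) (fun x _ => co0 x) mco).
  rewrite (intZl leb (ltW c0) (mo j) (ot0 j)).
  have In0 : (0 <= \int[leb]_x near_term s p u j x)%E by exact: integral_ge0.
  have Io0 : (0 <= \int[leb]_x osc_term s p u j x)%E by exact: integral_ge0.
  rewrite -(ge0_muleDr _ (adde_ge0 In0 (mule_ge0 ce Io0)) In0).
  apply: lee_wpmul2l; first by rewrite lee_fin ltW.
  rewrite addeAC (_ : 2 = 1 + 1 :> R); last by ring.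
  by rewrite EFinD ge0_muleDl ?lee_fin// !mul1e.
have In0 j : (0 <= \int[leb]_x near_term s p u j x)%E by exact: integral_ge0.
have Io0 j : (0 <= \int[leb]_x osc_term s p u j x)%E by exact: integral_ge0.
have KC0 : 0 <= K * Ck by rewrite mulr_ge0 ?ltW.
have I20 j : (0 <= 2%:E * \int[leb]_x near_term s p u j x + c%:E * \int[leb]_x osc_term s p u j x)%E.
  by rewrite adde_ge0 ?mule_ge0.
apply: le_trans (lee_nneseries _ (fun j _ => term j)) _.
  by move=> j _ _; apply: integral_ge0 => x _; exact: integral_ge0.
rewrite nneseriesZl; last by move=> j _; exact: I20.
rewrite nneseriesD; last 2 first.
- by move=> j _ _; rewrite mule_ge0.
- by move=> j _ _; rewrite mule_ge0.
rewrite nneseriesZl; last by move=> j _; exact: In0.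
rewrite nneseriesZl; last by move=> j _; exact: Io0.
set X := V_inside Omega s p u; set Y := V_across Omega s p u.
have X0 : (0 <= X)%E by apply: integral_ge0 => y _; exact: inside_ge0.
have Y0 : (0 <= Y)%E.
  apply: integral_ge0 => x _; apply: integral_ge0 => y _; rewrite lee_fin.
  by apply: mulr_ge0 => //; apply: mulr_ge0 => //; exact: vker_ge0.
have h1 := hCm s p u hs hp mu.
have h2 : (\sum_(j <oo) \int[leb]_x osc_term s p u j x <= (Co * (1 - s))%:E * (X + Y))%E.
  apply: le_trans (hCo s p u hs hp mu) _; apply: lee_wpmul2l; first by rewrite lee_fin mulr_ge0// ltW.
  by rewrite leeDl.
have two : (0 <= 2%:E :> \bar R)%E by rewrite lee_fin.
have KCe : (0 <= (K * Ck)%:E)%E by rewrite lee_fin.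
apply: le_trans (lee_wpmul2l KCe (leeD (lee_wpmul2l two h1) (lee_wpmul2l ce h2))) _.
rewrite !muleA -!EFinM -ge0_muleDl; last 2 first.
- by rewrite lee_fin !mulr_ge0// ltW.
- by rewrite lee_fin !mulr_ge0// ltW.
rewrite muleA -EFinD -EFinM le_eqVlt; apply/orP; left; apply/eqP.
by congr (_%:E * _)%E; ring.
Qed.

End chart_trace.

Lemma mass_algebra {R : realType} (w B b b' P P' Y : R) (N L : \bar R) :
  0 <= w -> 0 <= B -> 0 <= P -> 0 <= b' -> (0 <= N)%E -> (0 <= L)%E -> b * b' = 1 -> P <= P' ->
  (Y%:E <= P%:E * (N + B%:E * L))%E ->
  ((w * Y)%:E <= P'%:E * (b%:E * (w%:E * (b'%:E * N)) + B%:E * (L * w%:E)))%E.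
Proof.
move=> w0 B0 P0 b'0 N0 L0 bb PP hY; have we : (0 <= w%:E)%E by rewrite lee_fin.
have BL0 : (0 <= B%:E * L)%E by rewrite mule_ge0.
rewrite EFinM; apply: le_trans (lee_wpmul2l we hY) _; rewrite muleCA.
apply: (@le_trans _ _ (P'%:E * (w%:E * (N + B%:E * L)))%E).
  by apply: lee_wpmul2r; [rewrite mule_ge0 ?adde_ge0|rewrite lee_fin].
apply: lee_wpmul2l; first by rewrite lee_fin (le_trans P0).
rewrite (ge0_muleDr _ N0 BL0); apply: leeD; last by rewrite muleCA (muleC L).
by rewrite !muleA -!EFinM mulrAC bb mul1r.
Qed.

(** * The weighted mass in one chart *)

Section chart_mass.
Context {R : realType} {n : nat} (Omega : set 'rV[R]_n.+1).
Local Notation V := 'rV[R]_n.+1.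
Local Notation d := (dist_bd Omega).
Local Notation leb := (@lebesgue_rV R n.+1).
Local Notation om := (@vball R n).
Local Notation wt := (wt Omega).
Hypotheses (Olip : lipschitz_domain Omega) (Obnd : bounded_set Omega).
Let oO : open Omega. Proof. by have [] := Olip. Qed.
Let bd0 : boundary Omega !=set0. Proof. by have [] := Olip. Qed.
Let mO : measurable Omega := open_measurable_rV oO.
Let mcO : measurable (~` Omega) := measurableC mO.
Let om0 := @vball_gt0 R n.
Variables (s_lo p_lo p_hi : R).
Hypotheses (slo01 : 0 < s_lo < 1) (plo1 : 1 < p_lo) (plohi : p_lo <= p_hi).

(** What the trace estimates require of [u]; [trace_energy_le] bounds it by twice the p-th power of
    the norm. *)
Definition trace_energy (s p : R) (u : V -> R) : \bar R :=
  (Lp_pow Omega p u + (1 - s)%:E * (V_inside Omega s p u + V_across Omega s p u))%E.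

Lemma V_inside_ge0 s p u : (0 <= V_inside Omega s p u)%E.
Proof. by apply: integral_ge0 => y _; exact: inside_ge0. Qed.

Lemma across_ge0 s p u x : (0 <= \int[leb]_y (\1_(~` Omega) x * (\1_Omega y * vker s p u x y))%:E)%E.
Proof.
apply: integral_ge0 => y _; rewrite lee_fin.
by apply: mulr_ge0 => //; apply: mulr_ge0 => //; exact: vker_ge0.
Qed.

Lemma V_across_ge0 s p u : (0 <= V_across Omega s p u)%E.
Proof. by apply: integral_ge0 => x _; exact: across_ge0. Qed.

Lemma trace_energy_ge s p u : s < 1 ->
  (Lp_pow Omega p u <= trace_energy s p u /\
   (1 - s)%:E * (V_inside Omega s p u + V_across Omega s p u) <= trace_energy s p u)%E.
Proof.
move=> s1; have V0 := adde_ge0 (V_inside_ge0 s p u) (V_across_ge0 s p u).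
have L0 := Lp_pow_ge0 Omega p u.
have c0 : (0 <= (1 - s)%:E)%E by rewrite lee_fin subr_ge0 ltW.
by rewrite /trace_energy; split; [rewrite leeDl// mule_ge0|rewrite leeDr].
Qed.

Lemma trace_energy_ge0 s p u : s < 1 -> (0 <= trace_energy s p u)%E.
Proof. by move=> s1; apply: (le_trans (Lp_pow_ge0 Omega p u)); case: (trace_energy_ge p u s1). Qed.

Variables (z v : V) (r M : R).
Hypotheses (r0 : 0 < r) (M0 : 0 < M) (vM : enorm v <= M) (cc : cone_chart Omega r z v).
Local Notation near_term := (near_term Omega z v r M).

Definition near_mass (s p : R) (u : V -> R) (x : V) : R :=
  (d x < r)%R%:R * (enorm (x - z) < 2 * r)%R%:R * (wt s p x * `|u x| `^ p).

(** Scale 0 suffices, where t_0 = r: the shifted ball of radius r lies in [Omega], and [mass_split]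
    compares u x with the values there. *)
Lemma near_mass_le s p u x : s_lo <= s < 1 -> p_lo <= p <= p_hi -> measurable_fun setT u ->
  ((near_mass s p u x)%:E <= (2 `^ p_hi)%:E * ((r `^ (s * (p - 1)))%:E * near_term s p u 0 x +
     ((om * r ^+ n.+1)^-1)%:E * (Lp_pow Omega p u * (wt s p x)%:E)))%E.
Proof.
move=> hs hp mu; have /andP[slo s1] := hs; have /andP[plo phi] := hp.
have p1 : 1 <= p by rewrite (le_trans _ plo)// ltW.
have L0 := Lp_pow_ge0 Omega p u.
have w0 : 0 <= wt s p x by exact: wt_ge0.
have n0 : (0 <= near_term s p u 0 x)%E by apply: near_term_ge0 hs _ _.
have B0 : 0 <= (om * r ^+ n.+1)^-1 by rewrite invr_ge0 mulr_ge0 ?exprn_ge0 ?ltW.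
have R0 : (0 <= (r `^ (s * (p - 1)))%:E * near_term s p u 0 x +
     ((om * r ^+ n.+1)^-1)%:E * (Lp_pow Omega p u * (wt s p x)%:E))%E.
  by apply: adde_ge0; apply: mule_ge0 => //; [rewrite lee_fin powR_ge0|rewrite mule_ge0].
have R0' : (0 <= (2 `^ p_hi)%:E * ((r `^ (s * (p - 1)))%:E * near_term s p u 0 x +
     ((om * r ^+ n.+1)^-1)%:E * (Lp_pow Omega p u * (wt s p x)%:E)))%E.
  by apply: mule_ge0 => //; rewrite lee_fin powR_ge0.
have zero : near_mass s p u x = 0 -> ((near_mass s p u x)%:E <= (2 `^ p_hi)%:E *
    ((r `^ (s * (p - 1)))%:E * near_term s p u 0 x +
     ((om * r ^+ n.+1)^-1)%:E * (Lp_pow Omega p u * (wt s p x)%:E)))%E by move=> ->.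
have [hd|hd] := ltP (d x) r; last by apply: zero; rewrite /near_mass ltNge hd !mul0r.
have [hz|hz] := ltP (enorm (x - z)) (2 * r); last first.
  by apply: zero; rewrite /near_mass [(enorm _ < _)%R]ltNge hz mulr0 mul0r.
have [Ox|Ox] := pselect (Omega x); first by apply: zero; rewrite /near_mass wt_in// !(mul0r, mulr0).
have t0E : scale r M 0 = r by rewrite /scale expr0 mulr1.
have hz3 : enorm (x - z) < 3 * r.
  by rewrite (lt_le_trans hz)// ler_wpM2r ?(ltW r0)// ler_nat.
have hd' : d x < scale r M 0 by rewrite t0E.
have b1 : below Omega z r M 0 x = 1.
  by rewrite /below /collar hz3 hd' indicE mem_set// !mulr1.
have hO y : enorm (y - shift v r M 0 x) < r -> Omega y.
  move=> hy; have [|Oy _ _] // := cone_in Olip r0 M0 vM cc Ox hz3 hd' (y := y).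
  by rewrite t0E (lt_le_trans hy)// ler_peMl ?ler1n// ltW.
have ms := mass_split x p1 r0 mu hO.
set N := avg _ _ _ in ms.
have N0 : (0 <= N)%E by apply: avg_ge0 => // y; rewrite lee_fin powR_ge0.
have nE : near_term s p u 0 x = ((wt s p x)%:E * ((r `^ (- (s * (p - 1))))%:E * N))%E.
  rewrite /near_term b1 t0E (mul1r (r `^ _)) /near_avg t0E; reflexivity.
have mE : near_mass s p u x = wt s p x * `|u x| `^ p.
  by rewrite /near_mass hd hz; have aux (a : R) : 1 * 1 * a = a by ring; exact: aux.
have h2 : 2 `^ p <= 2 `^ p_hi :> R by apply: ler_powR => //; rewrite ler1n.
have rr : r `^ (s * (p - 1)) * r `^ (- (s * (p - 1))) = 1 by rewrite -powR_add// subrr powRr0.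
rewrite mE nE; exact: (mass_algebra w0 B0 (powR_ge0 _ _) (powR_ge0 _ _) N0 L0 rr h2 ms).
Qed.

Lemma exists_near_mass_bound : exists2 C : R, 0 < C &
  forall s p u, s_lo <= s < 1 -> p_lo <= p <= p_hi -> measurable_fun setT u ->
  (\int[leb]_x (near_mass s p u x)%:E <= C%:E * trace_energy s p u)%E.
Proof.
have [Cm Cm0 hCm] := exists_master_bound Olip Obnd r0 M0 vM cc slo01 plo1 plohi.
have /andP[slo0 _] := slo01.
have [W W0 hW] := int_wt_unif Olip Obnd slo0.
pose B := (om * r ^+ n.+1)^-1.
have B0 : 0 < B by rewrite /B invr_gt0 mulr_gt0 ?exprn_gt0.
pose Kr := (1 + r) `^ p_hi.
have Kr0 : 0 < Kr by apply: powR_gt0; rewrite addr_gt0.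
exists (2 `^ p_hi * (Kr * Cm + B * W)).
  by apply: mulr_gt0; [exact: powR_gt0|apply: addr_gt0; exact: mulr_gt0].
move=> s p u hs hp mu; have /andP[slo s1] := hs; have /andP[plo phi] := hp.
have p1 : 1 <= p by rewrite (le_trans _ plo)// ltW.
have L0 := Lp_pow_ge0 Omega p u.
have mw := measurable_wt Olip s p.
have w0 x : (0 <= (wt s p x)%:E)%E by rewrite lee_fin wt_ge0.
have Be : (0 <= B%:E)%E by rewrite lee_fin ltW.
have Kre : (0 <= Kr%:E)%E by rewrite lee_fin ltW.
have P0 : (0 <= (2 `^ p_hi : R)%:E)%E by rewrite lee_fin powR_ge0.
have k0 : 0 <= r `^ (s * (p - 1)) by exact: powR_ge0.
have hk : r `^ (s * (p - 1)) <= Kr.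
  have e0 : 0 <= s * (p - 1) by rewrite mulr_ge0 ?subr_ge0// (le_trans (ltW slo0)).
  apply: (@le_trans _ _ ((1 + r) `^ (s * (p - 1)))).
    by apply: ge0_ler_powR; rewrite ?nnegrE ?(ltW r0) ?addr_ge0 ?lerDr// ltW.
  rewrite ler_powR ?lerDl ?(ltW r0)//; apply: le_trans phi.
  apply: (@le_trans _ _ (1 * (p - 1))); last by rewrite mul1r gerBl.
  by apply: ler_wpM2r; [rewrite subr_ge0|exact: ltW].
have nt0 x : (0 <= near_term s p u 0 x)%E by apply: near_term_ge0 hs _ _.
have ntj0 j x : (0 <= near_term s p u j x)%E by apply: near_term_ge0 hs _ _.
have mn : measurable_fun setT (near_term s p u 0) by apply: measurable_near_term.
pose F1 x := ((r `^ (s * (p - 1)))%:E * near_term s p u 0 x)%E.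
pose F2 x := (B%:E * (Lp_pow Omega p u * (wt s p x)%:E))%E.
have m1 : measurable_fun setT F1 by apply: emeasurable_funM => //; exact: measurable_cst.
have mLw : measurable_fun setT (fun x => Lp_pow Omega p u * (wt s p x)%:E)%E.
  by apply: emeasurable_funM; [exact: measurable_cst|exact/measurable_EFinP].
have m2 : measurable_fun setT F2 by apply: emeasurable_funM => //; exact: measurable_cst.
have Lw0 x : (0 <= Lp_pow Omega p u * (wt s p x)%:E)%E by exact: mule_ge0.
have F10 x : (0 <= F1 x)%E by rewrite /F1 mule_ge0 ?lee_fin.
have F20 x : (0 <= F2 x)%E by exact: mule_ge0.
apply: (@le_trans _ _ (\int[leb]_x ((2 `^ p_hi)%:E * (F1 x + F2 x)))%E).
  apply: le_int => x; last exact: near_mass_le.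
  rewrite lee_fin; apply: mulr_ge0; first exact: mulr_ge0.
  by apply: mulr_ge0; [exact: wt_ge0|exact: powR_ge0].
rewrite (intZl leb (powR_ge0 _ _) (emeasurable_funD m1 m2) (fun x => adde_ge0 (F10 x) (F20 x))).
rewrite (ge0_integralD leb measurableT (fun x _ => F10 x) m1 (fun x _ => F20 x) m2).
rewrite EFinM -muleA; apply: lee_wpmul2l => //.
rewrite /F1 /F2 (intZl leb k0 mn nt0) (intZl leb (ltW B0) mLw Lw0).
have [e1 e2] := trace_energy_ge p u s1.
have te0 := trace_energy_ge0 p u s1.
have i1 : (\int[leb]_x near_term s p u 0 x <= Cm%:E * trace_energy s p u)%E.
  apply: (@le_trans _ _ (\sum_(j <oo) \int[leb]_x near_term s p u j x)%E).
    by apply: (nneseries_ge_term (f := fun j => \int[leb]_x near_term s p u j x)%E) => j; exact: integral_ge0.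
  apply: le_trans (hCm s p u hs hp mu) _; rewrite EFinM -muleA.
  by apply: lee_wpmul2l => //; rewrite lee_fin ltW.
have i2 : (\int[leb]_x (Lp_pow Omega p u * (wt s p x)%:E) <= W%:E * trace_energy s p u)%E.
  rewrite ge0_integralZl//; last exact/measurable_EFinP.
  by rewrite muleC; apply: lee_pmul => //; [exact: integral_ge0|exact: hW].
have c1 : (0 <= (Kr * Cm)%:E)%E by rewrite lee_fin; exact: mulr_ge0 (ltW Kr0) (ltW Cm0).
have c2 : (0 <= (B * W)%:E)%E by rewrite lee_fin; exact: mulr_ge0 (ltW B0) (ltW W0).
rewrite [in leRHS]EFinD [in leRHS](ge0_muleDl _ c1 c2); apply: leeD.
  rewrite [in leRHS]EFinM -[leRHS]muleA; apply: lee_pmul i1; rewrite ?lee_fin//.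
  exact: integral_ge0.
by rewrite [in leRHS]EFinM -[leRHS]muleA; apply: lee_wpmul2l i2.
Qed.

End chart_mass.

Lemma le_sum_seq {R : realType} (T : eqType) (zs : seq T) (f : T -> \bar R) z :
  z \in zs -> (forall t, 0 <= f t)%E -> (f z <= \sum_(t <- zs) f t)%E.
Proof. by move=> zin f0; rewrite (big_rem z)//= leeDl// sume_ge0. Qed.

Lemma sum_seq_le {R : realType} (T : eqType) (zs : seq T) (f : T -> \bar R) (C : T -> R) (E : \bar R) :
  (forall t, 0 <= C t) -> (forall t, t \in zs -> f t <= (C t)%:E * E)%E ->
  (\sum_(t <- zs) f t <= (\sum_(t <- zs) C t)%:E * E)%E.
Proof.
move=> C0 h; rewrite -sumEFin ge0_sume_distrl; last by move=> t _; rewrite lee_fin.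
by rewrite big_seq [leRHS]big_seq; apply: lee_sum => t; exact: h.
Qed.

Lemma far_algebra {R : realType} (w w' D T A P X Y : R) : 0 <= w -> 0 <= w' -> 0 <= D -> 0 <= T ->
  T <= A -> D <= P * (X + Y) -> w * w' * (D * T) <= A * P * (w * X * w' + w' * Y * w).
Proof.
move=> w0 w'0 D0 T0 TA hD.
apply: (@le_trans _ _ (w * w' * (P * (X + Y) * A))).
  by apply: ler_wpM2l; [exact: mulr_ge0|exact: ler_pM].
by rewrite le_eqVlt; apply/orP; left; apply/eqP; ring.
Qed.

(** * The trace estimate for mass and energy *)

Section trace_bound.
Context {R : realType} {n : nat} (Omega : set 'rV[R]_n.+1).
Local Notation V := 'rV[R]_n.+1.
Local Notation d := (dist_bd Omega).
Local Notation leb := (@lebesgue_rV R n.+1).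
Local Notation om := (@vball R n).
Local Notation wt := (wt Omega).
Local Notation rho := (rho Omega).
Local Notation trk := (trk Omega).
Local Notation T_mass := (T_mass Omega).
Local Notation T_energy := (T_energy Omega).
Local Notation trace_energy := (trace_energy Omega).
Hypotheses (Olip : lipschitz_domain Omega) (Obnd : bounded_set Omega).
Let oO : open Omega. Proof. by have [] := Olip. Qed.
Let bd0 : boundary Omega !=set0. Proof. by have [] := Olip. Qed.
Let mO : measurable Omega := open_measurable_rV oO.
Let mcO : measurable (~` Omega) := measurableC mO.
Let om0 := @vball_gt0 R n.
Variables (s_lo p_lo p_hi : R).
Hypotheses (slo01 : 0 < s_lo < 1) (plo1 : 1 < p_lo) (plohi : p_lo <= p_hi).

Lemma ball_in_domain : exists c t, 0 < t /\ forall y, enorm (y - c) < t -> Omega y.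
Proof.
have [z bz] := bd0; have [_ h] := (boundaryP oO z).1 bz.
have [y Oy _] := h 1 ltr01; have [e e0 he] := open_eball oO Oy.
by exists y, e; split => // y' yy'; apply: he; rewrite enormBC.
Qed.

(** For r <= d x, a boundary point within 2 d x of x gives |x - y| <= 2 d x + 2 D <= (2 + 2 D / r) d
    x, so the density is dominated by 1 - s times the kernel of [V_space], for every y in
    [Omega]. *)
Lemma wt_far_le (D r s p : R) x y : 0 < r -> 0 < D ->
  (forall y, Omega y -> enorm y <= D) -> (forall y, boundary Omega y -> enorm y <= D) ->
  s_lo <= s < 1 -> p_lo <= p <= p_hi -> r <= d x -> Omega y -> ~ Omega x ->
  wt s p x <= (2 + 2 * D / r) `^ (n.+1%:R + p_hi) * (1 - s) * enorm (x - y) `^ (- (n.+1%:R + s * p)).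
Proof.
move=> r0 D0 hD1 hD2 /andP[slo s1] /andP[plo phi] rd Oy Ox.
have h1 := slo01; have h2 := plo1.
have s0 : 0 < s by lra. have p1 : 1 < p by lra. have s1' : 0 <= 1 - s by lra.
have dx0 : 0 < d x by lra.
have n1 : 1 <= n.+1%:R :> R by rewrite ler1n.
have spp : s * p <= p_hi.
  by apply: le_trans phi; rewrite -[leRHS]mul1r; apply: ler_wpM2r; lra.
have sp0 : 0 <= s * p by rewrite mulr_ge0; lra.
have sp10 : 0 <= s * (p - 1) by rewrite mulr_ge0; lra.
pose L := 2 + 2 * D / r.
have Dr0 : 0 <= D / r by rewrite divr_ge0 ?ltW.
have L1 : 1 <= L by rewrite /L -mulrA; lra.
have xy0 : 0 < enorm (x - y).
  by rewrite enormBC; apply: lt_le_trans (dist_cross_in oO bd0 Oy Ox); exact: dist_gt0.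
have xyL : enorm (x - y) <= L * d x.
  have dd : d x < 2 * d x by lra.
  have [z bz xz] := dist_lt bd0 dd.
  have hz := hD2 z bz; have hy := hD1 y Oy.
  have t1 := enorm_tri z x y; have t2 := enormB z y.
  have : 2 * D <= 2 * D / r * d x by rewrite mulrAC ler_pdivlMr// ler_wpM2l// mulr_ge0// ltW.
  by rewrite /L; lra.
have key : d x `^ (- (n.+1%:R + s * p)) <= L `^ (n.+1%:R + s * p) * enorm (x - y) `^ (- (n.+1%:R + s * p)).
  by apply: negpow_le => //; lra.
have LL : L `^ (n.+1%:R + s * p) <= L `^ (n.+1%:R + p_hi) by apply: ler_powR => //; lra.
rewrite wt_out// /mu_density -mulrA [leRHS]mulrAC [leRHS]mulrC; apply: ler_wpM2l => //.
apply: (@le_trans _ _ (d x `^ (- (n.+1%:R + s * p)))); last first.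
  by apply: le_trans key _; apply: ler_wpM2r => //; exact: powR_ge0.
have -> : - (n.+1%:R + s * p) = - s + (- n.+1%:R - s * (p - 1)) by ring.
rewrite [in leRHS]powR_add//; apply: ler_wpM2l; first exact: powR_ge0.
have -> : - n.+1%:R - s * (p - 1) = - (n.+1%:R + s * (p - 1)) by ring.
have a1 : 0 < 1 + d x by lra.
have := @negpow_le R (d x) (1 + d x) 1 (n.+1%:R + s * (p - 1)) dx0 a1 ltr01.
by rewrite powR1 !mul1r; apply; lra.
Qed.

(** Points with d < r are covered by the charts. All others are compared with the values of [u] in
    one fixed ball of [Omega]: [wt_far_le] turns their density into the interaction across the
    boundary, and [int_wt_unif] bounds the coefficient of the L^p norm. *)
Lemma exists_mass_bound : exists2 C : R, 0 < C &
  forall s p u, s_lo <= s < 1 -> p_lo <= p <= p_hi -> measurable_fun setT u ->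
  (T_mass s p u <= C%:E * trace_energy s p u)%E.
Proof.
have [zs [v [r [M [r0 M0 hv hcov]]]]] := finite_charts Olip Obnd.
have /andP[slo0 _] := slo01.
have [W W0 hW] := int_wt_unif Olip Obnd slo0.
have [c [t [t0 hct]]] := ball_in_domain.
have [D D1 [hD1 [_ hD2]]] := bounded_domain Olip Obnd.
have D0 : 0 < D by exact: lt_le_trans D1.
have /choice[Cf hCf] : forall z, exists C, 0 <= C /\ (z \in zs -> forall s p u,
    s_lo <= s < 1 -> p_lo <= p <= p_hi -> measurable_fun setT u ->
    (\int[leb]_x (near_mass Omega z r s p u x)%:E <= C%:E * trace_energy s p u)%E).
  move=> z; have [zin|nz] := boolP (z \in zs); last by exists 0.
  have [vM cc] := hv z zin.
  have [C C0 hC] := exists_near_mass_bound Olip Obnd slo01 plo1 plohi r0 M0 vM cc.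
  by exists C; split; [exact: ltW|].
pose B := (om * t ^+ n.+1)^-1.
have B0 : 0 < B by rewrite /B invr_gt0 mulr_gt0 ?exprn_gt0.
have [K defK K0] : exists2 K, K = (2 + 2 * D / r) `^ (n.+1%:R + p_hi) & 0 < K.
  by eexists; first reflexivity; apply: powR_gt0; rewrite addr_gt0// divr_gt0 ?mulr_gt0.
have [P defP P0] : exists2 P : R, P = 2 `^ p_hi & 0 < P.
  by eexists; first reflexivity; exact: powR_gt0.
pose C2 := P * (B * (K + W)).
have C20 : 0 < C2 by apply: mulr_gt0 => //; apply: mulr_gt0 => //; exact: addr_gt0.
have S0 : 0 <= \sum_(z <- zs) Cf z by apply: sumr_ge0 => z _; case: (hCf z).
exists (\sum_(z <- zs) Cf z + C2); first exact: ltr_wpDl.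
move=> s p u hs hp mu; have /andP[slo s1] := hs; have /andP[plo phi] := hp.
have p1 : 1 <= p by rewrite (le_trans _ plo)// ltW.
have s1' : 0 <= 1 - s by rewrite subr_ge0 ltW.
have mw := measurable_wt Olip s p.
have w0 x : 0 <= wt s p x by exact: wt_ge0.
have we x : (0 <= (wt s p x)%:E)%E by rewrite lee_fin.
have L0 := Lp_pow_ge0 Omega p u.
have te0 := trace_energy_ge0 Omega p u s1.
have mv := measurable_vker s p mu.
pose far x := (r <= d x)%R%:R * (wt s p x * `|u x| `^ p).
have far0 x : 0 <= far x.
  by apply: mulr_ge0 => //; exact: mulr_ge0 (w0 x) (powR_ge0 _ _).
have mfar : measurable_fun setT far by rewrite /far; meas.
have nm0 z x : (0 <= (near_mass Omega z r s p u x)%:E)%E.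
  rewrite lee_fin; apply: mulr_ge0; first exact: mulr_ge0.
  exact: mulr_ge0 (w0 x) (powR_ge0 _ _).
have mnm z : measurable_fun setT (fun x => (near_mass Omega z r s p u x)%:E).
  by rewrite /near_mass; meas.
pose acr x := (\int[leb]_y (\1_(~` Omega) x * (\1_Omega y * vker s p u x y))%:E)%E.
have acr0 x : (0 <= acr x)%E by exact: across_ge0.
have macr : measurable_fun setT acr.
  apply: (@measurable_int _ _ _ _ _ leb (fun x y => (\1_(~` Omega) x * (\1_Omega y * vker s p u x y))%:E)).
    by meas.
  move=> x y; rewrite lee_fin; apply: mulr_ge0 => //.
  by apply: mulr_ge0 => //; exact: vker_ge0.
have K1 : 0 <= K * (1 - s) by exact: mulr_ge0 (ltW K0) s1'.
have K1e : (0 <= (K * (1 - s))%:E)%E by rewrite lee_fin.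
have Be : (0 <= B%:E)%E by rewrite lee_fin ltW.
have farle x : ((far x)%:E <= P%:E * (B%:E * ((K * (1 - s))%:E * acr x + Lp_pow Omega p u * (wt s p x)%:E)))%E.
  have R0 : (0 <= (K * (1 - s))%:E * acr x + Lp_pow Omega p u * (wt s p x)%:E)%E.
    by apply: adde_ge0; exact: mule_ge0.
  have RR0 : (0 <= P%:E * (B%:E * ((K * (1 - s))%:E * acr x + Lp_pow Omega p u * (wt s p x)%:E)))%E.
    by apply: mule_ge0; [rewrite lee_fin ltW|exact: mule_ge0].
  rewrite /far; have [rd|_] := leP r (d x); last by rewrite mul0r.
  have [Ox|Ox] := pselect (Omega x); first by rewrite (_ : true%:R * _ = 0)// wt_in// mul0r mulr0.
  rewrite (mul1r (wt s p x * _)).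
  have f0 y : (0 <= (`|u x - u y| `^ p)%:E)%E by rewrite lee_fin powR_ge0.
  have A1 y : enorm (y - c) < t -> 1 <= \1_Omega y :> R by move=> /hct Oy; rewrite indicE mem_set.
  have ms := mass_split x p1 t0 mu hct.
  have iO y : 0 <= \1_Omega y :> R by [].
  have av := avg_le_int t0 f0 A1 iO.
  have i0 : (0 <= \int[leb]_y ((\1_Omega y)%:E * (`|u x - u y| `^ p)%:E))%E.
    by apply: integral_ge0 => y _; rewrite mule_ge0// lee_fin.
  have wi : ((wt s p x)%:E * \int[leb]_y ((\1_Omega y)%:E * (`|u x - u y| `^ p)%:E) <=
      (K * (1 - s))%:E * acr x)%E.
    have mi : measurable_fun setT (fun y => (\1_Omega y)%:E * (`|u x - u y| `^ p)%:E)%E by meas.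
    have ii0 y : (0 <= (\1_Omega y)%:E * (`|u x - u y| `^ p)%:E)%E by rewrite mule_ge0// lee_fin.
    have ma : measurable_fun setT (fun y => (\1_(~` Omega) x * (\1_Omega y * vker s p u x y))%:E).
      by have := measurable_slice x mv; move: (vker s p u x) => vx mvx; meas.
    have ia0 y : (0 <= (\1_(~` Omega) x * (\1_Omega y * vker s p u x y))%:E)%E.
      rewrite lee_fin; apply: mulr_ge0 => //.
      by apply: mulr_ge0 => //; exact: vker_ge0.
    rewrite -(intZl leb (w0 x) mi ii0) /acr -(intZl leb K1 ma ia0).
    apply: le_int => y; first by rewrite mule_ge0// mule_ge0// lee_fin.
    rewrite -!EFinM lee_fin.
    have [Oy|Oy] := pselect (Omega y); last first.
      by rewrite [\1_Omega y]indicE memNset// !(mul0r, mulr0).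
    have hw := wt_far_le r0 D0 hD1 hD2 hs hp rd Oy Ox; rewrite -defK in hw.
    rewrite !indicE mem_set// mem_set// !mul1r /vker.
    have aux (a b1 b2 : R) : a * (b1 * b2) = a * b2 * b1 by ring.
    by rewrite aux; apply: ler_wpM2r => //; exact: powR_ge0.
  rewrite EFinM; apply: le_trans (lee_wpmul2l (we x) ms) _; rewrite muleCA.
  have h2 : 2 `^ p <= P by rewrite defP; apply: ler_powR => //; rewrite ler1n.
  have a0 : (0 <= avg c t (fun y => (`|u x - u y| `^ p)%:E))%E by exact: avg_ge0.
  have BL0 : (0 <= B%:E * Lp_pow Omega p u)%E := mule_ge0 Be L0.
  apply: lee_pmul; rewrite ?lee_fin ?powR_ge0//.
    exact: mule_ge0 (we x) (adde_ge0 a0 BL0).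
  rewrite (ge0_muleDr _ a0 BL0) (ge0_muleDr B%:E (mule_ge0 K1e (acr0 x)) (mule_ge0 L0 (we x))).
  apply: leeD; last by rewrite muleCA (muleC (Lp_pow _ _ _)).
  apply: le_trans (lee_wpmul2l (we x) av) _; rewrite muleCA; exact: lee_wpmul2l.
have Pe : (0 <= P%:E)%E by rewrite lee_fin ltW.
have mLw : measurable_fun setT (fun x => Lp_pow Omega p u * (wt s p x)%:E)%E.
  by apply: emeasurable_funM; [exact: measurable_cst|exact/measurable_EFinP].
have mKa : measurable_fun setT (fun x => (K * (1 - s))%:E * acr x)%E.
  by apply: emeasurable_funM => //; exact: measurable_cst.
have Ka0 x : (0 <= (K * (1 - s))%:E * acr x)%E by exact: mule_ge0.
have Lw0 x : (0 <= Lp_pow Omega p u * (wt s p x)%:E)%E by exact: mule_ge0.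
have msum := emeasurable_funD mKa mLw.
have sum0 x := adde_ge0 (Ka0 x) (Lw0 x).
have [e1 e2] := trace_energy_ge Omega p u s1.
have ifar : (\int[leb]_x (far x)%:E <= C2%:E * trace_energy s p u)%E.
  apply: (@le_trans _ _ (\int[leb]_x (P%:E * (B%:E * ((K * (1 - s))%:E * acr x + Lp_pow Omega p u * (wt s p x)%:E))))%E).
    by apply: le_int => x; [rewrite lee_fin|exact: farle].
  have mB : measurable_fun setT (fun x => B%:E * ((K * (1 - s))%:E * acr x + Lp_pow Omega p u * (wt s p x)%:E))%E.
    by apply: emeasurable_funM => //; exact: measurable_cst.
  rewrite (intZl leb (ltW P0) mB (fun x => mule_ge0 Be (sum0 x))) (intZl leb (ltW B0) msum sum0).
  rewrite (ge0_integralD leb measurableT (fun x _ => Ka0 x) mKa (fun x _ => Lw0 x) mLw).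
  rewrite /C2 [in leRHS]EFinM -[leRHS]muleA; apply: lee_wpmul2l => //.
  rewrite [in leRHS]EFinM -[leRHS]muleA; apply: lee_wpmul2l => //.
  rewrite (intZl leb K1 macr acr0) ge0_integralZl//; last exact/measurable_EFinP.
  have Ke : (0 <= K%:E)%E by rewrite lee_fin ltW.
  have We : (0 <= W%:E)%E by rewrite lee_fin ltW.
  rewrite [in leRHS]EFinD [in leRHS](ge0_muleDl _ Ke We); apply: leeD.
    rewrite EFinM -muleA; apply: lee_wpmul2l => //; apply: le_trans e2.
    by apply: lee_wpmul2l; [rewrite lee_fin|rewrite leeDr// V_inside_ge0].
  rewrite muleC; apply: lee_pmul e1 => //; [exact: integral_ge0|exact: hW].
apply: (@le_trans _ _ (\int[leb]_x (\sum_(z <- zs) (near_mass Omega z r s p u x)%:E + (far x)%:E))%E).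
  apply: le_int => x; first by rewrite lee_fin; exact: mulr_ge0 (w0 x) (powR_ge0 _ _).
  have sn0 : (0 <= \sum_(z <- zs) (near_mass Omega z r s p u x)%:E)%E by exact: sume_ge0.
  have [rd|dr] := leP r (d x).
    by rewrite /far rd (mul1r (wt s p x * _)) leeDr.
  have [z zin xz] := hcov x dr.
  apply: (@le_trans _ _ (near_mass Omega z r s p u x)%:E).
    by rewrite /near_mass dr xz; have aux (a : R) : 1 * 1 * a = a by [ring]; rewrite aux.
  apply: le_trans (le_sum_seq (f := fun z => (near_mass Omega z r s p u x)%:E) zin (fun z => nm0 z x)) _.
  by rewrite leeDl// lee_fin.
have msn : measurable_fun setT (fun x => \sum_(z <- zs) (near_mass Omega z r s p u x)%:E)%E.
  by apply: emeasurable_sum.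
have sn0 x : (0 <= \sum_(z <- zs) (near_mass Omega z r s p u x)%:E)%E by apply: sume_ge0.
have mfe : measurable_fun setT (fun x => (far x)%:E) by exact/measurable_EFinP.
have fe0 x : (0 <= (far x)%:E)%E by rewrite lee_fin.
rewrite (ge0_integralD leb measurableT (fun x _ => sn0 x) msn (fun x _ => fe0 x) mfe).
have S0e : (0 <= (\sum_(z <- zs) Cf z)%:E)%E by rewrite lee_fin.
have C2e : (0 <= C2%:E)%E by rewrite lee_fin ltW.
rewrite [in leRHS]EFinD [in leRHS](ge0_muleDl _ S0e C2e); apply: leeD ifar.
rewrite ge0_integral_sum//; apply: sum_seq_le => z; first by case: (hCf z).
by move=> zin; apply: (proj2 (hCf z)).
Qed.

(** For rho x y >= r the trace kernel is bounded, and |u x - u y|^p is split by the triangle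
    inequality. *)
Lemma far_pair_le (r s p : R) (u : V -> R) x y : 0 < r -> s_lo <= s < 1 -> p_lo <= p <= p_hi ->
  (r <= rho x y)%R%:R * (wt s p x * wt s p y * (`|u x - u y| `^ p * trk s p x y)) <=
  Num.min r 1 `^ (- (n.+1%:R + p_hi)) * 2 `^ p_hi *
    (wt s p x * `|u x| `^ p * wt s p y + wt s p y * `|u y| `^ p * wt s p x).
Proof.
move=> r0 hs hp; have /andP[slo s1] := hs; have /andP[plo phi] := hp.
have h1 := slo01; have h2 := plo1.
have p1 : 1 <= p by lra. have p0 : 0 <= p by lra. have s0 : 0 < s by lra.
have w0 : 0 <= wt s p x by exact: wt_ge0.
have w0' : 0 <= wt s p y by exact: wt_ge0.
set w := wt s p x in w0 *; set w' := wt s p y in w0' *.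
have X0 := powR_ge0 `|u x| p; have Y0 := powR_ge0 `|u y| p.
have hD : `|u x - u y| `^ p <= 2 `^ p_hi * (`|u x| `^ p + `|u y| `^ p).
  apply: (@le_trans _ _ (2 `^ p * (`|u x| `^ p + `|u y| `^ p))); last first.
    by apply: ler_wpM2r; [exact: addr_ge0|apply: ler_powR => //; rewrite ler1n].
  apply: le_trans (powR_add_le (normr_ge0 _) (normr_ge0 _) p1).
  by apply: ge0_ler_powR; rewrite ?nnegrE ?addr_ge0//; exact: ler_normB.
have D0 := powR_ge0 `|u x - u y| p.
set D := `|u x - u y| `^ p in hD D0 *; set X := `|u x| `^ p in X0 hD *; set Y := `|u y| `^ p in Y0 hD *.
set m := Num.min r 1; have m0 : 0 < m by rewrite /m lt_min r0 ltr01.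
have m1 : m <= 1 by rewrite /m ge_min lexx orbT.
set A := m `^ _; have A0 : 0 <= A by exact: powR_ge0.
have B0 : 0 <= 2 `^ p_hi :> R by exact: powR_ge0.
have R0 : 0 <= A * 2 `^ p_hi * (w * X * w' + w' * Y * w).
  exact: mulr_ge0 (mulr_ge0 A0 B0) (addr_ge0 (mulr_ge0 (mulr_ge0 w0 X0) w0') (mulr_ge0 (mulr_ge0 w0' Y0) w0)).
have [hr|_] := leP r (rho x y); last by rewrite mul0r.
rewrite (mul1r (w * w' * _)).
have hT : trk s p x y <= A.
  have e0 := le_trans (_ : 0 <= Num.min 1 (p_lo - 1)) (trace_exponent_ge (n := n) slo01 plo1 plohi hs hp).
  have {}e0 : 0 <= n.+1%:R + s * (p - 2) by apply: e0; rewrite le_min ler01 subr_ge0 ltW.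
  have mr : m <= 1 * Num.min (rho x y) 1.
    by rewrite mul1r /m le_min ge_min hr ge_min lexx orbT.
  have mn0 : 0 < Num.min (rho x y) 1 by rewrite lt_min ltr01 andbT (lt_le_trans r0).
  have := negpow_le m0 mn0 ltr01 e0 mr; rewrite powR1 mul1r => /le_trans; apply.
  rewrite /A ger_powR ?m0//.
  have spp : s * (p - 2) <= p_hi.
    have [p2|p2] := leP 2 p.
      apply: (@le_trans _ _ (1 * (p - 2))); last by lra.
      by apply: ler_wpM2r; lra.
    have : s * (p - 2) <= 0 by rewrite mulr_ge0_le0 ?(ltW s0)// subr_le0 ltW.
    lra.
  by lra.
set T := trk s p x y in hT *; have T0 : 0 <= T by exact: trk_ge0.
exact: far_algebra.
Qed.

(** Pairs with rho < r fall into a chart, because then d x < r. The remaining pairs cost the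
    weighted mass of [u] times the total mass of [mu_s], which is bounded uniformly in s and p. *)
Lemma exists_energy_bound : exists2 C : R, 0 < C &
  forall s p u, s_lo <= s < 1 -> p_lo <= p <= p_hi -> measurable_fun setT u ->
  (T_energy s p u <= C%:E * trace_energy s p u)%E.
Proof.
have [zs [v [r [M [r0 M0 hv hcov]]]]] := finite_charts Olip Obnd.
have /andP[slo0 _] := slo01.
have [W W0 hW] := int_wt_unif Olip Obnd slo0.
have [Cm Cm0 hCm] := exists_mass_bound.
have /choice[Cf hCf] : forall z, exists C, 0 <= C /\ (z \in zs -> forall s p u,
    s_lo <= s < 1 -> p_lo <= p <= p_hi -> measurable_fun setT u ->
    (\int[leb]_x \int[leb]_y (near_pair Omega z r s p u x y)%:E <= C%:E * trace_energy s p u)%E).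
  move=> z; have [zin|nz] := boolP (z \in zs); last by exists 0.
  have [vM cc] := hv z zin.
  have [C C0 hC] := exists_near_pair_bound Olip Obnd r0 M0 vM cc slo01 plo1 plohi.
  exists C; split; first exact: ltW.
  move=> _ s p u hs hp mu; apply: le_trans (hC s p u hs hp mu) _.
  rewrite EFinM -muleA; apply: lee_wpmul2l; first by rewrite lee_fin ltW.
  by have /andP[_ s1] := hs; case: (trace_energy_ge Omega p u s1).
have [K defK K0] : exists2 K : R, K = Num.min r 1 `^ (- (n.+1%:R + p_hi)) * 2 `^ p_hi & 0 < K.
  by eexists; first reflexivity; apply: mulr_gt0; apply: powR_gt0; rewrite ?lt_min ?r0 ?ltr01 ?ltr0n.
have S0 : 0 <= \sum_(z <- zs) Cf z by apply: sumr_ge0 => z _; case: (hCf z).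
have KW0 : 0 < K * (2 * (W * Cm)) by rewrite !mulr_gt0.
exists (\sum_(z <- zs) Cf z + K * (2 * (W * Cm))); first exact: ltr_wpDl.
move=> s p u hs hp mu; have /andP[slo s1] := hs; have /andP[plo phi] := hp.
have p1 : 1 <= p by rewrite (le_trans _ plo)// ltW.
have mw := measurable_wt Olip s p; have mt := measurable_trk Omega s p.
have w0 x : 0 <= wt s p x by exact: wt_ge0.
have we x : (0 <= (wt s p x)%:E)%E by rewrite lee_fin.
pose a x y := wt s p x * wt s p y * (`|u x - u y| `^ p * trk s p x y).
have a0 x y : 0 <= a x y.
  exact: mulr_ge0 (mulr_ge0 (w0 x) (w0 y)) (mulr_ge0 (powR_ge0 _ _) (trk_ge0 _ _ _ _ _)).
have ma : measurable_fun setT (fun t : V * V => a t.1 t.2) by rewrite /a; meas.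
pose far x y := (r <= rho x y)%R%:R * a x y.
have far0 x y : (0 <= (far x y)%:E)%E by rewrite lee_fin; exact: mulr_ge0.
have mfar : measurable_fun setT (fun t : V * V => (far t.1 t.2)%:E) by rewrite /far /rho; meas.
have np0 z x y : (0 <= (near_pair Omega z r s p u x y)%:E)%E.
  by rewrite lee_fin; apply: mulr_ge0 (a0 x y); exact: mulr_ge0.
have mnp z : measurable_fun setT (fun t : V * V => (near_pair Omega z r s p u t.1 t.2)%:E).
  by rewrite /near_pair /rho; meas.
have sp0 x y : (0 <= \sum_(z <- zs) (near_pair Omega z r s p u x y)%:E)%E by apply: sume_ge0.
have msp : measurable_fun setT (fun t : V * V => \sum_(z <- zs) (near_pair Omega z r s p u t.1 t.2)%:E)%E.
  by apply: emeasurable_sum.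
have split x y : ((a x y)%:E <= \sum_(z <- zs) (near_pair Omega z r s p u x y)%:E + (far x y)%:E)%E.
  rewrite /far; have [hr|hr] := leP r (rho x y).
    by rewrite (mul1r (a x y)) leeDr.
  have [|dx _ _] := rho_parts (Omega := Omega) _ hr; first exact: Olip.
  have [z zin xz] := hcov x dx.
  apply: (@le_trans _ _ (near_pair Omega z r s p u x y)%:E).
    by rewrite /near_pair hr xz; have aux (b : R) : 1 * 1 * b = b by [ring]; rewrite aux.
  apply: le_trans (le_sum_seq (f := fun z => (near_pair Omega z r s p u x y)%:E) zin (fun z => np0 z x y)) _.
  by rewrite leeDl// mul0r.
pose H x y := ((wt s p x * `|u x| `^ p)%:E * (wt s p y)%:E)%E.
have H0 x y : (0 <= H x y)%E.
  by apply: mule_ge0 => //; rewrite lee_fin; exact: mulr_ge0 (w0 x) (powR_ge0 _ _).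
have mH : measurable_fun setT (fun t : V * V => H t.1 t.2) by rewrite /H; meas.
have mH' : measurable_fun setT (fun t : V * V => H t.2 t.1) by rewrite /H; meas.
have iH : (\int[leb]_x \int[leb]_y H x y <= W%:E * T_mass s p u)%E.
  have mm : measurable_fun setT (fun x => (wt s p x * `|u x| `^ p)%:E) by meas.
  have m0 x : (0 <= (wt s p x * `|u x| `^ p)%:E)%E by rewrite lee_fin; exact: mulr_ge0 (w0 x) (powR_ge0 _ _).
  rewrite /T_mass -(intZl leb (ltW W0) mm m0); apply: le_int => x; first by apply: integral_ge0 => y _; exact: H0.
  rewrite /H ge0_integralZl//; last exact/measurable_EFinP.
  by rewrite muleC; apply: lee_wpmul2r => //; exact: hW.
have te0 := trace_energy_ge0 Omega p u s1.
have We : (0 <= W%:E)%E by rewrite lee_fin ltW.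
have Ke : (0 <= K%:E)%E by rewrite lee_fin ltW.
have iH2 : (\int[leb]_x \int[leb]_y H x y <= (W * Cm)%:E * trace_energy s p u)%E.
  apply: le_trans iH _; rewrite EFinM -muleA; apply: lee_wpmul2l => //; exact: hCm.
have tH : (\int[leb]_x \int[leb]_y H y x <= (W * Cm)%:E * trace_energy s p u)%E.
  exact: (eq_le_trans (@tonelli _ _ _ _ _ leb leb (fun x y => H y x) mH' (fun x y => H0 y x)) iH2).
have ifar : (\int[leb]_x \int[leb]_y (far x y)%:E <= (K * (2 * (W * Cm)))%:E * trace_energy s p u)%E.
  have iy0 x : (0 <= \int[leb]_y H x y)%E by apply: integral_ge0 => y _; exact: H0.
  have iy0' x : (0 <= \int[leb]_y H y x)%E by apply: integral_ge0 => y _; exact: H0.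
  have mi : measurable_fun setT (fun x => \int[leb]_y H x y)%E.
    exact: (@measurable_int _ _ _ _ _ leb H mH H0).
  have mi' : measurable_fun setT (fun x => \int[leb]_y H y x)%E.
    exact: (@measurable_int _ _ _ _ _ leb (fun x y => H y x) mH' (fun x y => H0 y x)).
  apply: (@le_trans _ _ (\int[leb]_x (K%:E * (\int[leb]_y H x y + \int[leb]_y H y x)))%E).
    apply: le_int => x; first by apply: integral_ge0.
    have m1 := measurable_slice (u := H) x mH.
    have m2 := measurable_slice (u := fun x y => H y x) x mH'.
    rewrite -(ge0_integralD leb measurableT (fun y _ => H0 x y) m1 (fun y _ => H0 y x) m2).
    rewrite -(intZl leb (ltW K0) (emeasurable_funD m1 m2) (fun y => adde_ge0 (H0 x y) (H0 y x))).
    apply: le_int => y //.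
    have e : (K%:E * (H x y + H y x) = (K * (wt s p x * `|u x| `^ p * wt s p y +
      wt s p y * `|u y| `^ p * wt s p x))%:E)%E by [].
    by rewrite e lee_fin defK; exact: far_pair_le.
  rewrite (intZl leb (ltW K0) (emeasurable_funD mi mi') (fun x => adde_ge0 (iy0 x) (iy0' x))).
  rewrite (ge0_integralD leb measurableT (fun x _ => iy0 x) mi (fun x _ => iy0' x) mi').
  rewrite [in leRHS]EFinM -[leRHS]muleA; apply: lee_wpmul2l => //.
  apply: le_trans (leeD iH2 tH) _.
  have two (b : R) : 2 * b = b + b by ring.
  have c0 : (0 <= (W * Cm)%:E)%E by rewrite lee_fin mulr_ge0 ?ltW.
  by rewrite two EFinD (ge0_muleDl _ c0 c0).
apply: (@le_trans _ _ (\int[leb]_x (\int[leb]_y (\sum_(z <- zs) (near_pair Omega z r s p u x y)%:E) +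
    \int[leb]_y (far x y)%:E))%E).
  apply: le_int => x; first by apply: integral_ge0 => y _; rewrite lee_fin; exact: a0.
  have m1 := measurable_slice (u := fun x y => \sum_(z <- zs) (near_pair Omega z r s p u x y)%:E)%E x msp.
  have m2 := measurable_slice (u := fun x y => (far x y)%:E) x mfar.
  rewrite -(ge0_integralD leb measurableT (fun y _ => sp0 x y) m1 (fun y _ => far0 x y) m2).
  by apply: le_int => y; [rewrite lee_fin; exact: a0|exact: split].
have mi1 : measurable_fun setT (fun x => \int[leb]_y (\sum_(z <- zs) (near_pair Omega z r s p u x y)%:E))%E.
  exact: (@measurable_int _ _ _ _ _ leb (fun x y => \sum_(z <- zs) (near_pair Omega z r s p u x y)%:E)%E msp sp0).
have mi2 : measurable_fun setT (fun x => \int[leb]_y (far x y)%:E)%E.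
  exact: (@measurable_int _ _ _ _ _ leb (fun x y => (far x y)%:E) mfar far0).
have i10 x : (0 <= \int[leb]_y (\sum_(z <- zs) (near_pair Omega z r s p u x y)%:E))%E by apply: integral_ge0.
have i20 x : (0 <= \int[leb]_y (far x y)%:E)%E by apply: integral_ge0.
rewrite (ge0_integralD leb measurableT (fun x _ => i10 x) mi1 (fun x _ => i20 x) mi2).
have S0e : (0 <= (\sum_(z <- zs) Cf z)%:E)%E by rewrite lee_fin.
have KWe : (0 <= (K * (2 * (W * Cm)))%:E)%E by rewrite lee_fin ltW.
rewrite [in leRHS]EFinD [in leRHS](ge0_muleDl _ S0e KWe); apply: leeD ifar.
have mny z : measurable_fun setT (fun x => \int[leb]_y (near_pair Omega z r s p u x y)%:E)%E.
  exact: (@measurable_int _ _ _ _ _ leb (fun x y => (near_pair Omega z r s p u x y)%:E) (mnp z) (np0 z)).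
rewrite (_ : \int[leb]_x \int[leb]_y (\sum_(z <- zs) _) =
    \sum_(z <- zs) \int[leb]_x \int[leb]_y (near_pair Omega z r s p u x y)%:E)%E; last first.
  rewrite -ge0_integral_sum//; last by move=> z x _; exact: integral_ge0.
  apply: eq_integral => x _; rewrite ge0_integral_sum// => z.
  exact: (measurable_slice (u := fun x y => (near_pair Omega z r s p u x y)%:E) x (mnp z)).
apply: sum_seq_le => z; first by case: (hCf z).
by move=> zin; apply: (proj2 (hCf z)).
Qed.

End trace_bound.

(** For C >= 1 one has C^(1 / p) <= C, so the constant survives the p-th root independently of p. *)
Lemma root_scale_le {R : realType} (x y : \bar R) (C p : R) : 1 <= C -> 1 <= p ->
  (0 <= x)%E -> (0 <= y)%E -> (x <= C%:E * y)%E -> (x `^ p^-1 <= C%:E * y `^ p^-1)%E.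
Proof.
move=> C1 p1 x0 y0 xy; have p0 : 0 < p by exact: lt_le_trans p1.
have C0 : 0 <= C by exact: le_trans C1.
have pi0 : 0 <= p^-1 by rewrite invr_ge0 ltW.
apply: le_trans (le_poweR pi0 x0 xy) _.
rewrite poweRM ?lee_fin// poweR_EFin; apply: lee_wpmul2r; first exact: poweR_ge0.
by rewrite lee_fin -[leRHS](powRr1 C0) ler_powR// invf_le1.
Qed.

(** The bound is asked only when the norm of the difference is finite; for the extension this makes
    the difference a member of [T_space], to which the operator bound applies. *)
Lemma lipschitz_continuous_op {R : realType} (E : Type) (X Y : fspace R E) F (C : R) : 0 < C ->
  (forall u v, fs_mem X u -> fs_mem X v -> (fs_norm X (fun x => v x - u x)%R < +oo)%E ->
    (fs_norm Y (fun x => F v x - F u x)%R <= C%:E * fs_norm X (fun x => v x - u x)%R)%E) ->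
  continuous_op X Y F.
Proof.
move=> C0 h u Xu e e0; exists (e / C); first exact: divr_gt0.
move=> v Xv vu; apply: le_lt_trans (h u v Xu Xv _) _.
  by apply: lt_trans vu _; exact: ltry.
have -> : e%:E = (C%:E * (e / C)%:E)%E by rewrite -EFinM mulrC divfK// gt_eqF.
by rewrite lte_pmul2l// lte_fin.
Qed.

Lemma scale_finite {R : realType} (c : R) (x : \bar R) : 0 < c ->
  (0 <= x -> c%:E * x < +oo -> x < +oo)%E.
Proof.
by move=> c0; case: x => [a||]// _; rewrite ?ltry// gt0_muley ?lte_fin// ltxx.
Qed.

Lemma double_bound {R : realType} (c : R) (L X Y I : \bar R) : 0 <= c ->
  (0 <= L -> 0 <= X -> 0 <= Y -> X <= I -> Y <= I ->
   L + c%:E * (X + Y) <= 2%:E * (L + c%:E * I))%E.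
Proof.
move=> c0 L0 X0 Y0 XI YI; have I0 := le_trans X0 XI.
have ce : (0 <= c%:E)%E by rewrite lee_fin.
have cI0 : (0 <= c%:E * I)%E by exact: mule_ge0.
have two : (2%:E * (L + c%:E * I) = L + (c%:E * I + c%:E * I) + L)%E.
  rewrite (_ : 2 = 1 + 1 :> R)// EFinD ge0_muleDl ?lee_fin// mul1e.
  by rewrite addeACA [RHS]addeAC.
rewrite two; apply: (@le_trans _ _ (L + (c%:E * I + c%:E * I))%E); last by rewrite leeDl.
by apply: leeD => //; rewrite ge0_muleDr//; apply: leeD; exact: lee_wpmul2l.
Qed.

(** * Trace and extension as operators between the spaces *)

Section operators.
Context {R : realType} {n : nat} (Omega : set 'rV[R]_n.+1).
Local Notation V := 'rV[R]_n.+1.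
Local Notation d := (dist_bd Omega).
Local Notation leb := (@lebesgue_rV R n.+1).
Local Notation om := (@vball R n).
Local Notation wt := (wt Omega).
Local Notation T_mass := (T_mass Omega).
Local Notation T_energy := (T_energy Omega).
Local Notation trace_energy := (trace_energy Omega).
Local Notation ext := (ext Omega).
Hypotheses (Olip : lipschitz_domain Omega) (Obnd : bounded_set Omega).
Let oO : open Omega. Proof. by have [] := Olip. Qed.
Let bd0 : boundary Omega !=set0. Proof. by have [] := Olip. Qed.
Let mO : measurable Omega := open_measurable_rV oO.
Let mcO : measurable (~` Omega) := measurableC mO.
Let om0 := @vball_gt0 R n.

Lemma Lp_powE p u : (\int[leb]_(x in Omega) (`|u x| `^ p)%:E = Lp_pow Omega p u)%E.
Proof. by rewrite int_mkcond; apply: eq_integral => x _; rewrite EFinM. Qed.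

Lemma vker_sym s p (u : V -> R) x y : vker s p u x y = vker s p u y x.
Proof. by rewrite /vker distrC enormBC. Qed.

(** The kernel is symmetric, so the interaction across the boundary may be read with its inner point
    first; each of the two parts is then at most the integral in the seminorm, which explains the
    factor 2. *)
Lemma trace_energy_le s p u : s < 1 -> measurable_fun setT u ->
  (trace_energy s p u <= 2%:E * (Lp_pow Omega p u + V_seminorm_pow s p Omega u))%E.
Proof.
move=> s1 mu; have mv := measurable_vker s p mu.
have s1' : (0 <= (1 - s)%:E)%E by rewrite lee_fin subr_ge0 ltW.
rewrite V_energyE; set I := (\int[leb]_x \int[leb]_y _)%E.
have g0 x y : (0 <= (\1_Omega x * vker s p u x y)%:E)%E.
  by rewrite lee_fin; apply: mulr_ge0 => //; exact: vker_ge0.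
have I0 : (0 <= I)%E by apply: integral_ge0 => x _; apply: integral_ge0 => y _; exact: g0.
have VI : (V_inside Omega s p u <= I)%E.
  apply: le_int => y; first exact: inside_ge0.
  apply: le_int => w; first by rewrite lee_fin indic_vker_ge0.
  rewrite lee_fin; apply: ler_wpM2r; first exact: vker_ge0.
  by apply: ler_piMr => //; rewrite indicE; case: (_ \in _).
have VA : (V_across Omega s p u <= I)%E.
  have mg : measurable_fun setT (fun t : V * V => (\1_(~` Omega) t.1 * (\1_Omega t.2 * vker s p u t.1 t.2))%:E).
    by meas.
  have gg0 x y : (0 <= (\1_(~` Omega) x * (\1_Omega y * vker s p u x y))%:E)%E.
    by rewrite lee_fin; apply: mulr_ge0 => //; apply: mulr_ge0 => //; exact: vker_ge0.
  apply: (eq_le_trans (@tonelli _ _ _ _ _ leb leb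
    (fun x y => (\1_(~` Omega) x * (\1_Omega y * vker s p u x y))%:E) mg gg0)).
  apply: le_int => y; first by apply: integral_ge0.
  apply: le_int => x //; rewrite lee_fin vker_sym; apply: ler_piMl; last first.
    by rewrite indicE; case: (_ \in _).
  by apply: mulr_ge0 => //; exact: vker_ge0.
have c0 : 0 <= 1 - s by rewrite subr_ge0 ltW.
exact: (double_bound c0 (Lp_pow_ge0 Omega p u) (V_inside_ge0 Omega s p u)
  (V_across_ge0 Omega s p u) VI VA).
Qed.

(** Membership in [V_space] only demands a finite seminorm. Some y in [Omega] has finite interaction
    with [Omega]; since [Omega] is bounded, the kernel is bounded below there, so u - u y is in L^p,
    and so are constants. *)
Lemma Lp_finite s p u : 0 < s < 1 -> 1 < p -> fs_mem (V_space s p Omega) u ->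
  (Lp_pow Omega p u < +oo)%E.
Proof.
move=> /andP[s0 s1] p1 [mu]; rewrite V_energyE; set I := (\int[leb]_x _)%E => If.
have p0 : 0 < p by exact: lt_trans p1.
have mv := measurable_vker s p mu.
have s1' : 0 < 1 - s by rewrite subr_gt0.
have iI y : (0 <= inside Omega s p u y)%E by exact: inside_ge0.
have [c [t [t0 hct]]] := ball_in_domain Olip.
have [D D1 [hD1 _]] := bounded_domain Olip Obnd.
have D0 : 0 < D by exact: lt_le_trans D1.
have VI : (V_inside Omega s p u < +oo)%E.
  have VI : (V_inside Omega s p u <= I)%E.
    apply: le_int => // y; apply: le_int => w; first by rewrite lee_fin indic_vker_ge0.
    rewrite lee_fin; apply: ler_wpM2r; first exact: vker_ge0.
    by apply: ler_piMr => //; rewrite indicE; case: (_ \in _).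
  have I0 : (0 <= I)%E by apply: le_trans VI; exact: V_inside_ge0.
  exact: le_lt_trans VI (scale_finite s1' I0 If).
have [y Oy hy] : exists2 y, Omega y & (inside Omega s p u y < +oo)%E.
  (* Otherwise the inner integral is infinite on a ball of positive volume, which would give an
     energy of value a the lower bound a + 1. *)
  apply: contrapT => no.
  have inf y : Omega y -> inside Omega s p u y = +oo%E.
    move=> Oy; apply/eqP; rewrite -leye_eq leNgt; apply/negP => h; by apply: no; exists y.
  have mi := measurable_inside Olip s p mu.
  pose m := om * t ^+ n.+1; have m0 : 0 < m by rewrite /m mulr_gt0 ?exprn_gt0.
  have V0 := V_inside_ge0 Omega s p u.
  have [a aE] : exists a, V_inside Omega s p u = a%:E.
    by move: VI V0; case: V_inside => [a||]// _ _; exists a.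
  have : (((a + 1) / m)%:E * m%:E <= V_inside Omega s p u)%E.
    have a0 : 0 <= a by rewrite -lee_fin -aE.
    have k0 : 0 <= (a + 1) / m by rewrite divr_ge0 ?addr_ge0// ltW.
    rewrite /m -(int_eball c t0) -intZl//; last by meas.
    apply: le_int => w; first by rewrite mule_ge0// lee_fin.
    rewrite -/(inside Omega s p u w); case: ltP => [/hct/inf ->|_]; first by rewrite leey.
    by rewrite mule0; exact: iI.
  by rewrite aE -EFinM divfK ?gt_eqF// lee_fin; lra.
pose k := (2 * D) `^ (n.+1%:R + s * p).
have k0 : 0 <= k by exact: powR_ge0.
have uy0 : 0 <= `|u y| `^ p by exact: powR_ge0.
have mi : measurable_fun setT (fun w => (\1_Omega y * \1_Omega w * vker s p u y w)%:E).
  by have := measurable_slice y mv; move: (vker s p u y) => vy mvy; meas.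
have i0 w : (0 <= (\1_Omega y * \1_Omega w * vker s p u y w)%:E)%E.
  by rewrite lee_fin indic_vker_ge0.
have mO1 : measurable_fun setT (fun w => (\1_Omega w : R)%:E) by meas.
have O10 w : (0 <= (\1_Omega w : R)%:E)%E by rewrite lee_fin.
have vol : (\int[leb]_w (\1_Omega w : R)%:E < +oo)%E.
  apply: (@le_lt_trans _ _ (\int[leb]_w ((enorm (w - 0) < 2 * D)%R%:R)%:E)%E).
    apply: le_int => // w; rewrite lee_fin indicE.
    have [Ow|Ow] := pselect (Omega w); last by rewrite memNset.
    rewrite mem_set// subr0 (_ : enorm w < 2 * D)//.
    by apply: le_lt_trans (hD1 w Ow) _; rewrite ltr_pMl// ltr1n.
  by rewrite int_eball ?mulr_gt0// ltry.
have pt w : ((\1_Omega w * `|u w| `^ p)%:E <= (2 `^ p)%:E * (k%:E *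
    (\1_Omega y * \1_Omega w * vker s p u y w)%:E + (`|u y| `^ p)%:E * (\1_Omega w)%:E))%E.
  have -> : ((2 `^ p)%:E * (k%:E * (\1_Omega y * \1_Omega w * vker s p u y w)%:E +
      (`|u y| `^ p)%:E * (\1_Omega w)%:E) = (2 `^ p * (k * (\1_Omega y * \1_Omega w *
      vker s p u y w) + `|u y| `^ p * \1_Omega w))%:E)%E by [].
  rewrite lee_fin !indicE (mem_set Oy) mul1r.
  have [Ow|Ow] := pselect (Omega w); last by rewrite (memNset Ow) !(mul0r, mulr0) addr0 mulr0.
  rewrite (mem_set Ow) !mul1r mulr1.
  have h1 : `|u w| `^ p <= 2 `^ p * (`|u y - u w| `^ p + `|u y| `^ p).
    apply: le_trans (powR_add_le (normr_ge0 _) (normr_ge0 _) (ltW p1)).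
    apply: ge0_ler_powR; rewrite ?nnegrE ?addr_ge0 ?(ltW p0)//.
    rewrite -(distrC (u w)); apply: le_trans (ler_normD _ _).
    by rewrite subrK.
  apply: le_trans h1 _; apply: ler_wpM2l; first exact: powR_ge0.
  rewrite lerD2r /vker.
  have [yw|yw] := eqVneq y w.
    by rewrite yw subrr normr0 powR0 ?gt_eqF// mul0r mulr0.
  have e0 : 0 < enorm (y - w).
    by rewrite lt_neqAle enorm_ge0 andbT eq_sym enorm_eq0 subr_eq0.
  have e2 : enorm (y - w) <= 2 * D.
    by apply: le_trans (enormB _ _) _; have := hD1 y Oy; have := hD1 w Ow; lra.
  rewrite mulrCA ler_peMr ?powR_ge0// powRN ler_pdivlMr ?powR_gt0// mul1r.
  apply: ge0_ler_powR => //; rewrite ?nnegrE ?enorm_ge0 ?mulr_ge0 ?(ltW D0)//.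
  by rewrite addr_ge0// mulr_ge0 ?ltW.
apply: le_lt_trans (le_int leb _ pt) _.
  by move=> w; rewrite lee_fin mulr_ge0 ?powR_ge0.
have m1 := emeasurable_funM (measurable_cst (k%:E)) mi.
have m2 := emeasurable_funM (measurable_cst ((`|u y| `^ p)%:E)) mO1.
have f1 w : (0 <= k%:E * (\1_Omega y * \1_Omega w * vker s p u y w)%:E)%E by exact: mule_ge0.
have f2 w : (0 <= (`|u y| `^ p)%:E * (\1_Omega w)%:E)%E by exact: mule_ge0.
rewrite (intZl leb (powR_ge0 _ _) (emeasurable_funD m1 m2) (fun w => adde_ge0 (f1 w) (f2 w))).
rewrite (ge0_integralD leb measurableT (fun w _ => f1 w) m1 (fun w _ => f2 w) m2).
rewrite (intZl leb k0 mi i0) (intZl leb uy0 mO1 O10).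
apply: lte_mul_pinfty; rewrite ?lee_fin ?powR_ge0//.
by apply: lte_add_pinfty; apply: lte_mul_pinfty; rewrite ?lee_fin.
Qed.

Lemma T_mass_restrict s p g : T_mass s p (g \_ (~` Omega)) = T_mass s p g.
Proof.
apply: eq_integral => x _; have [Ox|Ox] := pselect (Omega x); last by rewrite restrict_out.
by rewrite !wt_in// !mul0r.
Qed.

Lemma T_energy_restrict s p g : T_energy s p (g \_ (~` Omega)) = T_energy s p g.
Proof.
apply: eq_integral => x _; apply: eq_integral => y _.
have [Ox|Ox] := pselect (Omega x); first by rewrite !(wt_in _ _ Ox) !mul0r.
have [Oy|Oy] := pselect (Omega y); first by rewrite !(wt_in _ _ Oy) !mulr0 !mul0r.
by rewrite !restrict_out.
Qed.

Lemma measurable_trace u : measurable_fun setT u -> measurable_fun (~` Omega) (trace Omega u).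
Proof.
move=> mu; apply: measurable_funTS; apply: measurable_restrict_out Olip _ _.
exact: measurable_funTS.
Qed.

Lemma exists_trace_bound s_lo p_lo p_hi : 0 < s_lo < 1 -> 1 < p_lo -> p_lo <= p_hi ->
  exists2 C : R, 1 <= C & forall s p u, s_lo <= s < 1 -> p_lo <= p <= p_hi ->
  measurable_fun setT u ->
  (T_norm s p Omega (trace Omega u) <= C%:E * V_norm s p Omega u)%E.
Proof.
move=> slo01 plo1 plohi.
have [C1 C10 h1] := exists_mass_bound Olip Obnd slo01 plo1 plohi.
have [C2 C20 h2] := exists_energy_bound Olip Obnd slo01 plo1 plohi.
exists (1 + (C1 + C2) * 2); first by rewrite lerDl mulr_ge0// addr_ge0 ?ltW.
move=> s p u hs hp mu; have /andP[_ s1] := hs; have /andP[plo phi] := hp.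
have p1 : 1 <= p by rewrite (le_trans _ plo)// ltW.
rewrite (T_normE Olip p s1 (measurable_trace mu)) /trace !T_mass_restrict !T_energy_restrict.
have te0 := trace_energy_ge0 Omega p u s1.
have L0 := Lp_pow_ge0 Omega p u.
have V0 : (0 <= V_seminorm_pow s p Omega u)%E.
  rewrite V_energyE; apply: mule_ge0; first by rewrite lee_fin subr_ge0 ltW.
  apply: integral_ge0 => x _; apply: integral_ge0 => y _; rewrite lee_fin.
  by rewrite !mulr_ge0 ?powR_ge0.
rewrite /V_norm Lp_powE; apply: root_scale_le => //.
- by rewrite lerDl mulr_ge0// addr_ge0 ?ltW.
- by apply: adde_ge0; [exact: T_mass_ge0|exact: T_energy_ge0].
- exact: adde_ge0.
apply: le_trans (leeD (h1 s p u hs hp mu) (h2 s p u hs hp mu)) _.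
have C1e : (0 <= C1%:E)%E by rewrite lee_fin ltW.
have C2e : (0 <= C2%:E)%E by rewrite lee_fin ltW.
rewrite -(ge0_muleDl _ C1e C2e) -EFinD.
have C12 : (0 <= (C1 + C2)%:E)%E by rewrite lee_fin addr_ge0 ?ltW.
apply: le_trans (lee_wpmul2l C12 (trace_energy_le p s1 mu)) _.
rewrite muleA -EFinM; apply: lee_wpmul2r; first exact: adde_ge0.
by rewrite lee_fin lerDr.
Qed.

Lemma eop_linear s p g h a x : 0 < s < 1 -> 1 < p -> Omega x ->
  measurable_fun setT g -> (T_mass s p g < +oo)%E ->
  measurable_fun setT h -> (T_mass s p h < +oo)%E ->
  eop Omega s p (fun z => a * g z + h z) x = a * eop Omega s p g x + eop Omega s p h x.
Proof.
move=> s01 p1 Ox mg gf mh hf; have /andP[_ s1] := s01.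
(* At fixed parameters the uniform estimates are used with ranges reduced to s_lo = s and p_lo =
   p_hi = p. *)
have [A A0 hA] := exists_kernel_facts Olip Obnd s01 p1 (lexx p).
have kf := hA s p x _ _ Ox; have {}kf : kernel_facts Omega A s p x.
  by apply: kf; rewrite ?lexx// s1.
have mk := measurable_kker1 Olip p x s1.
have k0 z : 0 <= kker Omega s p x z by exact: kker_ge0.
have kfin : (\int[leb]_z (kker Omega s p x z)%:E < +oo)%E.
  by rewrite (int_kker Olip s1 kf) ?ltry.
have ig : leb.-integrable setT (fun z => (kker Omega s p x z * g z)%:E).
  exact: (integrable_weight (ltW p1) mk mg k0 kfin (kker_finite Olip A0 s1 kf mg gf)).
have ih : leb.-integrable setT (fun z => (kker Omega s p x z * h z)%:E).
  exact: (integrable_weight (ltW p1) mk mh k0 kfin (kker_finite Olip A0 s1 kf mh hf)).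
have iag : leb.-integrable setT (fun z => a%:E * (kker Omega s p x z * g z)%:E)%E.
  exact: integrableZl.
rewrite /eop (_ : \int[leb]_z _ = a%:E * \int[leb]_z (kker Omega s p x z * g z)%:E +
    \int[leb]_z (kker Omega s p x z * h z)%:E)%E; last first.
  rewrite -integralZl// -integralD//; apply: eq_integral => z _.
  by rewrite -EFinM -EFinD; congr EFin; ring.
have fg := integrable_fin_num measurableT ig.
have fh := integrable_fin_num measurableT ih.
by rewrite fineD ?fin_numM// fineM.
Qed.

Lemma ext_linear s p g h a x : 0 < s < 1 -> 1 < p ->
  fs_mem (T_space s p Omega) g -> fs_mem (T_space s p Omega) h ->
  ext s p (fun z => a * g z + h z) x = a * ext s p g x + ext s p h x.
Proof.
move=> s01 p1 Tg Th; have /andP[_ s1] := s01.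
have [mg gf _] := T_finite Olip s1 p1 Tg; have [mh hf _] := T_finite Olip s1 p1 Th.
have e : (fun z => a * g z + h z) \_ (~` Omega) =
    (fun z => a * (g \_ (~` Omega)) z + (h \_ (~` Omega)) z).
  apply/funext => z; have [Oz|Oz] := pselect (Omega z).
    by rewrite !restrict_in// mulr0 addr0.
  by rewrite !restrict_out.
rewrite /ext e; have [Ox|Ox] := pselect (Omega x); last first.
  have -> : \1_Omega x = 0 :> R by rewrite indicE memNset.
  by ring.
have -> : \1_Omega x = 1 :> R by rewrite indicE mem_set.
by rewrite (eop_linear _ s01 p1 Ox mg gf mh hf); ring.
Qed.

Lemma exists_ext_bound s_lo p_lo p_hi : 0 < s_lo < 1 -> 1 < p_lo -> p_lo <= p_hi ->
  exists2 C : R, 1 <= C & forall s p g, s_lo <= s < 1 -> p_lo <= p <= p_hi ->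
  fs_mem (T_space s p Omega) g ->
  (V_norm s p Omega (ext s p g) <= C%:E * T_norm s p Omega g)%E.
Proof.
move=> slo01 plo1 plohi; have [C C1 h] := ext_bound Olip Obnd slo01 plo1 plohi.
exists C => // s p g hs hp Tg; have /andP[_ s1] := hs; have /andP[plo phi] := hp.
have p1 : 1 <= p by rewrite (le_trans _ plo)// ltW.
have [mg _] := Tg; rewrite (T_normE Olip p s1 mg) /V_norm; apply: root_scale_le => //.
- apply: adde_ge0; first by apply: integral_ge0 => x _; rewrite lee_fin powR_ge0.
  rewrite V_energyE; apply: mule_ge0; first by rewrite lee_fin subr_ge0 ltW.
  apply: integral_ge0 => x _; apply: integral_ge0 => y _; rewrite lee_fin.
  by rewrite !mulr_ge0 ?powR_ge0.
- by apply: adde_ge0; [exact: T_mass_ge0|exact: T_energy_ge0].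
- exact: h.
Qed.

(** Integrals against the kernel ignore null sets, so the averages agree at every point; only the
    values outside agree merely almost everywhere. *)
Lemma ext_ae s p g h : 0 < s < 1 -> 1 < p ->
  fs_mem (T_space s p Omega) g -> fs_mem (T_space s p Omega) h ->
  fs_eq (T_space s p Omega) g h -> fs_eq (V_space s p Omega) (ext s p g) (ext s p h).
Proof.
move=> s01 p1 Tg Th gh; have /andP[_ s1] := s01.
have [mg _ _] := T_finite Olip s1 p1 Tg; have [mh _ _] := T_finite Olip s1 p1 Th.
have rgh : \forall x \ae leb, (g \_ (~` Omega)) x = (h \_ (~` Omega)) x.
  apply: filterS gh => x hx; have [Ox|Ox] := pselect (Omega x).
    by rewrite !restrict_in.
  by rewrite !restrict_out//; exact: hx.
have eE x : eop Omega s p (g \_ (~` Omega)) x = eop Omega s p (h \_ (~` Omega)) x.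
  rewrite /eop; congr fine; apply: ae_eq_integral => //.
  - by have := measurable_kker1 Olip p x s1; move: (kker _ _ _ x) (g \_ _) mg => k f mf mk; meas.
  - by have := measurable_kker1 Olip p x s1; move: (kker _ _ _ x) (h \_ _) mh => k f mf mk; meas.
  - by apply: filterS rgh => z -> _.
by apply: filterS rgh => x hx _; rewrite /ext eE hx.
Qed.

Lemma trace_ext s p g : fs_eq (T_space s p Omega) (trace Omega (ext s p g)) g.
Proof.
apply: aeW => x Ox; rewrite /trace restrict_out// /ext indicE memNset//.
by rewrite mul0r add0r restrict_out.
Qed.

Lemma V_norm_finite s p u : 0 < s < 1 -> 1 < p -> fs_mem (V_space s p Omega) u ->
  (V_norm s p Omega u < +oo)%E.
Proof.
move=> s01 p1 Vu; have /andP[_ s1] := s01; have [mu uf] := Vu.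
have Lf := Lp_finite s01 p1 Vu; have L0 := Lp_pow_ge0 Omega p u.
rewrite /V_norm Lp_powE; apply: finite_poweR; last exact: lte_add_pinfty.
apply: adde_ge0 => //; rewrite V_energyE; apply: mule_ge0.
  by rewrite lee_fin subr_ge0 ltW.
apply: integral_ge0 => x _; apply: integral_ge0 => y _; rewrite lee_fin.
by rewrite !mulr_ge0 ?powR_ge0.
Qed.

Lemma V_norm_mem s p u : 1 < p -> s < 1 -> measurable_fun setT u -> (V_norm s p Omega u < +oo)%E ->
  fs_mem (V_space s p Omega) u.
Proof.
move=> p1 s1 mu uf; split => //.
have pi0 : 0 < p^-1 by rewrite invr_gt0 (lt_trans ltr01).
apply: le_lt_trans (poweR_finite pi0 uf); rewrite leeDr//.
by apply: integral_ge0 => x _; rewrite lee_fin powR_ge0.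
Qed.

Lemma finite_scale (C : R) (x : \bar R) : 0 <= C -> (0 <= x -> x < +oo -> C%:E * x < +oo)%E.
Proof. by move=> C0 x0 xf; apply: lte_mul_pinfty; rewrite ?lee_fin. Qed.

Lemma trace_operator s p : 0 < s < 1 -> 1 < p ->
  [/\ well_defined (V_space s p Omega) (T_space s p Omega) (trace Omega),
      linear_op (V_space s p Omega) (T_space s p Omega) (trace Omega) &
      continuous_op (V_space s p Omega) (T_space s p Omega) (trace Omega)].
Proof.
move=> s01 p1; have /andP[_ s1] := s01.
(* Continuity at fixed s and p is the uniform bound on the one-point ranges s_lo = s and p_lo = p_hi
   = p. *)
have [C C1 hC] := exists_trace_bound s01 p1 (lexx p).
have hs : s <= s < 1 by rewrite lexx.
have hp : p <= p <= p by rewrite lexx.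
have C0 : 0 < C by exact: lt_le_trans C1.
split.
- split=> [u Vu|u v _ _ uv].
    have [mu _] := Vu; split; first exact: measurable_trace.
    apply: le_lt_trans (hC s p u hs hp mu) _; apply: finite_scale; first exact: ltW.
      exact: poweR_ge0.
    exact: V_norm_finite.
  by apply: filterS uv => x h Ox; rewrite /trace !restrict_out//; exact: h.
- by move=> a u v _ _; apply: aeW => x Ox; rewrite /trace !restrict_out.
- apply: (lipschitz_continuous_op C0) => u v [mu _] [mv _] _.
  rewrite (_ : (fun x => trace Omega v x - trace Omega u x) = trace Omega (fun x => v x - u x)).
    by apply: hC => //; exact: measurable_funB.
  apply/funext => x; rewrite /trace; have [Ox|Ox] := pselect (Omega x).
    by rewrite !restrict_in// subr0.
  by rewrite !restrict_out.
Qed.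

Lemma ext_operator s p : 0 < s < 1 -> 1 < p ->
  [/\ well_defined (T_space s p Omega) (V_space s p Omega) (ext s p),
      linear_op (T_space s p Omega) (V_space s p Omega) (ext s p),
      continuous_op (T_space s p Omega) (V_space s p Omega) (ext s p) &
      forall g, fs_mem (T_space s p Omega) g ->
        fs_eq (T_space s p Omega) (trace Omega (ext s p g)) g].
Proof.
move=> s01 p1; have /andP[_ s1] := s01.
have [C C1 hC] := exists_ext_bound s01 p1 (lexx p).
have hs : s <= s < 1 by rewrite lexx.
have hp : p <= p <= p by rewrite lexx.
have C0 : 0 < C by exact: lt_le_trans C1.
split.
- split=> [g Tg|g h Tg Th]; last exact: ext_ae.
  have [mg gf] := Tg; apply: V_norm_mem => //; first exact: measurable_ext.
  apply: le_lt_trans (hC s p g hs hp Tg) _; apply: finite_scale => //; first exact: ltW.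
  exact: poweR_ge0.
- by move=> a g h Tg Th; apply: aeW => x _; exact: ext_linear.
- apply: (lipschitz_continuous_op C0) => g h Tg Th hgf.
  have [mg _] := Tg; have [mh _] := Th.
  have Thg : fs_mem (T_space s p Omega) (fun x => h x - g x).
    by split=> //; exact: measurable_funB.
  rewrite (_ : (fun x => ext s p h x - ext s p g x) = ext s p (fun x => h x - g x)).
    exact: hC.
  apply/funext => x; have := ext_linear (-1) x s01 p1 Tg Th.
  rewrite (_ : (fun z => -1 * g z + h z) = (fun z => h z - g z)); last first.
    by apply/funext => z; ring.
  by move=> ->; ring.
- by move=> g _; exact: trace_ext.
Qed.

End operators.

Theorem theorem1p2 (R : realType) (n : nat) (Omega : set 'rV[R]_n.+1)
    (Omega_lip : lipschitz_domain Omega) (Omega_bnd : bounded_set Omega) :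
  (forall s p : R, 0 < s < 1 -> 1 < p ->
    [/\ well_defined (V_space s p Omega) (T_space s p Omega) (trace Omega),
        linear_op (V_space s p Omega) (T_space s p Omega) (trace Omega) &
        continuous_op (V_space s p Omega) (T_space s p Omega) (trace Omega)]) /\
  exists Ext : R -> R -> ('rV[R]_n.+1 -> R) -> 'rV[R]_n.+1 -> R,
    (forall s p : R, 0 < s < 1 -> 1 < p ->
      [/\ well_defined (T_space s p Omega) (V_space s p Omega) (Ext s p),
          linear_op (T_space s p Omega) (V_space s p Omega) (Ext s p),
          continuous_op (T_space s p Omega) (V_space s p Omega) (Ext s p) &
          forall g, fs_mem (T_space s p Omega) g ->
            fs_eq (T_space s p Omega) (trace Omega (Ext s p g)) g]) /\
    (forall s_lo p_lo p_hi : R, 0 < s_lo < 1 -> 1 < p_lo -> p_lo <= p_hi ->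
      exists C : R, 0 < C /\
        forall s p : R, s_lo <= s < 1 -> p_lo <= p <= p_hi ->
          bounded_op_by C (V_space s p Omega) (T_space s p Omega)
            (trace Omega) /\
          bounded_op_by C (T_space s p Omega) (V_space s p Omega) (Ext s p)).
Proof.
split=> [s p s01 p1|]; first exact: trace_operator.
(* The formula of [ext] depends on s and p but not on the ranges [s_lo], [p_lo], [p_hi], so one
   family of operators serves all of them. *)
exists (ext Omega); split=> [s p s01 p1|s_lo p_lo p_hi slo plo phi].
  exact: ext_operator.
have [C1 C11 h1] := exists_trace_bound Omega_lip Omega_bnd slo plo phi.
have [C2 C21 h2] := exists_ext_bound Omega_lip Omega_bnd slo plo phi.
exists (Num.max C1 C2); split; first by rewrite lt_max (lt_le_trans ltr01 C11).
move=> s p hs hp; split=> [u [mu _]|g Tg].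
  apply: le_trans (h1 s p u hs hp mu) _; apply: lee_wpmul2r; first exact: poweR_ge0.
  by rewrite lee_fin le_max lexx.
apply: le_trans (h2 s p g hs hp Tg) _; apply: lee_wpmul2r; first exact: poweR_ge0.
by rewrite lee_fin le_max lexx orbT.
Qed.
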